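(* Let $\mathcal{H}$ be a separable Hilbert space, $Q$ a strictly positive, symmetric, trace-class operator on $\mathcal{H}$, $\sigma_t$ a bounded continuous function of $t\in[0,1]$ with values in $\mathbb{R}_{\ge0}$, and $P_{\mathrm{data}}$ a probability distribution on $\mathcal{H}$. Consider the SDE in $\mathcal{H}$ $$dY_t=-\frac{\sigma_t}{2}Y_t\,dt+\sqrt{\sigma_t}\,dW_t,\qquad Y_0\sim P_{\mathrm{data}},$$ where $W_t$ is a $Q$-Wiener process in $\mathcal{H}$, and let $\mu_{t\mid Y_0}$ denote the conditional distribution of $Y_t$ given $Y_0$. Let $S^*$ denote the minimizer, over measurable $S:[0,1]\times\mathcal{H}\to\mathcal{H}$, of $$\int_0^1\mathbb{E}_{Y_0\sim P_{\mathrm{data}}}\mathbb{E}_{Y_t\sim\mu_{t\mid Y_0}}\big\|S(t,Y_t)-\rho^{\mu_{t\mid Y_0}}_{\mathcal{H}_Q}(Y_t)\big\|^2\,dt,$$ where $\rho^{\mu}_{\mathcal{H}_Q}$ is the logarithmic gradient of $\mu$ along the Cameron–Martin space $\mathcal{H}_Q$. Then the probability flow ODE $$dY_t=-\frac{\sigma_t}{2}\big(Y_t+S^*(t,Y_t)\big)\,dt,\qquad Y_1\sim\mathcal{N}(0,Q),$$ to be solved in reverse time from $t=1$ to $t=0$, is the rectified flow induced by the process $Y'_t$ defined as $$Y'_t=\eta(t)\,Y'_0+\sqrt{\kappa(t)}\,U,$$ where $$\eta(t)=\exp\Big(-\tfrac12\int_0^t\sigma_s\,ds\Big),\qquad \kappa(t)=\int_0^t\exp\Big(-\int_s^t\sigma_\tau\,d\tau\Big)\sigma_s\,ds,$$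 and $Y'_0\sim P_{\mathrm{data}}$, $U\sim\mathcal{N}(0,Q)$ are sampled independently. Equivalently, $$\mathbb{E}[\dot Y'_t\mid Y'_t]=-\frac{\sigma_t}{2}\big(Y'_t+S^*(t,Y'_t)\big).$$
   Context: $\langle\cdot,\cdot\rangle$ and $\|\cdot\|$ are the inner product and norm of $\mathcal{H}$; a dot denotes the time derivative. Convention here: time $t=0$ corresponds to the data distribution and $t=1$ to the noise distribution. A $Q$-Wiener process $W_t$ is a continuous Gaussian process in $\mathcal{H}$ with $W_0=0$ and independent, stationary increments, with $W_t-W_s\sim\mathcal{N}(0,(t-s)Q)$ for all $0\le s\le t$. The Cameron–Martin space is $\mathcal{H}_Q=Q^{1/2}(\mathcal{H})$ with inner product $\langle x,y\rangle_{\mathcal{H}_Q}=\langle Q^{-1/2}x,Q^{-1/2}y\rangle$. Let $\{\zeta_i\}$ be an orthonormal basis of $\mathcal{H}$ consisting of eigenvectors of $Q$, with eigenvalues $\{\lambda_i\}$. Logarithmic gradient: a Borel probability measure $\mu$ on $\mathcal{H}$ is Fomin differentiable along $h\in\mathcal{H}_Q$ if there is $\rho_h^\mu\in L^1(\mathcal{H},\mu)$ such that for all cylinder functions $F(x)=f(\langle\zeta_1,x\rangle,\dots,\langle\zeta_m,x\rangle)$, $f\in C_0^\infty(\mathbb{R}^m)$, $m\in\mathbb{N}$, one has $\int_{\mathcal{H}}\partial_hF(x)\,\mu(dx)=-\int_{\mathcal{H}}F(x)\rho_h^\mu(x)\,\mu(dx)$, where $\partial_h$ is the Gâteaux differential along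 $h$. If there is a function $\rho^\mu_{\mathcal{H}_Q}:\mathcal{H}\to\mathcal{H}$ with $\langle\rho^\mu_{\mathcal{H}_Q}(x),h\rangle_{\mathcal{H}_Q}=\rho^\mu_h(x)$ for all $x\in\mathcal{H}$, $h\in\mathcal{H}_Q$, it is called the logarithmic gradient of $\mu$ along $\mathcal{H}_Q$. Since $\rho^\mu_{\mathcal{H}_Q}(x)$ need not lie in $\mathcal{H}_Q$, for Gaussian $\mu$ the pairing is understood as the limit in $L^2(\mu)$ of $\sum_{i\le n}\lambda_i^{-1}\langle\rho^\mu_{\mathcal{H}_Q}(x),\zeta_i\rangle\langle h,\zeta_i\rangle$ as $n\to\infty$. Rectified flow: for a pathwise continuously differentiable $\mathcal{H}$-valued process $\mathbb{X}=\{X_t\}_{t\in[0,1]}$, the expected velocity is $v^{\mathbb{X}}(t,x)=\mathbb{E}[\dot X_t\mid X_t=x]$ for $x\in\operatorname{supp}(X_t)$, and $0$ otherwise. The rectified flow induced by $\mathbb{X}$ is the process driven by this velocity field, $Z_t=Z_0+\int_0^t v^{\mathbb{X}}(s,Z_s)\,ds$ with $Z_0\sim X_0$. In the claim above, the ODE is run in reverse time, starting at $t=1$.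
   Formalization: If the loss over [0,1] is infinite for every S (e.g. Gaussian data), every S would be a minimizer and the claim fails; there S* must also minimize the loss over [ε,1] for all ε in (0,1). The velocity identity is for almost every t, with the expected velocity taken as a version. *)

(* Defs.v *)
From HB Require Import structures.
From mathcomp Require Import all_boot all_order all_algebra sesquilinear.
From mathcomp Require Import all_classical all_reals all_analysis.
Set Implicit Arguments.
Unset Strict Implicit.
Unset Printing Implicit Defensive.
Import Order.TTheory GRing.Theory Num.Theory.
Import numFieldNormedType.Exports.
Local Open Scope classical_set_scope.
Local Open Scope ring_scope.

Notation borel H := (g_sigma_algebraType (@open H)).

(* A real Hilbert space is a complete normed module H with a scalar product
   ip : {dot H for idfun} that induces its norm. *)

Definition separable_space (T : topologicalType) : Prop :=
  exists A : set T, countable A /\ dense A.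

Section hilbert.
Context {R : realType} {H : completeNormedModType R}.
Variable ip : {dot H for idfun}.
Local Notation leb := (@lebesgue_measure R).

(* The index set I is an initial segment of nat: {0, .., d-1} if H has finite
   dimension d, and all of nat otherwise. *)
Definition orthonormal_basis (I : pred nat) (e : nat -> H) : Prop :=
  [/\ forall i j, (i <= j)%N -> I j -> I i,
      forall i j, I i -> I j -> ip (e i) (e j) = (i == j)%:R
    & forall x, (fun n => \sum_(i < n | I i) ip (e i) x *: e i) @ \oo --> x].

(* For a positive symmetric Q one has |Q| = Q, and the trace norm
   \sum_i <|Q| e_i, e_i> does not depend on the orthonormal basis e. *)
Definition trace_class_pos (Q : H -> H) : Prop :=
  exists I e, orthonormal_basis I e /\
    (\sum_(0 <= i <oo | I i) (ip (Q (e i)) (e i))%:E < +oo)%E.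

Definition covariance_operator (Q : {linear H -> H}) : Prop :=
  [/\ continuous Q,
      forall x y, ip (Q x) y = ip x (Q y),
      forall x, x != 0 -> 0 < ip (Q x) x
    & trace_class_pos Q].

Definition is_sqrt_op (Q T : {linear H -> H}) : Prop :=
  [/\ continuous T,
      forall x y, ip (T x) y = ip x (T y),
      forall x, 0 <= ip (T x) x
    & forall x, T (T x) = Q x].

Definition cameron_martin (Q : {linear H -> H}) : set H :=
  [set h | exists T, is_sqrt_op Q T /\ exists y, h = T y].

Section random_variables.
Context {d : measure_display} {Omega : measurableType d}.
Variable P : probability Omega R.

Definition random_vector (X : Omega -> H) : Prop :=
  measurable_fun setT (X : Omega -> borel H).

Definition has_law (X : Omega -> H) (nu : probability (borel H) R) : Prop :=
  random_vector X /\
  forall A : set (borel H), measurable A -> P (X @^-1` A) = nu A.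

(* normal_prob takes the standard deviation, and is not a Dirac mass when the
   standard deviation is 0. *)
Definition gaussian1 (m v : R) (A : set R) : \bar R :=
  if v == 0 then \d_m A else normal_prob m (Num.sqrt v) A.

Definition gaussian_vector (X : Omega -> H) (m : H) (C : H -> H) : Prop :=
  random_vector X /\
  forall h (A : set R), measurable A ->
    P [set w | A (ip h (X w))] = gaussian1 (ip h m) (ip (C h) h) A.

Definition independent2 (X Y : Omega -> H) : Prop :=
  forall A B : set (borel H), measurable A -> measurable B ->
    P (X @^-1` A `&` Y @^-1` B) = (P (X @^-1` A) * P (Y @^-1` B))%E.

Definition independent_family n (X : 'I_n -> Omega -> H) : Prop :=
  forall A : 'I_n -> set (borel H), (forall i, measurable (A i)) ->
    P [set w | forall i, A i (X i w)] = (\prod_(i < n) P (X i @^-1` A i))%E.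

(* Processes are indexed by R; only times in [0, +oo[ (for Wiener processes)
   or in [0, 1] are meaningful. *)

Definition independent_of_process (X : Omega -> H) (W : R -> Omega -> H) : Prop :=
  forall n (t : 'I_n -> R) (A : set (borel H)) (B : 'I_n -> set (borel H)),
    (forall i, 0 <= t i) -> measurable A -> (forall i, measurable (B i)) ->
    P (X @^-1` A `&` [set w | forall i, B i (W (t i) w)]) =
    (P (X @^-1` A) * P [set w | forall i, B i (W (t i) w)])%E.

Definition gaussian_process (W : R -> Omega -> H) : Prop :=
  forall n (t : 'I_n -> R) (h : 'I_n -> H), (forall i, 0 <= t i) ->
    exists m v, 0 <= v /\ forall A : set R, measurable A ->
      P [set w | A (\sum_(i < n) ip (h i) (W (t i) w))] = gaussian1 m v A.

Definition Q_wiener (Q : H -> H) (W : R -> Omega -> H) : Prop :=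
  [/\ forall t, 0 <= t -> random_vector (W t),
      {ae P, forall w, {within `[0, +oo[, continuous (W^~ w)}}
        /\ gaussian_process W,
      {ae P, forall w, W 0 w = 0},
      forall n (t : nat -> R), 0 <= t 0%N -> (forall i, t i <= t i.+1) ->
        independent_family
          (fun (i : 'I_n) w => W (t i.+1) w - W (t i) w)
    & forall s t, 0 <= s -> s <= t ->
        gaussian_vector (fun w => W t w - W s w) 0 (fun x => (t - s) *: Q x)].

(* H is separable, so the Bochner integral is characterized by Borel
   measurability, integrability of the norm, and the scalar integrals. *)
Definition is_bochner_integral (f : R -> H) (a b : R) (v : H) : Prop :=
  [/\ measurable_fun `[a, b] (f : R -> borel H),
      leb.-integrable `[a, b] (fun s => (`|f s|)%:E)
    & forall h, ip h v = \int[leb]_(s in `[a, b]) ip h (f s)].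

(* The Ito integral on [0, t] of a continuous deterministic scalar integrand
   is the mean-square limit of its left-endpoint Riemann sums. *)
Definition is_ito_integral (W : R -> Omega -> H) (phi : R -> R) (t : R)
    (M : Omega -> H) : Prop :=
  random_vector M /\
  (fun n => \int[P]_w
     ((`| \sum_(k < n) phi (k%:R * t / n%:R) *:
            (W (k.+1%:R * t / n%:R) w - W (k%:R * t / n%:R) w) - M w | ^+ 2)%:E))%E
    @ \oo --> 0%E.

(* dY_t = - sigma_t / 2 Y_t dt + sqrt(sigma_t) dW_t on [0, 1], in integral
   form, with initial condition independent of the noise. *)
Definition sde_solution (sigma : R -> R) (W Y : R -> Omega -> H) : Prop :=
  [/\ forall t, t \in `[0, 1] -> random_vector (Y t),
      {ae P, forall w, {within `[0, 1], continuous (Y^~ w)}},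
      independent_of_process (Y 0) W
    & exists M : R -> Omega -> H, forall t, t \in `[0, 1] ->
        is_ito_integral W (fun s => Num.sqrt (sigma s)) t (M t) /\
        {ae P, forall w,
          is_bochner_integral (fun s => - (sigma s / 2) *: Y s w) 0 t
            (Y t w - Y 0 w - M t w)}].

Definition is_conditional_law (nu : probability (borel H) R)
    (X Y : Omega -> H) (K : R.-pker (borel H) ~> (borel H)) : Prop :=
  forall A B : set (borel H), measurable A -> measurable B ->
    P (X @^-1` A `&` Y @^-1` B) = (\int[nu]_(x in A) K x B)%E.

(* g(x) = E[V | X = x].  V need not be integrable: it is enough that it is
   integrable on the events {X \in B n} of a countable cover, as is the case of
   the velocity of a process whose initial law has no first moment.  For
   integrable V this is the usual conditional expectation. *)
Definition is_conditional_expectation (V X : Omega -> H) (g : H -> H) : Prop :=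
  [/\ random_vector V,
      measurable_fun setT (g : borel H -> borel H),
      exists B : nat -> set (borel H),
        [/\ forall n, measurable (B n), \bigcup_n B n = setT
          & forall n, P.-integrable (X @^-1` B n) (fun w => (`|V w|)%:E)]
    & forall B : set (borel H), measurable B ->
        P.-integrable (X @^-1` B) (fun w => (`|V w|)%:E) ->
        P.-integrable (X @^-1` B) (fun w => (`|g (X w)|)%:E) /\
        forall h, \int[P]_(w in X @^-1` B) ip h (V w) =
                  \int[P]_(w in X @^-1` B) ip h (g (X w))].

Definition law_support (X : Omega -> H) : set H :=
  [set x | forall r, 0 < r -> (0 < P (X @^-1` ball x r))%E].

Definition measurable_field (v : R -> H -> H) : Prop :=
  measurable_fun ([set p | 0 <= p.1 <= 1] : set (measurableTypeR R * borel H))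
    ((fun p => v p.1 p.2) : measurableTypeR R * borel H -> borel H).

Definition velocity (X : R -> Omega -> H) (t : R) (w : Omega) : H :=
  derive1 (X^~ w) t.

(* The time derivative and the conditional expectation are required at almost
   every time: this determines the flow, and the processes of interest need not
   be differentiable at the time 0. *)
Definition conditional_velocity (X : R -> Omega -> H) (v : R -> H -> H) : Prop :=
  {ae leb, forall t, t \in `[0, 1] ->
     (forall w, derivable (X^~ w) t 1) /\
     is_conditional_expectation (velocity X t) (X t) (v t)}.

Definition expected_velocity (X : R -> Omega -> H) (v : R -> H -> H) : Prop :=
  [/\ measurable_field v,
      conditional_velocity X v
    & forall t x, t \in `[0, 1] -> ~ law_support (X t) x -> v t x = 0].

(* Flow of dZ_t = v(t, Z_t) dt run in reverse time from Z_1 ~ N(0, Q). *)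
Definition reverse_flow (Q : H -> H) (v : R -> H -> H) (Z : R -> Omega -> H)
    : Prop :=
  [/\ forall t, t \in `[0, 1] -> random_vector (Z t),
      gaussian_vector (Z 1) 0 Q
    & {ae P, forall w, forall t, t \in `[0, 1] ->
        is_bochner_integral (fun s => v s (Z s w)) t 1 (Z 1 w - Z t w)}].

End random_variables.

Fixpoint Cn m (n : nat) (f : 'rV[R]_m -> R) : Prop :=
  continuous f /\
  if n is k.+1 then
    forall v, (forall x, derivable f x v) /\ Cn k (fun x => 'D_v f x)
  else True.

Definition test_function m (f : 'rV[R]_m -> R) : Prop :=
  (forall n, Cn n f) /\ compact (closure [set x | f x != 0]).

Definition cylinder (zeta : nat -> H) m (f : 'rV[R]_m -> R) (x : H) : R :=
  f (\row_(i < m) ip (zeta i) x).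

Section log_gradient.
Variables (Q : {linear H -> H}) (I : pred nat) (zeta : nat -> H) (lam : nat -> R).

Definition fomin_derivative (mu : {measure set (borel H) -> \bar R}) (h : H) (rho_h : H -> R) : Prop :=
  mu.-integrable setT ((fun x => (rho_h x)%:E) : borel H -> \bar R) /\
  forall m (f : 'rV[R]_m -> R), (forall i : 'I_m, I i) -> test_function f ->
    \int[mu]_x 'D_h (cylinder zeta f : H -> R) x =
    - \int[mu]_x (cylinder zeta f x * rho_h x).

(* <rho, h>_{H_Q} is the limit in L^2(mu) of the truncated pairings. *)
Definition is_log_gradient (mu : {measure set (borel H) -> \bar R})
    (rho : H -> H) : Prop :=
  measurable_fun setT (rho : borel H -> borel H) /\
  forall h, cameron_martin Q h ->
    exists2 rho_h, fomin_derivative mu h rho_h &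
      (fun n => \int[mu]_x
        (((\sum_(i < n | I i) (lam i)^-1 * ip (rho x) (zeta i) * ip h (zeta i)
          - rho_h x) ^+ 2)%:E))%E @ \oo --> 0%E.

(* It is unique up to mu-null sets.  A measure without a logarithmic gradient
   (such as a Dirac mass, at the times where no noise has been added yet) gets
   the value 0. *)
Definition log_gradient (mu : {measure set (borel H) -> \bar R}) : H -> H :=
  xget (fun=> 0) (is_log_gradient mu).

Section score.
Variables (Pdata : probability (borel H) R).
Variable mu : R -> R.-pker (borel H) ~> (borel H).

(* Loss over the times in [eps, 1]; Pdata is the law of Y_0 and mu t y that of
   Y_t given Y_0 = y. *)
Definition score_loss (eps : R) (S : R -> H -> H) : \bar R :=
  (\int[leb]_(t in `[eps, 1%R]) \int[Pdata]_y \int[mu t y]_x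
     ((`| S t x - log_gradient (mu t y) x | ^+ 2)%:E))%E.

Definition minimizes_from (eps : R) (S : R -> H -> H) : Prop :=
  forall S', measurable_field S' ->
    (score_loss eps S <= score_loss eps S')%E.

(* The conditional laws become singular as t -> 0 and the loss over [0, 1] may
   be infinite for every S, so that its minimization carries no information;
   in that case S is required to minimize the loss over all [eps, 1], eps > 0
   (which follows from minimality over [0, 1] when the loss is finite). *)
Definition score_minimizer (S : R -> H -> H) : Prop :=
  [/\ measurable_field S,
      minimizes_from 0 S
    & score_loss 0 S = +oo%E ->
      forall eps, 0 < eps < 1 -> minimizes_from eps S].

End score.
End log_gradient.

Definition eta (sigma : R -> R) (t : R) : R :=
  expR (- (2^-1 * \int[leb]_(s in `[0, t]) sigma s)).

Definition kappa (sigma : R -> R) (t : R) : R :=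
  \int[leb]_(s in `[0, t])
     (expR (- \int[leb]_(u in `[s, t]) sigma u) * sigma s).

Definition interpolation (sigma : R -> R) (Omega : Type) (X0 U : Omega -> H)
    (t : R) (w : Omega) : H :=
  eta sigma t *: X0 w + Num.sqrt (kappa sigma t) *: U w.

Definition prob_flow_field (sigma : R -> R) (S : R -> H -> H) (t : R) (x : H) : H :=
  - (sigma t / 2) *: (x + S t x).

End hilbert.

(* Main.v *)
Require Import Defs.
From HB Require Import structures.
From mathcomp Require Import all_boot all_order all_algebra sesquilinear.
From mathcomp Require Import all_classical all_reals all_analysis.
From mathcomp Require Import measurable_realfun lebesgue_integral_under.
From mathcomp Require Import ring lra.
Set Implicit Arguments.
Unset Strict Implicit.
Unset Printing Implicit Defensive.
Import Order.TTheory GRing.Theory Num.Theory.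
Import numFieldNormedType.Exports.
Local Open Scope classical_set_scope.
Local Open Scope ring_scope.

(* Put e = eta t, k = sqrt (kappa t) and X_t = e Y'_0 + k U.  Since kappa is
   1 - eta^2, the velocity of X at t is -(sigma_t / 2) (X_t - U / k).

   Given Y_0, the solution Y_t of the SDE has the law of e Y_0 + k U.  Indeed, if
   B is a primitive of sigma vanishing at 0, then exp(B_t / 2) <h, Y_t> - <h, Y_0>
   is a limit of Riemann sums of independent Gaussian increments, which determines
   the joint characteristic function of Y_0 and Y_t.

   By Gaussian integration by parts the logarithmic gradient of the law of
   e y + k U is -u / k at e y + k u, so the loss is the integral in t of
   E |S(t, X_t) + U / k|^2.  Its first variation at the minimizer in the directions
   1_A(t) 1_C(x) zeta_i gives E[S(t, X_t) + U / k | X_t] = 0 for almost every t with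
   kappa t > 0, hence E[X'_t | X_t] = -(sigma_t / 2) (X_t + S(t, X_t)).  Where kappa
   vanishes, sigma vanishes too and X is locally constant.

   As soon as kappa t > 0 the law of X_t has full support, so that the field
   only has to be modified at the time 0 to vanish outside the supports. *)

(** * Integration *)

(** Nothing is known about how the logarithmic gradients depend on [t] and [y]: [mu] is given time
    by time and [log_gradient] is picked by [xget]. The loss is therefore treated as a lower
    integral, and computed only over [[eps], 1] with [kappa sigma eps > 0], where its integrand
    proves to be measurable in t. Rational [eps] then exhaust the times with noise.

    The weight exp(B / 2) does not occur in the given Ito integrals, which are limits of Riemann
    sums of sqrt sigma alone. Hence two meshes: the weight is frozen on a coarse one, the Ito sums
    run on a refinement, and the refinement passes to its limit first, in mean square, before the
    coarse mesh does, path by path.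

    Laws on H are compared through cosines and sines of <h, x>, one coordinate at a time, by
    smoothing indicators of half-lines with narrow Gaussians. A function of Y_0 is kept as a factor,
    which yields joint laws from uniqueness on H alone.

    The data may have no first moment: the velocity is integrable only on events such as {|X_t| <
    n}, where X_t - U / k is dominated by n + |U| / k. *)

Section density.
Context d (T : measurableType d) (R : realType).
Variables (nu : {finite_measure set T -> \bar R}) (mu : {sigma_finite_measure set T -> \bar R}).
Variable p : T -> R.
Hypotheses (mp : measurable_fun setT p) (p0 : forall x, 0 <= p x).
Hypothesis nuE : forall A, measurable A -> nu A = (\int[mu]_(x in A) (p x)%:E)%E.

Lemma density_dominates : nu `<< mu.
Proof.
apply/null_content_dominatesP => A mA A0; rewrite nuE//.
by apply: null_set_integral => //; apply/measurable_EFinP; exact: measurable_funTS.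
Qed.

(** The Radon-Nikodym derivative of [nu] and [p] have the same integral over every measurable set,
    so they agree [mu]-almost everywhere, and the change of variables for the former passes to
    [p]. *)
Lemma ge0_integral_density (f : T -> \bar R) : measurable_fun setT f ->
  (forall x, 0 <= f x)%E -> (\int[nu]_x f x = \int[mu]_x (f x * (p x)%:E))%E.
Proof.
move=> mf f0.
rewrite -(Radon_Nikodym_SigmaFinite.change_of_variables density_dominates)//.
have If := Radon_Nikodym_SigmaFinite.f_integrable density_dominates.
apply: ae_eq_integral => //.
- by apply: emeasurable_funM => //; exact: measurable_int If.
- by apply: emeasurable_funM => //; exact/measurable_EFinP.
apply: ae_eqe_mul2l; apply: integral_ae_eq => //; first exact/measurable_EFinP.
move=> E _ mE; rewrite -nuE//.
by rewrite -(Radon_Nikodym_SigmaFinite.f_integral density_dominates).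
Qed.

Lemma integrable_density (f : T -> R) : measurable_fun setT f ->
  nu.-integrable setT (EFin \o f) <-> mu.-integrable setT (fun x => (f x * p x)%:E).
Proof.
move=> mf; have E : (\int[nu]_x `|(f x)%:E| = \int[mu]_x `|(f x * p x)%:E|)%E.
  rewrite ge0_integral_density//; last exact/measurableT_comp/measurable_EFinP.
  by apply: eq_integral => x _; rewrite EFinM abseM [in RHS](gee0_abs (_ : 0 <= (p x)%:E)%E)// lee_fin.
have m1 : measurable_fun setT (EFin \o f) by exact/measurable_EFinP.
have m2 : measurable_fun setT (fun x => (f x * p x)%:E).
  by apply/measurable_EFinP; exact: measurable_funM.
split=> /integrableP[_ h]; apply/integrableP; split => //.
  by rewrite -E.
by rewrite E.
Qed.

Lemma integral_density (f : T -> R) : nu.-integrable setT (EFin \o f) ->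
  (\int[nu]_x (f x)%:E = \int[mu]_x (f x * p x)%:E)%E.
Proof.
move=> intf.
have mf := measurable_int _ intf.
rewrite integralE ge0_integral_density//; last exact: measurable_funepos.
rewrite ge0_integral_density//; last exact: measurable_funeneg.
rewrite [RHS]integralE; congr (_ - _)%E; apply: eq_integral => x _ /=.
  rewrite !funeposE /= -!EFin_max -EFinM; congr EFin.
  by rewrite -{2}[0](mul0r (p x)) maxr_pMl.
rewrite !funenegE /= -!EFin_max -EFinM; congr EFin.
by rewrite -mulNr -{2}[0](mul0r (p x)) maxr_pMl.
Qed.

End density.

Section finite_bounded.
Context d (T : measurableType d) (R : realType).
Variable (mu : {finite_measure set T -> \bar R}).

Lemma bounded_integrable (f : T -> R) (C : R) : measurable_fun setT f ->
  (forall x, `|f x| <= C) -> mu.-integrable setT (EFin \o f).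
Proof.
move=> mf fC; apply: measurable_bounded_integrable => //.
  by rewrite -ge0_fin_numE// fin_num_measure.
exists C; split; first exact: num_real.
by move=> M CM x _ /=; apply: (le_trans (fC x)); apply: ltW.
Qed.

End finite_bounded.

Section Rdominated.
Context d (T : measurableType d) (R : realType).
Variables (mu : {measure set T -> \bar R}) (D : set T).
Hypothesis mD : measurable D.

Lemma Rdominated_convergence (f_ : nat -> T -> R) (f g : T -> R) :
  (forall n, measurable_fun D (f_ n)) -> measurable_fun D f ->
  {ae mu, forall x, D x -> f_ ^~ x @ \oo --> f x} ->
  mu.-integrable D (EFin \o g) ->
  {ae mu, forall x n, D x -> `|f_ n x| <= g x} ->
  mu.-integrable D (EFin \o f) /\
  \int[mu]_(x in D) f_ n x @[n --> \oo] --> \int[mu]_(x in D) f x.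
Proof.
move=> mf_ mf cf ig fg.
have mEf_ n : measurable_fun D (EFin \o f_ n) by exact/measurable_EFinP.
have mEf : measurable_fun D (EFin \o f) by exact/measurable_EFinP.
have cEf : {ae mu, forall x, D x -> (EFin \o f_ n) x @[n --> \oo] --> (EFin \o f) x}.
  apply: filterS cf => x h Dx; apply: cvg_EFin; first exact: nearW.
  exact: h.
have fEg : {ae mu, forall x n, D x -> (`|(EFin \o f_ n) x| <= (EFin \o g) x)%E}.
  by apply: filterS fg => x h n Dx; rewrite /= lee_fin; exact: h.
have [intf _ h] := dominated_convergence mD mEf_ mEf cEf ig fEg.
split=> //; apply: fine_cvg; rewrite /Rintegral fineK//.
exact: integrable_fin_num.
Qed.

End Rdominated.

Section real_calculus.
Context {R : realType}.
Local Notation leb := (@lebesgue_measure R).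

Lemma is_derive_continuous (h h' : R -> R) :
  (forall x : R, is_derive x 1 h (h' x)) -> continuous h.
Proof.
by move=> dh x; apply/differentiable_continuous/derivable1_diffP; exact: (ex_derive (is_derive := dh x)).
Qed.

Lemma integral_is_derive (F f : R -> R) (a b : R) : a < b ->
  (forall x : R, is_derive x 1 F (f x)) -> continuous f ->
  (\int[leb]_(x in `[a, b]) (f x)%:E = (F b)%:E - (F a)%:E)%E.
Proof.
move=> ab dF cf; apply: continuous_FTC2 => //.
- exact: continuous_subspaceT.
- have cF := is_derive_continuous dF.
  split; first by move=> x _; exact: (ex_derive (is_derive := dF x)).
    by apply: cvg_at_right_filter; exact: cF.
  by apply: cvg_at_left_filter; exact: cF.
- by move=> x _; rewrite derive1E; exact: (derive_val (is_derive := dF x)).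
Qed.

End real_calculus.

Lemma Rintegral_prob_cst d (T : measurableType d) (R : realType) (P : probability T R) (c : R) :
  \int[P]_x c = c.
Proof. by rewrite /Rintegral integral_cst//= [X in (_ * X)%E](_ : _ = 1%E) ?mule1//; exact: probability_setT. Qed.

(** * Real Gaussian measures and characteristic functions *)

Section normal_law.
Context {R : realType}.
Variables (m s : R).
Hypothesis s0 : s != 0.
Local Notation leb := (@lebesgue_measure R).
Local Notation pdf := (normal_pdf m s).
Local Notation N := (normal_prob m s).

Let s2_gt0 : 0 < s ^+ 2.
Proof. by rewrite exprn_even_gt0. Qed.

Lemma is_derive_normal_pdf (x : R) :
  is_derive x 1 pdf (- (x - m) / s ^+ 2 * pdf x).
Proof.
rewrite normal_pdfE// /normal_fun.
have H : is_derive x 1 (fun y : R => - (y - m) ^+ 2 / (s ^+ 2 *+ 2)) (- (x - m) / s ^+ 2).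
  apply: is_derive_eq; rewrite scaler0 add0r /GRing.scale /=.
  by field.
have H2 : is_derive x 1 (fun y : R => expR (- (y - m) ^+ 2 / (s ^+ 2 *+ 2)))
   (- (x - m) / s ^+ 2 * expR (- (x - m) ^+ 2 / (s ^+ 2 *+ 2))).
  rewrite mulrC; exact: (is_derive1_comp (is_derive_expR _) H).
apply: is_derive_eq; rewrite /GRing.scale /=. ring.
Qed.

Lemma cvg_integral_itvNn (f : R -> R) : leb.-integrable setT (EFin \o f) ->
  \int[leb]_(x in `[- n%:R, n%:R]) f x @[n --> \oo] --> \int[leb]_x f x.
Proof.
move=> intf; have mf := measurable_int _ intf.
have mf' : measurable_fun setT f by exact/measurable_EFinP.
have [] := @Rdominated_convergence _ _ _ leb setT measurableT
  (fun n : nat => f \_ `[- n%:R, n%:R]) f (fun x => `|f x|).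
- by move=> n; apply/(measurable_restrictT _ _).1 => //; exact: measurable_funTS.
- exact: mf'.
- apply: aeW => x _; apply: cvg_near_cst.
  near=> n; rewrite patchE mem_set//= in_itv/= -ler_norml.
  by near: n; apply: nbhs_infty_ger.
- exact: integrable_norm.
- apply: aeW => x n _; rewrite patchE; case: ifP => // _.
  by rewrite normr0.
by move=> _; under eq_fun do rewrite -Rintegral_mkcond.
Unshelve. all: by end_near. Qed.

(** Integration by parts on [m - n, m + n]: the boundary terms of the primitive [F] have the right
    signs, so an inequality follows without any decay at infinity. Monotone convergence concludes,
    and the inequality is enough for integrability and for Chebyshev. *)
Lemma normal_second_moment :
  (\int[N]_x ((x - m) ^+ 2)%:E <= (s ^+ 2)%:E)%E.
Proof.
rewrite (@ge0_integral_density _ _ _ N leb pdf (measurable_normal_pdf m s) (fun _ _ => erefl)); last 2 first.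
- exact/measurable_EFinP/measurable_funX/measurable_funB.
- by move=> x; rewrite lee_fin sqr_ge0.
pose F : R -> R := fun x => - (x - m) * s ^+ 2 * pdf x.
pose f (x : R) := (x - m) ^+ 2 * pdf x - s ^+ 2 * pdf x.
have dF (x : R) : is_derive x 1 F (f x).
  have ? := is_derive_normal_pdf x.
  rewrite /F; apply: is_derive_eq.
  rewrite /GRing.scale /= /f; field. done.
have cpdf := @continuous_normal_pdf _ m s s0.
have c1 : continuous (fun x : R => (x - m) ^+ 2 * pdf x).
  move=> x; apply: cvgM; last exact: cpdf.
  by apply: cvgM; (apply: cvgB; [exact: cvg_id|exact: cvg_cst]).
have c2 : continuous (fun x => s ^+ 2 * pdf x).
  by move=> x; apply: cvgM; [exact: cvg_cst|exact: cpdf].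
have cf : continuous f by move=> x; apply: cvgB; [exact: c1|exact: c2].
have cF : continuous F by move=> x; apply/differentiable_continuous/derivable1_diffP.
have I2 n : (\int[leb]_(x in `[(m - n%:R)%R, (m + n%:R)%R]) ((x - m) ^+ 2 * pdf x)%:E <= (s ^+ 2)%:E)%E.
  case: n => [|n].
    by rewrite subr0 addr0 set_itv1 integral_set1 lee_fin ltW.
  have mn : m - n.+1%:R < m + n.+1%:R by rewrite ltrBlDr -addrA ltrDl ltr_pwDl.
  have cw (h : R -> R) : continuous h -> leb.-integrable `[m - n.+1%:R, m + n.+1%:R] (EFin \o h).
    move=> ch; apply: continuous_compact_integrable; first exact: segment_compact.
    exact: continuous_subspaceT.
  have := integral_is_derive mn dF cf.
  under eq_integral do rewrite EFinB.
  rewrite integralB//=; [|exact: (cw _ c1)|exact: (cw _ c2)].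
    move=> e; have le12 : (\int[leb]_(x in `[(m - n.+1%:R)%R, (m + n.+1%:R)%R]) ((x - m) ^+ 2 * pdf x)%:E <=
     \int[leb]_(x in `[(m - n.+1%:R)%R, (m + n.+1%:R)%R]) (s ^+ 2 * pdf x)%:E)%E.
    rewrite -sube_le0 ?e// -EFinB lee_fin /F.
    rewrite subr_le0; apply: (@le_trans _ _ 0).
      rewrite (_ : m + n.+1%:R - m = n.+1%:R); last by ring.
      rewrite 2!mulNr oppr_le0.
      exact: (mulr_ge0 (mulr_ge0 (ler0n _ _) (ltW s2_gt0)) (normal_pdf_ge0 _ _ _)).
    rewrite (_ : - (m - n.+1%:R - m) = n.+1%:R); last by ring.
    exact: (mulr_ge0 (mulr_ge0 (ler0n _ _) (ltW s2_gt0)) (normal_pdf_ge0 _ _ _)).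
  apply: (le_trans le12).
  apply: (@le_trans _ _ (\int[leb]_x (s ^+ 2 * pdf x)%:E)%E).
    apply: ge0_subset_integral => //.
      by apply/measurable_EFinP/measurable_funM => //; exact: measurable_normal_pdf.
    by move=> x _; rewrite lee_fin mulr_ge0 ?normal_pdf_ge0// ltW.
  under eq_integral do rewrite EFinM.
  rewrite integralZl//; last exact: integrable_normal_pdf.
  by rewrite integral_normal_pdf mule1.
have mI : measurable_fun [set: measurableTypeR R] (fun x : R => ((x - m) ^+ 2 * pdf x)%:E).
  by apply/measurable_EFinP/measurable_funM; [exact/measurable_funX/measurable_funB|exact: measurable_normal_pdf].
have h := @ge0_nondecreasing_set_cvg_integral _ (measurableTypeR R) R (fun n : nat => `[m - n%:R, m + n%:R]%classic) (fun x : R => ((x - m) ^+ 2 * pdf x)%:E) leb.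
have UT : \bigcup_i (`[m - i%:R, m + i%:R]%classic : set R) = setT.
  apply/seteqP; split=> // x _.
  have [n hn] : exists n : nat, `|x - m| <= n%:R.
    by exists (Num.truncn `|x - m|).+1; rewrite ltW// truncnS_gt.
  by exists n => //=; rewrite in_itv/= -ler_distl.
move: h; rewrite UT => h.
under eq_integral do rewrite -EFinM.
have {}h := h _ (fun i => measurable_itv _) (fun i => measurable_funTS mI) _.
rewrite -(cvg_lim _ (h _ _))//.
- apply: lime_le; last exact: nearW.
  apply: cvgP; apply: h.
    move=> i j ij; rewrite subsetEset => x /=; rewrite !in_itv/=; have : (i%:R <= j%:R :> R) by rewrite ler_nat.
    by move=> ? /andP[? ?]; apply/andP; split; lra.
  by move=> i x _; rewrite lee_fin mulr_ge0 ?sqr_ge0 ?normal_pdf_ge0.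
- move=> i j ij; rewrite subsetEset => x /=; rewrite !in_itv/=; have : (i%:R <= j%:R :> R) by rewrite ler_nat.
  by move=> ? /andP[? ?]; apply/andP; split; lra.
- by move=> i x _; rewrite lee_fin mulr_ge0 ?sqr_ge0 ?normal_pdf_ge0.
Qed.

Lemma integrable_normal_sqr : N.-integrable setT (fun x => ((x - m) ^+ 2)%:E).
Proof.
apply/integrableP; split; first exact/measurable_EFinP/measurable_funX/measurable_funB.
under eq_integral do rewrite gee0_abs ?lee_fin ?sqr_ge0//.
by rewrite (le_lt_trans normal_second_moment)// ltry.
Qed.

Lemma integrable_normal_center : N.-integrable setT (fun x => (x - m)%:E).
Proof.
apply: (@le_integrable _ _ _ N _ measurableT _ (fun x => (1 + (x - m) ^+ 2)%:E)).
- exact/measurable_EFinP/measurable_funB.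
- move=> x _; rewrite !abse_EFin lee_fin [leRHS]ger0_norm; last by rewrite addr_ge0// sqr_ge0.
  rewrite -real_normK ?num_real//; have := normr_ge0 (x - m).
  move: `|x - m| => y; nra.
- under eq_fun do rewrite EFinD.
  apply: integrableD => //; last exact: integrable_normal_sqr.
  exact: finite_measure_integrable_cst.
Qed.

(** Comes from [1 + u <= expR u]. Quadratic decay suffices for the boundary terms in Stein's
    identity. *)
Lemma normal_pdf_le_sqr x : pdf x * (x - m) ^+ 2 <= normal_peak s * (s ^+ 2 *+ 2).
Proof.
rewrite normal_pdfE// /normal_fun mulNr expRN -mulrA ler_wpM2l ?normal_peak_ge0//.
set u := (x - m) ^+ 2; have u0 : 0 <= u by exact: sqr_ge0.
have s22 : 0 < s ^+ 2 *+ 2 by rewrite pmulrn_lgt0.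
rewrite mulrC ler_pdivrMr ?expR_gt0// -ler_pdivrMl// mulrC.
by rewrite (le_trans _ (expR_ge1Dx _))// lerDr.
Qed.

Lemma cvg_normal_pdf_infty : (pdf n%:R @[n --> \oo] --> (0 : R)) /\ (pdf (- n%:R) @[n --> \oo] --> (0 : R)).
Proof.
have K (e : R) : 0 < e -> exists M : R, forall x, M <= `|x| -> pdf x < e.
  move=> e0; set c := normal_peak s * (s ^+ 2 *+ 2).
  have c0 : 0 <= c by rewrite mulr_ge0 ?normal_peak_ge0// mulrn_wge0// sqr_ge0.
  exists (`|m| + c / e + 1) => x xM.
  have xm : c / e + 1 <= `|x - m|.
    have := lerB_dist x m; lra.
  have ce : 0 <= c / e by rewrite divr_ge0// ltW.
  have h1 : c / e < (x - m) ^+ 2.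
    rewrite -real_normK ?num_real//; nra.
  rewrite ltr_pdivrMr// in h1.
  have h2 := normal_pdf_le_sqr x; rewrite -/c in h2.
  have := lt_le_trans h1 (le_refl _); rewrite ltNge; case: ltP => // ep.
  suff : c < c by rewrite ltxx.
  have s2 := sqr_ge0 (x - m).
  by apply: lt_le_trans h1 _; apply: le_trans h2; rewrite mulrC ler_wpM2r.
split; apply/cvgrPdist_lt => e e0; have [M hM] := K e e0; near=> n;
  rewrite sub0r normrN ger0_norm ?normal_pdf_ge0//; apply: hM; rewrite ?normrN ger0_norm//;
  by near: n; exact: nbhs_infty_ger.
Unshelve. all: by end_near. Qed.

(** The difference of the two integrands, multiplied by the density, is the derivative of
    [g x * pdf x], which tends to 0 at infinity because [g] is bounded. *)
Lemma normal_stein (g g' : R -> R) (C : R) : (forall x : R, is_derive x 1 g (g' x)) ->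
  continuous g' -> (forall x, `|g x| <= C) -> (forall x, `|g' x| <= C) ->
  \int[N]_x g' x = \int[N]_x (g x * ((x - m) / s ^+ 2)).
Proof.
move=> dg cg' gC g'C.
have cg : continuous g by move=> x; apply/differentiable_continuous/derivable1_diffP.
have mg := continuous_measurable_fun cg; have mg' := continuous_measurable_fun cg'.
have ig' : N.-integrable setT (EFin \o g') by exact: (@bounded_integrable _ _ R N g' C mg' g'C).
have ig : N.-integrable setT (fun x => (g x * ((x - m) / s ^+ 2))%:E).
  have := @integrableMr _ _ _ N setT measurableT g (fun x => ((x - m) / s ^+ 2)%:E).
  move=> /(_ mg) h; apply: h.
    by exists C; split; [exact: num_real|move=> M CM x _ /=; apply: (le_trans (gC x)); exact: ltW].
  under eq_fun do rewrite mulrC EFinM.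
  exact/integrableZl/integrable_normal_center.
have dens := @integral_density _ _ _ N leb pdf (measurable_normal_pdf m s) (normal_pdf_ge0 m s) (fun _ _ => erefl).
have densi (f : R -> R) : measurable_fun setT f -> N.-integrable setT (EFin \o f) -> leb.-integrable setT (fun x => (f x * pdf x)%:E).
  by move=> mf /(@integrable_density _ _ _ N leb pdf (measurable_normal_pdf m s) (normal_pdf_ge0 m s) (fun _ _ => erefl) _ mf).
rewrite /Rintegral !dens//.
have i1 := densi _ mg' ig'.
have i2 := densi _ ((measurable_EFinP _ _).1 (measurable_int _ ig)) ig.
suff : \int[leb]_x (g' x * pdf x - g x * ((x - m) / s ^+ 2) * pdf x) = 0.
  by rewrite RintegralB// => /eqP; rewrite subr_eq0 => /eqP.
pose F x := g x * pdf x.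
have dF (x : R) : is_derive x 1 F (g' x * pdf x - g x * ((x - m) / s ^+ 2) * pdf x).
  have ? := is_derive_normal_pdf x; have ? := dg x.
  rewrite /F; apply: is_derive_eq; rewrite /GRing.scale /=. ring.
have h := cvg_integral_itvNn (integrableB measurableT i1 i2).
have cpdf := @continuous_normal_pdf _ m s s0.
have F0 : \int[leb]_(x in `[- n%:R, n%:R]) (g' x * pdf x - g x * ((x - m) / s ^+ 2) * pdf x) @[n --> \oo] --> (0 : R).
  have : F n%:R - F (- n%:R) @[n --> \oo] --> (0 - 0 : R).
    have [c1 c2] := cvg_normal_pdf_infty.
    have B (u : nat -> R) : (pdf (u n) @[n --> \oo] --> (0 : R)) -> F (u n) @[n --> \oo] --> (0 : R).
      move=> cu; apply/norm_cvg0P.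
      apply: (@squeeze_cvgr _ _ _ _ (fun=> 0) (fun n => `|C| * pdf (u n))).
      - near=> n; rewrite normr_ge0 /= normrM (ger0_norm (normal_pdf_ge0 _ _ _)).
        by rewrite ler_wpM2r ?normal_pdf_ge0// (le_trans (gC _))// ler_norm.
      - exact: cvg_cst.
      - by rewrite -(mulr0 `|C|); apply: cvgM => //; exact: cvg_cst.
    by apply: cvgB; exact: B.
  rewrite subr0; apply: cvg_trans; apply: near_eq_cvg; near=> n.
  have n0 : - n%:R < n%:R :> R.
    have : (0 < n)%N by near: n; exact: nbhs_infty_gt.
    by rewrite -(ltr_nat R) => ?; lra.
  rewrite /Rintegral (integral_is_derive n0 dF)// => x.
  apply: cvgB; apply: cvgM; try exact: cg'; try exact: cpdf.
  apply: cvgM; first exact: cg.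
  apply: cvgM; last exact: cvg_cst.
  by apply: cvgB; [exact: cvg_id|exact: cvg_cst].
exact: (cvg_unique _ h F0).
Unshelve. all: by end_near. Qed.

(** Multiplying [c] by the inverse of the expected Gaussian factor gives a function of zero
    derivative. *)
Let ode (c : R -> R) : (forall a : R, is_derive a 1 c (- (s ^+ 2) * a * c a)) ->
  forall a, c a = c 0 * expR (- (a ^+ 2 * s ^+ 2 / 2)).
Proof.
move=> dc a.
pose h := fun a : R => c a * expR (a ^+ 2 * s ^+ 2 / 2) : R.
have dh (x : R) : is_derive x 1 h 0.
  have H : is_derive x 1 (fun a : R => a ^+ 2 * s ^+ 2 / 2) (x * s ^+ 2).
    by apply: is_derive_eq; rewrite /GRing.scale /=; field.
  have H2 := is_derive1_comp (is_derive_expR _) H.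
  have H3 := dc x.
  have := @is_deriveM _ _ c (expR \o (fun a : R => a ^+ 2 * s ^+ 2 / 2)) x 1 _ _ H3 H2.
  move=> [h1 h2]; apply: DeriveDef; first exact: h1.
  rewrite [LHS]h2 /GRing.scale /=; ring.
have := @is_derive_0_is_cst R h a 0 dh.
rewrite /h expr0n /= !mul0r expR0 mulr1 => <-.
by rewrite expRN mulfK// gt_eqF// expR_gt0.
Qed.

Let idx : N.-integrable setT (fun x => `|x - m|%:E).
Proof. by have := integrable_abse integrable_normal_center. Qed.

(* Applied to the pairs (cos, - sin) and (sin, cos). *)
Let integral_normal_trig (u v : R -> R) : (forall x : R, is_derive x 1 u (v x)) ->
  (forall x : R, is_derive x 1 v (- u x)) -> (forall x, `|u x| <= 1) -> (forall x, `|v x| <= 1) ->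
  forall a, \int[N]_x u (a * (x - m)) = u 0 * expR (- (a ^+ 2 * s ^+ 2 / 2)).
Proof.
move=> du dv u1 v1 a.
have cu := is_derive_continuous du; have cv := is_derive_continuous dv.
pose c (a : R) : R := \int[N]_x u (a * (x - m)).
have dc (t : R) : is_derive t 1 c (- (s ^+ 2) * t * c t).
  have ml (r : R) : measurable_fun [set: measurableTypeR R] (fun x : R => r * (x - m)).
    by apply: measurable_funM => //; exact: measurable_funB.
  have I (r : R) : N.-integrable setT (EFin \o (fun x => u (r * (x - m)))).
    apply: (@bounded_integrable _ _ R N _ 1); last by move=> x; exact: u1.
    by apply: measurableT_comp => //; exact: continuous_measurable_fun.
  have dd (r y : R) : is_derive r 1 (fun t : R => u (t * (y - m))) (v (r * (y - m)) * (y - m)).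
    have H : is_derive r 1 (fun t : R => t * (y - m)) (y - m).
      apply: is_derive_eq; rewrite /GRing.scale /=; ring.
    exact: (is_derive1_comp (du _) H).
  have pE (r y : R) : partial1of2 (fun t y => u (t * (y - m))) r y = v (r * (y - m)) * (y - m).
    by rewrite partial1of2E; exact: (derive_val (is_derive := dd r y)).
  have aI : (`]t - 1, t + 1[%classic : set R) t.
    by rewrite /= in_itv/=; apply/andP; split; lra.
  have G (r y : R) : `|partial1of2 (fun t y => u (t * (y - m))) r y| <= `|y - m|.
    by rewrite pE normrM ler_piMl//; exact: v1.
  have D1 := @derivable_under_integral _ _ _ N (fun t y => u (t * (y - m))) setT measurableT t (t - 1) (t + 1) aI (fun t _ => I t)
    (fun t y _ _ => ex_derive (is_derive := dd t y)) (fun y => `|y - m|) (fun y => normr_ge0 _) idx (fun t y _ _ => G t y).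
  have D2 := @differentiation_under_integral _ _ _ N (fun t y => u (t * (y - m))) setT measurableT t (t - 1) (t + 1) aI (fun t _ => I t)
    (fun t y _ _ => ex_derive (is_derive := dd t y)) (fun y => `|y - m|) (fun y => normr_ge0 _) idx (fun t y _ _ => G t y).
  apply: DeriveDef; first exact: D1.
  rewrite -derive1E [LHS]D2.
  under eq_Rintegral do rewrite pE.
  (* Differentiation under the integral has produced the integral of [v (t * (x - m)) * (x - m)].
     Stein's identity for [v (t * (x - m))] turns it into [- s ^+ 2 * t] times the integral of [u],
     which is the equation solved by [ode]. *)
  have dg (x : R) : is_derive x 1 (fun x => v (t * (x - m))) (- u (t * (x - m)) * t).
    have H : is_derive x 1 (fun x : R => t * (x - m)) t.
      apply: is_derive_eq; rewrite /GRing.scale /=; ring.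
    exact: (is_derive1_comp (dv _) H).
  have := @normal_stein _ _ (1 + `|t|) dg _ _ _.
  have -> : \int[N]_x (- u (t * (x - m)) * t) = - t * c t.
    under eq_Rintegral do rewrite mulNr -mulrN.
    by rewrite RintegralZr// mulrC.
  have -> : \int[N]_x (v (t * (x - m)) * ((x - m) / s ^+ 2)) = (s ^+ 2)^-1 * \int[N]_x (v (t * (x - m)) * (x - m)).
    under eq_Rintegral do rewrite mulrA mulrC.
    rewrite RintegralZl//.
    have := @integrableMr _ _ _ N setT measurableT (fun x => v (t * (x - m))) (fun x => (x - m)%:E).
    apply => //.
    - by apply: (measurableT_comp (continuous_measurable_fun cv)); exact: ml.
    - by exists 1; split => // M M1 x _ /=; apply: (le_trans (v1 _)); exact: ltW.
    - exact: integrable_normal_center.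
  move=> h; have {}h : - t * c t = s ^- 2 * \int[N]_x (v (t * (x - m)) * (x - m)).
    apply: h.
    - move=> x; apply: cvgM; last exact: cvg_cst.
      apply: cvgN; apply: (@continuous_comp _ _ _ (fun x0 : R => t * (x0 - m)) u); last exact: cu.
      by apply: cvgM; [exact: cvg_cst|apply: cvgB; [exact: cvg_id|exact: cvg_cst]].
    - by move=> x; rewrite (le_trans (v1 _))// lerDl.
    - move=> x; rewrite normrM normrN; have := u1 (t * (x - m)); have := normr_ge0 t.
      have := normr_ge0 (u (t * (x - m))); nra.
  by rewrite -[LHS](@mulVKf _ (s ^+ 2)) ?lt0r_neq0// -h; ring.
rewrite -/(c a) (ode dc) /c; congr (_ * _).
under eq_Rintegral do rewrite mul0r.
exact: Rintegral_prob_cst.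
Qed.

Lemma integral_normal_cos (a : R) :
  \int[N]_x cos (a * (x - m)) = expR (- (a ^+ 2 * s ^+ 2 / 2)).
Proof.
rewrite (@integral_normal_trig cos (fun x => - sin x)) ?cos0 ?mul1r//.
- by move=> x; exact: cos_max.
- by move=> x; rewrite normrN; exact: sin_max.
Qed.

Lemma integral_normal_sin (a : R) : \int[N]_x sin (a * (x - m)) = 0.
Proof.
rewrite (@integral_normal_trig sin cos) ?sin0 ?mul0r//.
- by move=> x; exact: sin_max.
- by move=> x; exact: cos_max.
Qed.

(** Chebyshev's inequality. *)
Lemma normal_prob_tail (e : R) : 0 < e ->
  (N [set x | (e <= `|x - m|)%R] <= (s ^+ 2 / e ^+ 2)%:E)%E.
Proof.
move=> e0; have mE : measurable ([set x | e <= `|x - m|] : set (measurableTypeR R)).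
  rewrite (_ : [set x | _] = (fun x => `|x - m|) @^-1` `[e, +oo[); last first.
    by apply/seteqP; split=> x /=; rewrite in_itv/= andbT.
  rewrite -[X in measurable X]setTI; apply: (_ : measurable_fun setT (fun x : measurableTypeR R => `|x - m|)) => //.
  by apply: measurableT_comp => //; exact: measurable_funB.
have h : ((e ^+ 2)%:E * N [set x | (e <= `|x - m|)%R] <= (s ^+ 2)%:E)%E.
  apply: le_trans normal_second_moment.
  rewrite -integral_cst//.
  apply: (@le_trans _ _ (\int[N]_(x in [set x | (e <= `|x - m|)%R]) ((x - m) ^+ 2)%:E)%E).
    apply: ge0_le_integral => //.
    - by move=> x _; rewrite lee_fin sqr_ge0.
    - apply/measurable_EFinP; apply: measurable_funX; exact: measurable_funB.
    - move=> x /= ex; rewrite lee_fin -[leRHS]real_normK ?num_real// lerXn2r// ?nnegrE// ltW//.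
  apply: ge0_subset_integral => //.
  - by apply/measurable_EFinP; apply: measurable_funX; exact: measurable_funB.
  - by move=> x _; rewrite lee_fin sqr_ge0.
rewrite -[N _]fineK ?fin_num_measure// in h *.
by rewrite lee_fin ler_pdivlMr ?exprn_gt0// mulrC -lee_fin EFinM.
Qed.

End normal_law.

Section Rfubini.
Context d1 d2 (T1 : measurableType d1) (T2 : measurableType d2) (R : realType).
Variables (m1 : {sigma_finite_measure set T1 -> \bar R}) (m2 : {sigma_finite_measure set T2 -> \bar R}).

(** Integrability of every section, not just of almost every one, lets [fine] pass through the inner
    integrals. *)
Lemma RFubini (f : T1 * T2 -> R) : (m1 \x m2)%E.-integrable setT (EFin \o f) ->
  (forall x, m2.-integrable setT (fun y => (f (x, y))%:E)) ->
  (forall y, m1.-integrable setT (fun x => (f (x, y))%:E)) ->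
  \int[m1]_x \int[m2]_y f (x, y) = \int[m2]_y \int[m1]_x f (x, y).
Proof.
move=> If I1 I2; rewrite /Rintegral; congr fine.
transitivity (\int[m1]_x \int[m2]_y (EFin \o f) (x, y))%E.
  by apply: eq_integral => x _; rewrite fineK// integrable_fin_num.
rewrite Fubini//.
by apply: eq_integral => y _; rewrite fineK// integrable_fin_num.
Qed.
End Rfubini.

Section Rfubini_finite.
Context d1 d2 (T1 : measurableType d1) (T2 : measurableType d2) (R : realType).
Variables (m1 : {finite_measure set T1 -> \bar R}) (m2 : {finite_measure set T2 -> \bar R}).

Lemma integrable_prod_bounded (f : T1 * T2 -> R) (C : R) : measurable_fun setT f ->
  (forall z, `|f z| <= C) -> (m1 \x m2)%E.-integrable setT (EFin \o f).
Proof.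
move=> mf fC; have mEf : measurable_fun setT (EFin \o f) by exact/measurable_EFinP.
apply/integrableP; split => //.
apply: (@le_lt_trans _ _ (\int[(m1 \x m2)%E]_z (C%:E))%E).
  apply: ge0_le_integral => //; first exact: measurableT_comp.
  by move=> z _; rewrite lee_fin (le_trans _ (fC z)).
have mT : (m1 \x m2)%E setT = (m1 setT * m2 setT)%E by rewrite -setXTT product_measure1E.
rewrite integral_cst//= [X in (_ * X)%E]mT lte_mul_pinfty ?lee_fin ?(le_trans _ (fC point))//.
by rewrite ltey_eq fin_numM ?fin_num_measure.
Qed.

Lemma integrable_Rintegral_bounded (f : T1 * T2 -> R) (C : R) : measurable_fun setT f ->
  (forall z, `|f z| <= C) -> m1.-integrable setT (fun x => (\int[m2]_y f (x, y))%:E).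
Proof.
move=> mf fC; have := integrable_fubini_F (integrable_prod_bounded mf fC).
apply: eq_integrable => // x _; rewrite /fubini_F /Rintegral fineK//.
apply: integrable_fin_num => //.
apply: (@bounded_integrable _ _ R m2 (fun y => f (x, y)) C) => //.
exact: measurableT_comp.
Qed.

Lemma RFubini_bounded (f : T1 * T2 -> R) (C : R) : measurable_fun setT f ->
  (forall z, `|f z| <= C) ->
  \int[m1]_x \int[m2]_y f (x, y) = \int[m2]_y \int[m1]_x f (x, y).
Proof.
move=> mf fC; apply: RFubini; first exact: (integrable_prod_bounded mf fC).
- move=> x; apply: (@bounded_integrable _ _ R m2 (fun y => f (x, y)) C) => //.
  exact: measurableT_comp.
- move=> x; apply: (@bounded_integrable _ _ R m1 (fun y => f (y, x)) C) => //.
  exact: measurableT_comp.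
Qed.
End Rfubini_finite.

(** * Inversion of characteristic functions by Gaussian smoothing *)

Section inversion.
Context d (T : measurableType d) (R : realType).
Local Notation leb := (@lebesgue_measure R).

(** The indicator of []-oo, b]] smoothed by a centred Gaussian of standard deviation [s]; as a
    function of [x] it is the mass that the normal law of mean [x] gives to the half-line. *)
Let K (s b x : R) : R := \int[leb]_y (\1_(`]-oo, b]) y * normal_pdf x s y).

Let K_prob (s b x : R) : K s b x = fine (normal_prob x s `]-oo, b]).
Proof.
rewrite /K /normal_prob /Rintegral [in RHS]integral_mkcond; congr fine.
apply: eq_integral => y _; rewrite patchE indicE; case: ifPn => _.
  by rewrite mul1r.
by rewrite mul0r.
Qed.

Let K_bound (s b x : R) : 0 <= K s b x <= 1.
Proof.
rewrite K_prob fine_ge0//= -lee_fin fineK ?fin_num_measure//.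
exact: probability_le1.
Qed.

Let measurable_tail (x e : R) : measurable ([set y | e <= `|y - x|] : set (measurableTypeR R)).
Proof.
rewrite (_ : [set y | _] = (fun y => `|y - x|) @^-1` `[e, +oo[); last first.
  by apply/seteqP; split=> y /=; rewrite in_itv/= andbT.
rewrite -[X in measurable X]setTI; apply: (_ : measurable_fun setT (fun y : measurableTypeR R => `|y - x|)) => //.
by apply: measurableT_comp => //; exact: measurable_funB.
Qed.

Let K_small (s b x e : R) : s != 0 -> 0 < e -> b + e <= x -> K s b x <= s ^+ 2 / e ^+ 2.
Proof.
move=> s0 e0 bex; rewrite K_prob -lee_fin fineK ?fin_num_measure//.
apply: le_trans (normal_prob_tail x s0 e0).
apply: le_measure; rewrite ?inE//.
by move=> y /=; rewrite in_itv/= => yb; rewrite distrC ler_normr; apply/orP; left; lra.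
Qed.

Let K_large (s b x e : R) : s != 0 -> 0 < e -> x + e <= b -> 1 - s ^+ 2 / e ^+ 2 <= K s b x.
Proof.
move=> s0 e0 bex; rewrite K_prob lerBlDr -lerBlDl -lee_fin.
apply: le_trans (normal_prob_tail x s0 e0).
rewrite EFinB fineK ?fin_num_measure// -probability_setC//.
apply: le_measure; rewrite ?inE//.
  exact: measurableC.
by move=> y /=; rewrite in_itv/= => /negP; rewrite -ltNge => yb; rewrite ler_normr; apply/orP; left; lra.
Qed.

(** The width [seq_s n] tends to 0 faster than the gap [seq_b q n - q]. Without the gap, the limit
    at [x = q] would be 1/2; with it, [K] converges everywhere to the indicator of the closed
    half-line. *)
Let seq_s (n : nat) : R := (n.+1%:R ^+ 2)^-1.
Let seq_b (q : R) (n : nat) : R := q + n.+1%:R^-1.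

Let cvg_K (q x : R) : K (seq_s n) (seq_b q n) x @[n --> \oo] --> (\1_(`]-oo, q]) x : R).
Proof.
rewrite indicE; have [xq|qx] := leP x q.
  rewrite mem_set/=; last by rewrite in_itv/=.
  apply: (@squeeze_cvgr _ _ _ _ (fun n => 1 - n.+1%:R^-1) (fun=> 1)).
  - near=> n; have /andP[_ ->] := K_bound (seq_s n) (seq_b q n) x; rewrite andbT.
    have n0 : 0 < n.+1%:R :> R by [].
    apply: le_trans (@K_large (seq_s n) (seq_b q n) x (n.+1%:R^-1) _ _ _).
    + rewrite lerD2l lerN2 /seq_s !exprVn invrK -exprM.
      rewrite (_ : _ * _ = n.+1%:R ^- 2); last by field; rewrite gt_eqF.
      by rewrite lef_pV2 ?posrE ?exprn_gt0// -[leLHS]expr1 ler_weXn2l// ler1n.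
    + by rewrite invr_eq0 expf_neq0// gt_eqF.
    + by rewrite invr_gt0.
    + by rewrite /seq_b lerD2r.
  - rewrite -[X in _ --> X]subr0; apply: cvgB; first exact: cvg_cst.
    exact: cvg_harmonic.
  - exact: cvg_cst.
rewrite memNset/=; last by rewrite in_itv/= => h; move: (lt_le_trans qx h); rewrite ltxx.
pose e := (x - q) / 2; have e0 : 0 < e by rewrite /e; lra.
apply: (@squeeze_cvgr _ _ _ _ (fun=> 0) (fun n => n.+1%:R^-1 / e ^+ 2)).
- near=> n; have /andP[-> _] /= := K_bound (seq_s n) (seq_b q n) x.
  have n0 : 0 < n.+1%:R :> R by [].
  apply: le_trans (@K_small (seq_s n) (seq_b q n) x e _ _ _) _ => //.
  + by rewrite invr_eq0 expf_neq0// gt_eqF.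
  + have : n.+1%:R^-1 < e.
      by near: n; exact: near_infty_natSinv_lt (PosNum e0).
    rewrite /seq_b /e; move: (n.+1%:R^-1) => k ?; lra.
  + rewrite ler_wpM2r ?invr_ge0 ?sqr_ge0// /seq_s.
    by rewrite exprVn -exprM lef_pV2 ?posrE ?exprn_gt0// -[leLHS]expr1 ler_weXn2l// ler1n.
- exact: cvg_cst.
- rewrite -[X in _ --> X](mul0r (e ^- 2)); apply: cvgM; last exact: cvg_cst.
  exact: cvg_harmonic.
Unshelve. all: by end_near. Qed.

Variables (X g : T -> R) (C : R).
Hypotheses (mX : measurable_fun setT X) (mg : measurable_fun setT g) (gC : forall w, `|g w| <= C).

Let f (s b : R) (z : T * measurableTypeR R) : R := \1_(`]-oo, b]) z.2 * normal_pdf (X z.1) s z.2 * g z.1.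

Let mf s b : s != 0 -> measurable_fun setT (f s b).
Proof.
move=> s0; apply: measurable_funM; last exact: measurableT_comp.
apply: measurable_funM; first by apply: measurableT_comp => //; exact: measurable_indic.
under eq_fun do rewrite normal_pdfE//.
apply: measurable_funM => //; apply: measurableT_comp => //; apply: measurable_funM => //.
apply: measurableT_comp => //; apply: measurable_funX; apply: measurable_funB => //.
exact: measurableT_comp.
Qed.

Let fsec s b w : leb.-integrable setT (fun y => (f s b (w, y))%:E).
Proof.
rewrite /f /=; under eq_fun do rewrite mulrC EFinM.
apply: integrableZl => //.
have h := @integrableMr _ _ _ leb setT measurableT \1_(`]-oo, b]) (fun y => (normal_pdf (X w) s y)%:E).
apply: h.
- exact: measurable_indic.
- exists 1; split => // M M1 x _ /=; rewrite indicE; case: (_ \in _); rewrite ?normr1 ?normr0 ?ltW//.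
  exact: lt_trans M1.
- exact: integrable_normal_pdf.
Qed.

Let fint s b (m : {finite_measure set T -> \bar R}) : s != 0 -> (m \x leb)%E.-integrable setT (EFin \o f s b).
Proof.
move=> s0; have mE : measurable_fun [set: T * measurableTypeR R] (EFin \o f s b) by apply/measurable_EFinP; exact: mf.
apply/integrable12ltyP => //.
apply: (@le_lt_trans _ _ (\int[m]_w C%:E)%E); last first.
  by rewrite integral_cst// lte_mul_pinfty// ?lee_fin ?(le_trans _ (gC point))// -ge0_fin_numE// fin_num_measure.
apply: ge0_le_integral => //.
- by move=> x _; exact: integral_ge0.
- have := @measurable_fun_fubini_tonelli_F _ _ T (measurableTypeR R) R leb (abse \o (EFin \o f s b)).
  move=> h; apply: h => //.
    exact: measurableT_comp.
  by move=> x; exact: abse_ge0.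
move=> w _; apply: (@le_trans _ _ (\int[leb]_y (`|g w| * normal_pdf (X w) s y)%:E)%E).
  apply: ge0_le_integral => //.
  - by apply: measurableT_comp => //; exact: measurable_int (fsec s b w).
  - by apply/measurable_EFinP; apply: measurable_funM => //; exact: measurable_normal_pdf.
  move=> y _; rewrite lee_fin /f /= !normrM mulrC ler_wpM2l//.
  rewrite (ger0_norm (normal_pdf_ge0 _ _ _)) ler_piMl ?normal_pdf_ge0//.
  by rewrite indicE; case: (_ \in _); rewrite ?normr1 ?normr0.
under eq_integral do rewrite EFinM.
rewrite integralZl//; last exact: integrable_normal_pdf.
by rewrite integral_normal_pdf mule1 lee_fin.
Qed.

(** The weight [g] will carry the coordinates treated before [X]. A smoothed indicator is an
    integral of Gaussian densities, and a Gaussian density is a mean of cosines whose frequency is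
    normal with standard deviation [s^-1]. Fubini moves both integrals outside, where [mu] and [nu]
    enter only through their trigonometric integrals. *)
Lemma trig_unique (mu nu : {finite_measure set T -> \bar R}) :
  (forall a, \int[mu]_w (cos (a * X w) * g w) = \int[nu]_w (cos (a * X w) * g w)) ->
  (forall a, \int[mu]_w (sin (a * X w) * g w) = \int[nu]_w (sin (a * X w) * g w)) ->
  forall q, \int[mu]_w (\1_[set x | x <= q] (X w) * g w) = \int[nu]_w (\1_[set x | x <= q] (X w) * g w).
Proof.
move=> hcos hsin q.
have mtrig (t : R -> R) (a : R) : continuous t -> measurable_fun setT (fun w => t (a * X w) * g w).
  move=> ct; apply: measurable_funM => //.
  by apply: (measurableT_comp (continuous_measurable_fun ct)); exact: measurable_funM.
have mpdf (s y : R) : s != 0 -> measurable_fun setT (fun w => normal_pdf (X w) s y).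
  move=> s0; under eq_fun do rewrite normal_pdfE//.
  apply: measurable_funM => //; apply: measurableT_comp => //; apply: measurable_funM => //.
  by apply: measurableT_comp => //; apply: measurable_funX; exact: measurable_funB.
have itrig (m : {finite_measure set T -> \bar R}) (t : R -> R) (a : R) : continuous t -> (forall x, `|t x| <= 1) ->
    m.-integrable setT (EFin \o (fun w => t (a * X w) * g w)).
  move=> ct t1; apply: (@bounded_integrable _ _ R m _ C); first exact: mtrig.
  by move=> w; rewrite normrM (le_trans _ (gC w))// ler_piMl.
(* The Gaussian bump is a superposition of cosines. *)
have s1 s y : s != 0 -> \int[mu]_w (normal_pdf (X w) s y * g w) = \int[nu]_w (normal_pdf (X w) s y * g w).
  move=> s0.
  have E (m : {finite_measure set T -> \bar R}) : \int[m]_w (normal_pdf (X w) s y * g w) =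
     normal_peak s * \int[normal_prob 0 s^-1]_x (cos (y * x) * \int[m]_w (cos (x * X w) * g w) + sin (y * x) * \int[m]_w (sin (x * X w) * g w)).
    have mI1 : measurable_fun setT (fun z : T * measurableTypeR R => cos ((y - X z.1) * z.2) * g z.1).
      apply: measurable_funM; last exact: measurableT_comp.
      apply: (measurableT_comp (continuous_measurable_fun (@continuous_cos R))).
      apply: measurable_funM => //; apply: measurable_funB => //; exact: measurableT_comp.
    have bI1 (z : T * measurableTypeR R) : `|cos ((y - X z.1) * z.2) * g z.1| <= C.
      by rewrite normrM (le_trans _ (gC z.1))// ler_piMl// cos_max.
    transitivity (normal_peak s * \int[m]_w \int[normal_prob 0 s^-1]_x (cos ((y - X w) * x) * g w)).
      rewrite -RintegralZl//; last first.
        exact: (@integrable_Rintegral_bounded _ _ _ _ _ m (normal_prob 0 s^-1) _ _ mI1 bI1).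
      apply: eq_Rintegral => w _; rewrite normal_pdfE// /normal_fun -mulrA; congr (_ * _).
      rewrite RintegralZr//; last first.
        apply: (@bounded_integrable _ _ R (normal_prob 0 s^-1) _ 1); last by move=> x; exact: cos_max.
        by apply: (measurableT_comp (continuous_measurable_fun (@continuous_cos R))); exact: measurable_funM.
      congr (_ * _); transitivity (expR (- ((y - X w) ^+ 2 * s^-1 ^+ 2 / 2))).
        by congr expR; field.
      rewrite -(@integral_normal_cos R 0 s^-1) ?invr_eq0//.
      by apply: eq_Rintegral => x _; rewrite subr0.
    congr (_ * _); rewrite (@RFubini_bounded _ _ _ _ _ m (normal_prob 0 s^-1) _ _ mI1 bI1).
    apply: eq_Rintegral => x _ /=.
    rewrite -!RintegralZl//; [|exact: (itrig m _ x (@continuous_sin R) (@sin_max R))|exact: (itrig m _ x (@continuous_cos R) (@cos_max R))].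
    rewrite -RintegralD//; last 2 first.
    - by have := integrableZl measurableT (cos (y * x)) (itrig m _ x (@continuous_cos R) (@cos_max R)).
    - by have := integrableZl measurableT (sin (y * x)) (itrig m _ x (@continuous_sin R) (@sin_max R)).
    by apply: eq_Rintegral => w _; rewrite mulrBl cosB (mulrC (X w)) !mulrA -mulrDl.
  rewrite !E; congr (_ * _); apply: eq_Rintegral => x _; by rewrite hcos hsin.
have KE s b w : K s b (X w) * g w = \int[leb]_y f s b (w, y).
  rewrite /K /f /= RintegralZr//.
  have := @integrableMr _ _ _ leb setT measurableT \1_(`]-oo, b]) (fun y => (normal_pdf (X w) s y)%:E).
  apply.
  - exact: measurable_indic.
  - exists 1; split => // M M1 x _ /=; rewrite indicE; case: (_ \in _); rewrite ?normr1 ?normr0 ?ltW//.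
    exact: lt_trans M1.
  - exact: integrable_normal_pdf.
have s2 s b : s != 0 -> \int[mu]_w (K s b (X w) * g w) = \int[nu]_w (K s b (X w) * g w).
  move=> s0.
  have E (m : {finite_measure set T -> \bar R}) : \int[m]_w (K s b (X w) * g w) = \int[leb]_y (\1_(`]-oo, b]) y * \int[m]_w (normal_pdf (X w) s y * g w)).
    have Ipdf y : m.-integrable setT (EFin \o (fun w => normal_pdf (X w) s y * g w)).
      apply: (@bounded_integrable _ _ R m _ (normal_peak s * C)).
        exact: (measurable_funM (mpdf _ _ s0) mg).
      by move=> w; rewrite normrM ler_pM// ger0_norm ?normal_pdf_ub ?normal_pdf_ge0.
    transitivity (\int[m]_w \int[leb]_y f s b (w, y)).
      by apply: eq_Rintegral => w _; exact: KE.
    rewrite RFubini; last 3 first.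
    - exact: fint.
    - exact: fsec.
    - move=> y; rewrite /f /=; under eq_fun do rewrite -mulrA EFinM.
      by apply: integrableZl => //; exact: Ipdf.
    apply: eq_Rintegral => y _; rewrite /f /=.
    under eq_Rintegral do rewrite -mulrA.
    by rewrite RintegralZl//; exact: Ipdf.
  rewrite !E; apply: eq_Rintegral => y _; by rewrite s1.
have lim (m : {finite_measure set T -> \bar R}) :
    \int[m]_w (K (seq_s n) (seq_b q n) (X w) * g w) @[n --> \oo] --> \int[m]_w (\1_[set x | x <= q] (X w) * g w).
  apply: (@Rdominated_convergence _ _ _ m setT measurableT _ _ (fun=> C) _ _ _ _ _).2.
  - move=> n; have sn0 : seq_s n != 0 by rewrite invr_eq0 expf_neq0.
    have h := @integrable_fubini_F _ _ _ _ _ m leb _ (fint (seq_b q n) m sn0).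
    have := measurable_int _ h; rewrite /fubini_F => mh.
    have := measurableT_comp (@fine_measurable R setT measurableT) mh.
    apply: eq_measurable_fun => w _ /=; rewrite -/(Rintegral _ _ _) -/(Rintegral leb setT (fun y => f (seq_s n) (seq_b q n) (w, y))).
    exact/esym/KE.
  - apply: measurable_funM => //; apply: measurableT_comp => //.
    rewrite (_ : [set x | x <= q] = `]-oo, q]%classic); first exact: measurable_indic.
    by apply/seteqP; split=> x /=; rewrite in_itv.
  - apply: aeW => w _; apply: cvgM; last exact: cvg_cst.
    rewrite (_ : [set x | x <= q] = `]-oo, q]%classic); first exact: cvg_K.
    by apply/seteqP; split=> x /=; rewrite in_itv.
  - by apply: (@bounded_integrable _ _ R m _ C) => // w; rewrite ger0_norm// (le_trans _ (gC point)).
  - apply: aeW => w n _; rewrite normrM (le_trans _ (gC w))// ler_piMl//.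
    by have /andP[k0 k1] := K_bound (seq_s n) (seq_b q n) (X w); rewrite ger0_norm.
apply: (cvg_unique _ (lim mu)) => //.
have -> : (fun n => \int[mu]_w (K (seq_s n) (seq_b q n) (X w) * g w)) = (fun n => \int[nu]_w (K (seq_s n) (seq_b q n) (X w) * g w)).
  by apply/funext => n; apply: s2; rewrite invr_eq0 expf_neq0.
exact: lim.
Qed.

End inversion.

(** * Borel sets of a separable Hilbert space *)

Section inner_product.
Context {R : realType} {H : completeNormedModType R}.
Variable ip : {dot H for idfun}.
Hypothesis normE : forall x : H, `|x| ^+ 2 = ip x x.
Implicit Types (x y z : H) (a : R).

Lemma ipC x y : ip x y = ip y x.
Proof. by rewrite [LHS](hermC (theta := idfun)) expr0 mul1r. Qed.

Lemma ipDr x y z : ip x (y + z) = ip x y + ip x z.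
Proof. exact: linearDr. Qed.
Lemma ipNr x y : ip x (- y) = - ip x y.
Proof. exact: linearNr. Qed.
Lemma ipBr x y z : ip x (y - z) = ip x y - ip x z.
Proof. exact: linearBr. Qed.
Lemma ipZr a x y : ip x (a *: y) = a * ip x y.
Proof. exact: linearZr_LR. Qed.
Lemma ip0r x : ip x 0 = 0.
Proof. exact: linear0r. Qed.
Lemma ip_sumr (J : Type) (r : seq J) (P : pred J) (F : J -> H) x :
  ip x (\sum_(i <- r | P i) F i) = \sum_(i <- r | P i) ip x (F i).
Proof. exact: linear_sumr. Qed.
Lemma ipDl x y z : ip (x + y) z = ip x z + ip y z.
Proof. by rewrite ipC ipDr !(ipC z). Qed.
Lemma ipNl x y : ip (- x) y = - ip x y.
Proof. by rewrite ipC ipNr (ipC y). Qed.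
Lemma ipBl x y z : ip (x - y) z = ip x z - ip y z.
Proof. by rewrite ipDl ipNl. Qed.
Lemma ipZl a x y : ip (a *: x) y = a * ip x y.
Proof. by rewrite ipC ipZr (ipC y). Qed.
Lemma ip0l x : ip 0 x = 0.
Proof. by rewrite ipC ip0r. Qed.
Lemma ip_suml (J : Type) (r : seq J) (P : pred J) (F : J -> H) x :
  ip (\sum_(i <- r | P i) F i) x = \sum_(i <- r | P i) ip (F i) x.
Proof. by rewrite ipC ip_sumr; apply: eq_bigr => i _; rewrite ipC. Qed.

Lemma ip_ge0 x : 0 <= ip x x.
Proof. by rewrite -normE sqr_ge0. Qed.

Lemma cauchy_schwarz x y : `|ip x y| <= `|x| * `|y|.
Proof.
suff : `|ip x y| ^+ 2 <= (`|x| * `|y|) ^+ 2 by rewrite ler_pXn2r// nnegrE ?mulr_ge0.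
rewrite real_normK ?num_real// exprMn !normE.
have [->|y0] := eqVneq y 0; first by rewrite !ip0r mulr0 expr0n.
have yy : 0 < ip y y by exact: neq0_dnorm_gt0.
have := ip_ge0 (ip y y *: x - ip x y *: y).
rewrite !(ipBl, ipBr, ipZl, ipZr) (ipC y x) => h.
have {}h : 0 <= ip y y * (ip x x * ip y y - ip x y ^+ 2) by apply: le_trans h _; rewrite le_eqVlt; apply/orP; left; apply/eqP; ring.
by rewrite pmulr_rge0// subr_ge0 in h.
Qed.

Lemma continuous_ip x : continuous (ip x : H -> R).
Proof.
move=> y; apply/cvgrPdist_lt => e e0; near=> z.
rewrite -ipBr (le_lt_trans (cauchy_schwarz _ _))//.
have : `|y - z| < e / (`|x| + 1).
  by near: z; apply: cvgr_dist_lt => //; rewrite divr_gt0// ltr_pwDr.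
rewrite ltr_pdivlMr ?ltr_pwDr// => h; apply: le_lt_trans h.
by rewrite mulrC ler_wpM2l// lerDl.
Unshelve. all: by end_near. Qed.

(** Polarization reduces joint continuity to that of the norm. *)
Lemma cvg_ip2 (T : Type) (F : set_system T) {FF : Filter F} (f g : T -> H) x y :
  f @ F --> x -> g @ F --> y -> (fun t => ip (f t) (g t)) @ F --> ip x y.
Proof.
move=> fx gy.
have E u v : ip u v = 2^-1 * (`|u + v| ^+ 2 - `|u| ^+ 2 - `|v| ^+ 2).
  rewrite !normE !(ipDl, ipDr) (ipC v u); by field.
rewrite E; under eq_fun do rewrite E.
apply: cvgM; first exact: cvg_cst.
have sq (u : T -> H) z : u @ F --> z -> (fun t => `|u t| ^+ 2) @ F --> `|z| ^+ 2.
  move=> uz; have h := cvg_norm uz; have {}h := h FF.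
  rewrite (_ : (fun t => _) = fun t => `|u t| * `|u t|) ?expr2; first exact: cvgM.
  by apply/funext => t; rewrite expr2.
by apply: cvgB; [apply: cvgB|]; apply: sq => //; exact: cvgD.
Qed.

Section basis.
Variables (I : pred nat) (e : nat -> H).
Hypothesis he : orthonormal_basis ip I e.

Lemma orthonormal_ip i j : I i -> I j -> ip (e i) (e j) = (i == j)%:R.
Proof. by case: he => _ + _; apply. Qed.

Let expand x : (fun n => \sum_(i < n | I i) ip (e i) x *: e i) @ \oo --> x.
Proof. by case: he. Qed.

Lemma ip_expand x y : (fun n => \sum_(i < n | I i) ip (e i) x * ip (e i) y) @ \oo --> ip x y.
Proof.
rewrite (_ : (fun n => _) = fun n => ip (\sum_(i < n | I i) ip (e i) x *: e i) y).
  exact: cvg_ip2 (@expand x) (cvg_cst y).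
by apply/funext => n; rewrite ip_suml; apply: eq_bigr => i _; rewrite ipZl.
Qed.

Lemma parseval x : (fun n => \sum_(i < n | I i) ip (e i) x ^+ 2) @ \oo --> `|x| ^+ 2.
Proof. by rewrite normE; under eq_fun do under eq_bigr do rewrite expr2; exact: ip_expand. Qed.

Lemma bessel_basis x n : \sum_(i < n | I i) ip (e i) x ^+ 2 <= `|x| ^+ 2.
Proof.
have <- := cvg_lim (@Rhausdorff R) (@parseval x).
apply: (nondecreasing_cvgn_le (u_ := fun n => \sum_(i < n | I i) ip (e i) x ^+ 2)).
  apply/nondecreasing_seqP => k; rewrite big_mkcond [leRHS]big_mkcond big_ord_recr/= lerDl.
  by case: ifP => // _; rewrite sqr_ge0.
by apply: cvgP; exact: parseval.
Qed.

Lemma norm_coord_inj x y : (forall i, I i -> ip (e i) x = ip (e i) y) -> x = y.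
Proof.
move=> xy; apply: (cvg_unique (@norm_hausdorff _ H) (@expand x)).
rewrite (_ : (fun n => _) = fun n => \sum_(i < n | I i) ip (e i) y *: e i); first exact: expand.
by apply/funext => n; apply: eq_bigr => i Ii; rewrite xy.
Qed.

End basis.

Lemma measurable_continuous_borel (f : H -> R) : continuous f ->
  measurable_fun setT (f : borel H -> R).
Proof.
move=> /continuousP cf; apply: (measurability _ (RGenOpens.measurableE R)).
move=> _ [_ [a [b ->] <-]]; rewrite setTI; apply: sub_sigma_algebra.
by apply: cf; exact: interval_open.
Qed.

Lemma measurable_ip d (T : measurableType d) (f : T -> borel H) x :
  measurable_fun setT f -> measurable_fun setT (fun w => ip x (f w)).
Proof. by move=> mf; exact: (measurableT_comp (measurable_continuous_borel (@continuous_ip x)) mf). Qed.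

Lemma measurable_norm d (T : measurableType d) (f : T -> borel H) :
  measurable_fun setT f -> measurable_fun setT (fun w => `|f w : H|).
Proof. by move=> mf; exact: (measurableT_comp (measurable_continuous_borel (@norm_continuous R H)) mf). Qed.

Hypothesis sepH : separable_space H.
Variables (I : pred nat) (e : nat -> H).
Hypothesis he : orthonormal_basis ip I e.

(** An open set is the union of the balls contained in it with centre in the countable dense set and
    radius 1 / (n + 1), and the preimage of a ball is governed by the distance to its centre. *)
Lemma measurable_dist_borel d (T : measurableType d) (f : T -> borel H) :
  (forall c : H, measurable_fun setT (fun w => `|c - f w : H|)) -> measurable_fun setT f.
Proof.
move=> mf; apply: (@measurability _ _ _ (borel H) setT f (@open H) erefl) => _ [V oV <-]; rewrite setTI.
have [A [/countable_injP[g ginj] dA]] := sepH.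
pose B c n := if `[< ball c n.+1%:R^-1 `<=` V >] then f @^-1` (ball c n.+1%:R^-1) else set0.
have mB c n : measurable (B c n).
  rewrite /B; case: ifP => // _.
  rewrite (_ : f @^-1` _ = (fun w => `|c - f w : H|) @^-1` `]-oo, n.+1%:R^-1[); last first.
    by apply/seteqP; split=> w /=; rewrite -ball_normE/= in_itv.
  by rewrite -[X in measurable X]setTI; exact: mf.
rewrite (_ : f @^-1` V = \bigcup_k \bigcup_n (B (xget 0 [set c | A c /\ g c = k]) n)).
  by apply: bigcupT_measurable => k; apply: bigcupT_measurable => n; exact: mB.
apply/seteqP; split=> w /=; last first.
  by move=> [k _ [n _]]; rewrite /B; case: ifP => // /asboolP h /h.
move=> Vw.
have [r r0 rV] : exists2 r : R, 0 < r & ball (f w) r `<=` V.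
  by have := open_nbhs_nbhs (conj oV Vw) => /nbhs_ballP[r r0 rV]; exists r.
have [n hn] : exists n : nat, n.+1%:R^-1 < r / 2.
  have r2 : 0 < r / 2 by rewrite divr_gt0.
  by have [n _ /(_ n (leqnn n))] := near_infty_natSinv_lt (PosNum r2); exists n.
have n0 : 0 < n.+1%:R^-1 :> R by rewrite invr_gt0.
have [c [Bc Ac]] := dA (ball (f w : H) n.+1%:R^-1) (ex_intro _ (f w : H) (ballxx (f w : H) n0)) (ball_open (f w : H) _).
exists (g c) => //; exists n => //.
rewrite (_ : xget _ _ = c); last first.
  apply: xget_unique; first by split.
  by move=> c' [Ac' gc]; apply: ginj; rewrite ?inE.
rewrite /B ifT; first by apply: ball_sym.
apply/asboolP => z cz; apply: rV; apply: (@ball_splitr _ _ c).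
  by apply: ball_sym; apply: (le_ball (ltW hn)).
by apply: (le_ball (ltW hn)).
Qed.

(** By Parseval, the squared distance to a fixed point is a limit of polynomials in the
    coordinates. *)
Lemma measurable_coord d (T : measurableType d) (f : T -> borel H) :
  (forall i, I i -> measurable_fun setT (fun w => ip (e i) (f w))) -> measurable_fun setT f.
Proof.
move=> mf; apply: measurable_dist_borel => c.
under eq_fun do rewrite -[`|_|]ger0_norm// -sqrtr_sqr.
apply: measurableT_comp; first exact: (continuous_measurable_fun (@sqrt_continuous R)).
have ms n : measurable_fun setT (fun w => \sum_(i < n | I i) ip (e i) (c - f w) ^+ 2).
  under eq_fun do rewrite big_mkcond.
  apply: measurable_sum => i; case: (boolP (I i)) => // Ii.
  by apply: measurable_funX; under eq_fun do rewrite ipBr; apply: measurable_funB => //; exact: mf.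
apply: (@measurable_fun_cvg _ _ _ _ (fun n w => \sum_(i < n | I i) ip (e i) (c - f w) ^+ 2)).
- exact: ms.
- by move=> w _; exact: (parseval he).
Qed.

Lemma measurable_lincomb d (T : measurableType d) (a c : T -> R) (f g : T -> borel H) :
  measurable_fun setT a -> measurable_fun setT c -> measurable_fun setT f -> measurable_fun setT g ->
  measurable_fun setT (fun z : T => a z *: (f z : H) + c z *: (g z : H) : borel H).
Proof.
move=> ma mc mf mg; apply: measurable_coord => i _.
under eq_fun do rewrite ipDr !ipZr.
by apply: measurable_funD; apply: measurable_funM => //; exact: measurable_ip.
Qed.

(** Rational bounds and finite lists make the family countable, so that almost sure statements about
    its members can be intersected; concatenation of lists makes it a pi-system. Constraints on
    indices outside [I] are void. *)
Definition cylset (l : seq (nat * rat)) : set (borel H) :=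
  [set x | forall p, p \in l -> I p.1 -> ip (e p.1) x <= ratr p.2].

Lemma cylset_nil : cylset [::] = setT.
Proof. by apply/seteqP; split=> x //= _ p; rewrite in_nil. Qed.

Lemma cylset_cat l1 l2 : cylset (l1 ++ l2) = cylset l1 `&` cylset l2.
Proof.
apply/seteqP; split=> [x h|x [h1 h2] p]; last by rewrite mem_cat => /orP[/h1|/h2].
by split=> p pl; apply: h; rewrite mem_cat pl ?orbT.
Qed.

Lemma cylset_cons i q l : cylset ((i, q) :: l) = [set x | I i -> ip (e i) x <= ratr q] `&` cylset l.
Proof.
rewrite -cat1s cylset_cat; congr (_ `&` _); apply/seteqP; split=> x /=.
  by move=> /(_ (i, q)); rewrite mem_head => /(_ isT).
by move=> h p; rewrite inE => /eqP ->.
Qed.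

Lemma setI_closed_cylset : setI_closed (range cylset).
Proof. by move=> _ _ [l1 _ <-] [l2 _ <-]; exists (l1 ++ l2) => //; rewrite cylset_cat. Qed.

(** For the inclusion of the Borel sets, the identity is measurable from the sigma-algebra of the
    cylinders, coordinate by coordinate; an open half-line is a union of closed ones with rational
    endpoints. *)
Lemma borel_cylset : @measurable _ (borel H) = <<s range cylset >>.
Proof.
apply/seteqP; split.
  pose G := range cylset.
  have : measurable_fun setT (id : g_sigma_algebraType G -> borel H).
    apply: measurable_coord => i Ii.
    apply: (measurability _ (RGenInftyO.measurableE R)) => _ [_ [r ->] <-]; rewrite setTI.
    rewrite (_ : _ @^-1` _ = \bigcup_(q : rat) if ratr q < r then cylset [:: (i, q)] else set0).
      apply: bigcupT_measurable_rat => q; case: ifP => // _.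
      by apply: sub_sigma_algebra; exists [:: (i, q)].
    apply/seteqP; split=> x /=; rewrite in_itv/=.
      move=> xr; have [q] := rat_in_itvoo xr; rewrite in_itv/= => /andP[xq qr].
      exists q => //; rewrite qr => p; rewrite inE => /eqP -> _ /=; exact: ltW.
    move=> [q _]; case: ifP => // qr /(_ (i, q)); rewrite inE eqxx => /(_ isT Ii) xq.
    exact: le_lt_trans qr.
  by move=> h A mA; have := h measurableT A mA; rewrite setTI.
apply: smallest_sub; first exact: sigma_algebra_measurable.
move=> _ [l _ <-]; elim: l => [|[i q] l IH]; first by rewrite cylset_nil.
rewrite cylset_cons; apply: measurableI => //.
have [Ii|nIi] := boolP (I i); last by rewrite (_ : [set x | _] = setT)//; apply/seteqP; split.
rewrite (_ : [set x | _] = (ip (e i) : H -> R) @^-1` `]-oo, ratr q]); last first.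
  by apply/seteqP; split=> x /=; rewrite in_itv/=; [apply|].
have := measurable_continuous_borel (@continuous_ip (e i)) measurableT (measurable_itv `]-oo, ratr q : R]).
by rewrite setTI.
Qed.

Lemma measurable_cylset l : measurable (cylset l).
Proof. by rewrite borel_cylset; apply: sub_sigma_algebra; exists l. Qed.

Lemma borel_measure_unique (mu nu : {finite_measure set (borel H) -> \bar R}) :
  (forall l, mu (cylset l) = nu (cylset l)) -> forall A, measurable A -> mu A = nu A.
Proof.
move=> h; apply: (measure_unique (range cylset) (fun=> setT)).
- exact: borel_cylset.
- exact: setI_closed_cylset.
- by move=> _; exists [::] => //; rewrite cylset_nil.
- by rewrite bigcup_const.
- by move=> _ [l _ <-]; exact: h.
- by move=> _; rewrite -ge0_fin_numE// fin_num_measure.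
Qed.

(** Induction on the constraints of a cylinder, for the trigonometric integrals of all frequencies
    [h] against its indicator. The free frequency makes the induction pass: the new constraint is
    treated by [trig_unique], and a product with a cosine or sine of one coordinate is, by the
    product-to-sum formulas, a combination of terms of frequencies [h + a *: e i] and
    [h - a *: e i]. *)
Theorem char_unique (mu nu : {finite_measure set (borel H) -> \bar R}) :
  (forall h : H, \int[mu]_x cos (ip h x) = \int[nu]_x cos (ip h x)) ->
  (forall h : H, \int[mu]_x sin (ip h x) = \int[nu]_x sin (ip h x)) ->
  forall A, measurable A -> mu A = nu A.
Proof.
move=> hc hs; apply: borel_measure_unique.
have mip h : measurable_fun setT (ip h : borel H -> R) by exact: (measurable_continuous_borel (@continuous_ip h)).
have mt (t : R -> R) h l : continuous t -> measurable_fun setT (fun x : borel H => \1_(cylset l) x * t (ip h x)).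
  move=> ct; apply: measurable_funM; first by apply: measurable_indic; exact: measurable_cylset.
  exact: (measurableT_comp (continuous_measurable_fun ct)).
have bt (t : R -> R) h l : (forall r : R, `|t r| <= 1) -> forall x : borel H, `|\1_(cylset l) x * t (ip h x)| <= 1.
  move=> t1 x; rewrite normrM mulr_ile1//; rewrite indicE; case: (_ \in _); rewrite ?normr1 ?normr0//.
have it (m : {finite_measure set (borel H) -> \bar R}) (t : R -> R) h l : continuous t -> (forall r : R, `|t r| <= 1) ->
    m.-integrable setT (EFin \o (fun x : borel H => \1_(cylset l) x * t (ip h x))).
  by move=> ct t1; apply: (@bounded_integrable _ _ R m _ 1); [exact: mt|exact: bt].
have key l : (forall h : H, \int[mu]_x (\1_(cylset l) x * cos (ip h x)) = \int[nu]_x (\1_(cylset l) x * cos (ip h x))) /\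
             (forall h : H, \int[mu]_x (\1_(cylset l) x * sin (ip h x)) = \int[nu]_x (\1_(cylset l) x * sin (ip h x))).
  elim: l => [|[i q] l [IHc IHs]].
    by split=> h; rewrite cylset_nil; under eq_Rintegral do rewrite indicT mul1r; under [RHS]eq_Rintegral do rewrite indicT mul1r.
  have [Ii|nIi] := boolP (I i); last first.
    have -> : cylset ((i, q) :: l) = cylset l.
      by rewrite cylset_cons (_ : [set x | _] = setT) ?setTI//; apply/seteqP; split=> // x _ /= Ii; rewrite Ii in nIi.
    by split.
  have E x : \1_(cylset ((i, q) :: l)) x = \1_[set r | r <= ratr q] (ip (e i) x) * \1_(cylset l) x :> R.
    rewrite cylset_cons indicI /=; congr (_ * _); rewrite !indicE; congr (_%:R); congr nat_of_bool.
    by apply/idP/idP; rewrite !inE /=; [apply|].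
  have lin (m : {finite_measure set (borel H) -> \bar R}) (t : R -> R) h1 h2 (c : R) (w : H -> R) : continuous t -> (forall r : R, `|t r| <= 1) ->
     (forall x, w x = 2^-1 * (\1_(cylset l) x * t (ip h1 x)) + c * (\1_(cylset l) x * t (ip h2 x))) ->
     \int[m]_x w x = 2^-1 * \int[m]_x (\1_(cylset l) x * t (ip h1 x)) + c * \int[m]_x (\1_(cylset l) x * t (ip h2 x)).
    move=> ct t1 wE; rewrite -RintegralZl//; last exact: it.
    rewrite -RintegralZl//; last exact: it.
    rewrite -RintegralD//; last 2 first.
    - by have := integrableZl measurableT 2^-1 (it m t h1 l ct t1).
    - by have := integrableZl measurableT c (it m t h2 l ct t1).
    by apply: eq_Rintegral => x _; exact: wE.
  have step (t : R -> R) : continuous t -> (forall r : R, `|t r| <= 1) ->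
      (forall h a, \int[mu]_x (cos (a * ip (e i) x) * (\1_(cylset l) x * t (ip h x))) = \int[nu]_x (cos (a * ip (e i) x) * (\1_(cylset l) x * t (ip h x)))) ->
      (forall h a, \int[mu]_x (sin (a * ip (e i) x) * (\1_(cylset l) x * t (ip h x))) = \int[nu]_x (sin (a * ip (e i) x) * (\1_(cylset l) x * t (ip h x)))) ->
      forall h, \int[mu]_x (\1_(cylset ((i, q) :: l)) x * t (ip h x)) = \int[nu]_x (\1_(cylset ((i, q) :: l)) x * t (ip h x)).
    move=> ct t1 H1 H2 h.
    under eq_Rintegral do rewrite E -mulrA.
    under [RHS]eq_Rintegral do rewrite E -mulrA.
    exact: (@trig_unique _ (borel H) R (ip (e i)) (fun x => \1_(cylset l) x * t (ip h x)) 1 (mip _) (mt _ _ _ ct) (bt _ _ _ t1) mu nu (H1 h) (H2 h) (ratr q)).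
  have cc := @continuous_cos R; have cs := @continuous_sin R.
  have c1 := @cos_max R; have s1 := @sin_max R.
  split; apply: step => // h a.
  - have wE x : cos (a * ip (e i) x) * (\1_(cylset l) x * cos (ip h x)) =
      2^-1 * (\1_(cylset l) x * cos (ip (h + a *: e i) x)) + 2^-1 * (\1_(cylset l) x * cos (ip (h - a *: e i) x)).
      by rewrite ipDl ipBl ipZl cosD cosB; field.
    by rewrite (lin mu _ _ _ _ _ cc c1 wE) (lin nu _ _ _ _ _ cc c1 wE) !IHc.
  - have wE x : sin (a * ip (e i) x) * (\1_(cylset l) x * cos (ip h x)) =
      2^-1 * (\1_(cylset l) x * sin (ip (h + a *: e i) x)) + (- 2^-1) * (\1_(cylset l) x * sin (ip (h - a *: e i) x)).
      by rewrite ipDl ipBl ipZl sinD sinB; field.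
    by rewrite (lin mu _ _ _ _ _ cs s1 wE) (lin nu _ _ _ _ _ cs s1 wE) !IHs.
  - have wE x : cos (a * ip (e i) x) * (\1_(cylset l) x * sin (ip h x)) =
      2^-1 * (\1_(cylset l) x * sin (ip (h + a *: e i) x)) + 2^-1 * (\1_(cylset l) x * sin (ip (h - a *: e i) x)).
      by rewrite ipDl ipBl ipZl sinD sinB; field.
    by rewrite (lin mu _ _ _ _ _ cs s1 wE) (lin nu _ _ _ _ _ cs s1 wE) !IHs.
  - have wE x : sin (a * ip (e i) x) * (\1_(cylset l) x * sin (ip h x)) =
      2^-1 * (\1_(cylset l) x * cos (ip (h - a *: e i) x)) + (- 2^-1) * (\1_(cylset l) x * cos (ip (h + a *: e i) x)).
      by rewrite ipBl ipDl ipZl cosB cosD; field.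
    by rewrite (lin mu _ _ _ _ _ cc c1 wE) (lin nu _ _ _ _ _ cc c1 wE) !IHc.
(* The frequency 0 recovers the measure of the cylinder. *)
have mE (m : {finite_measure set (borel H) -> \bar R}) l : (m (cylset l) = (\int[m]_x (\1_(cylset l) x * cos (ip 0 x)))%:E)%E.
  under eq_Rintegral do rewrite ip0l cos0 mulr1.
  rewrite /Rintegral integral_indic ?setIT ?fineK ?fin_num_measure//; exact: measurable_cylset.
by move=> l; rewrite !mE (key l).1.
Qed.

End inner_product.

Arguments parseval {R H ip} normE {I e} he x.
Arguments ip_expand {R H ip} normE {I e} he x y.
Arguments continuous_ip {R H ip} normE x.
Arguments measurable_ip {R H ip} normE {d T f} x.
Arguments measurable_norm {R H d T f}.
Arguments measurable_coord {R H ip} normE sepH {I e} he {d T f}.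

(** * Gaussian measures on a Hilbert space *)

Section law.
Context d d' (T : measurableType d) (T' : measurableType d') (R : realType).
Variables (P : probability T R) (X : T -> T').
Hypothesis mX : measurable_fun setT X.

Let Xm : {mfun T >-> T'} := HB.pack X (isMeasurableFun.Build _ _ _ _ X mX).

Definition law : probability T' R := distribution P Xm.

Lemma lawE A : law A = P (X @^-1` A).
Proof. by []. Qed.

Lemma ge0_integral_law (f : T' -> \bar R) : measurable_fun setT f -> (forall x, 0 <= f x)%E ->
  (\int[law]_x f x = \int[P]_w f (X w))%E.
Proof. by move=> mf f0; rewrite (ge0_integral_distribution Xm)//. Qed.

Lemma integrable_law (f : T' -> \bar R) : measurable_fun setT f ->
  law.-integrable setT f <-> P.-integrable setT (f \o X).
Proof.
move=> mf; have mfX : measurable_fun setT (f \o X) by exact: measurableT_comp.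
have E : (\int[law]_x `|f x| = \int[P]_w `|(f \o X) w|)%E.
  by rewrite ge0_integral_law//; exact: measurableT_comp.
by split=> /integrableP[_ h]; apply/integrableP; split => //; rewrite ?E// -E.
Qed.

Lemma integral_law (f : T' -> \bar R) : measurable_fun setT f -> P.-integrable setT (f \o X) ->
  (\int[law]_x f x = \int[P]_w f (X w))%E.
Proof. by move=> mf If; rewrite (integral_distribution (X := Xm)). Qed.

Lemma Rintegral_law_bounded (f : T' -> R) (C : R) : measurable_fun setT f -> (forall x, `|f x| <= C) ->
  \int[law]_x f x = \int[P]_w f (X w).
Proof.
move=> mf fC; rewrite /Rintegral integral_law//; first exact/measurable_EFinP.
apply: (@bounded_integrable _ _ R P (f \o X) C); first exact: measurableT_comp.
by move=> x; exact: fC.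
Qed.

End law.

Section real_char.
Context {R : realType}.

(** The frequency 0 gives the total masses, so that equality on the half-lines []-oo, q]] passes to
    their complements, which form the generating pi-system used at the end. *)
Lemma real_char_unique (mu nu : {finite_measure set (measurableTypeR R) -> \bar R}) :
  (forall a : R, \int[mu]_x cos (a * x) = \int[nu]_x cos (a * x)) ->
  (forall a : R, \int[mu]_x sin (a * x) = \int[nu]_x sin (a * x)) ->
  forall B, measurable B -> mu B = nu B.
Proof.
move=> hc hs.
have half q : mu `]-oo, q]%classic = nu `]-oo, q]%classic.
  have mid : measurable_fun [set: measurableTypeR R] (id : _ -> R) by exact: measurable_id.
  have b1 : forall x : measurableTypeR R, `|1 : R| <= 1 by move=> ?; rewrite normr1.
  have := @trig_unique _ (measurableTypeR R) R id (fun=> 1) 1 mid (measurable_cst _) b1 mu nu.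
  have E (m : {finite_measure set (measurableTypeR R) -> \bar R}) : m `]-oo, q]%classic = (\int[m]_w (\1_[set x | x <= q] w * 1))%:E.
    under eq_Rintegral do rewrite mulr1.
    rewrite (_ : [set x | x <= q] = `]-oo, q]%classic); last by apply/seteqP; split=> x /=; rewrite in_itv.
    by rewrite /Rintegral integral_indic// setIT fineK// fin_num_measure.
  move=> h; rewrite !E; congr EFin; apply: h => a.
    by under eq_Rintegral do rewrite mulr1; under [RHS]eq_Rintegral do rewrite mulr1; exact: hc.
  by under eq_Rintegral do rewrite mulr1; under [RHS]eq_Rintegral do rewrite mulr1; exact: hs.
have fin (m : {finite_measure set (measurableTypeR R) -> \bar R}) A : measurable A -> (m A < +oo)%E.
  by move=> mA; rewrite -ge0_fin_numE// fin_num_measure.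
have compl q : mu `]q, +oo[%classic = nu `]q, +oo[%classic.
  have C (m : {finite_measure set (measurableTypeR R) -> \bar R}) : m `]q, +oo[%classic = (m setT - m `]-oo, q]%classic)%E.
    by rewrite -setCitvl -setTD measureD ?setTI// fin.
  rewrite !C half; congr (_ - _)%E.
  have E (m : {finite_measure set (measurableTypeR R) -> \bar R}) : m setT = (\int[m]_x cos (0 * x))%:E.
    under eq_Rintegral do rewrite mul0r cos0.
    by rewrite /Rintegral integral_cst// mul1e fineK// fin_num_measure.
  by rewrite !E hc.
apply: (@measure_unique _ R (measurableTypeR R) (@RGenOInfty.G R) (fun n => `](- n%:R : R), +oo[%classic)).
- exact: RGenOInfty.measurableE.
- move=> _ _ [q1 ->] [q2 ->]; exists (Num.max q1 q2).
  apply/seteqP; split=> x /=; rewrite !in_itv/= !andbT gt_max.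
    by move=> [-> ->].
  by move=> /andP[].
- by move=> n; exists (- n%:R).
- apply/seteqP; split=> // x _; exists (Num.truncn `|x|).+1 => //=.
  by rewrite in_itv/= andbT; have := truncnS_gt `|x|; have := ler_norm (- x); rewrite normrN; lra.
- by move=> _ [q ->]; exact: compl.
- by move=> n; exact: fin.
Qed.

End real_char.

Section normal_trig_shift.
Context {R : realType}.
Variables (m s : R).
Hypothesis s0 : s != 0.
Local Notation N := (normal_prob m s).

Let it (t : R -> R) a : continuous t -> (forall r : R, `|t r| <= 1) ->
  N.-integrable setT (EFin \o (fun x => t (a * (x - m)))).
Proof.
move=> ct t1; apply: (@bounded_integrable _ _ R N _ 1); last by move=> x; exact: t1.
apply: (measurableT_comp (continuous_measurable_fun ct)).
by apply: measurable_funM => //; exact: measurable_funB.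
Qed.

Lemma integral_normal_cosD (a b : R) :
  \int[N]_x cos (a * x + b) = cos (a * m + b) * expR (- (a ^+ 2 * s ^+ 2 / 2)).
Proof.
have E x : cos (a * x + b) = cos (a * m + b) * cos (a * (x - m)) - sin (a * m + b) * sin (a * (x - m)).
  by rewrite -cosD; congr cos; ring.
have Ic := it a (@continuous_cos R) (@cos_max R); have Is := it a (@continuous_sin R) (@sin_max R).
under eq_Rintegral do rewrite E.
rewrite RintegralB//; last 2 first.
- by have := integrableZl measurableT (cos (a * m + b)) Ic.
- by have := integrableZl measurableT (sin (a * m + b)) Is.
by rewrite !RintegralZl// integral_normal_cos// integral_normal_sin// mulr0 subr0.
Qed.

Lemma integral_normal_sinD (a b : R) :
  \int[N]_x sin (a * x + b) = sin (a * m + b) * expR (- (a ^+ 2 * s ^+ 2 / 2)).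
Proof.
transitivity (\int[N]_x cos (a * x + (b - pi / 2))).
  by apply: eq_Rintegral => x _; rewrite addrA cosBpihalf.
by rewrite integral_normal_cosD addrA cosBpihalf.
Qed.

End normal_trig_shift.

(** * Null sets of real Gaussian measures under translation *)

Section normal_null.
Context {R : realType}.
Variable (s : R).
Hypothesis s0 : s != 0.
Local Notation leb := (@lebesgue_measure R).

Lemma normal_null_lebesgue B : measurable B -> normal_prob 0 s B = 0%E -> leb B = 0%E.
Proof.
move=> mB N0.
have mp : measurable_fun B (fun x : R => (normal_pdf 0 s x)%:E).
  by apply/measurable_EFinP/measurable_funTS; exact: measurable_normal_pdf.
have E : (\int[leb]_(x in B) `|(normal_pdf 0 s x)%:E| = 0)%E.
  rewrite -[RHS]N0; apply: eq_integral => x _.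
  by rewrite gee0_abs// lee_fin normal_pdf_ge0.
have := (ae_eq_integral_abs leb mB mp).1 E => h.
apply: (negligibleP leb mB).1; apply: negligibleS h => x Bx /= /(_ Bx) [] p0.
have : 0 < normal_pdf 0 s x by rewrite normal_pdfE// mulr_gt0 ?expR_gt0// normal_peak_gt0.
by rewrite p0 ltxx.
Qed.

(** Characteristic functions show that the translated measure is normal of mean [a]. It is dominated
    by Lebesgue measure, which the centred normal law dominates because its density is positive. *)
Lemma normal_null_shift (a : R) B : measurable B -> normal_prob 0 s B = 0%E ->
  normal_prob 0 s [set x | B (x + a)] = 0%E.
Proof.
move=> mB N0.
have ma : measurable_fun [set: measurableTypeR R] (fun x : measurableTypeR R => (x + a : measurableTypeR R)).
  exact: measurable_funD.
pose L : probability (measurableTypeR R) R := law (normal_prob 0 s : probability (measurableTypeR R) R) ma.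
have -> : normal_prob 0 s [set x | B (x + a)] = normal_prob a s B.
  rewrite -[LHS]/(L B); apply: real_char_unique mB => t.
  - have mc : measurable_fun [set: measurableTypeR R] (fun x : measurableTypeR R => cos (t * x)).
      by apply: (measurableT_comp (continuous_measurable_fun (@continuous_cos R))); exact: measurable_funM.
    rewrite (Rintegral_law_bounded _ _ mc (fun x => cos_max _)).
    under eq_Rintegral do rewrite mulrDr.
    rewrite integral_normal_cosD//.
    under [RHS]eq_Rintegral do rewrite -[t * _]addr0.
    by rewrite integral_normal_cosD// mulr0 add0r addr0.
  - have mc : measurable_fun [set: measurableTypeR R] (fun x : measurableTypeR R => sin (t * x)).
      by apply: (measurableT_comp (continuous_measurable_fun (@continuous_sin R))); exact: measurable_funM.
    rewrite (Rintegral_law_bounded _ _ mc (fun x => sin_max _)).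
    under eq_Rintegral do rewrite mulrDr.
    rewrite integral_normal_sinD//.
    under [RHS]eq_Rintegral do rewrite -[t * _]addr0.
    by rewrite integral_normal_sinD// mulr0 add0r addr0.
have := @normal_prob_dominates R a s.
move=> /null_content_dominatesP; apply => //.
exact: normal_null_lebesgue.
Qed.
End normal_null.

Section gaussian1_char.
Context d (T : measurableType d) (R : realType).
Variables (P : probability T R) (X : T -> R) (v : R).
Hypotheses (mX : measurable_fun setT X) (v0 : 0 <= v).
Hypothesis hX : forall A, measurable A -> P (X @^-1` A) = gaussian1 0 v A.

Let mX' : measurable_fun setT (X : T -> measurableTypeR R). Proof. exact: mX. Qed.

Let lawX : v != 0 -> forall A, measurable A -> law P mX' A = normal_prob 0 (Num.sqrt v) A.
Proof. by move=> vn0 A mA; rewrite lawE hX// /gaussian1 (negbTE vn0). Qed.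

Let lawX0 : v = 0 -> forall A, measurable A -> law P mX' A = \d_(0 : measurableTypeR R) A.
Proof. by move=> vn0 A mA; rewrite lawE hX// /gaussian1 vn0 eqxx. Qed.

Lemma integral_gaussian1_cos (a : R) : \int[P]_w cos (a * X w) = expR (- (a ^+ 2 * v / 2)).
Proof.
have mc : measurable_fun [set: measurableTypeR R] (fun x : measurableTypeR R => cos (a * x)).
  by apply: (measurableT_comp (continuous_measurable_fun (@continuous_cos R))); exact: measurable_funM.
rewrite -(Rintegral_law_bounded P mX' mc (fun x => cos_max _)).
have [v00|vn0] := eqVneq v 0.
  rewrite /Rintegral (eq_measure_integral (\d_(0 : measurableTypeR R))); last by move=> A mA _; exact: lawX0.
  rewrite integral_dirac//; last exact/measurable_EFinP.
  by rewrite diracT mul1e/= mulr0 cos0 v00 mulr0 mul0r oppr0 expR0.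
rewrite /Rintegral (eq_measure_integral (normal_prob 0 (Num.sqrt v))); last by move=> A mA _; exact: lawX.
have s0 : Num.sqrt v != 0 by rewrite gt_eqF// sqrtr_gt0 lt0r vn0.
have := integral_normal_cos 0 s0 a; rewrite sqr_sqrtr// => <-.
by apply: eq_Rintegral => x _; rewrite subr0.
Qed.

Lemma integral_gaussian1_sin (a : R) : \int[P]_w sin (a * X w) = 0.
Proof.
have mc : measurable_fun [set: measurableTypeR R] (fun x : measurableTypeR R => sin (a * x)).
  by apply: (measurableT_comp (continuous_measurable_fun (@continuous_sin R))); exact: measurable_funM.
rewrite -(Rintegral_law_bounded P mX' mc (fun x => sin_max _)).
have [v00|vn0] := eqVneq v 0.
  rewrite /Rintegral (eq_measure_integral (\d_(0 : measurableTypeR R))); last by move=> A mA _; exact: lawX0.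
  rewrite integral_dirac//; last exact/measurable_EFinP.
  by rewrite diracT mul1e/= mulr0 sin0.
rewrite /Rintegral (eq_measure_integral (normal_prob 0 (Num.sqrt v))); last by move=> A mA _; exact: lawX.
have s0 : Num.sqrt v != 0 by rewrite gt_eqF// sqrtr_gt0 lt0r vn0.
transitivity (\int[normal_prob 0 (Num.sqrt v)]_x sin (a * (x - 0))).
  by apply: eq_Rintegral => x _; rewrite subr0.
exact: integral_normal_sin.
Qed.

Lemma gaussian1_second_moment : (\int[P]_w (X w ^+ 2)%:E <= v%:E)%E.
Proof.
have mc : measurable_fun [set: measurableTypeR R] (fun x : measurableTypeR R => (x ^+ 2)%:E).
  by apply/measurable_EFinP; exact: measurable_funX.
rewrite -(ge0_integral_law P mX' mc); last by move=> x; rewrite lee_fin sqr_ge0.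
have [v00|vn0] := eqVneq v 0.
  rewrite (eq_measure_integral (\d_(0 : measurableTypeR R))); last by move=> A mA _; exact: lawX0.
  by rewrite integral_dirac// diracT mul1e/= expr0n v00.
rewrite (eq_measure_integral (normal_prob 0 (Num.sqrt v))); last by move=> A mA _; exact: lawX.
have s0 : Num.sqrt v != 0 by rewrite gt_eqF// sqrtr_gt0 lt0r vn0.
have := normal_second_moment 0 s0; rewrite sqr_sqrtr//; apply: le_trans.
by rewrite le_eqVlt; apply/orP; left; apply/eqP; apply: eq_integral => x _; rewrite subr0.
Qed.

End gaussian1_char.

Section gaussian.
Context {R : realType} {H : completeNormedModType R}.
Variable ip : {dot H for idfun}.
Hypothesis normE : forall x : H, `|x| ^+ 2 = ip x x.
Hypothesis sepH : separable_space H.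
Variable Q : {linear H -> H}.
Hypothesis hQ : covariance_operator ip Q.
Variables (I : pred nat) (zeta : nat -> H) (lam : nat -> R).
Hypothesis hzeta : orthonormal_basis ip I zeta.
Hypothesis hlam : forall i, I i -> Q (zeta i) = lam i *: zeta i.
Variable G : probability (borel H) R.
Hypothesis hG : forall (h : H) (A : set R), measurable A ->
  G [set x | A (ip h x)] = gaussian1 0 (ip (Q h) h) A.

Lemma cov_sym x y : ip (Q x) y = ip x (Q y).
Proof. by case: hQ => _ + _ _; apply. Qed.

Lemma cov_gt0 x : x != 0 -> 0 < ip (Q x) x.
Proof. by case: hQ => _ _ + _; apply. Qed.

Lemma cov_ge0 x : 0 <= ip (Q x) x.
Proof. by have [->|/cov_gt0/ltW//] := eqVneq x 0; rewrite ip0r. Qed.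

Lemma zeta_neq0 i : I i -> zeta i != 0.
Proof.
move=> Ii; apply/eqP => z0; have := orthonormal_ip hzeta Ii Ii.
by rewrite z0 ip0l eqxx => /eqP; rewrite eq_sym oner_eq0.
Qed.

Lemma lam_gt0 i : I i -> 0 < lam i.
Proof.
move=> Ii; have := cov_gt0 (zeta_neq0 Ii).
by rewrite hlam// ipZl (orthonormal_ip hzeta)// eqxx mulr1.
Qed.

Let mip h : measurable_fun setT (ip h : borel H -> R).
Proof. exact: (measurable_continuous_borel (continuous_ip normE h)). Qed.

Lemma gaussian_cos h : \int[G]_x cos (ip h x) = expR (- (ip (Q h) h / 2)).
Proof.
have := integral_gaussian1_cos (mip h) (cov_ge0 h) (hG h) 1.
by rewrite expr1n mul1r => <-; apply: eq_Rintegral => x _; rewrite mul1r.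
Qed.

Lemma gaussian_sin h : \int[G]_x sin (ip h x) = 0.
Proof.
have := integral_gaussian1_sin (mip h) (cov_ge0 h) (hG h) 1.
by move=> <-; apply: eq_Rintegral => x _; rewrite mul1r.
Qed.

Lemma gaussian_ip_second_moment h : (\int[G]_x (ip h x ^+ 2)%:E <= (ip (Q h) h)%:E)%E.
Proof. exact: gaussian1_second_moment (mip h) (cov_ge0 h) (hG h). Qed.

(** Parseval in the basis in which the trace of [Q] is known to be finite, which may differ from
    [zeta], bounds the second moment by the trace. *)
Lemma gaussian_norm_second_moment : (\int[G]_x (`|x : H| ^+ 2)%:E < +oo)%E.
Proof.
have [_ _ _ [J [e [he]]]] := hQ.
rewrite eseries_mkcond => tr; apply: le_lt_trans tr.
pose f n (x : borel H) : \bar R := if J n then (ip (e n) x ^+ 2)%:E else 0%E.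
have f0 n x : (0 <= f n x)%E by rewrite /f; case: ifP => // _; rewrite lee_fin sqr_ge0.
have mf n : measurable_fun setT (f n).
  rewrite /f; case: (J n) => //; apply/measurable_EFinP; apply: measurable_funX; exact: mip.
have -> : (\int[G]_x (`|x : H| ^+ 2)%:E = \int[G]_x \sum_(n <oo) f n x)%E.
  apply: eq_integral => x _; apply/esym/cvg_lim => //.
  rewrite (_ : (fun n => _) = EFin \o (fun n => \sum_(i < n | J i) ip (e i) x ^+ 2)).
    by apply: cvg_EFin; [exact: nearW|exact: (parseval normE he x)].
  apply/funext => n /=.
  rewrite big_mkord [in RHS]big_mkcond -sumEFin; apply: eq_bigr => i _; rewrite /f.
  by case: ifP.
rewrite integral_nneseries//; apply: lee_nneseries => n _.
  by rewrite integral_ge0.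
rewrite /f; case: ifP => Jn; last by rewrite integral0.
exact: gaussian_ip_second_moment.
Qed.

Lemma integrable_gaussian_norm_sqr : G.-integrable setT (fun x => (`|x : H| ^+ 2)%:E).
Proof.
apply/integrableP; split.
  by apply/measurable_EFinP; apply: measurable_funX; exact: measurable_norm.
under eq_integral do rewrite gee0_abs ?lee_fin ?sqr_ge0//.
exact: gaussian_norm_second_moment.
Qed.

Lemma integrable_gaussian_norm : G.-integrable setT (fun x => (`|x : H|)%:E).
Proof.
apply: (@le_integrable _ _ _ G _ measurableT _ (fun x => (1 + `|x : H| ^+ 2)%:E)).
- by apply/measurable_EFinP; exact: measurable_norm.
- move=> x _; rewrite !abse_EFin lee_fin normr_id [leRHS]ger0_norm; last by rewrite addr_ge0// sqr_ge0.
  have := normr_ge0 (x : H); move: `|x : H| => y; nra.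
- under eq_fun do rewrite EFinD.
  apply: integrableD => //; last exact: integrable_gaussian_norm_sqr.
  exact: finite_measure_integrable_cst.
Qed.

Lemma integrable_gaussian_ip h : G.-integrable setT (fun x => (ip h x)%:E).
Proof.
apply: (@le_integrable _ _ _ G _ measurableT _ (fun x => (`|h| * `|x : H|)%:E)).
- by apply/measurable_EFinP; exact: mip.
- by move=> x _; rewrite !abse_EFin lee_fin normrM !normr_id; exact: cauchy_schwarz.
- by under eq_fun do rewrite EFinM; apply: integrableZl => //; exact: integrable_gaussian_norm.
Qed.

Lemma measurable_addr (h : H) : measurable_fun setT (fun x : borel H => (x + h : borel H)).
Proof.
apply: (measurable_coord normE sepH hzeta) => i _.
under eq_fun do rewrite ipDr.
by apply: measurable_funD => //; exact: mip.
Qed.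

(** * Disintegration of a Gaussian measure along a direction [Q k] *)

Section decomposition.
Variable k : H.
Let c := ip (Q k) k.
Hypothesis c0 : 0 < c.
Let s := Num.sqrt c.
Let s0 : s != 0. Proof. by rewrite gt_eqF// sqrtr_gt0. Qed.
Let s2 : s ^+ 2 = c. Proof. by rewrite sqr_sqrtr// ltW. Qed.
Let N : probability (measurableTypeR R) R := normal_prob 0 s.

(** Resampling: the part of [z.1] correlated with [ip k] is replaced by one with coordinate [z.2].
    Under [G], the variable [ip k x] and the remainder [x - (ip k x / c) *: Q k] are uncorrelated
    Gaussians, hence independent, so that the image of [G \x N] is [G] again. This splits [G] into
    real Gaussians on the lines of direction [Q k]. *)
Definition along (z : borel H * measurableTypeR R) : borel H :=
  (z.2 / c) *: Q k + ((z.1 : H) - (ip k z.1 / c) *: Q k).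

Let ip_along l z : ip l (along z) =
  (ip l (Q k) / c) * z.2 + ip (l - (ip l (Q k) / c) *: k) z.1.
Proof. by rewrite /along ipDr ipBr !ipZr ipBl ipZl; ring. Qed.

Lemma measurable_along : measurable_fun setT along.
Proof.
apply: (measurable_coord normE sepH hzeta) => i _.
under eq_fun do rewrite ip_along.
apply: measurable_funD; first by apply: measurable_funM.
exact: (measurableT_comp (mip _)).
Qed.

Let D : probability (borel H) R := law ((G \x N)%E : probability _ R) measurable_along.

Let trig_along (t : R -> R) (l : H) : continuous t -> (forall r : R, `|t r| <= 1) ->
  \int[D]_x t (ip l x) = \int[G]_x \int[N]_y t (ip l (along (x, y))).
Proof.
move=> ct t1.
have mt : measurable_fun setT (fun x : borel H => t (ip l x)).
  exact: (measurableT_comp (continuous_measurable_fun ct) (mip l)).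
have mta : measurable_fun setT (fun z => t (ip l (along z))).
  exact: (measurableT_comp mt measurable_along).
rewrite (Rintegral_law_bounded _ _ mt (C := 1))//.
rewrite /Rintegral -integral12_prod_meas1; last exact: (@integrable_prod_bounded _ _ _ _ _ G N _ 1 mta).
congr fine; apply: eq_integral => x _; rewrite fineK// integrable_fin_num//.
apply: (@bounded_integrable _ _ R N (fun y => t (ip l (along (x, y)))) 1); last by move=> y.
by apply: (measurableT_comp mta).
Qed.

Let var_along l : ip (Q (l - (ip l (Q k) / c) *: k)) (l - (ip l (Q k) / c) *: k) =
  ip (Q l) l - ip l (Q k) ^+ 2 / c.
Proof.
have -> (a : R) : Q (l - a *: k) = Q l - a *: Q k by rewrite linearB linearZ.
rewrite !(ipBl, ipBr, ipZl, ipZr) -/c.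
rewrite (cov_sym l k) (ipC ip (Q k) l); field.
by rewrite gt_eqF.
Qed.

Let cosN a b : \int[N]_y cos (a * y + b) = cos b * expR (- (a ^+ 2 * c / 2)).
Proof. by rewrite integral_normal_cosD// mulr0 add0r s2. Qed.

Let sinN a b : \int[N]_y sin (a * y + b) = sin b * expR (- (a ^+ 2 * c / 2)).
Proof. by rewrite integral_normal_sinD// mulr0 add0r s2. Qed.

(** Comparison of characteristic functions: the variance of [ip l] is the sum of that of its
    regression on [ip k] and that of the residual, computed in [var_along]. *)
Let DG A : measurable A -> D A = G A.
Proof.
apply: (char_unique normE sepH hzeta) => l.
  rewrite (trig_along l (@continuous_cos R) (@cos_max R)).
  transitivity (\int[G]_x (cos (ip (l - (ip l (Q k) / c) *: k) x) * expR (- ((ip l (Q k) / c) ^+ 2 * c / 2)))).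
    by apply: eq_Rintegral => x _; under eq_Rintegral do rewrite ip_along /=; exact: cosN.
  rewrite RintegralZr//; last first.
    apply: (@bounded_integrable _ _ R G _ 1); last by move=> x; exact: cos_max.
    exact: (measurableT_comp (continuous_measurable_fun (@continuous_cos R)) (mip _)).
  rewrite !gaussian_cos -expRD var_along; congr expR; field.
  by rewrite gt_eqF.
rewrite (trig_along l (@continuous_sin R) (@sin_max R)).
transitivity (\int[G]_x (sin (ip (l - (ip l (Q k) / c) *: k) x) * expR (- ((ip l (Q k) / c) ^+ 2 * c / 2)))).
  by apply: eq_Rintegral => x _; under eq_Rintegral do rewrite ip_along /=; exact: sinN.
rewrite RintegralZr//; last first.
  apply: (@bounded_integrable _ _ R G _ 1); last by move=> x; exact: sin_max.
  exact: (measurableT_comp (continuous_measurable_fun (@continuous_sin R)) (mip _)).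
by rewrite !gaussian_sin mul0r.
Qed.

Lemma gaussian_along_measure (B : set (borel H)) : measurable B ->
  G B = (\int[G]_x N [set y | B (along (x, y))])%E.
Proof.
move=> mB; have /esym -> := DG mB; rewrite lawE.
have mBa : measurable (along @^-1` B) by have := measurable_along measurableT mB; rewrite setTI.
rewrite -[LHS]/((G \x N)%E (along @^-1` B)).
rewrite -[LHS]/(\int[G]_x N (xsection (along @^-1` B) x))%E.
apply: eq_integral => x _ /=; congr (N _).
by apply/seteqP; split=> y; rewrite /xsection /= inE.
Qed.

Lemma gaussian_along (F : borel H -> R) : measurable_fun setT F -> G.-integrable setT (EFin \o F) ->
  (forall x, N.-integrable setT (fun y => (F (along (x, y)))%:E)) ->
  \int[G]_x F x = \int[G]_x \int[N]_y F (along (x, y)).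
Proof.
move=> mF IF IN; have mEF : measurable_fun setT (EFin \o F) by exact/measurable_EFinP.
have IE : (G \x N)%E.-integrable setT ((EFin \o F) \o along).
  apply/(integrable_law ((G \x N)%E : probability _ R) measurable_along mEF).
  apply/integrableP; split => //; rewrite (@eq_measure_integral _ _ _ _ G).
    by case/integrableP : IF.
  by move=> A mA _; exact: DG.
rewrite /Rintegral (@eq_measure_integral _ _ _ _ D); last by move=> A mA _; exact/esym/DG.
rewrite integral_law// -integral12_prod_meas1//; congr fine.
by apply: eq_integral => x _; rewrite fineK// integrable_fin_num.
Qed.

(** On each line of direction [Q k] this is the real Stein identity, with [ip k] as coordinate on
    the line. This is why the derivative along [Q k] is paired with the functional [ip k]. *)
Lemma gaussian_stein_neq0 (F DF : H -> R) (C : R) :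
  measurable_fun setT (F : borel H -> R) -> measurable_fun setT (DF : borel H -> R) ->
  (forall x, `|F x| <= C) -> (forall x, `|DF x| <= C) ->
  (forall x (r : R), is_derive r 1 (fun r => F (x + r *: Q k)) (DF (x + r *: Q k))) ->
  (forall x, continuous (fun r : R => DF (x + r *: Q k))) ->
  \int[G]_x DF x = \int[G]_x (F x * ip k x).
Proof.
move=> mF mDF FC DFC dF cDF.
have C0 : 0 <= C by apply: le_trans (FC 0).
have ipk x y : ip k (along (x, y)) = y.
  by rewrite ip_along (ipC ip k (Q k)) -/c divff ?gt_eqF// scale1r subrr ip0l mul1r addr0.
have mFa x : measurable_fun setT (fun y : measurableTypeR R => F (along (x, y))).
  by have mta := measurableT_comp mF measurable_along; apply: (measurableT_comp mta).
have mDFa x : measurable_fun setT (fun y : measurableTypeR R => DF (along (x, y))).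
  by have mta := measurableT_comp mDF measurable_along; apply: (measurableT_comp mta).
have bnd (T : Type) (u : T -> R) : (forall x, `|u x| <= C) -> [bounded u x | x in setT].
  by move=> uC; exists C; split; first exact: num_real; move=> M M1 x _ /=; apply: (le_trans (uC x)); exact: ltW.
have I2 x : N.-integrable setT (fun y => (F (along (x, y)) * y)%:E).
  have := @integrableMr _ _ _ N setT measurableT (fun y => F (along (x, y))) (fun y => y%:E) (mFa x).
  apply; first by apply: bnd => y; exact: FC.
  have := integrable_normal_center 0 s0; apply: eq_integrable => // y _.
  by rewrite subr0.
rewrite gaussian_along//; last 2 first.
- exact: (@bounded_integrable _ _ R G _ C mDF DFC).
- move=> x; apply: (@bounded_integrable _ _ R N (fun y => DF (along (x, y))) C) => //.
have mFk := measurable_funM mF (mip k).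
have IFk : G.-integrable setT (EFin \o (fun x => F x * ip k x)).
  have := @integrableMr _ _ _ G setT measurableT F (fun x => (ip k x)%:E) mF.
  by apply; [apply: bnd|exact: integrable_gaussian_ip].
have IFk' x : N.-integrable setT (fun y => ((fun x => F x * ip k x) (along (x, y)))%:E).
  by under eq_fun do rewrite ipk; exact: I2.
rewrite (gaussian_along mFk IFk IFk').
apply: eq_Rintegral => x _ /=.
under [RHS]eq_Rintegral do rewrite ipk.
pose x' := (x : H) - (ip k x / c) *: Q k.
(* The line is run through with velocity [Q k / c]; the factor [c] in [g] compensates for this and
   cancels the variance in the real identity. *)
pose g (r : R) : R := c * F (along (x, r)); pose g' (r : R) : R := DF (along (x, r)).
have alongE r : along (x, r) = x' + (r / c) *: Q k by rewrite /along addrC.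
have dg (r : R) : is_derive r 1 g (g' r).
  have h1 : is_derive r 1 (fun r : R => r / c) (c^-1).
    by apply: is_derive_eq; rewrite /GRing.scale /=; ring.
  have h2 := @is_derive1_comp R (fun u => F (x' + u *: Q k)) (fun r => r / c) r _ _ (dF x' (r / c)) h1.
  have h3 := is_deriveZ c h2.
  rewrite /g /g' alongE.
  have -> : (fun r => c * F (along (x, r))) = c *: ((fun r => F (x' + r *: Q k)) \o (fun r => r / c)).
    by apply/funext => u; rewrite alongE.
  by apply: (is_derive_eq h3); rewrite /GRing.scale /= mulrCA divff ?mulr1// gt_eqF.
have cg' : continuous g'.
  move=> r; rewrite /g'; under eq_fun do rewrite alongE.
  apply: (@continuous_comp _ _ _ (fun r : R => r / c) (fun u => DF (x' + u *: Q k)) r); last exact: cDF.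
  by apply: cvgM; [exact: cvg_id|exact: cvg_cst].
have := normal_stein 0 s0 (C := (1 + c) * C) dg cg' _ _.
rewrite s2 => ->.
- apply: eq_Rintegral => r _; rewrite /g subr0; field.
  by rewrite gt_eqF.
- move=> r; rewrite /g normrM gtr0_norm//; have := FC (along (x, r)); move: (normr_ge0 (F (along (x, r)))) c0; nra.
- move=> r; rewrite /g'; apply: (le_trans (DFC _)); rewrite ler_peMl// lerDl ltW//.
Qed.

(** Quasi-invariance of [G] in the direction [Q k]: a shift by [t *: Q k] moves the coordinate on
    each line by [t * c], and real Gaussians are quasi-invariant. *)
Lemma gaussian_null_shift (A : set (borel H)) (t : R) : measurable A -> G A = 0%E ->
  G [set x | A (x + t *: Q k)] = 0%E.
Proof.
move=> mA GA0.
have mS : measurable ([set x | A (x + t *: Q k)] : set (borel H)).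
  by have := measurable_addr (t *: Q k) measurableT mA; rewrite setTI.
have mN (B : set (borel H)) : measurable B -> measurable_fun setT (fun x => N [set y | B (along (x, y))]).
  move=> mB; have mBa : measurable (along @^-1` B) by have := measurable_along measurableT mB; rewrite setTI.
  have := measurable_fun_xsection N mBa.
  apply: eq_measurable_fun => x _ /=; congr (N _).
  by apply/seteqP; split=> y; rewrite /xsection /= inE.
move: GA0; rewrite (gaussian_along_measure mA) (gaussian_along_measure mS) => h0.
have h : ae_eq G setT (fun x => N [set y | A (along (x, y))]) (cst 0%E).
  apply/(ae_eq_integral_abs G measurableT (mN A mA)); rewrite -[RHS]h0.
  by apply: eq_integral => x _; rewrite gee0_abs.
rewrite (@ae_eq_integral _ _ _ G setT (cst 0%E) _ measurableT); last 3 first.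
- exact: mN.
- exact: measurable_cst.
- apply: filterS h => x /(_ Logic.I) /= NA _ /=.
  rewrite (_ : [set y | _] = [set y | [set y | A (along (x, y))] (y + t * c)]).
    apply: normal_null_shift => //.
    have mta : measurable (along @^-1` A) by have := measurable_along measurableT mA; rewrite setTI.
    have := measurable_xsection x mta.
    rewrite (_ : xsection _ _ = [set y | A (along (x, y))])//.
    by apply/seteqP; split=> y; rewrite /xsection /= inE.
  apply/seteqP; split=> y /=; rewrite /along /= mulrDl mulfK ?gt_eqF// scalerDl addrAC //.
by rewrite integral0.
Qed.

End decomposition.

Lemma gaussian_stein (k : H) (F DF : H -> R) (C : R) :
  measurable_fun setT (F : borel H -> R) -> measurable_fun setT (DF : borel H -> R) ->
  (forall x, `|F x| <= C) -> (forall x, `|DF x| <= C) ->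
  (forall x (r : R), is_derive r 1 (fun r => F (x + r *: Q k)) (DF (x + r *: Q k))) ->
  (forall x, continuous (fun r : R => DF (x + r *: Q k))) ->
  \int[G]_x DF x = \int[G]_x (F x * ip k x).
Proof.
move=> mF mDF FC DFC dF cDF.
have [k0|k0] := eqVneq k 0; last by apply: (gaussian_stein_neq0 (cov_gt0 k0) mF mDF FC DFC).
apply: eq_Rintegral => x _; have -> : ip k x = 0 by rewrite k0 ip0l.
rewrite mulr0.
have := dF x 0; rewrite k0 raddf0; under eq_fun do rewrite scaler0 addr0.
rewrite scaler0 addr0 => d1; have d2 : is_derive (0 : R) 1 (fun r : R => F x) 0 by exact: is_derive_cst.
by rewrite -(derive_val (is_derive := d1)) (derive_val (is_derive := d2)).
Qed.

Lemma cov_range_dense (z : H) (e : R) : 0 < e -> exists k, `|z - Q k| < e.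
Proof.
move=> e0; have [_ _ /(_ z) h] := hzeta.
move/cvgrPdist_lt : h => /(_ _ e0)[n _ /(_ n (leqnn n))].
move=> /= hn; exists (\sum_(i < n | I i) (ip (zeta i) z / lam i) *: zeta i).
rewrite raddf_sum /= (eq_bigr (fun i : 'I_n => ip (zeta i) z *: zeta i))// => i Ii.
by rewrite linearZ /= hlam// scalerA divfK// gt_eqF// lam_gt0.
Qed.

Lemma measurable_ball_borel (z : H) (r : R) : measurable (ball z r : set (borel H)).
Proof. by apply: sub_sigma_algebra; exact: ball_open. Qed.

(** If this ball were null, so would be its translates by all [Q k]. As the range of [Q] is dense,
    every ball of radius [r / 2] lies in such a translate, and countably many of these cover the
    space. *)
Let null_ball0 (r : R) : 0 < r -> G (ball (0 : H) r) != 0%E.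
Proof.
move=> r0; apply/eqP => G0.
have nk k : G (ball (Q k) r) = 0%E.
  have [->|k0] := eqVneq k 0; first by rewrite raddf0.
  have := gaussian_null_shift (cov_gt0 k0) (-1) (measurable_ball_borel 0 r) G0.
  rewrite (_ : [set x | _] = ball (Q k) r)//.
  by apply/seteqP; split=> x; rewrite -!ball_normE /= sub0r scaleN1r opprB.
have [A [/countable_injP[g ginj] dA]] := sepH.
have r2 : 0 < r / 2 by rewrite divr_gt0.
pose c k := xget 0 [set c | A c /\ g c = k].
have null a : G (ball (a : H) (r / 2)) = 0%E.
  have [k hk] := cov_range_dense a r2.
  apply/eqP; rewrite -measure_le0 -(nk k); apply: le_measure; rewrite ?inE; try exact: measurable_ball_borel.
  move=> x; rewrite -!ball_normE /= => h.
  have := ler_distD a (Q k) x; rewrite (distrC (Q k) a); lra.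
have : G setT = 0%E.
  have -> : [set: borel H] = \bigcup_k ball (c k : H) (r / 2).
    apply/esym/seteqP; split=> // x _.
    have [a [Ba Aa]] := dA (ball (x : H) (r / 2)) (ex_intro _ (x : H) (ballxx (x : H) r2)) (ball_open (x : H) _).
    exists (g a) => //; rewrite /c (_ : xget _ _ = a); first exact: ball_sym.
    apply: xget_unique; first by split.
    by move=> c' [Ac' gc]; apply: ginj; rewrite ?inE.
  apply/negligibleP; first by apply: bigcupT_measurable => k; exact: measurable_ball_borel.
  apply: negligible_bigcup => k; apply/negligibleP; first exact: measurable_ball_borel.
  exact: null.
by rewrite probability_setT => /eqP; rewrite onee_eq0.
Qed.

(** A null ball contains a null ball around some [Q k], which translates back to a null ball around
    0. *)
Lemma gaussian_ball_gt0 (z : H) (r : R) : 0 < r -> (0 < G (ball z r))%E.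
Proof.
move=> r0; rewrite lt0e measure_ge0 andbT; apply/eqP => G0.
have r2 : 0 < r / 2 by rewrite divr_gt0.
have [k hk] := cov_range_dense z r2.
have Gk : G (ball (Q k) (r / 2)) = 0%E.
  apply/eqP; rewrite -measure_le0 -G0; apply: le_measure; rewrite ?inE; try exact: measurable_ball_borel.
  move=> x; rewrite -!ball_normE /= => h.
  have := ler_distD (Q k) z x; lra.
have /negP[] := null_ball0 r2.
have [k0|k0] := eqVneq k 0; first by rewrite -Gk k0 raddf0.
have := gaussian_null_shift (cov_gt0 k0) 1 (measurable_ball_borel _ _) Gk.
rewrite (_ : [set x | _] = ball 0 (r / 2)); first by move=> ->.
by apply/seteqP; split=> x; rewrite -!ball_normE /= sub0r scale1r opprD addrCA subrr addr0.
Qed.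

End gaussian.

(** * Test functions *)

Section flat.
Context {R : realType}.

(** The classical smooth function exp(-c / u) extended by 0. The polynomial factor in 1 / u closes
    the family under differentiation. *)
Definition flat (c : R) (p : {poly R}) (u : R) : R :=
  if 0 < u then p.[u^-1] * expR (- (c / u)) else 0.

Lemma expR_geXn (x : R) n : 0 <= x -> x ^+ n / n`!%:R <= expR x.
Proof.
case: n => [|n] x0; first by rewrite expr0 fact0 divr1 -expR0 ler_expR.
by apply: le_trans (expR_ge1Dxn n x0); rewrite lerDr.
Qed.

Lemma poly_expRN_bounded c (p : {poly R}) : 0 < c ->
  exists C, forall z, 0 <= z -> `|p.[z] * expR (- (c * z))| <= C.
Proof.
move=> c0; exists (\sum_(i < size p) `|p`_i| * (i`!%:R / c ^+ i)) => z z0.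
rewrite horner_coef mulr_suml; apply: le_trans (ler_norm_sum _ _ _) _.
apply: ler_sum => i _; rewrite -mulrA normrM ler_wpM2l// ger0_norm; last first.
  by rewrite mulr_ge0 ?exprn_ge0 ?expR_ge0.
have := expR_geXn i (mulr_ge0 (ltW c0) z0).
rewrite expRN ler_pdivrMr ?ltr0n ?fact_gt0// ler_pdivrMr ?expR_gt0// exprMn => h.
rewrite -mulrA mulrCA -ler_pdivrMl ?exprn_gt0 ?invr_gt0 ?exprn_gt0// invrK.
by rewrite (le_trans h)// mulrC.
Qed.

Lemma flat_sqr c (p : {poly R}) : 0 < c -> exists C, forall u, `|flat c p u| <= C * u ^+ 2.
Proof.
move=> c0; have [C hC] := poly_expRN_bounded (p * 'X^2) c0.
exists C => u; rewrite /flat; case: ifPn => u0; last first.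
  rewrite normr0 mulr_ge0 ?sqr_ge0//.
  by apply: le_trans (hC 0 (lexx 0)).
have ui : 0 <= u^-1 by rewrite invr_ge0 ltW.
have := hC _ ui; rewrite hornerM hornerXn => h.
rewrite -ler_pdivrMr ?exprn_gt0//; apply: le_trans h.
rewrite [X in _ <= `|X|]mulrAC [leRHS]normrM [X in _ <= _ * X]ger0_norm ?exprn_ge0//.
by rewrite exprVn.
Qed.

(** For u > 0 the derivative is (c p - p')(1 / u) (1 / u)^2 exp(-c / u), which is of the same form.
    At 0 the bound of [flat_sqr] makes the difference quotient vanish in the limit. *)
Lemma is_derive_flat c (p : {poly R}) (u : R) : 0 < c ->
  is_derive u 1 (flat c p) (flat c ((c%:P * p - p^`()) * 'X^2) u).
Proof.
move=> c0; rewrite {2}/flat; case: ifPn => u0.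
  have near_flat : \forall v \near u, p.[v^-1] * expR (- (c * v^-1)) = flat c p v.
    near=> v; rewrite /flat ifT//.
    by near: v; exact: lt_nbhsr.
  have un0 : u != 0 by rewrite gt_eqF.
  have d1 : is_derive u 1 (fun u : R => u^-1) (- u ^- 2).
    by have := is_deriveV (f := id) un0 (is_derive_id u 1); rewrite /GRing.scale /= mulr1.
  have d2 := @is_derive1_comp _ (horner p) (fun u : R => u^-1) u _ _ (is_derive_poly p u^-1) d1.

  have d4 : is_derive u 1 (fun u : R => - (c * u^-1)) (c / u ^+ 2).
    apply: is_derive_eq; rewrite /GRing.scale /=; by field.
  have d5 := @is_derive1_comp _ (@expR R) (fun u : R => - (c * u^-1)) u _ _ (is_derive_expR _) d4.
  have d6 := is_deriveM d2 d5.
  apply: (near_eq_is_derive near_flat (is_derive_eq d6 _)).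
  rewrite /GRing.scale /= !hornerE /=; by field.
have [uN|] := ltP u 0.
  have near_flat : \forall v \near u, (cst 0 : R -> R) v = flat c p v.
    near=> v; rewrite /flat ifF//; apply/negbTE; rewrite -leNgt ltW//.
    by near: v; exact: lt_nbhsl.
  exact: (near_eq_is_derive near_flat (is_derive_cst _ _ _)).
rewrite -leNgt in u0; move=> u0'; have {u0 u0'}-> : u = 0 by apply/le_anti; rewrite u0.
apply/is_derive1_caratheodory; exists (fun z => flat c p z / z); split.
- move=> z; rewrite {2}/flat ltxx !subr0; have [->|z0] := eqVneq z 0; last by rewrite divfK.
  by rewrite /flat ltxx mul0r mulr0.
- have [C hC] := flat_sqr p c0.
  have C0 : 0 <= C by have := hC 1; rewrite expr1n mulr1; exact: le_trans.
  rewrite -[{for 0, _}]/((fun z : R => flat c p z / z) z @[z --> 0] --> flat c p 0 / 0) invr0 mulr0.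
  apply/cvgr0Pnorm_lt => e e0; near=> z.
  have [->|z0] := eqVneq z 0; first by rewrite invr0 mulr0 normr0.
  rewrite normrM normfV ltr_pdivrMr ?normr_gt0// (le_lt_trans (hC z))// -real_normK ?num_real//.
  rewrite expr2 mulrA ltr_pM2r ?normr_gt0//.
  have : `|z| < e / (C + 1).
    by near: z; apply/nbhs_normP; exists (e / (C + 1)) => /=; [rewrite divr_gt0// ltr_wpDl|by move=> y; rewrite /ball_/= sub0r normrN].
  rewrite ltr_pdivlMr ?ltr_wpDl//; have := normr_ge0 z; move: `|z| => y; nra.
- by rewrite invr0 mulr0.
Unshelve. all: by end_near. Qed.

Lemma flat_ge0 c u : 0 <= flat c 1 u.
Proof. by rewrite /flat; case: ifP => // _; rewrite hornerE mul1r expR_ge0. Qed.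

Lemma flat_le1 c u : 0 < c -> flat c 1 u <= 1.
Proof.
move=> c0; rewrite /flat; case: ifP => // u0.
by rewrite hornerE mul1r -expR0 ler_expR oppr_le0 divr_ge0 ?ltW.
Qed.

End flat.

Section smooth.
Context {R : realType} {m : nat}.
Implicit Types (f g : 'rV[R]_m -> R) (x v : 'rV[R]_m).

Lemma Cn_continuous n f : Cn n f -> continuous f.
Proof. by case: n => [|n] []. Qed.

Lemma CnW n f : Cn n.+1 f -> Cn n f.
Proof.
elim: n f => [|n IH] f; first by case.
case=> cf df; split=> // v; have [dfv Cf] := df v; split=> //.
exact: IH.
Qed.

Lemma CnD n f g : Cn n f -> Cn n g -> Cn n (f + g).
Proof.
elim: n f g => [|n IH] f g Cf Cg; split=> //; try by move=> x; exact: (continuousD (@Cn_continuous _ _ Cf x) (@Cn_continuous _ _ Cg x)).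
move=> v.
case: Cf Cg => _ df [_ dg].
have [dfv Cf] := df v; have [dgv Cg] := dg v; split=> [x|]; first exact: derivableD.
rewrite (_ : (fun x => _) = (fun x => 'D_v f x) + (fun x => 'D_v g x)); first exact: IH.
by apply/funext => x; rewrite deriveD.
Qed.

Lemma CnM n f g : Cn n f -> Cn n g -> Cn n (f * g).
Proof.
elim: n f g => [|n IH] f g Cf Cg; split=> //; try by move=> x; exact: (continuousM (@Cn_continuous _ _ Cf x) (@Cn_continuous _ _ Cg x)).
move=> v.
have Cf' := CnW Cf; have Cg' := CnW Cg; case: Cf Cg => _ df [_ dg].
have [dfv Cdf] := df v; have [dgv Cdg] := dg v; split=> [x|]; first exact: derivableM.
rewrite (_ : (fun x => _) = f * (fun x => 'D_v g x) + g * (fun x => 'D_v f x)).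
  by apply: CnD; apply: IH.
by apply/funext => x; rewrite deriveM.
Qed.

Lemma Cn_cst n (a : R) : Cn n (fun _ : 'rV[R]_m => a).
Proof.
elim: n a => [|n IH] a; split=> //; try exact: (@cst_continuous _ _ a).
move=> v; split=> [x|]; first exact: derivable_cst.
by under eq_fun do rewrite derive_cst; exact: IH.
Qed.

Lemma is_derive_line f x v l : is_derive (0 : R) 1 (fun h : R => f (h *: v + x)) l ->
  is_derive x v f l.
Proof.
move=> [df <-]; apply: DeriveDef; first exact/derivable1P.
rewrite /derive.
set g1 := fun h => h^-1 *: _; set g2 := fun h => h^-1 *: _.
suff -> : g1 = g2 by [].
by apply/funext => h; rewrite /g1 /g2 /= addr0 scale0r add0r [_%:A]mulr1.
Qed.

Lemma Cn_flat n c (p : {poly R}) (a r s : R) (i : 'I_m) : 0 < c ->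
  Cn n (fun x => s * flat c p (a + r * x 0 i)).
Proof.
move=> c0; elim: n p s => [|n IH] p s.
  split=> // x; apply: (@continuousM _ _ (cst s) (fun x => flat c p (a + r * x 0 i)) x); first exact: cst_continuous.
  apply: (@continuous_comp _ _ _ (fun x : 'rV[R]_m => a + r * x 0 i) (flat c p)).
    apply: (@continuousD _ _ _ (cst a) (fun x : 'rV[R]_m => r * x 0 i) x); first exact: cst_continuous.
    apply: (@continuousM _ _ (cst r) (fun x : 'rV[R]_m => x 0 i) x); first exact: cst_continuous.
    exact: coord_continuous.
  by apply: is_derive_continuous => u; exact: is_derive_flat.
split=> [|v]; first exact: Cn_continuous (IH p s).
have D x : is_derive x v (fun x => s * flat c p (a + r * x 0 i))
    (s * (r * v 0 i) * flat c ((c%:P * p - p^`()) * 'X^2) (a + r * x 0 i)).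
  apply: is_derive_line => /=.
  have d1 : is_derive (0 : R) 1 (fun h : R => a + r * (h * v 0 i + x 0 i)) (r * v 0 i).
    by apply: is_derive_eq; rewrite /GRing.scale /=; ring.
  have E : a + r * (0 * v 0 i + x 0 i) = a + r * x 0 i by ring.
  have d2 := @is_derive1_comp _ (flat c p) _ 0 _ _ (is_derive_flat p _ c0) d1.
  have d3 := is_deriveZ s d2.
  rewrite (_ : (fun h => _) = s *: (flat c p \o (fun h : R => a + r * (h * v 0 i + x 0 i)))).
    by apply: (is_derive_eq d3); rewrite E /GRing.scale /=; ring.
  by apply/funext => h; rewrite !mxE.
split=> [x|]; first exact: ex_derive.
have -> : 'D_v (fun x => s * flat c p (a + r * x 0 i)) =
    (fun x => s * (r * v 0 i) * flat c ((c%:P * p - p^`()) * 'X^2) (a + r * x 0 i)).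
  by apply/funext => x; rewrite derive_val.
exact: IH.
Qed.

Lemma Cn_prod n (T : Type) (s : seq T) (P : pred T) (F : T -> 'rV[R]_m -> R) :
  (forall i, Cn n (F i)) -> Cn n (fun y => \prod_(i <- s | P i) F i y).
Proof.
move=> CF; elim: s => [|i s IH].
  by under eq_fun do rewrite big_nil; exact: Cn_cst.
under eq_fun do rewrite big_cons; case: (P i) => //.
exact: (CnM (CF i) IH).
Qed.

Lemma compact_support_bounded (K : set 'rV[R]_m) f : compact K -> continuous f ->
  (forall x, ~ K x -> f x = 0) -> exists C, forall x, `|f x| <= C.
Proof.
move=> cK cf f0.
have : compact (f @` K) by apply: continuous_compact => //; exact: continuous_subspaceT.
move=> /compact_bounded[M [Mr hM]]; exists (`|M| + 1) => x.
have [Kx|nKx] := pselect (K x); last by rewrite f0// normr0 addr_ge0.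
apply: hM; last by exists x.
by rewrite (le_lt_trans (ler_norm M))// ltrDl.
Qed.

Lemma derive_support0 f x v : ~ closure [set x | f x != 0] x -> 'D_v f x = 0.
Proof.
move=> nx; rewrite (near_eq_derive v (g := cst 0)) ?derive_cst//.
have : nbhs x (~` closure [set x | f x != 0]).
  by apply: open_nbhs_nbhs; split=> //; apply: closed_openC; exact: closed_closure.
apply: filterS => y /= ny; apply/eqP; apply/negPn/negP => fy; apply: ny.
exact: subset_closure.
Qed.

Lemma test_function_bounded f : test_function f -> exists C, forall x, `|f x| <= C.
Proof.
move=> [Cf cK]; apply: (compact_support_bounded cK); first exact: Cn_continuous (Cf 0%N).
move=> x nx; apply/eqP; apply/negPn/negP => fx; apply: nx.
exact: subset_closure.
Qed.

Lemma test_function_derive_bounded f v : test_function f -> exists C, forall x, `|'D_v f x| <= C.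
Proof.
move=> [Cf cK]; apply: (compact_support_bounded cK); last by move=> x; exact: derive_support0.
by have [_ /(_ v)[_ []]] := Cf 1%N.
Qed.

End smooth.

Section flat_limit.
Context {R : realType}.

(** With the parameter 1 / (n + 1)^2, arguments as small as 1 / (n + 1) still give at least exp(-1 /
    (n + 1)). The slack of that size in [cyl_bump] is chosen accordingly. *)
Lemma cvg_flat1 (a : nat -> R) : (\forall n \near \oo, n.+1%:R^-1 <= a n) ->
  (fun n => flat (n.+1%:R^-1 ^+ 2) 1 (a n)) @ \oo --> (1 : R).
Proof.
move=> ha.
have h0 : (fun n => expR (- n.+1%:R^-1) : R) @ \oo --> (1 : R).
  have : (fun n => expR (- n.+1%:R^-1) : R) @ \oo --> expR (- 0 : R).
    apply: (continuous_cvg _ (@continuous_expR R _)); apply: cvgN.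
    exact: cvg_harmonic.
  by rewrite oppr0 expR0.
apply: (squeeze_cvgr _ h0 (cvg_cst _)).
near=> n.
have n0 : (0 : R) < n.+1%:R^-1 by rewrite invr_gt0 ltr0n.
have an : n.+1%:R^-1 <= a n by near: n.
rewrite flat_le1 ?exprn_gt0// andbT /flat (lt_le_trans n0)// hornerE mul1r ler_expR lerN2.
by rewrite ler_pdivrMr ?(lt_le_trans n0)// expr2 ler_pM2l.
Unshelve. all: by end_near. Qed.

Lemma cvg_flat0 (a : nat -> R) : (\forall n \near \oo, a n <= 0) ->
  (fun n => flat (n.+1%:R^-1 ^+ 2) 1 (a n)) @ \oo --> (0 : R).
Proof.
move=> ha; apply: cvg_near_cst; apply: filterS ha => n an.
by rewrite /flat ltNge an.
Qed.

Lemma cvg_prod_seq (T : Type) (s : seq T) (P : pred T) (F : T -> nat -> R) (l : T -> R) :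
  (forall i, P i -> F i @ \oo --> l i) ->
  (fun n => \prod_(i <- s | P i) F i n) @ \oo --> \prod_(i <- s | P i) l i.
Proof.
move=> FL; elim: s => [|i s IH].
  by under eq_fun do rewrite big_nil; rewrite big_nil; exact: cvg_cst.
under eq_fun do rewrite big_cons; rewrite big_cons; case: ifPn => // Pi.
by apply: cvgM => //; exact: FL.
Qed.

End flat_limit.

Section integral_pi_system.
Context d (T : measurableType d) {R : realType} {H : completeNormedModType R}.
Variable ip : {dot H for idfun}.
Hypothesis normE : forall x : H, `|x| ^+ 2 = ip x x.
Hypothesis sepH : separable_space H.
Variables (I : pred nat) (e : nat -> H).
Hypothesis he : orthonormal_basis ip I e.

(** The sets over which [g] integrates to 0 form a Dynkin system, complements being handled by the
    empty list of constraints, and the cylinders are a generating pi-system. *)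
Lemma integral0_cylset (mu : {finite_measure set T -> \bar R}) (X : T -> borel H) (g : T -> R) :
  measurable_fun setT X -> mu.-integrable setT (EFin \o g) ->
  (forall l, \int[mu]_(w in X @^-1` cylset ip I e l) (g w)%:E = 0)%E ->
  forall B, measurable B -> (\int[mu]_(w in X @^-1` B) (g w)%:E = 0)%E.
Proof.
move=> mX ig h0 B.
have mXB C : measurable C -> measurable (X @^-1` C) by move=> mC; rewrite -[X in measurable X]setTI; exact: mX.
have igB C : measurable C -> mu.-integrable (X @^-1` C) (EFin \o g).
  by move=> mC; apply: integrableS ig => //; exact: mXB.
rewrite (borel_cylset normE sepH he).
apply: (@dynkin_induction _ (borel H) (range (cylset ip I e))
  (fun C => \int[mu]_(w in X @^-1` C) (g w)%:E = 0)%E).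
- exact: (borel_cylset normE sepH he).
- exact: setI_closed_cylset.
- by have := h0 [::]; rewrite cylset_nil.
- by move=> _ [l _ <-].
- move=> C mC C0.
  have := h0 [::]; rewrite cylset_nil -(setUv C) preimage_setU.
  rewrite integral_setU_EFin//; [|exact: mXB|by apply: mXB; exact: measurableC| |].
  + by rewrite C0 add0e.
  + rewrite -preimage_setU setUv preimage_setT.
    by have /measurable_int/measurable_EFinP := ig.
  + by apply/disj_setPS; rewrite -preimage_setI setICr preimage_set0.
- move=> F mF tF F0; rewrite preimage_bigcup.
  rewrite integral_bigcup//.
  + by rewrite eseries0// => n _ _; exact: F0.
  + apply/trivIsetP => i j _ _ ij.
    by rewrite -preimage_setI; move/trivIsetP : tF => ->//; rewrite preimage_set0.
  + by move=> k; exact: mXB.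
  + rewrite -preimage_bigcup; apply: igB; exact: bigcup_measurable.
Qed.

End integral_pi_system.

Section test_functions.
Context {R : realType} {H : completeNormedModType R}.
Variable ip : {dot H for idfun}.
Hypothesis normE : forall x : H, `|x| ^+ 2 = ip x x.
Hypothesis sepH : separable_space H.
Variables (I : pred nat) (e : nat -> H).
Hypothesis he : orthonormal_basis ip I e.

(** The first product confines every coordinate to [-(n + 1), n + 1] and makes the support compact.
    The second smooths the constraints of [l], relaxed by 1 / (n + 1) so that the limit is the
    indicator of closed half-lines, boundary included. *)
Definition cyl_bump (l : seq (nat * rat)) m (n : nat) (y : 'rV[R]_m) : R :=
  (\prod_(j < m) (flat (n.+1%:R^-1 ^+ 2) 1 (n.+1%:R - y 0 j) * flat (n.+1%:R^-1 ^+ 2) 1 (n.+1%:R + y 0 j))) *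
  \prod_(p <- l) \prod_(j < m | j == p.1 :> nat) flat (n.+1%:R^-1 ^+ 2) 1 (ratr p.2 + n.+1%:R^-1 - y 0 j).

Let c0 n : (0 : R) < n.+1%:R^-1 ^+ 2.
Proof. by rewrite exprn_gt0// invr_gt0 ltr0n. Qed.

Lemma cyl_bump_test_function l m n : test_function (@cyl_bump l m n).
Proof.
have sm (a r : R) (j : 'I_m) k : Cn k (fun y : 'rV[R]_m => flat (n.+1%:R^-1 ^+ 2) 1 (a + r * y 0 j)).
  rewrite (_ : (fun y : 'rV[R]_m => _) = (fun y => 1 * flat (n.+1%:R^-1 ^+ 2) 1 (a + r * y 0 j))).
    exact: Cn_flat.
  by apply/funext => y; rewrite mul1r.
have smB (a : R) j k : Cn k (fun y : 'rV[R]_m => flat (n.+1%:R^-1 ^+ 2) 1 (a - y 0 j)).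
  by under eq_fun do rewrite -mulN1r; exact: sm.
have smD (a : R) j k : Cn k (fun y : 'rV[R]_m => flat (n.+1%:R^-1 ^+ 2) 1 (a + y 0 j)).
  by under eq_fun do rewrite -[X in _ + X]mul1r; exact: sm.
have boxc : compact [set y : 'rV[R]_m | forall j, y ord0 j \in `[(- n.+1%:R), n.+1%:R]].
  by apply: (@rV_compact R m (fun=> `[(- n.+1%:R : R), n.+1%:R]%classic)) => _; exact: segment_compact.
split=> [k|].
  apply: CnM.
    apply: Cn_prod => j; apply: CnM; [exact: smB|exact: smD].
  apply: Cn_prod => p; apply: Cn_prod => j; exact: smB.
apply: (@subclosed_compact _ _ [set y : 'rV[R]_m | forall j, y ord0 j \in `[(- n.+1%:R), n.+1%:R]]).
- exact: closed_closure.
- exact: boxc.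
- have cl : closed [set y : 'rV[R]_m | forall j, y ord0 j \in `[(- n.+1%:R), n.+1%:R]].
    by apply: compact_closed; first exact: norm_hausdorff.
  rewrite [X in _ `<=` X](closure_id _).1//; apply: closure_subset => y /= b0 j.
  rewrite in_itv /=; apply/andP; split; rewrite leNgt; apply: contra b0 => hj.
    by rewrite /cyl_bump (bigD1 j)//= /flat (_ : 0 < _ + y 0 j = false) ?mulr0 ?mul0r//; apply/negbTE; rewrite -leNgt; lra.
  by rewrite /cyl_bump (bigD1 j)//= /flat (_ : 0 < _ - y 0 j = false) ?mul0r//; apply/negbTE; rewrite -leNgt; lra.
Qed.

Let flat01 n (u : R) : 0 <= flat (n.+1%:R^-1 ^+ 2) 1 u <= 1.
Proof. by rewrite flat_ge0 flat_le1. Qed.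

Lemma cyl_bump_bound l m n y : 0 <= @cyl_bump l m n y <= 1.
Proof.
have p01 (a b : R) : 0 <= a <= 1 -> 0 <= b <= 1 -> 0 <= a * b <= 1.
  by move=> /andP[a0 a1] /andP[b0 b1]; rewrite mulr_ge0//= mulr_ile1.
have prod01 (T : Type) (s : seq T) (P : pred T) (F : T -> R) : (forall i, 0 <= F i <= 1) ->
    0 <= \prod_(i <- s | P i) F i <= 1.
  by move=> hF; apply: (big_ind (fun u : R => 0 <= u <= 1)) => //; rewrite ler01 lexx.
rewrite /cyl_bump; apply: (p01 _ _ _ _); apply: (prod01 _ _ _ _ _) => j; first exact: p01.
exact: (prod01 _ _ _ _ _).
Qed.

Lemma cvg_bump (l : seq (nat * rat)) m (x : H) : (forall i, (i < m)%N -> I i) ->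
  (forall p, p \in l -> I p.1 -> (p.1 < m)%N) ->
  (fun n => cylinder ip e (@cyl_bump l m n) x) @ \oo --> (\1_(cylset ip I e l) x : R).
Proof.
move=> mI hl; rewrite /cylinder /cyl_bump.
rewrite -[X in _ --> X]mul1r; apply: cvgM.
  have := @cvg_prod_seq R _ (index_enum 'I_m) xpredT
    (fun j n => flat (n.+1%:R^-1 ^+ 2) 1 (n.+1%:R - (\row_i ip (e i) x) 0 j) *
      flat (n.+1%:R^-1 ^+ 2) 1 (n.+1%:R + (\row_i ip (e i) x) 0 j)) (fun=> 1).
  rewrite (_ : \prod_i 1 = 1 :> R); last by rewrite big1.
  apply=> j _; rewrite -[X in _ --> X]mul1r.
  have aux (N a : R) : 1 <= N -> `|a| + 1 <= N -> N^-1 <= N - a /\ N^-1 <= N + a.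
    move=> N1 aN; have : N^-1 <= 1 by rewrite invf_le1// (lt_le_trans ltr01).
    have := ler_norm a; have := ler_norm (- a); rewrite normrN; move: (N^-1) => r.
    by move=> *; split; lra.
  have hn : \forall n \near \oo, `|ip (e j) x| + 1 <= (n.+1%:R : R).
    by near=> n; rewrite (@le_trans _ _ n%:R) ?ler_nat//; near: n; exact: nbhs_infty_ger.
  by apply: cvgM; apply: cvg_flat1; apply: filterS hn => n hn; rewrite mxE;
    have [] := aux n.+1%:R (ip (e j) x) _ hn; rewrite ?ler1n.
elim: l hl => [|[i q] l IH] hl.
  by rewrite cylset_nil indicT; under eq_fun do rewrite big_nil; exact: cvg_cst.
rewrite cylset_cons indicI /=; under eq_fun do rewrite big_cons.
apply: cvgM; last by apply: IH => p pl; apply: hl; rewrite inE pl orbT.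
have [im|mi] := ltnP i m; last first.
  rewrite (_ : [set x | _] = setT); last first.
    apply/seteqP; split=> // y _ /= Ii.
    by have := hl (i, q); rewrite mem_head ltnNge mi => /(_ isT Ii).
  rewrite indicT; apply: cvg_near_cst; apply: nearW => n.
  by rewrite big1//= => j /eqP ji; have := ltn_ord j; rewrite ji ltnNge mi.
have Ii : I i by exact: mI.
under eq_fun do rewrite (big_pred1 (Ordinal im)) ?mxE //=.
rewrite indicE; have [xq|qx] := leP (ip (e i) x) (ratr q).
  rewrite mem_set//=; apply: cvg_flat1; apply: nearW => n.
  by rewrite addrAC lerDr subr_ge0.
rewrite memNset/=; last by move=> /(_ Ii); rewrite leNgt qx.
apply: cvg_flat0; near=> n; rewrite subr_le0 -lerBrDl ltW//.
near: n; have d0 : 0 < ip (e i) x - ratr q by rewrite subr_gt0.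
exact: (near_infty_natSinv_lt (PosNum d0)).
Unshelve. all: by end_near. Qed.

Lemma measurable_cylinder m (f : 'rV[R]_m -> R) : continuous f ->
  measurable_fun setT (cylinder ip e f : borel H -> R).
Proof.
move=> cf; apply: measurable_continuous_borel => x.
apply: (@continuous_comp _ _ _ (fun x : H => \row_(i < m) ip (e i) x) f); last exact: cf.
move=> A [B nB sB]; apply: (@filterS _ (nbhs x) _ [set y : H | forall i, B 0 i (ip (e i) y)]).
  by move=> y /= hy; apply: sB => i j; rewrite mxE ord1; exact: hy.
apply: (@filter_forall _ _ (fun i y => B 0 i (ip (e i) y))) => i.
by have := nB 0 i; rewrite mxE; exact: (@continuous_ip _ _ _ normE (e i) x).
Qed.

Section fomin_unique.
Variable nu : probability (borel H) R.

(** Testing against bumps that converge to indicators of cylinders shows that [r1 - r2] integrates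
    to 0 over every cylinder, hence over every Borel set. *)
Lemma fomin_derivative_unique h r1 r2 :
  fomin_derivative ip I e nu h r1 -> fomin_derivative ip I e nu h r2 ->
  {ae nu, forall x, r1 x = r2 x}.
Proof.
move=> [i1 f1] [i2 f2].
have m1 : measurable_fun setT (r1 : borel H -> R) by apply/measurable_EFinP; exact: (measurable_int _ i1).
have m2 : measurable_fun setT (r2 : borel H -> R) by apply/measurable_EFinP; exact: (measurable_int _ i2).
pose g x := r1 x - r2 x.
have ig : nu.-integrable setT (EFin \o (g : borel H -> R)).
  by apply: eq_integrable (integrableB measurableT i1 i2) => // x _.
have bnd m (f : 'rV[R]_m -> R) r : test_function f -> nu.-integrable setT (EFin \o (r : borel H -> R)) ->
    nu.-integrable setT (fun x : borel H => (cylinder ip e f x * r x)%:E).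
  move=> tf ir; have [C fC] := test_function_bounded tf.
  apply: (@integrableMr _ _ _ nu setT measurableT (cylinder ip e f) (fun x => (r x)%:E)) => //.
    apply: measurable_cylinder; have [Cf _] := tf; exact: Cn_continuous (Cf 0%N).
  exists C; split; first exact: num_real.
  by move=> M CM x _; apply: le_trans (fC _) (ltW CM).
have key m (f : 'rV[R]_m -> R) : (forall i : 'I_m, I i) -> test_function f ->
    \int[nu]_x (cylinder ip e f x * g x) = 0.
  move=> Im tf; rewrite /g; under eq_Rintegral do rewrite mulrBr.
  rewrite RintegralB//; [|exact: bnd..].
  by apply/eqP; rewrite subr_eq0 -eqr_opp -f1// -f2.
have cyl0 l : (\int[nu]_(x in cylset ip I e l) (g x)%:E = 0)%E.
  (* All constrained indices of [I] lie below [m], and all indices below [m] lie in [I], an initial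
     segment; the latter is required of test functions by [fomin_derivative]. *)
  pose m := \max_(p <- l | I p.1) p.1.+1.
  have lm p : p \in l -> I p.1 -> (p.1 < m)%N.
    by move=> pl Ip; rewrite /m -/(p.1.+1 <= m)%N (big_rem p)//= Ip leq_maxl.
  have mI i : (i < m)%N -> I i.
    move=> im; apply/negPn/negP => nIi; move: im; rewrite ltnNge => /negP; apply.
    apply/bigmax_leqP_seq => p pl Ip; rewrite ltnNge; apply/negP => ip'.
    by move/negP: nIi; apply; have [+ _ _] := he; apply; [exact: ip'|].
  have mcyl n : measurable_fun setT (cylinder ip e (@cyl_bump l m n) : borel H -> R).
    apply: measurable_cylinder; have [Cf _] := cyl_bump_test_function l m n; exact: Cn_continuous (Cf 0%N).
  have mB := measurable_cylset normE sepH he l.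
  have mg : measurable_fun setT (g : borel H -> R) by exact: measurable_funB.
  have m1g n := measurable_funM (mcyl n) mg.
  have m2g : measurable_fun setT (fun x : borel H => \1_(cylset ip I e l) x * g x).
    by apply: measurable_funM => //; exact: measurable_indic.
  have cv : {ae nu, forall x, [set: borel H] x ->
      (fun n => cylinder ip e (@cyl_bump l m n) x * g x) @ \oo --> \1_(cylset ip I e l) x * g x}.
    apply: aeW => x _; apply: cvgM; last exact: cvg_cst.
    exact: cvg_bump.
  have bd : {ae nu, forall x n, [set: borel H] x -> `|cylinder ip e (@cyl_bump l m n) x * g x| <= `|g x|}.
    apply: aeW => x n _; rewrite normrM ler_piMl//.
    have /andP[b0 b1] := cyl_bump_bound l n (\row_(i < m) ip (e i) x).
    by rewrite ger0_norm.
  have [ig1] := Rdominated_convergence measurableT m1g m2g cv (integrable_norm ig) bd.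
  rewrite (_ : (fun n => _) = cst 0); last first.
    apply/funext => n; apply: key; first by move=> i; exact: mI.
    exact: cyl_bump_test_function.
  move=> /(cvg_unique (@Rhausdorff R) (cvg_cst _)) E.
  rewrite (_ : (\int[nu]_(x in _) _)%E = (\int[nu]_x (\1_(cylset ip I e l) x * g x)%:E)%E).
    by rewrite -[LHS]fineK ?integrable_fin_num// -[fine _]/(\int[nu]_x (\1_(cylset ip I e l) x * g x)) -E.
  rewrite integral_mkcond; apply: eq_integral => x _.
  rewrite patchE indicE; case: ifPn => _; first by rewrite mul1r.
  by rewrite mul0r.
have z0 := integral0_cylset normE sepH he (mu := nu) (X := id) (@measurable_id _ _ _) ig cyl0.
have := integral_ae_eq measurableT ig (measurable_cst 0%E) _ => /(_ _)[]//.
  by move=> E _ mE; rewrite integral0; exact: z0.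
move=> N [mN N0 sN]; exists N; split=> // x /= xr; apply: sN => /= gx; apply: xr.
by have /eqP := gx Logic.I; rewrite eqe subr_eq0 => /eqP.
Qed.

End fomin_unique.

End test_functions.

(** * Logarithmic gradients *)

Section L2_limit.
Context d (T : measurableType d) (R : realType) (P : probability T R).

Lemma fatou_le (f : nat -> T -> R) (h : T -> R) (c : R) :
  (forall n, measurable_fun setT (f n)) -> measurable_fun setT h ->
  (forall n x, 0 <= f n x) -> {ae P, forall x, f ^~ x @ \oo --> h x} ->
  (forall n, \int[P]_x (f n x)%:E <= c%:E)%E -> (\int[P]_x (h x)%:E <= c%:E)%E.
Proof.
move=> mf mh f0 fh fc.
have mEf n : measurable_fun setT (fun x => (f n x)%:E) by exact/measurable_EFinP.
have -> : (\int[P]_x (h x)%:E = \int[P]_x limn_einf (fun n => (f n x)%:E))%E.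
  apply: ae_eq_integral => //; first exact/measurable_EFinP.
    rewrite (_ : (fun x => _) = (fun x => - limn_esup (-%E \o (fun n => (f n x)%:E)))%E).
      apply: measurableT_comp => //; apply: measurable_fun_limn_esup => n /=.
      by apply/measurable_EFinP; exact: measurableT_comp.
    by apply/funext => x; rewrite limn_esupN oppeK.
  apply: filterS fh => x fx _; apply/esym.
  have fx' : (fun n => (f n x)%:E) @ \oo --> (h x)%:E by apply: cvg_EFin; first exact: nearW.
  by have [-> _] := cvg_limn_einf_sup fx'.
apply: le_trans (fatou P measurableT mEf _) _; first by move=> n x _; rewrite lee_fin.
rewrite limn_einf_lim; apply: lime_le; first exact: is_cvg_einfs.
by apply: nearW => n; apply: le_trans (fc n); apply: ereal_inf_lbound; exists n => /=.
Qed.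

(** The Riesz-Fischer argument: a fast subsequence converges almost everywhere, and Fatou's lemma
    transfers the Cauchy bound to the distance to its limit. *)
Lemma L2_limit (f : nat -> T -> R) (a : nat -> R) :
  (forall n, measurable_fun setT (f n)) ->
  (forall m n, (m <= n)%N -> (\int[P]_x ((f n x - f m x) ^+ 2)%:E <= (a m)%:E)%E) ->
  a @ \oo --> 0 ->
  exists2 g : T -> R, measurable_fun setT g &
    (fun n => \int[P]_x ((f n x - g x) ^+ 2)%:E)%E @ \oo --> 0%E.
Proof.
move=> mf fa a0.
have a_ge0 m : 0 <= a m.
  rewrite -lee_fin; apply: le_trans (fa m m (leqnn m)).
  by apply: integral_ge0 => x _; rewrite lee_fin sqr_ge0.
have /choice[k kP] : forall j, exists k, forall n, (k <= n)%N -> a n <= 16^-1 ^+ j.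
  move=> j; have e0 : (0 : R) < 16^-1 ^+ j by rewrite exprn_gt0.
  move/cvgr0Pnorm_le : a0 => /(_ _ e0)[N _ hN]; exists N => n Nn.
  by have := hN n Nn; rewrite ger0_norm.
(* A nondecreasing sequence of indices that is at least [k j], for the speed of convergence, and at
   least [j], so as to pass any given index. *)
pose u j := (j + \sum_(i < j.+1) k i)%N.
have uS j : (u j <= u j.+1)%N by rewrite /u [in X in (_ <= X)%N]big_ord_recr/= addSn (leq_trans _ (leqnSn _))// leq_add2l leq_addr.
have uk j : (k j <= u j)%N by rewrite /u big_ord_recr/= addnA leq_addl.
have ju j : (j <= u j)%N by exact: leq_addr.
pose D j x := f (u j.+1) x - f (u j) x.
have mD j : measurable_fun setT (D j) by exact: measurable_funB.
(* Increments have mean square at most 16^-j. The weight 4^j leaves the summable 4^-j, while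
   finiteness of the weighted sum forces |D j x| to be O(2^-j), hence pointwise convergence. *)
pose t j x : \bar R := (4 ^+ j * D j x ^+ 2)%:E.
have t0 j x : (0 <= t j x)%E by rewrite lee_fin mulr_ge0 ?sqr_ge0.
have mt j : measurable_fun setT (t j).
  by apply/measurable_EFinP; apply: measurable_funM => //; exact: measurable_funX.
have it j : (\int[P]_x t j x <= (4^-1 ^+ j)%:E)%E.
  rewrite /t; under eq_integral do rewrite EFinM.
  rewrite ge0_integralZl//; last 2 first.
  - by apply/measurable_EFinP; exact: measurable_funX.
  - by move=> x _; rewrite lee_fin sqr_ge0.
  apply: le_trans (_ : ((4 ^+ j)%:E * (16^-1 ^+ j)%:E <= _)%E).
    by rewrite lee_pmul2l//; apply: le_trans (fa _ _ (uS j)) _; rewrite lee_fin kP.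
  rewrite lee_fin -exprMn (_ : 4 * 16^-1 = 4^-1 :> R)//; by field.
have sum_fin : {ae P, forall x, (\sum_(j <oo) t j x < +oo)%E}.
  have it' : P.-integrable setT (fun x => \sum_(j <oo) t j x)%E.
    apply/integrableP; split; first by apply: ge0_emeasurable_sum => //.
    under eq_integral do rewrite gee0_abs ?nneseries_ge0//.
    rewrite integral_nneseries//.
    apply: (@le_lt_trans _ _ (\sum_(j <oo) (4^-1 ^+ j)%:E)%E).
      by apply: lee_nneseries => [j *|j *]; [by apply: integral_ge0 => x _; exact: t0|exact: it].
    apply: (@le_lt_trans _ _ (2 : R)%:E); last exact: ltry.
    apply: lime_le; first by apply: is_cvg_nneseries => j _ _; rewrite lee_fin exprn_ge0.
    apply: nearW => n; rewrite sumEFin lee_fin.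
    suff : \sum_(0 <= j < n) 4^-1 ^+ j <= 2 - 2 * 4^-1 ^+ n :> R.
      by move=> /le_trans; apply; rewrite gerBl mulr_ge0// exprn_ge0.
    elim: n => [|n IH]; first by rewrite big_nil expr0; lra.
    rewrite big_nat_recr//= exprS; have : 0 <= 4^-1 ^+ n :> R by rewrite exprn_ge0.
    move: IH; move: (\sum_(0 <= j < n) _) (4^-1 ^+ n) => s r; lra.
  apply: filterS (integrable_ae measurableT it') => x /(_ Logic.I).
  by rewrite ge0_fin_numE// nneseries_ge0.
(* An upper limit is measurable whether or not the subsequence converges at [x]; [fine] sets its
   infinite values to 0. *)
pose g x := fine (limn_esup (fun j => (f (u j) x)%:E)).
have mg : measurable_fun setT g.
  apply: measurableT_comp; first exact: fine_measurable.
  by apply: measurable_fun_limn_esup => j; exact/measurable_EFinP.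
have fg : {ae P, forall x, (fun j => f (u j) x) @ \oo --> g x}.
  apply: filterS sum_fin => x hx.
  suff cf : cvgn (fun j => f (u j) x).
    have [l fl] := (cvg_ex _).1 cf.
    have fl' : (fun n => (f (u n) x)%:E) @ \oo --> l%:E by apply: cvg_EFin; first exact: nearW.
    by rewrite /g; have [_ ->] := cvg_limn_einf_sup fl'.
  pose M := fine (\sum_(j <oo) t j x)%E.
  have DM j : `|D j x| <= Num.sqrt M * 2^-1 ^+ j.
    have : (t j x <= M%:E)%E.
      rewrite /M fineK ?ge0_fin_numE ?nneseries_ge0//.
      apply: le_trans (nneseries_lim_ge j.+1 _) => //.
      by rewrite big_nat_recr//= leeDr// sume_ge0.
    rewrite lee_fin => tM.
    have M0 : 0 <= M by apply: le_trans tM; rewrite mulr_ge0 ?sqr_ge0.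
    rewrite -(ler_pXn2r (ltn0Sn 1)) ?nnegrE ?mulr_ge0 ?sqrtr_ge0//.
    rewrite real_normK ?num_real// exprMn sqr_sqrtr// -ler_pdivrMr ?exprn_gt0 ?invr_gt0//.
    have -> : (2^-1 ^+ j ^+ 2)^-1 = 4 ^+ j :> R.
      by rewrite exprAC -exprVn; congr (_ ^+ _); field.
    by apply: le_trans tM; rewrite mulrC.
  rewrite (_ : (fun j => _) = (fun n => f (u 0%N) x + series (fun j => D j x) n)); last first.
    by apply/funext => n; rewrite /series/= telescope_sumr// addrC subrK.
  apply: is_cvgD; first exact: is_cvg_cst.
  apply: normed_cvg; apply: (series_le_cvg (v_ := geometric (Num.sqrt M) 2^-1)).
  - by move=> n /=.
  - by move=> n /=; rewrite mulr_ge0 ?sqrtr_ge0.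
  - by move=> n /=.
  - by apply: is_cvg_geometric_series; rewrite ger0_norm; lra.
exists g => //.
apply: (@squeeze_cvge _ _ _ _ (cst 0%E) _ (EFin \o a)).
- apply: nearW => n; rewrite integral_ge0 ?andTb/=; last by move=> x _; rewrite lee_fin sqr_ge0.
  apply: (@fatou_le (fun j x => (f n x - f (u (n + j)%N) x) ^+ 2)).
  + by move=> j; apply: measurable_funX; exact: measurable_funB.
  + by apply: measurable_funX; exact: measurable_funB.
  + by move=> j x; exact: sqr_ge0.
  + apply: filterS fg => x fgx.
    have h : (fun j => f (u (n + j)%N) x) @ \oo --> g x by under eq_fun do rewrite addnC; rewrite -(cvg_shiftn n) in fgx; exact: fgx.
    under eq_fun do rewrite expr2; rewrite expr2.
    by apply: cvgM; apply: cvgB => //; exact: cvg_cst.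
  + move=> j; under eq_integral do rewrite -sqrrN opprB; apply: fa.
    by rewrite (leq_trans _ (ju _))// leq_addr.
- exact: cvg_cst.
- by apply: cvg_EFin; first exact: nearW.
Qed.

Lemma integrable_L2_limit (f : nat -> T -> R) (g : T -> R) :
  (forall n, P.-integrable setT (EFin \o f n)) -> measurable_fun setT g ->
  (fun n => \int[P]_x ((f n x - g x) ^+ 2)%:E)%E @ \oo --> 0%E -> P.-integrable setT (EFin \o g).
Proof.
move=> fi mg h.
have mf n : measurable_fun setT (f n) by apply/measurable_EFinP; exact: (measurable_int _ (fi n)).
have [n hn] : exists n, (\int[P]_x ((f n x - g x) ^+ 2)%:E < 1%:E)%E.
  have : \forall n \near \oo, (\int[P]_x ((f n x - g x) ^+ 2)%:E < 1%:E)%E.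
    by have := h _ (open_ereal_lt' (@lte01 R)).
  by case=> n _ hn; exists n; apply: hn => /=.
have i2 : P.-integrable setT (fun x => ((f n x - g x) ^+ 2)%:E).
  apply/integrableP; split; first by apply/measurable_EFinP; apply: measurable_funX; exact: measurable_funB.
  under eq_integral do rewrite gee0_abs ?lee_fin ?sqr_ge0//.
  exact: (lt_trans hn (ltry _)).
have i1 : P.-integrable setT (cst 1%:E) by exact: finite_measure_integrable_cst.
have iD := integrableD measurableT (integrableD measurableT (integrable_abse (fi n)) i2) i1.
apply: le_integrable iD => //; first exact/measurable_EFinP.
move=> x _ /=; rewrite lee_fin [leRHS]ger0_norm ?addr_ge0 ?sqr_ge0//.
have := ler_normD (f n x) (g x - f n x); rewrite subrKC -sqrrN opprB -[_ ^+ 2]real_normK ?num_real//.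
move: `|f n x| `|g x - f n x| `|g x| => u v w; nra.
Qed.

Lemma L2_limit_pairing (f : nat -> T -> R) (g F : T -> R) (C c : R) (m : nat) :
  (forall n, P.-integrable setT (EFin \o f n)) -> measurable_fun setT g ->
  measurable_fun setT F -> (forall x, `|F x| <= C) ->
  (fun n => \int[P]_x ((f n x - g x) ^+ 2)%:E)%E @ \oo --> 0%E ->
  (forall n, (m <= n)%N -> \int[P]_x (F x * f n x) = c) -> \int[P]_x (F x * g x) = c.
Proof.
move=> fi mg mF FC h hc.
have gi := integrable_L2_limit fi mg h.
have mf n : measurable_fun setT (f n) by apply/measurable_EFinP; exact: (measurable_int _ (fi n)).
have C0 : 0 <= C by apply: le_trans (FC point).
have bF (k : T -> R) : P.-integrable setT (EFin \o k) -> P.-integrable setT (fun x => (F x * k x)%:E).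
  move=> ki; apply: (@integrableMr _ _ _ P setT measurableT F (EFin \o k)) => //.
  exists C; split; first exact: num_real.
  by move=> M CM x _; apply: le_trans (FC _) (ltW CM).
apply/eqP; rewrite -subr_eq0 -normr_le0; apply/ler_addgt0Pl => e e0; rewrite addr0.
(* The pointwise bound |d| <= r + d^2 / r, for d = f n - g, replaces Cauchy-Schwarz. It integrates
   to at most [2 * r] once the mean square is below [r ^+ 2], and [2 * C * r <= e]. *)
pose r := e / (2 * C + 1).
have C1 : 0 < 2 * C + 1 by lra.
have r0 : 0 < r by rewrite divr_gt0.
have [n mn hn] : exists2 n, (m <= n)%N & (\int[P]_x ((f n x - g x) ^+ 2)%:E < (r ^+ 2)%:E)%E.
  have : \forall n \near \oo, (\int[P]_x ((f n x - g x) ^+ 2)%:E < (r ^+ 2)%:E)%E.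
    have r2 : (0%:E < (r ^+ 2)%:E)%E by rewrite lte_fin exprn_gt0.
    by have := h _ (open_ereal_lt' r2).
  case=> n _ hn; exists (maxn m n); first exact: leq_maxl.
  by apply: hn => /=; exact: leq_maxr.
rewrite -(hc n mn) -RintegralB//; [|exact: bF..].
have i2 : P.-integrable setT (fun x => ((f n x - g x) ^+ 2)%:E).
  apply/integrableP; split; first by apply/measurable_EFinP; apply: measurable_funX; exact: measurable_funB.
  under eq_integral do rewrite gee0_abs ?lee_fin ?sqr_ge0//.
  exact: (lt_trans hn (ltry _)).
have iB : P.-integrable setT (EFin \o (fun x => F x * g x - F x * f n x)).
  by apply: eq_integrable (integrableB measurableT (bF _ gi) (bF _ (fi n))).
apply: le_trans (le_normr_Rintegral measurableT iB) _.
have iR : P.-integrable setT (EFin \o (fun x => C * (r + r^-1 * (f n x - g x) ^+ 2))).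
  have i1 : P.-integrable setT (cst r%:E) by exact: finite_measure_integrable_cst.
  have := integrableZl measurableT C (integrableD measurableT i1 (integrableZl measurableT r^-1 i2)).
  exact: eq_integrable.
apply: (@le_trans _ _ (\int[P]_x (C * (r + r^-1 * (f n x - g x) ^+ 2)))).
  apply: le_Rintegral => //; first exact: integrable_norm iB.
  move=> x _; rewrite -mulrBr normrM; apply: ler_pM; [exact: normr_ge0|exact: normr_ge0|exact: FC|].
  have := sqr_ge0 (r - `|f n x - g x|); rewrite -[(f n x - g x) ^+ 2]real_normK ?num_real// (distrC (g x)).
  move: `|f n x - g x| (normr_ge0 (f n x - g x)) => v v0.
  rewrite -(ler_pM2l r0 v); have -> : r * (r + r^-1 * v ^+ 2) = r ^+ 2 + v ^+ 2.
    by field; rewrite gt_eqF.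
  nra.
have i1 : P.-integrable setT (EFin \o cst r) by exact: finite_measure_integrable_cst.
have i3 : P.-integrable setT (EFin \o (fun x => r^-1 * (f n x - g x) ^+ 2)).
  by have := integrableZl measurableT r^-1 i2; exact: eq_integrable.
rewrite RintegralZl//; last by have := integrableD measurableT i1 i3; exact: eq_integrable.
rewrite RintegralD// Rintegral_prob_cst RintegralZl//.
have hs : \int[P]_x ((f n x - g x) ^+ 2) <= r ^+ 2.
  rewrite -lee_fin /Rintegral fineK ?integrable_fin_num//; exact: ltW.
have rr : r * (2 * C + 1) = e by rewrite /r divfK// gt_eqF.
have : r^-1 * \int[P]_x ((f n x - g x) ^+ 2) <= r.
  by rewrite ler_pdivrMl// -expr2.
move: (r^-1 * _) => z; nra.
Qed.

End L2_limit.

Section orthonormal_sums.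
Context {R : realType} {H : completeNormedModType R}.
Variable ip : {dot H for idfun}.
Hypothesis normE : forall x : H, `|x| ^+ 2 = ip x x.
Variables (I : pred nat) (e : nat -> H).
Hypothesis he : orthonormal_basis ip I e.

Lemma ip_orthonormal_sum m n (a c : nat -> R) :
  ip (\sum_(m <= i < n | I i) a i *: e i) (\sum_(m <= i < n | I i) c i *: e i) =
  \sum_(m <= i < n | I i) a i * c i.
Proof.
rewrite ip_suml big_nat_cond [RHS]big_nat_cond; apply: eq_bigr => i /andP[imn Ii].
rewrite ip_sumr big_mkcond (bigD1_seq i) ?iota_uniq ?mem_index_iota//= Ii.
rewrite ipZl ipZr (orthonormal_ip he)// eqxx mulr1 big1 ?addr0// => j ji; case: ifP => // Ij.
by rewrite ipZl ipZr (orthonormal_ip he)// eq_sym (negbTE ji) !mulr0.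
Qed.

Lemma norm_orthonormal_sum m n (c : nat -> R) :
  `|\sum_(m <= i < n | I i) c i *: e i| ^+ 2 = \sum_(m <= i < n | I i) c i ^+ 2.
Proof. by rewrite normE ip_orthonormal_sum; apply: eq_bigr => i _; rewrite expr2. Qed.

Lemma coord_orthonormal_sum n (c : nat -> R) j : I j -> (j < n)%N ->
  ip (e j) (\sum_(i < n | I i) c i *: e i) = c j.
Proof.
move=> Ij jn; rewrite ip_sumr (bigD1 (Ordinal jn))//= ipZr (orthonormal_ip he)// eqxx mulr1.
rewrite big1 ?addr0// => i /andP[Ii ij].
have ji : (j == i) = false by apply/negbTE; rewrite eq_sym; exact: ij.
by rewrite ipZr (orthonormal_ip he)// ji mulr0.
Qed.

Lemma cvg_orthonormal_sum (c : nat -> R) :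
  cvgn (fun n => \sum_(i < n | I i) c i ^+ 2) -> cvgn (fun n => \sum_(i < n | I i) c i *: e i).
Proof.
pose w i : R := if I i then c i ^+ 2 else 0; pose v i : H := if I i then c i *: e i else 0.
have -> : (fun n => \sum_(i < n | I i) c i ^+ 2) = series w.
  by apply/funext => n; rewrite /series/= big_mkord big_mkcond.
have -> : (fun n => \sum_(i < n | I i) c i *: e i) = series v.
  by apply/funext => n; rewrite /series/= big_mkord big_mkcond.
move=> /cauchy_cvgP/cauchy_seriesP hw; apply/cauchy_cvgP/cauchy_seriesP => r r0.
have r2 : 0 < r ^+ 2 by rewrite exprn_gt0.
apply: filterS (hw _ r2) => -[m n] /=.
rewrite -!big_mkcond /= => h.
rewrite -(ltr_pXn2r (ltn0Sn 1)) ?nnegrE// ?(ltW r0)// norm_orthonormal_sum.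
by apply: le_lt_trans h; exact: ler_norm.
Qed.

End orthonormal_sums.

(** * The square root of the covariance and the Cameron-Martin space *)

Section covariance_sqrt.
Context {R : realType} {H : completeNormedModType R}.
Variable ip : {dot H for idfun}.
Hypothesis normE : forall x : H, `|x| ^+ 2 = ip x x.
Variable Q : {linear H -> H}.
Hypothesis hQ : covariance_operator ip Q.
Variables (I : pred nat) (zeta : nat -> H) (lam : nat -> R).
Hypothesis hzeta : orthonormal_basis ip I zeta.
Hypothesis hlam : forall i, I i -> Q (zeta i) = lam i *: zeta i.

Lemma linear_norm_bound (f : {linear H -> H}) : continuous f -> exists2 r, 0 < r & forall x, `|f x| <= r * `|x|.
Proof.
move=> cf; have /linear_boundedP/pinfty_ex_gt0[r r0 hr] := @continuous_linear_bounded _ _ _ 0 f (cf 0).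
by exists r.
Qed.

(** The Cameron-Martin space is defined through some square root, so one has to be exhibited: the
    diagonal operator in the eigenbasis. Its series converges because the eigenvalues are at most a
    norm bound of [Q]. *)
Lemma is_sqrt_op_exists : exists2 T : {linear H -> H}, is_sqrt_op ip Q T &
  forall i, I i -> T (zeta i) = Num.sqrt (lam i) *: zeta i.
Proof.
have lam0 i : I i -> 0 < lam i := @lam_gt0 _ _ _ Q hQ _ _ _ hzeta hlam i.
have [cQ symQ _ _] := hQ; have [r r0 hr] := linear_norm_bound cQ.
have n1 i : I i -> `|zeta i| = 1.
  move=> Ii; have := normE (zeta i); rewrite (orthonormal_ip hzeta)// eqxx => /eqP.
  by rewrite sqrp_eq1// => /eqP.
have lamr i : I i -> lam i <= r.
  move=> Ii; have := hr (zeta i).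
  by rewrite hlam// normrZ n1// !mulr1 ger0_norm// ltW// lam0.
have cv x : cvgn (fun n => \sum_(i < n | I i) (Num.sqrt (lam i) * ip (zeta i) x) *: zeta i).
  apply: (cvg_orthonormal_sum normE hzeta (c := fun i => Num.sqrt (lam i) * ip (zeta i) x)).
  apply: nondecreasing_is_cvgn.
    apply/nondecreasing_seqP => k; rewrite big_mkcond [leRHS]big_mkcond big_ord_recr/= lerDl.
    by case: ifP => // _; rewrite sqr_ge0.
  exists (r * `|x| ^+ 2) => _ [n _ <-].
  apply: (@le_trans _ _ (\sum_(i < n | I i) r * ip (zeta i) x ^+ 2)).
    apply: ler_sum => i Ii; rewrite exprMn sqr_sqrtr ?(ltW (lam0 _ _))//.
    by rewrite ler_wpM2r ?sqr_ge0 ?lamr.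
  by rewrite -mulr_sumr ler_wpM2l ?(ltW r0)//; exact: (bessel_basis normE hzeta).
pose T x := limn (fun n => \sum_(i < n | I i) (Num.sqrt (lam i) * ip (zeta i) x) *: zeta i).
have coordT j x : I j -> ip (zeta j) (T x) = Num.sqrt (lam j) * ip (zeta j) x.
  move=> Ij.
  have h1 : (fun n => ip (zeta j) (\sum_(i < n | I i) (Num.sqrt (lam i) * ip (zeta i) x) *: zeta i)) @ \oo --> ip (zeta j) (T x).
    by apply: (cvg_ip2 normE); [exact: cvg_cst|exact: (cv x)].
  apply: (cvg_unique (@Rhausdorff R) h1).
  apply: cvg_near_cst; near=> n.
  apply: (coord_orthonormal_sum hzeta (fun i => Num.sqrt (lam i) * ip (zeta i) x) Ij).
  by near: n; exists j.+1.
have lT : linear T.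
  move=> a x y; apply: (norm_coord_inj hzeta) => i Ii.
  by rewrite ipDr ipZr !coordT// ipDr ipZr mulrDr mulrCA.
pose Tl : {linear H -> H} := HB.pack T (GRing.isLinear.Build _ _ _ _ T lT).
have symT x y : ip (T x) y = ip x (T y).
  have h1 := @ip_expand _ _ _ normE _ _ hzeta (T x) y.
  apply: (cvg_unique (@Rhausdorff R) h1).
  rewrite (_ : (fun n => _) = fun n => \sum_(i < n | I i) ip (zeta i) x * ip (zeta i) (T y)).
    exact: (ip_expand normE hzeta).
  by apply/funext => n; apply: eq_bigr => i Ii; rewrite !coordT// mulrCA mulrA.
have TT x : T (T x) = Q x.
  apply: (norm_coord_inj hzeta) => i Ii.
  rewrite !coordT// mulrA -expr2 sqr_sqrtr ?(ltW (lam0 _ _))//.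
  by rewrite -symQ hlam// ipZl.
exists Tl; last first.
  move=> i Ii; apply: (norm_coord_inj hzeta) => j Ij.
  rewrite /= coordT// ipZr (orthonormal_ip hzeta)//.
  by have [->//|_] := eqVneq j i; rewrite !mulr0.
split=> //.
  apply: bounded_linear_continuous; apply/linear_boundedP; near=> M => x /=.
  have rM : Num.sqrt r <= M by near: M; apply: nbhs_pinfty_ge; rewrite num_real.
  rewrite (le_trans _ (ler_wpM2r (normr_ge0 x) rM))//.
  rewrite -(ler_pXn2r (ltn0Sn 1)) ?nnegrE ?mulr_ge0 ?sqrtr_ge0// exprMn sqr_sqrtr ?(ltW r0)//.
  rewrite normE symT TT ipC (le_trans (ler_norm _))// (le_trans (cauchy_schwarz normE _ _))//.
  by rewrite expr2 mulrA ler_wpM2r.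
move=> x /=; have h := @ip_expand _ _ _ normE _ _ hzeta (T x) x.
rewrite -(cvg_lim (@Rhausdorff R) h); apply: limr_ge; first by apply/cvg_ex; exists (ip (T x) x).
apply: nearW => n; apply: sumr_ge0 => i Ii.
by rewrite coordT// -mulrA -expr2 mulr_ge0 ?sqrtr_ge0 ?sqr_ge0.
Unshelve. all: by end_near. Qed.

Lemma cameron_martin_basis j : I j -> cameron_martin ip Q (zeta j).
Proof.
move=> Ij; have [T sqT hT] := is_sqrt_op_exists.
exists T; split=> //; exists ((Num.sqrt (lam j))^-1 *: zeta j).
rewrite linearZ /= hT// scalerA mulVf ?scale1r// gt_eqF// sqrtr_gt0.
exact: (lam_gt0 hQ hzeta hlam).
Qed.

(** The root [T] with [h = T y] is arbitrary and not known to be diagonal. For [s] the truncation of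
    Q^-1 h, expanding |y - T s|^2 >= 0 involves [T] only through [T (T s) = Q s]; the cross term and
    the square are both multiples of the sum to be bounded. *)
Lemma cameron_martin_summable h : cameron_martin ip Q h ->
  exists M, forall n, \sum_(i < n | I i) ip h (zeta i) ^+ 2 / lam i <= M.
Proof.
move=> [T [[_ symT _ TT] [y ->]]]; exists (ip y y) => n.
have lam0 i : I i -> 0 < lam i := @lam_gt0 _ _ _ Q hQ _ _ _ hzeta hlam i.
pose b i := ip (T y) (zeta i) / lam i.
pose s := \sum_(i < n | I i) b i *: zeta i.
have := ip_ge0 normE (y - T s).
have -> : ip (y - T s) (y - T s) = ip y y - ip (T y) s *+ 2 + ip s (Q s).
  by rewrite ipBl !ipBr (symT s (T s)) TT (symT s y) -(symT y s) (ipC ip s (T y)); ring.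
have E1 : ip (T y) (\sum_(i < n | I i) b i *: zeta i) = \sum_(i < n | I i) ip (T y) (zeta i) ^+ 2 / lam i.
  by rewrite ip_sumr; apply: eq_bigr => i Ii; rewrite ipZr /b mulrAC expr2.
rewrite {}E1.
have -> : ip s (Q s) = \sum_(i < n | I i) ip (T y) (zeta i) ^+ 2 / lam i.
  rewrite /s raddf_sum /= [X in ip _ X](eq_bigr (fun i : 'I_n => (lam i * b i) *: zeta i)); last first.
    by move=> i Ii; rewrite linearZ /= hlam// scalerA mulrC.
  rewrite -(big_mkord I (fun i => b i *: zeta i)) -(big_mkord I (fun i => (lam i * b i) *: zeta i)).
  rewrite (ip_orthonormal_sum hzeta) big_mkord.
  apply: eq_bigr => i Ii; rewrite /b; field.
  by rewrite gt_eqF// lam0.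
by move: (\sum_(i < n | I i) _) => r; lra.
Qed.

End covariance_sqrt.

Section log_gradient_unique.
Context {R : realType} {H : completeNormedModType R}.
Variable ip : {dot H for idfun}.
Hypothesis normE : forall x : H, `|x| ^+ 2 = ip x x.
Hypothesis sepH : separable_space H.
Variable Q : {linear H -> H}.
Hypothesis hQ : covariance_operator ip Q.
Variables (I : pred nat) (zeta : nat -> H) (lam : nat -> R).
Hypothesis hzeta : orthonormal_basis ip I zeta.
Hypothesis hlam : forall i, I i -> Q (zeta i) = lam i *: zeta i.

Lemma is_log_gradient_eq (mu nu : {measure set (borel H) -> \bar R}) rho :
  (forall A, measurable A -> mu A = nu A) ->
  is_log_gradient ip Q I zeta lam mu rho -> is_log_gradient ip Q I zeta lam nu rho.
Proof.
move=> mn; have E (f : borel H -> \bar R) : (\int[mu]_x f x = \int[nu]_x f x)%E.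
  by apply: eq_measure_integral => A mA _; exact: mn.
move=> [mrho hrho]; split=> // h /hrho[r [ir fr] cr]; exists r; last first.
  by apply: cvg_trans cr; apply: near_eq_cvg; apply: nearW => n; rewrite E.
split.
  by have /integrableP[mr r_fin] := ir; apply/integrableP; split=> //; rewrite -E.
by move=> m f Im tf; have := fr m f Im tf; rewrite /Rintegral !E.
Qed.

(** Along [zeta j] the truncated pairing no longer changes once [n > j], so its mean-square limit is
    an equality almost everywhere. The coordinates are thus fixed by the Fomin derivatives, which
    are unique. *)
Lemma log_gradient_unique (nu : probability (borel H) R) rho1 rho2 :
  is_log_gradient ip Q I zeta lam nu rho1 -> is_log_gradient ip Q I zeta lam nu rho2 ->
  {ae nu, forall x, rho1 x = rho2 x}.
Proof.
have key rho j : I j -> is_log_gradient ip Q I zeta lam nu rho -> exists2 r : H -> R,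
    fomin_derivative ip I zeta nu (zeta j) r & {ae nu, forall x, (lam j)^-1 * ip (rho x) (zeta j) = r x}.
  move=> Ij [mrho /(_ _ (cameron_martin_basis normE hQ hzeta hlam Ij))[r fr cr]].
  exists r => //; have [ir _] := fr.
  have mr : measurable_fun setT (r : borel H -> R) by apply/measurable_EFinP; exact: (measurable_int _ ir).
  have mg : measurable_fun setT (fun x : borel H => ((lam j)^-1 * ip (rho x) (zeta j) - r x) ^+ 2).
    apply: measurable_funX; apply: measurable_funB => //; apply: measurable_funM => //.
    by under eq_fun do rewrite ipC; exact: (measurable_ip normE _ mrho).
  have : (\int[nu]_x `|(((lam j)^-1 * ip (rho x) (zeta j) - r x) ^+ 2)%:E| = 0)%E.
    under eq_integral do rewrite gee0_abs ?lee_fin ?sqr_ge0//.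
    apply: (cvg_unique (@ereal_hausdorff R) _ cr).
    apply: cvg_near_cst; near=> n; apply: eq_integral => x _; congr (_%:E); congr ((_ - _) ^+ 2).
    have jn : (j < n)%N by near: n; exists j.+1.
    rewrite (bigD1 (Ordinal jn))//= (orthonormal_ip hzeta)// eqxx mulr1 big1 ?addr0// => i /andP[Ii ij].
    have ji : (j == i) = false by apply/negbTE; rewrite eq_sym; exact: ij.
    by rewrite (orthonormal_ip hzeta)// ji mulr0.
  move/(ae_eq_integral_abs nu measurableT (proj2 (measurable_EFinP _ _) mg)).
  apply: filterS => x /(_ Logic.I) /= /eqP.
  by rewrite eqe sqrf_eq0 subr_eq0 => /eqP.
move=> h1 h2.
have coord j : {ae nu, forall x, I j -> ip (zeta j) (rho1 x) = ip (zeta j) (rho2 x)}.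
  have [Ij|nIj] := boolP (I j); last by apply: aeW => x.
  have [r1 f1 e1] := key _ _ Ij h1; have [r2 f2 e2] := key _ _ Ij h2.
  have e12 := fomin_derivative_unique normE sepH hzeta f1 f2.
  apply: (@filterS3 _ (almost_everywhere nu) _ _ _ _ _ _ e1 e2 e12) => x /= E1 E2 E12 _.
  have l0 : (lam j)^-1 != 0 by rewrite invr_eq0 gt_eqF// (lam_gt0 hQ hzeta hlam).
  by apply: (mulfI l0); rewrite ipC E1 E12 -E2 ipC.
have := ae_foralln coord.
apply: filterS => x hx; apply: (norm_coord_inj hzeta) => i Ii; exact: hx.
Unshelve. all: by end_near. Qed.

End log_gradient_unique.

Section derive_along.
Context {R : realType} {V : normedModType R}.

Lemma is_derive_along (f : V -> R) (y v : V) (r : R) : derivable f (r *: v + y) v ->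
  is_derive r 1 (fun r => f (r *: v + y)) ('D_v f (r *: v + y)).
Proof.
have E : (fun h => h^-1 *: (((fun r => f (r *: v + y)) \o shift r) (h *: 1) - f (r *: v + y))) =
    (fun h => h^-1 *: ((f \o shift (r *: v + y)) (h *: v) - f (r *: v + y))).
  by apply/funext => h /=; rewrite [_%:A]mulr1 scalerDl addrA.
by move=> df; split; [rewrite /derivable E|rewrite /derive E].
Qed.

End derive_along.

(** * The logarithmic gradient of a Gaussian law with mean [b] and covariance [s ^+ 2 *: Q] *)

Section log_gradient_gaussian.
Context {R : realType} {H : completeNormedModType R}.
Variable ip : {dot H for idfun}.
Hypothesis normE : forall x : H, `|x| ^+ 2 = ip x x.
Hypothesis sepH : separable_space H.
Variable Q : {linear H -> H}.
Hypothesis hQ : covariance_operator ip Q.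
Variables (I : pred nat) (zeta : nat -> H) (lam : nat -> R).
Hypothesis hzeta : orthonormal_basis ip I zeta.
Hypothesis hlam : forall i, I i -> Q (zeta i) = lam i *: zeta i.
Variable G : probability (borel H) R.
Hypothesis hG : forall (h : H) (A : set R), measurable A ->
  G [set x | A (ip h x)] = gaussian1 0 (ip (Q h) h) A.
Variables (b : H) (s : R).
Hypothesis s0 : 0 < s.

Let row m (x : H) : 'rV[R]_m := \row_(i < m) ip (zeta i) x.

Let rowD m x y : row m (x + y) = row m x + row m y.
Proof. by apply/rowP => i; rewrite !mxE ipDr. Qed.

Let rowZ m a x : row m (a *: x) = a *: row m x.
Proof. by apply/rowP => i; rewrite !mxE ipZr. Qed.

Lemma derive_cylinder m (f : 'rV[R]_m -> R) (h x : H) :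
  'D_h (cylinder ip zeta f : H -> R) x = 'D_(row m h) f (row m x).
Proof.
rewrite /derive; set g1 := fun h => h^-1 *: _; set g2 := fun h => h^-1 *: _.
suff -> : g1 = g2 by [].
by apply/funext => r; rewrite /g1 /g2 /cylinder /= -/(row m _) -/(row m _) rowD rowZ.
Qed.

Lemma measurable_affine : measurable_fun setT (fun u : borel H => (b + s *: u : borel H)).
Proof.
apply: (measurable_coord normE sepH hzeta) => i _.
under eq_fun do rewrite ipDr ipZr.
by apply: measurable_funD => //; apply: measurable_funM => //; exact: (measurable_ip normE).
Qed.

Let nu : probability (borel H) R := law G measurable_affine.

(** The derivative of a cylinder function along [Q k] at [b + s *: u] is that of its composition
    with the affine map along [Q (s^-1 *: k)], whence Stein's identity with [s^-1 *: k]. *)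
Let fomin_range (k : H) m (f : 'rV[R]_m -> R) : test_function f ->
  \int[nu]_x 'D_(Q k) (cylinder ip zeta f : H -> R) x =
  \int[G]_u (cylinder ip zeta f (b + s *: u) * ip (s^-1 *: k) u).
Proof.
move=> tf; have [Cf _] := tf; have [cf df] := Cf 1%N.
have [C1 hC1] := test_function_bounded tf.
have [C2 hC2] := test_function_derive_bounded (row m (Q k)) tf.
have [dfQ [cD _]] := df (row m (Q k)).
have mD : measurable_fun setT ((fun x => 'D_(row m (Q k)) f (row m x)) : borel H -> R).
  exact: (measurable_cylinder normE zeta cD).
have mF : measurable_fun setT (cylinder ip zeta f : borel H -> R) by exact: measurable_cylinder.
have -> : \int[nu]_x 'D_(Q k) (cylinder ip zeta f : H -> R) x =
    \int[G]_u 'D_(row m (Q k)) f (row m (b + s *: u)).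
  have h := Rintegral_law_bounded G measurable_affine mD (fun x => hC2 (row m x)).
  rewrite -[RHS]h; apply: eq_Rintegral => x _; exact: derive_cylinder.
apply: (@gaussian_stein _ _ _ normE sepH Q hQ I zeta hzeta G hG (s^-1 *: k)
  (fun u => cylinder ip zeta f (b + s *: u)) (fun u => 'D_(row m (Q k)) f (row m (b + s *: u))) (`|C1| + `|C2|)).
- exact: (measurableT_comp mF measurable_affine).
- exact: (measurableT_comp mD measurable_affine).
- by move=> x; rewrite (le_trans (hC1 _))// (le_trans (ler_norm _))// lerDl.
- by move=> x; rewrite (le_trans (hC2 _))// (le_trans (ler_norm _))// lerDr.
- move=> x r; have := @is_derive_along _ _ f (row m (b + s *: x)) (row m (Q k)) r (dfQ _).
  rewrite /cylinder -!/(row m _).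
  have E q : row m (b + s *: (x + q *: Q (s^-1 *: k))) = q *: row m (Q k) + row m (b + s *: x).
    rewrite linearZ /= scalerDr !scalerA mulrCA mulfV ?gt_eqF// mulr1 -rowZ -rowD; congr row.
    by rewrite addrA addrC.
  by under eq_fun do rewrite -E; rewrite -E.
- move=> x r; have E q : row m (b + s *: (x + q *: Q (s^-1 *: k))) = q *: row m (Q k) + row m (b + s *: x).
    rewrite linearZ /= scalerDr !scalerA mulrCA mulfV ?gt_eqF// mulr1 -rowZ -rowD; congr row.
    by rewrite addrA addrC.
  under eq_fun do rewrite E.
  have ca : {for r, continuous (fun q : R => q *: row m (Q k) + row m (b + s *: x))}.
    by apply: cvgD; [apply: cvgZr_tmp; exact: cvg_id|exact: cvg_cst].
  exact: (continuous_comp ca (cD _)).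
Qed.

(** A Cameron-Martin vector [h] need not lie in the range of [Q], so Stein's identity is applied to
    the truncations [k n] of Q^-1 h. Under [G] the variables [ip (k n)] form a Cauchy sequence in
    mean square, the variance of a difference being a difference of partial sums of a convergent
    series. Their limit [g], the Paley-Wiener integral of [h], gives the Fomin derivative. *)
Lemma is_log_gradient_gaussian :
  is_log_gradient ip Q I zeta lam nu (fun x => - (s ^- 2) *: (x - b)).
Proof.
split.
  apply: (measurable_coord normE sepH hzeta) => i _.
  under eq_fun do rewrite ipZr ipBr.
  by apply: measurable_funM => //; apply: measurable_funB => //; exact: (measurable_ip normE).
move=> h hh; have [M hM] := cameron_martin_summable normE hQ hzeta hlam hh.
have lam0 i : I i -> 0 < lam i := @lam_gt0 _ _ _ Q hQ _ _ _ hzeta hlam i.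
pose A n := \sum_(i < n | I i) ip h (zeta i) ^+ 2 / lam i.
pose k n := \sum_(i < n | I i) (ip h (zeta i) / lam i) *: zeta i.
have Qk n : Q (k n) = \sum_(i < n | I i) ip h (zeta i) *: zeta i.
  rewrite /k raddf_sum; apply: eq_bigr => i Ii.
  by rewrite /= linearZ /= hlam// scalerA divfK// gt_eqF// lam0.
have ndA : nondecreasing_seq A.
  apply/nondecreasing_seqP => n; rewrite /A big_mkcond [leRHS]big_mkcond big_ord_recr/= lerDl.
  by case: ifP => // Ii; rewrite divr_ge0 ?sqr_ge0// ltW// lam0.
have cA : cvgn A by apply: nondecreasing_is_cvgn => //; exists M => _ [n _ <-]; exact: hM.
have var m n : (m <= n)%N -> ip (Q (k n - k m)) (k n - k m) = A n - A m.
  move=> mn.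
  have E (c : nat -> H) : \sum_(i < n | I i) c i - \sum_(i < m | I i) c i = \sum_(m <= i < n | I i) c i.
    by rewrite -!(big_mkord I c) (big_cat_nat (leq0n m) mn)/= addrAC subrr add0r.
  have ER (c : nat -> R) : \sum_(i < n | I i) c i - \sum_(i < m | I i) c i = \sum_(m <= i < n | I i) c i.
    by rewrite -!(big_mkord I c) (big_cat_nat (leq0n m) mn)/= addrAC subrr add0r.
  have -> : Q (k n - k m) = Q (k n) - Q (k m) by exact: linearB.
  rewrite !Qk (E (fun i => ip h (zeta i) *: zeta i)) /k (E (fun i => (ip h (zeta i) / lam i) *: zeta i)).
  rewrite (ip_orthonormal_sum hzeta) /A (ER (fun i => ip h (zeta i) ^+ 2 / lam i)).
  by apply: eq_bigr => i _; rewrite expr2 mulrA.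
have mk n : measurable_fun setT (fun u : borel H => ip (k n) u) by exact: (measurable_ip normE).
have [g mg hg] : exists2 g : borel H -> R, measurable_fun setT g &
    (fun n => \int[G]_u ((ip (k n) u - g u) ^+ 2)%:E)%E @ \oo --> 0%E.
  apply: (L2_limit (a := fun m => limn A - A m)) => //.
    move=> m n mn; under eq_integral do rewrite -ipBl.
    apply: le_trans (gaussian_ip_second_moment normE hQ hG _) _.
    by rewrite lee_fin var// lerB// nondecreasing_cvgn_le.
  rewrite -[X in _ --> X](subrr (limn A)); apply: cvgB => //; exact: cvg_cst.
have ik n : G.-integrable setT (EFin \o (fun u : borel H => ip (k n) u)).
  exact: (integrable_gaussian_ip normE hQ hG).
pose T (x : borel H) : borel H := s^-1 *: (x - b).
have TK u : T (b + s *: u) = u by rewrite /T addrC addKr scalerA mulVf ?scale1r// gt_eqF.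
have mT : measurable_fun setT T.
  apply: (measurable_coord normE sepH hzeta) => i _.
  under eq_fun do rewrite ipZr ipBr.
  by apply: measurable_funM => //; apply: measurable_funB => //; exact: (measurable_ip normE).
(* [T] inverts the affine map, so [r] is [- s^-1 * g] carried over to [nu]. *)
pose r x := - s^-1 * g (T x).
have mr : measurable_fun setT (r : borel H -> R).
  by apply: measurable_funM => //; exact: measurableT_comp.
have gi := integrable_L2_limit ik mg hg.
have rE u : r (b + s *: u) = - s^-1 * g u by rewrite /r TK.
have ri : nu.-integrable setT (EFin \o (r : borel H -> R)).
  apply/(integrable_law G measurable_affine); first exact/measurable_EFinP.
  have := integrableZl measurableT (- s^-1) gi; apply: eq_integrable => // u _ /=.
  by rewrite rE.
exists r.
  split=> // m f Im tf.
  have [C hC] := test_function_bounded tf.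
  have mF : measurable_fun setT (cylinder ip zeta f : borel H -> R).
    by apply: measurable_cylinder => //; have [Cf _] := tf; exact: Cn_continuous (Cf 0%N).
  have mFa := measurableT_comp mF measurable_affine.
  (* A test function of [m] coordinates does not distinguish [h] from [Q (k n)] for [n >= m]: they
     agree in the first [m] coordinates. Hence the pairings are constant from [m] on. *)
  have D n : (m <= n)%N -> \int[nu]_x 'D_h (cylinder ip zeta f : H -> R) x =
      \int[G]_u (cylinder ip zeta f (b + s *: u) * ip (s^-1 *: k n) u).
    move=> mn; transitivity (\int[nu]_x 'D_(Q (k n)) (cylinder ip zeta f : H -> R) x); last exact: fomin_range.
    apply: eq_Rintegral => x _.
    rewrite (derive_cylinder f h x) (derive_cylinder f (Q (k n)) x); congr ('D__ f _); apply/rowP => i; rewrite !mxE Qk.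
    rewrite (coord_orthonormal_sum hzeta (fun i => ip h (zeta i)) (Im i)); first exact: ipC.
    exact: (leq_trans (ltn_ord i) mn).
  set c := \int[nu]_x _ in D.
  have FI (q : borel H -> R) : G.-integrable setT (EFin \o q) ->
      G.-integrable setT (EFin \o (fun u => cylinder ip zeta f (b + s *: u) * q u)).
    move=> qi; apply: (@integrableMr _ _ _ G setT measurableT (fun u => cylinder ip zeta f (b + s *: u)) (EFin \o q)) => //.
    exists C; split; first exact: num_real.
    by move=> N CN x _; apply: le_trans (hC _) (ltW CN).
  have hcm n : (m <= n)%N -> \int[G]_u (cylinder ip zeta f (b + s *: u) * ip (k n) u) = s * c.
    move=> mn; rewrite (D n mn).
    have -> : \int[G]_u (cylinder ip zeta f (b + s *: u) * ip (s^-1 *: k n) u) =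
        \int[G]_u (s^-1 * (cylinder ip zeta f (b + s *: u) * ip (k n) u)).
      by apply: eq_Rintegral => u _; rewrite ipZl mulrCA.
    rewrite RintegralZl//; last exact: FI (ik n).
    by rewrite mulrA mulfV ?mul1r// gt_eqF.
  have hP := L2_limit_pairing ik mg mFa (fun u => hC _) hg hcm.
  rewrite -/c; have -> : \int[nu]_x (cylinder ip zeta f x * r x) = - s^-1 * (s * c).
    rewrite -hP -RintegralZl//; last exact: FI gi.
    rewrite /Rintegral (integral_law measurable_affine).
    - by congr fine; apply: eq_integral => u _; rewrite /= rE mulrCA.
    - by apply/measurable_EFinP; exact: measurable_funM.
    - have := integrableZl measurableT (- s^-1) (FI _ gi); apply: eq_integrable => // u _ /=.
      by rewrite rE mulrCA.
  by rewrite mulNr mulKf ?opprK// gt_eqF.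
have -> : (fun n => \int[nu]_x ((\sum_(i < n | I i) (lam i)^-1 * ip (- s ^- 2 *: (x - b)) (zeta i) * ip h (zeta i) - r x) ^+ 2)%:E)%E =
    (fun n => (s ^- 2)%:E * \int[G]_u ((ip (k n) u - g u) ^+ 2)%:E)%E.
  apply/funext => n; rewrite (ge0_integral_law G measurable_affine); last 2 first.
  - apply/measurable_EFinP; apply: measurable_funX; apply: measurable_funB => //.
    under eq_fun do rewrite big_mkcond.
    apply: measurable_sum => i; case: (I i) => //.
    apply: measurable_funM => //; apply: measurable_funM => //.
    under eq_fun do rewrite ipC ipZr ipBr.
    by apply: measurable_funM => //; apply: measurable_funB => //; exact: (measurable_ip normE).
  - by move=> x; rewrite lee_fin sqr_ge0.
  rewrite -ge0_integralZl; last 4 first.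
  - exact: measurableT.
  - by apply/measurable_EFinP; apply: measurable_funX; exact: measurable_funB.
  - by move=> u _; rewrite lee_fin sqr_ge0.
  - by rewrite lee_fin invr_ge0 sqr_ge0.
  apply: eq_integral => u _; rewrite -EFinM; congr (_%:E); rewrite rE.
  have -> : \sum_(i < n | I i) (lam i)^-1 * ip (- s ^- 2 *: (b + s *: u - b)) (zeta i) * ip h (zeta i) = - s^-1 * ip (k n) u.
    rewrite ip_suml mulr_sumr; apply: eq_bigr => i Ii.
    rewrite addrC addKr scalerA ipZl ipZl (ipC ip u); field.
    by rewrite !gt_eqF// lam0.
  by field; rewrite gt_eqF.
rewrite -[X in _ --> X](mule0 (s ^- 2)%:E).
exact: cvgeZl.
Qed.

(** The explicit logarithmic gradient keeps [xget] away from its default value; the one selected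
    agrees with it up to a null set, by uniqueness. *)
Lemma log_gradient_gaussian (mu : {measure set (borel H) -> \bar R}) :
  (forall A, measurable A -> mu A = G [set u | A (b + s *: u)]) ->
  measurable_fun setT (log_gradient ip Q I zeta lam mu : borel H -> borel H) /\
  {ae G, forall u, log_gradient ip Q I zeta lam mu (b + s *: u) = - s^-1 *: u}.
Proof.
move=> hmu; have munu A : measurable A -> mu A = nu A by move=> mA; rewrite hmu.
have numu A : measurable A -> nu A = mu A by move=> mA; rewrite munu.
have h : is_log_gradient ip Q I zeta lam mu (log_gradient ip Q I zeta lam mu).
  rewrite /log_gradient; case: xgetP => [rho -> //|].
  by move=> /(_ _ (is_log_gradient_eq numu is_log_gradient_gaussian)).
split; first by case: h.
have [N [mN N0 sN]] := log_gradient_unique normE sepH hQ hzeta hlam (is_log_gradient_eq munu h) is_log_gradient_gaussian.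
exists [set u | N (b + s *: u)]; split=> //.
  by have := measurable_affine measurableT mN; rewrite setTI.
move=> u /= hu; apply: sN => /= E; apply: hu; rewrite E.
rewrite addrC addKr scalerA; congr (_ *: u); field.
by rewrite gt_eqF.
Qed.

End log_gradient_gaussian.

(** * The noise schedule *)

Section clamp.
Context {R : realType}.
Local Notation leb := (@lebesgue_measure R).

(** Composition with [clamp] extends functions on [0, 1] by constants: continuity within the
    interval becomes continuity on the line, and primitives have two-sided derivatives at the
    endpoints. *)
Definition clamp (x : R) : R := Num.max 0 (Num.min 1 x).

Lemma clamp01 x : 0 <= clamp x <= 1.
Proof. by rewrite /clamp le_max lexx/= ge_max ler01 ge_min lexx. Qed.

Lemma clamp_id x : 0 <= x <= 1 -> clamp x = x.
Proof. by move=> /andP[x0 x1]; rewrite /clamp min_r// max_r. Qed.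

Lemma clamp_le0 x : x <= 0 -> clamp x = 0.
Proof. by move=> x0; rewrite /clamp min_r ?(le_trans x0)// max_l. Qed.

Lemma continuous_clamp : continuous clamp.
Proof.
move=> x; rewrite /clamp; apply: continuous_max; first exact: cvg_cst.
by apply: continuous_min; [exact: cvg_cst|exact: cvg_id].
Qed.

Lemma continuous_comp_clamp (T : topologicalType) (f : R -> T) :
  {within `[0, 1], continuous f} -> continuous (f \o clamp).
Proof.
move=> /subspace_continuousP cf x; have x01 : `[0, 1]%classic (clamp x) by rewrite /= in_itv; exact: clamp01.
move=> A /(cf _ x01) nA.
have nA' : nbhs (clamp x) [set y | `[0, 1]%classic y -> A (f y)] by exact: nA.
have := @continuous_clamp x _ nA'; apply: (@filterS _ (nbhs x)) => y /=; apply.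
by rewrite in_itv; exact: clamp01.
Qed.

(** Integrating from -oo gives a two-sided derivative everywhere. Subtracting [f 0] first makes the
    integrand vanish on the negative half-line, hence integrable; the linear term restores it. *)
Lemma exists_primitive (f : R -> R) : continuous f -> (forall x, x <= 0 -> f x = f 0) ->
  exists2 F : R -> R, (forall x : R, is_derive x 1 F (f x)) & F 0 = 0.
Proof.
move=> cf f0; pose g x := f x - f 0.
have cg : continuous g by move=> x; apply: cvgB; [exact: cf|exact: cvg_cst].
have gi u : leb.-integrable `]-oo, u] (EFin \o g).
  pose m := Num.max 0 u.
  have : leb.-integrable `[0, m] (EFin \o g).
    apply: continuous_compact_integrable; first exact: segment_compact.
    exact: continuous_subspaceT.
  have mD1 : measurable (`[0, m]%classic : set (measurableTypeR R)) by [].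
  have mD2 : measurable (`]-oo, m]%classic : set (measurableTypeR R)) by [].
  move=> ig; have h := (@integrable_mkcond _ _ R leb `[0, m]%classic (EFin \o g) mD1).1 ig.
  have : leb.-integrable `]-oo, m] (EFin \o g).
    apply: (@integrable_mkcond _ _ R leb `]-oo, m]%classic (EFin \o g) mD2).2; move: h; congr integrable.
    apply/funext => x; rewrite !patchE; case: ifPn => [|].
      by rewrite inE/= in_itv/= => /andP[x0 xm]; rewrite mem_set//= in_itv.
    case: ifPn => //; rewrite notin_setE inE/= !in_itv/= => xm /negP; rewrite xm andbT -ltNge => x0.
    by rewrite /g (f0 x (ltW x0)) subrr.
  apply: integrableS => // x /=; rewrite !in_itv/= => xu; rewrite /m le_max xu orbT.
  done.
pose F0 x := \int[leb]_(y in `]-oo, x]) g y.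
have dF0 (x : R) : is_derive x 1 F0 (g x).
  have xx : x < x + 1 by rewrite ltrDl.
  have [d1 d2] := @continuous_FTC1 R g -oo%O x (x + 1) xx (gi _) (ltNyr x) (cg x).
  by split; [exact: d1|rewrite -derive1E; exact: d2].
exists (fun x => f 0 * x + (F0 x - F0 0)); last by rewrite mulr0 subrr addr0.
move=> x; have d1 := dF0 x.
by apply: is_derive_eq; rewrite /g /GRing.scale /=; ring.
Qed.

Lemma unif_continuous_itv (f : R -> R) (a b e : R) : continuous f -> 0 < e ->
  exists2 r, 0 < r & forall x y, a <= x <= b -> `|x - y| < r -> `|f x - f y| < e.
Proof.
move=> cf e0.
have /compact_near_coveringP h := @segment_compact R a b.
have e2 : 0 < e / 2 by rewrite divr_gt0.
pose P (n : nat) (x : R) := forall y, `|x - y| < n.+1%:R^-1 -> `|f x - f y| < e.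
have [N _ hN] : \forall n \near \oo, `[a, b]%classic `<=` P n.
  apply: h => x _.
  have /cvgrPdist_lt/(_ _ e2)/nbhs_normP[r /= r0 hr] := cf x.
  have r2 : 0 < r / 2 by rewrite divr_gt0.
  exists (ball x (r / 2), [set n : nat | n.+1%:R^-1 < r / 2]) => /=.
    by split; [exact: nbhsx_ballx|exact: (near_infty_natSinv_lt (PosNum r2))].
  move=> [x' n] /= []; rewrite -ball_normE /= => xx' nr y x'y.
  have h1 : `|f x - f x'| < e / 2 by apply: hr => /=; rewrite (lt_trans xx')// ltr_pdivrMr// ltr_pMr// ltr1n.
  have h2 : `|f x - f y| < e / 2.
    apply: hr => /=; rewrite (le_lt_trans (ler_distD x' _ _))// (splitr r) ltrD//.
    exact: lt_trans x'y nr.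
  by rewrite (le_lt_trans (ler_distD (f x) _ _))// distrC; lra.
exists N.+1%:R^-1 => // x y xab xy.
by apply: (hN N (leqnn N) x) => //=; rewrite in_itv.
Qed.

End clamp.

Section schedule.
Context {R : realType}.
Local Notation leb := (@lebesgue_measure R).
Variable sigma : R -> R.
Hypothesis sigma_continuous : {within `[0, 1], continuous sigma}.

Lemma Rintegral_primitive (F f : R -> R) (a b : R) : a <= b -> 0 <= a -> b <= 1 ->
  (forall x : R, is_derive x 1 F (f x)) -> continuous f ->
  forall g, (forall x, 0 <= x <= 1 -> g x = f x) ->
  \int[leb]_(x in `[a, b]) g x = F b - F a.
Proof.
rewrite le_eqVlt => /orP[/eqP <- _ _ _ _ g _|ab a0 b1 dF cf g gf].
  by rewrite set_itv1 Rintegral_set1 subrr.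
transitivity (\int[leb]_(x in `[a, b]) f x).
  apply: eq_Rintegral => x; rewrite inE/= in_itv/= => /andP[ax xb]; apply: gf.
  by rewrite (le_trans a0)//= (le_trans xb).
by rewrite /Rintegral (integral_is_derive ab dF cf).
Qed.

(** The integrand of [kappa] is the derivative in [s] of [expR (B s - B t)]. *)
Lemma schedule_primitive : exists B : R -> R, [/\ forall x : R, is_derive x 1 B (sigma (clamp x)),
  B 0 = 0, forall s t, 0 <= s -> s <= t -> t <= 1 -> \int[leb]_(u in `[s, t]) sigma u = B t - B s,
  forall t, 0 <= t <= 1 -> Defs.eta sigma t = expR (- (B t / 2)) &
  forall t, 0 <= t <= 1 -> kappa sigma t = 1 - expR (- B t)].
Proof.
have cs : continuous (sigma \o clamp) := continuous_comp_clamp sigma_continuous.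
have [|B dB B0] := exists_primitive cs; first by move=> x x0 /=; rewrite (clamp_le0 x0) clamp_le0.
have intB s t : 0 <= s -> s <= t -> t <= 1 -> \int[leb]_(u in `[s, t]) sigma u = B t - B s.
  move=> s0 st t1; apply: (Rintegral_primitive st s0 t1 dB cs) => x x01 /=.
  by rewrite clamp_id.
exists B; split=> //.
  by move=> t /andP[t0 t1]; have := intB 0 t (lexx 0) t0 t1; rewrite /Defs.eta => ->; rewrite B0 subr0 mulrC.
move=> t /andP[t0 t1]; rewrite /kappa.
have cB : continuous B := is_derive_continuous dB.
have dE (x : R) : is_derive x 1 (fun x => expR (B x - B t)) (expR (B x - B t) * sigma (clamp x)).
  have d1 := dB x.
  have d2 : is_derive x 1 (fun x => B x - B t) (sigma (clamp x)) by apply: is_derive_eq; rewrite subr0.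
  exact: is_derive1_comp.
rewrite (_ : \int[leb]_(s in `[0, t]) _ = \int[leb]_(s in `[0, t]) (expR (B s - B t) * sigma s)); last first.
  apply: eq_Rintegral => s; rewrite inE/= in_itv/= => /andP[s0 st].
  by rewrite intB// opprB.
rewrite (Rintegral_primitive t0 (lexx 0) t1 dE).
- by rewrite subrr expR0 B0 sub0r.
- move=> x; apply: cvgM; last exact: cs.
  apply: (continuous_comp (f := fun x => B x - B t)); last exact: continuous_expR.
  by apply: cvgB; [exact: cB|exact: cvg_cst].
- by move=> x x01; rewrite clamp_id.
Qed.

End schedule.

(** * Independence *)

Section independence.
Context d d1 d2 (Omega : measurableType d) (T1 : measurableType d1) (T2 : measurableType d2) (R : realType).
Variable P : probability Omega R.
Variables (X : Omega -> T1) (Y : Omega -> T2).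
Hypotheses (mX : measurable_fun setT X) (mY : measurable_fun setT Y).
Hypothesis indep : forall A B, measurable A -> measurable B ->
  P (X @^-1` A `&` Y @^-1` B) = (P (X @^-1` A) * P (Y @^-1` B))%E.

Lemma ge0_integral_indep (F : T1 * T2 -> \bar R) : measurable_fun setT F ->
  (forall z, 0 <= F z)%E ->
  (\int[P]_w F (X w, Y w) = \int[law P mX]_x \int[law P mY]_y F (x, y))%E.
Proof.
move=> mF F0; have mXY : measurable_fun setT (fun w => (X w, Y w)) by exact: measurable_fun_pair.
rewrite -fubini_tonelli1// -(ge0_integral_law P mXY)//.
by apply: eq_measure_integral => D mD _; apply/esym/product_measure_unique => // A B mA mB; exact: indep.
Qed.

Lemma Rintegral_indep (f : T1 -> R) (g : T2 -> R) (C C' : R) :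
  measurable_fun setT f -> measurable_fun setT g ->
  (forall x, `|f x| <= C) -> (forall y, `|g y| <= C') ->
  \int[P]_w (f (X w) * g (Y w)) = (\int[P]_w f (X w)) * (\int[P]_w g (Y w)).
Proof.
move=> mf mg fC gC.
have mXY : measurable_fun setT (fun w => (X w, Y w)) by exact: measurable_fun_pair.
have mfg : measurable_fun setT (fun z : T1 * T2 => f z.1 * g z.2).
  by apply: measurable_funM; [exact: measurableT_comp|exact: measurableT_comp].
have fgC (z : T1 * T2) : `|f z.1 * g z.2| <= C * C' by rewrite normrM ler_pM.
rewrite -(Rintegral_law_bounded P mX mf fC) -(Rintegral_law_bounded P mY mg gC).
have -> : \int[P]_w (f (X w) * g (Y w)) = \int[law P mXY]_z (f z.1 * g z.2).
  by rewrite (Rintegral_law_bounded P mXY mfg fgC).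
pose D := ((law P mX : probability T1 R) \x (law P mY : probability T2 R))%E.
have -> : \int[law P mXY]_z (f z.1 * g z.2) = \int[D]_z (f z.1 * g z.2).
  rewrite /Rintegral; congr fine; apply: eq_measure_integral => A mA _; apply/esym/product_measure_unique => // A1 A2 mA1 mA2; exact: indep.
rewrite {1}/Rintegral -integral12_prod_meas1; last exact: (integrable_prod_bounded _ _ mfg fgC).
have ig : (law P mY).-integrable setT (EFin \o g) by exact: (@bounded_integrable _ _ R (law P mY) g C' mg gC).
have if_ : (law P mX).-integrable setT (EFin \o f) by exact: (@bounded_integrable _ _ R (law P mX) f C mf fC).
transitivity (\int[law P mX]_x (f x * \int[law P mY]_y g y)).
  congr fine; apply: eq_integral => x _ /=.
  rewrite -[LHS]fineK; last first.
    apply: integrable_fin_num => //.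
    by have := integrableZl measurableT (f x) ig; apply: eq_integrable.
  by congr EFin; rewrite -RintegralZl.
by rewrite RintegralZr.
Qed.

End independence.

Section generated.
Context d (Omega : measurableType d) (R : realType) (H : completeNormedModType R).
Variable P : probability Omega R.

Lemma indep_generated (G : set (set Omega)) (B : set Omega) :
  setI_closed G -> G setT -> G `<=` measurable -> measurable B ->
  (forall A, G A -> P (A `&` B) = (P A * P B)%E) ->
  forall A, <<s G >> A -> P (A `&` B) = (P A * P B)%E.
Proof.
move=> GI GT mG mB GB A sA.
have PB : P B \is a fin_num by exact: fin_num_measure.
have PB0 : 0 <= fine (P B) by rewrite fine_ge0.
have cov : \bigcup_(_ in [set: nat]) [set: Omega] = setT by rewrite bigcup_const//; exists 0%N.
have h1 E : G E -> mrestr P mB E = mscale (NngNum PB0) P E.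
  by move=> GE; rewrite /= /mrestr /mscale/= fineK// muleC; exact: GB.
have h2 (n : nat) : (mrestr P mB [set: Omega] < +oo)%E.
  by rewrite /mrestr setTI -ge0_fin_numE.
have := @g_sigma_algebra_measure_unique _ R Omega G mG (fun=> setT) (fun=> GT) cov
  (mrestr P mB) (mscale (NngNum PB0) P) GI h1 h2 A sA.
rewrite -[LHS]/(P (A `&` B)) => ->.
by rewrite -[LHS]/((fine (P B))%:E * P A)%E fineK// muleC.
Qed.

(** The pi-system of joint events. The type [g_sigma_algebraType (family_cylinders V)] is [Omega]
    with the sigma-algebra generated by the family, so a function of all the [V i] is treated as one
    independent variable without a product space. *)
Definition family_cylinders n (V : 'I_n -> Omega -> borel H) : set (set Omega) :=
  [set E | exists2 B : 'I_n -> set (borel H), (forall i, measurable (B i)) &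
    E = [set w | forall i, B i (V i w)]].

Section family.
Variables (n : nat) (V : 'I_n -> Omega -> borel H).
Hypothesis mV : forall i, measurable_fun setT (V i).

Lemma family_cylinders_setI : setI_closed (family_cylinders V).
Proof.
move=> _ _ [B1 m1 ->] [B2 m2 ->]; exists (fun i => B1 i `&` B2 i).
  by move=> i; exact: measurableI.
by apply/seteqP; split=> w /=; [move=> [h1 h2] i; split|move=> h; split=> i; have [] := h i].
Qed.

Lemma family_cylinders_setT : family_cylinders V setT.
Proof. by exists (fun=> setT) => //; apply/seteqP; split. Qed.

Lemma measurable_family_cylinders : family_cylinders V `<=` measurable.
Proof.
move=> _ [B mB ->]; rewrite (_ : [set w | _] = \bigcap_(i in setT) (V i @^-1` B i)).
  apply: fin_bigcap_measurable => // i _.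
  by rewrite -[X in measurable X]setTI; exact: mV.
by apply/seteqP; split=> w /= h i; [move=> _; exact: h|exact: h].
Qed.

Lemma measurable_family (i : 'I_n) :
  measurable_fun setT (V i : g_sigma_algebraType (family_cylinders V) -> borel H).
Proof.
move=> _ B mB; rewrite setTI; apply: sub_sigma_algebra.
exists (fun j => if j == i then B else setT); first by move=> j; case: ifP.
by apply/seteqP; split=> w /=; [move=> h j; case: eqP => // ->|move=> /(_ i); rewrite eqxx].
Qed.

Lemma Rintegral_indep_family d2 (T2 : measurableType d2) (Y : Omega -> T2)
  (f : Omega -> R) (g : T2 -> R) (C C' : R) :
  measurable_fun setT Y ->
  (forall (B : 'I_n -> set (borel H)) D, (forall i, measurable (B i)) -> measurable D ->
    P ([set w | forall i, B i (V i w)] `&` Y @^-1` D) =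
    (P [set w | forall i, B i (V i w)] * P (Y @^-1` D))%E) ->
  measurable_fun setT (f : g_sigma_algebraType (family_cylinders V) -> R) ->
  measurable_fun setT g ->
  (forall x, `|f x| <= C) -> (forall y, `|g y| <= C') ->
  \int[P]_w (f w * g (Y w)) = (\int[P]_w f w) * (\int[P]_w g (Y w)).
Proof.
move=> mY indep mf mg fC gC.
have mid : measurable_fun setT (id : Omega -> g_sigma_algebraType (family_cylinders V)).
  move=> _ E mE; rewrite setTI; move: E mE.
  by apply: smallest_sub measurable_family_cylinders; exact: sigma_algebra_measurable.
apply: (Rintegral_indep mid mY _ mf mg fC gC) => A B mA mB.
apply: (indep_generated family_cylinders_setI family_cylinders_setT measurable_family_cylinders) => //.
  by rewrite -[X in measurable X]setTI; exact: mY.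
by move=> _ [D mD ->]; exact: indep.
Qed.

End family.

(** Induction with the addition formulas. The sine integrals of the summands vanish, which kills
    every mixed term and leaves the product of the cosine integrals. *)
Lemma trig_sum_indep (D : nat -> Omega -> borel H) (x : nat -> borel H -> R) :
  (forall i, measurable_fun setT (D i)) -> (forall i, measurable_fun setT (x i)) ->
  (forall n, independent_family P (fun i : 'I_n => D i)) ->
  (forall i, \int[P]_w sin (x i (D i w)) = 0) ->
  forall n, \int[P]_w cos (\sum_(i < n) x i (D i w)) = \prod_(i < n) \int[P]_w cos (x i (D i w)) /\
    \int[P]_w sin (\sum_(i < n) x i (D i w)) = 0.
Proof.
move=> mD mx indep s0; elim=> [|n [IHc IHs]].
  under eq_Rintegral do rewrite big_ord0; under [X in _ /\ X = _]eq_Rintegral do rewrite big_ord0.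
  by rewrite cos0 sin0 !Rintegral_prob_cst big_ord0.
pose V (i : 'I_n) := D i.
have ind (B : 'I_n -> set (borel H)) E : (forall i, measurable (B i)) -> measurable E ->
    P ([set w | forall i, B i (V i w)] `&` D n @^-1` E) =
    (P [set w | forall i, B i (V i w)] * P (D n @^-1` E))%E.
  move=> mB mE.
  (* The new event sits at [ord_max] and the others below it: independence of the family of length
     [n + 1], compared with that of length [n], separates the last variable from the block of the
     first [n]. *)
  pose A (i : 'I_n.+1) := if unlift ord_max i is Some j then B j else E.
  have mA i : measurable (A i) by rewrite /A; case: unlift.
  have := indep n.+1 A mA; rewrite big_ord_recr /=.
  have Alast : A ord_max = E by rewrite /A unlift_none.
  have Afirst (i : 'I_n) : A (widen_ord (leqnSn n) i) = B i.
    rewrite /A (_ : widen_ord _ i = lift ord_max i) ?liftK//.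
    by apply: val_inj => /=; rewrite /bump leqNgt ltn_ord.
  rewrite Alast; under eq_bigr do rewrite Afirst.
  rewrite -(indep n B mB) => <-; congr (P _).
  apply/seteqP; split=> w /=.
    move=> [h1 h2] i; case: (unliftP ord_max i) => [j ->|->]; last by rewrite Alast.
    rewrite /A liftK (_ : nat_of_ord (lift ord_max j) = j); first exact: h1.
    by rewrite /= /bump leqNgt ltn_ord.
  move=> h; split; last by have := h ord_max; rewrite Alast.
  by move=> i; have := h (widen_ord (leqnSn n) i); rewrite Afirst.
have mS : measurable_fun setT ((fun w => \sum_(i < n) x i (D i w)) : g_sigma_algebraType (family_cylinders V) -> R).
  by apply: measurable_sum => i; have := measurableT_comp (mx i) (@measurable_family n V i).
have mV i : measurable_fun setT (V i) by exact: mD.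
have mt (t : R -> R) : continuous t -> measurable_fun setT ((fun w => t (\sum_(i < n) x i (D i w))) : g_sigma_algebraType (family_cylinders V) -> R).
  by move=> ct; exact: (measurableT_comp (continuous_measurable_fun ct) mS).
have mtx (t : R -> R) : continuous t -> measurable_fun setT (fun y => t (x n y)).
  by move=> ct; exact: (measurableT_comp (continuous_measurable_fun ct) (mx n)).
have E (t u : R -> R) : continuous t -> continuous u -> (forall r, `|t r| <= 1) -> (forall r, `|u r| <= 1) ->
    \int[P]_w (t (\sum_(i < n) x i (D i w)) * u (x n (D n w))) =
    (\int[P]_w t (\sum_(i < n) x i (D i w))) * (\int[P]_w u (x n (D n w))).
  move=> ct cu t1 u1.
  by apply: (@Rintegral_indep_family n V mV _ _ (D n) _ (fun y => u (x n y)) 1 1 (mD n) ind (mt t ct) (mtx u cu)).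
have itg (t u : R -> R) : continuous t -> continuous u -> (forall r, `|t r| <= 1) -> (forall r, `|u r| <= 1) ->
    P.-integrable setT (EFin \o (fun w => t (\sum_(i < n) x i (D i w)) * u (x n (D n w)))).
  move=> ct cu t1 u1; apply: (@bounded_integrable _ _ R P _ 1).
    apply: measurable_funM; apply: (measurableT_comp (continuous_measurable_fun _)) => //.
      by apply: measurable_sum => i; exact: (measurableT_comp (mx i) (mD i)).
    exact: (measurableT_comp (mx n) (mD n)).
  by move=> w; rewrite normrM mulr_ile1.
have cc := @continuous_cos R; have cs := @continuous_sin R; have bc := @cos_max R; have bs := @sin_max R.
split.
  under eq_Rintegral do rewrite big_ord_recr/= cosD.
  rewrite RintegralB//; [|exact: itg|exact: itg].
  by rewrite !E// IHs mul0r subr0 IHc big_ord_recr.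
under eq_Rintegral do rewrite big_ord_recr/= sinD.
rewrite RintegralD//; [|exact: itg|exact: itg].
by rewrite !E// IHs mul0r add0r s0 mulr0.
Qed.

End generated.

(** * Riemann sums and mean-square limits *)

Section riemann.
Context {R : realType}.

Lemma continuous_itv_bounded (f : R -> R) (a b : R) : continuous f ->
  exists2 K, 0 < K & forall x, a <= x <= b -> `|f x| <= K.
Proof.
move=> cf; have : compact (f @` `[a, b]).
  by apply: continuous_compact; [exact: continuous_subspaceT|exact: segment_compact].
move=> /compact_bounded[M [_ hM]]; exists (`|M| + 1); first by rewrite ltr_wpDl.
by move=> x xab; apply: (hM (`|M| + 1)); [rewrite (le_lt_trans (ler_norm M))// ltrDl|exists x => //=; rewrite in_itv].
Qed.

Lemma mvt_error (F f : R -> R) (a b c e : R) : a <= b -> (forall x : R, is_derive x 1 F (f x)) ->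
  (forall x, a <= x <= b -> `|f x - c| <= e) -> `|F b - F a - c * (b - a)| <= e * (b - a).
Proof.
move=> ab dF fe.
have cF : {within `[a, b], continuous F} by apply: continuous_subspaceT; exact: is_derive_continuous dF.
have [x] := @MVT_segment R F f a b ab (fun x _ => dF x) cF; rewrite in_itv/= => xab ->.
by rewrite -mulrBl normrM [X in _ * X]ger0_norm ?subr_ge0// ler_wpM2r ?subr_ge0// fe.
Qed.

(** Pathwise form of d(a y) = a dn, for the integrating factor a' = s a and dn = dy + s y dt. Since
    [y] is only continuous, summation by parts rewrites the error of each step in terms of
    increments of [F] and [a], to which the mean value theorem applies. *)
Lemma discounted_sum (s a y F n : R -> R) (t : R) : 0 < t <= 1 ->
  continuous s -> continuous y ->
  (forall x : R, is_derive x 1 a (s x * a x)) ->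
  (forall x : R, is_derive x 1 F (s x * y x)) -> a 0 = 1 -> F 0 = 0 ->
  (forall x, 0 <= x <= 1 -> n x = y x - y 0 + F x) ->
  (fun N => \sum_(j < N.+1) a (j%:R * t / N.+1%:R) *
     (n (j.+1%:R * t / N.+1%:R) - n (j%:R * t / N.+1%:R))) @ \oo --> a t * y t - y 0.
Proof.
move=> /andP[t0 t1] cs cy da dF a0 F0 nE.
have ca := is_derive_continuous da.
have [K1 K10 hK1] := continuous_itv_bounded 0 1 cs.
have [K2 K20 hK2] := continuous_itv_bounded 0 1 ca.
have [K3 K30 hK3] := continuous_itv_bounded 0 1 cy.
apply/cvgrPdist_le => e e0.
(* Chosen so that [K1 * (K2 * r + K3 * r) = e]: each step then has an error of at most [e] times its
   length, and the total length is [t <= 1]. *)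
pose r := e / (K1 * (K2 + K3)).
have r0 : 0 < r by rewrite divr_gt0// mulr_gt0// addr_gt0.
have [d1 d10 hd1] := unif_continuous_itv 0 1 ca r0.
have [d2 d20 hd2] := unif_continuous_itv 0 1 cy r0.
have d0 : 0 < Num.min d1 d2 by rewrite lt_min d10.
near=> N.
have hN : N.+1%:R^-1 < Num.min d1 d2 by near: N; exact: (near_infty_natSinv_lt (PosNum d0)).
pose T (j : nat) : R := j%:R * t / N.+1%:R.
have N0 : (0 : R) < N.+1%:R by rewrite ltr0n.
have TS j : T j.+1 - T j = t / N.+1%:R by rewrite /T -mulrBl -mulrBl -addn1 natrD addrC addKr mul1r.
have TS0 j : 0 <= T j.+1 - T j by rewrite TS divr_ge0// ltW.
have T01 j : (j <= N.+1)%N -> 0 <= T j <= 1.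
  move=> jN; rewrite /T divr_ge0 ?mulr_ge0 ?(ltW t0)//= ler_pdivrMr// mul1r.
  by rewrite (le_trans (ler_wpM2l _ t1))// mulr1 ler_nat.
have step (j : 'I_N.+1) : `|a (T j) * (n (T j.+1) - n (T j)) - (a (T j.+1) * y (T j.+1) - a (T j) * y (T j))|
    <= e * (T j.+1 - T j).
  have hj : (j <= N.+1)%N by exact: (leq_trans (ltnW (ltn_ord j))).
  have T1 := T01 j hj; have T2 := T01 j.+1 (ltn_ord j).
  rewrite !nE//.
  have -> : a (T j) * (y (T j.+1) - y 0 + F (T j.+1) - (y (T j) - y 0 + F (T j))) -
      (a (T j.+1) * y (T j.+1) - a (T j) * y (T j)) =
      (a (T j) * F (T j.+1) - y (T j.+1) * a (T j.+1)) - (a (T j) * F (T j) - y (T j.+1) * a (T j)) - 0 * (T j.+1 - T j).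
    by ring.
  apply: (@mvt_error (fun x => a (T j) * F x - y (T j.+1) * a x)
    (fun x => s x * (a (T j) * y x - y (T j.+1) * a x))); first by rewrite -subr_ge0.
    move=> x; have d3 := dF x; have d4 := da x.
    by apply: is_derive_eq; rewrite /GRing.scale /=; ring.
  move=> x /andP[x1 x2]; have x01 : 0 <= x <= 1.
    by case/andP: T1 => h1 _; case/andP: T2 => _ h2; rewrite (le_trans h1)//= (le_trans x2).
  rewrite subr0 normrM.
  have -> : a (T j) * y x - y (T j.+1) * a x = a (T j) * (y x - y (T j.+1)) + y (T j.+1) * (a (T j) - a x) by ring.
  have small : t / N.+1%:R < Num.min d1 d2.
    by apply: le_lt_trans hN; rewrite ler_pdivrMr// mulVf// gt_eqF.
  have A1 : `|a (T j) - a x| <= r.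
    apply/ltW/hd1 => //; rewrite distrC ger0_norm ?subr_ge0//.
    apply: le_lt_trans (lt_le_trans small _); last by rewrite ge_min lexx.
    by rewrite -(TS j) lerD2r.
  have A2 : `|y x - y (T j.+1)| <= r.
    apply/ltW/hd2 => //; rewrite distrC ger0_norm ?subr_ge0//.
    apply: le_lt_trans (lt_le_trans small _); last by rewrite ge_min lexx orbT.
    by rewrite -(TS j) lerD2l lerN2.
  have e_eq : e = K1 * (K2 * r + K3 * r).
    by rewrite /r; field; rewrite !gt_eqF// addr_gt0.
  rewrite e_eq; apply: ler_pM; rewrite ?hK1//.
  apply: le_trans (ler_normD _ _) _; rewrite !normrM.
  by apply: lerD; apply: ler_pM; rewrite ?hK2 ?hK3.
have -> : a t * y t - y 0 - \sum_(j < N.+1) a (T j) * (n (T j.+1) - n (T j)) =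
    - \sum_(j < N.+1) (a (T j) * (n (T j.+1) - n (T j)) - (a (T j.+1) * y (T j.+1) - a (T j) * y (T j))).
  rewrite sumrB opprB; congr (_ - _).
  rewrite -(big_mkord xpredT (fun j => a (T j.+1) * y (T j.+1) - a (T j) * y (T j))).
  rewrite (telescope_sumr (fun j => a (T j) * y (T j)))// /T mul0r mul0r a0 mul1r.
  by rewrite mulrAC divff ?mul1r// gt_eqF.
rewrite normrN (le_trans (ler_norm_sum _ _ _))//.
apply: (@le_trans _ _ (\sum_(j < N.+1) e * (t / N.+1%:R))).
  by apply: ler_sum => j _; rewrite -(TS j); exact: step.
rewrite sumr_const card_ord -[_ *+ _]mulr_natr -mulrA divfK ?gt_eqF//.
by rewrite ler_piMr// ltW.
Unshelve. all: by end_near. Qed.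

(** The weight [E] is sampled on the mesh of [N.+1] steps, [s] on its refinement by [p]. The bound
    is uniform in [p], which allows the limit in [p] to be taken before that in [N]. *)
Lemma variance_sum (s E : R -> R) (t e : R) : 0 < t <= 1 -> continuous s ->
  (forall x : R, is_derive x 1 E (s x * E x)) -> 0 < e ->
  \forall N \near \oo, forall p, (0 < p)%N ->
    `|\sum_(k < N.+1 * p) E ((k %/ p)%:R * t / N.+1%:R) * s (k%:R * t / (N.+1 * p)%:R) * (t / (N.+1 * p)%:R)
      - (E t - E 0)| <= e.
Proof.
move=> /andP[t0 t1] cs dE e0.
have cE := is_derive_continuous dE.
have [K1 K10 hK1] := continuous_itv_bounded 0 1 cs.
have [K2 K20 hK2] := continuous_itv_bounded 0 1 cE.
pose r := e / (K1 + K2).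
have r0 : 0 < r by rewrite divr_gt0// addr_gt0.
have [d1 d10 hd1] := unif_continuous_itv 0 1 cE r0.
have [d2 d20 hd2] := unif_continuous_itv 0 1 cs r0.
have d0 : 0 < Num.min d1 d2 by rewrite lt_min d10.
near=> N => p p0.
have hN : N.+1%:R^-1 < Num.min d1 d2 by near: N; exact: (near_infty_natSinv_lt (PosNum d0)).
set D := t / (N.+1 * p)%:R.
have Np0 : (0 : R) < (N.+1 * p)%:R by rewrite ltr0n muln_gt0.
have pR : (0 : R) < p%:R by rewrite ltr0n.
have D0 : 0 < D by rewrite divr_gt0.
have DN : D * (N.+1 * p)%:R = t by rewrite /D divfK// gt_eqF.
have DN1 : t / N.+1%:R = D * p%:R.
  by rewrite /D natrM; field; rewrite !gt_eqF// ltr0n.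
pose T (k : nat) : R := k%:R * D.
have TE k : k%:R * t / (N.+1 * p)%:R = T k by rewrite /T /D mulrA.
have TE1 j : j%:R * t / N.+1%:R = T (j * p)%N.
  by rewrite /T -mulrA DN1 natrM; ring.
have TS k : T k.+1 - T k = D by rewrite /T -mulrBl -addn1 natrD addrC addKr mul1r.
have T01 k : (k <= N.+1 * p)%N -> 0 <= T k <= 1.
  move=> kN; rewrite /T mulr_ge0 ?(ltW D0)//=.
  by rewrite (le_trans _ t1)// -DN mulrC ler_wpM2l ?(ltW D0)// ler_nat.
have small : D * p%:R < Num.min d1 d2.
  by rewrite -DN1; apply: le_lt_trans hN; rewrite ler_pdivrMr ?ltr0n// mulVf// gt_eqF// ltr0n.
have step (k : 'I_(N.+1 * p)) :
    `|E (T (k %/ p * p)%N) * s (T k) * D - (E (T k.+1) - E (T k))| <= e * D.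
  have hk := ltn_ord k; have T1 := T01 k (ltnW hk); have T2 := T01 k.+1 hk.
  have kp : (k %/ p * p <= k)%N by exact: leq_trunc_div.
  have T3 := T01 _ (leq_trans kp (ltnW hk)).
  rewrite distrC -(TS k); apply: mvt_error (dE) _; first by rewrite -subr_ge0 TS ltW.
  move=> x /andP[x1 x2]; have x01 : 0 <= x <= 1.
    by case/andP: T1 => h1 _; case/andP: T2 => _ h2; rewrite (le_trans h1)//= (le_trans x2).
  have near1 : `|T (k %/ p * p)%N - x| < Num.min d1 d2.
    have le1 : T (k %/ p * p)%N <= T k by rewrite /T ler_wpM2r ?(ltW D0)// ler_nat.
    rewrite distrC ger0_norm ?subr_ge0 ?(le_trans le1)//; apply: le_lt_trans small.
    rewrite (le_trans (lerB x2 (lexx _)))// /T -mulrBl mulrC ler_wpM2l ?(ltW D0)//.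
    by rewrite lerBlDr -natrD ler_nat -mulSn ltn_ceil.
  have near2 : `|T k - x| < Num.min d1 d2.
    rewrite distrC ger0_norm ?subr_ge0//; apply: le_lt_trans small.
    rewrite (le_trans (lerB x2 (lexx _)))// TS ler_peMr ?(ltW D0)// ler1n//.
  have -> : s x * E x - E (T (k %/ p * p)%N) * s (T k) =
     s x * (E x - E (T (k %/ p * p)%N)) + E (T (k %/ p * p)%N) * (s x - s (T k)) by ring.
  have A1 : `|E x - E (T (k %/ p * p)%N)| <= r.
    rewrite distrC; apply/ltW/hd1 => //; apply: lt_le_trans near1 _; by rewrite ge_min lexx.
  have A2 : `|s x - s (T k)| <= r.
    rewrite distrC; apply/ltW/hd2 => //; apply: lt_le_trans near2 _; by rewrite ge_min lexx orbT.
  have e_eq : e = K1 * r + K2 * r.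
    by rewrite /r; field; rewrite !gt_eqF// addr_gt0.
  rewrite e_eq; apply: le_trans (ler_normD _ _) _; rewrite !normrM.
  by apply: lerD; apply: ler_pM; rewrite ?hK1 ?hK2.
have -> : E t - E 0 = \sum_(k < N.+1 * p) (E (T k.+1) - E (T k)).
  rewrite -(big_mkord xpredT (fun k => E (T k.+1) - E (T k))).
  by rewrite (telescope_sumr (fun k => E (T k)))// /T mul0r mulrC DN.
under eq_bigr do rewrite TE1 TE.
rewrite -sumrB (le_trans (ler_norm_sum _ _ _))//.
apply: (@le_trans _ _ (\sum_(k < N.+1 * p) e * D)); first by apply: ler_sum => k _; exact: step.
rewrite sumr_const card_ord -mulr_natr -mulrA DN.
by rewrite ler_piMr// ltW.
Unshelve. all: by end_near. Qed.

End riemann.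

(** * Mean-square convergence *)

Section L2_convergence.
Context d (T : measurableType d) (R : realType) (P : probability T R).

Definition L2_cvg (f : nat -> T -> R) (g : T -> R) : Prop :=
  [/\ forall n, measurable_fun setT (f n), measurable_fun setT g &
    (fun n => \int[P]_x ((f n x - g x) ^+ 2)%:E)%E @ \oo --> 0%E].

Lemma L2_cvg_le (f f' f'' : nat -> T -> R) (g g' g'' : T -> R) (c : R) :
  0 <= c -> L2_cvg f' g' -> L2_cvg f'' g'' ->
  (forall n, measurable_fun setT (f n)) -> measurable_fun setT g ->
  (forall n x, (f n x - g x) ^+ 2 <= c * ((f' n x - g' x) ^+ 2 + (f'' n x - g'' x) ^+ 2)) ->
  L2_cvg f g.
Proof.
move=> c0 [mf' mg' h'] [mf'' mg'' h''] mf mg le; split=> //.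
have m1 n : measurable_fun setT (fun x => ((f' n x - g' x) ^+ 2)%:E).
  by apply/measurable_EFinP; apply: measurable_funX; exact: measurable_funB.
have m2 n : measurable_fun setT (fun x => ((f'' n x - g'' x) ^+ 2)%:E).
  by apply/measurable_EFinP; apply: measurable_funX; exact: measurable_funB.
apply: (@squeeze_cvge _ _ _ _ (cst 0%E) _ (fun n => c%:E * (\int[P]_x ((f' n x - g' x) ^+ 2)%:E + \int[P]_x ((f'' n x - g'' x) ^+ 2)%:E))%E).
- apply: nearW => n; rewrite integral_ge0/=; last by move=> x _; rewrite lee_fin sqr_ge0.
  rewrite -ge0_integralD//; [|by move=> x _; rewrite lee_fin sqr_ge0..].
  rewrite -ge0_integralZl//; last 2 first.
  + exact: emeasurable_funD.
  + by move=> x _; rewrite -EFinD lee_fin addr_ge0 ?sqr_ge0.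
  apply: ge0_le_integral => //.
  + by move=> x _; rewrite lee_fin sqr_ge0.
  + by apply/measurable_EFinP; apply: measurable_funX; exact: measurable_funB.
  + by apply: measurable_funeM; exact: emeasurable_funD.
  + by move=> x _; rewrite -EFinD -EFinM lee_fin.
- exact: cvg_cst.
- rewrite -[X in _ --> X](mule0 c%:E) -[X in _ --> (_ * X)%E](adde0 0%E).
  by apply: cvgeZl => //; apply: cvgeD.
Qed.

Lemma L2_cvg_cst (g : T -> R) : measurable_fun setT g -> L2_cvg (fun=> g) g.
Proof.
move=> mg; split=> //; apply: cvg_near_cst; apply: nearW => n.
by under eq_integral do rewrite subrr expr0n/=; rewrite integral0.
Qed.

Lemma L2_cvgD f g f' g' : L2_cvg f g -> L2_cvg f' g' ->
  L2_cvg (fun n x => f n x + f' n x) (fun x => g x + g' x).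
Proof.
move=> h h'; have [mf mg _] := h; have [mf' mg' _] := h'.
apply: (@L2_cvg_le _ _ _ _ _ _ 2 _ h h') => //.
- by move=> n; exact: measurable_funD.
- exact: measurable_funD.
move=> n x; have := sqr_ge0 ((f n x - g x) - (f' n x - g' x)).
move: (f n x) (g x) (f' n x) (g' x) => *; nra.
Qed.

Lemma L2_cvgZ c f g : L2_cvg f g -> L2_cvg (fun n x => c * f n x) (fun x => c * g x).
Proof.
move=> h; have [mf mg _] := h.
apply: (@L2_cvg_le _ _ _ _ _ _ (c ^+ 2) _ h h) => //.
- exact: sqr_ge0.
- by move=> n; exact: measurable_funM.
- exact: measurable_funM.
move=> n x; rewrite -mulrBr exprMn ler_wpM2l ?sqr_ge0// lerDl sqr_ge0//.
Qed.

Lemma L2_cvg_sum N (f : nat -> nat -> T -> R) (g : nat -> T -> R) :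
  (forall j, (j < N)%N -> L2_cvg (f j) (g j)) ->
  L2_cvg (fun n x => \sum_(j < N) f j n x) (fun x => \sum_(j < N) g j x).
Proof.
elim: N => [|N IH] h.
  rewrite (_ : (fun n x => _) = (fun=> cst 0)); last by apply/funext => n; apply/funext => x; rewrite big_ord0.
  rewrite (_ : (fun x => _) = cst 0); last by apply/funext => x; rewrite big_ord0.
  exact: L2_cvg_cst.
rewrite (_ : (fun n x => _) = (fun n x => \sum_(j < N) f j n x + f N n x)); last first.
  by apply/funext => n; apply/funext => x; rewrite big_ord_recr.
rewrite (_ : (fun x => _) = (fun x => \sum_(j < N) g j x + g N x)); last first.
  by apply/funext => x; rewrite big_ord_recr.
by apply: L2_cvgD; [apply: IH => j jN; apply: h; exact: ltnW|exact: h].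
Qed.

(** For a 1-Lipschitz [t] the error is at most [C] times the mean of |f n - g|, again controlled by
    |d| <= r + d^2 / r. *)
Lemma L2_cvg_Rintegral (t : R -> R) (F : T -> R) (C : R) f g :
  continuous t -> (forall r, `|t r| <= 1) -> (forall r u, `|t r - t u| <= `|r - u|) ->
  measurable_fun setT F -> (forall x, `|F x| <= C) -> L2_cvg f g ->
  (fun n => \int[P]_x (F x * t (f n x))) @ \oo --> \int[P]_x (F x * t (g x)).
Proof.
move=> ct t1 tl mF FC [mf mg h].
have C0 : 0 <= C by apply: le_trans (FC point).
have mt (u : T -> R) : measurable_fun setT u -> measurable_fun setT (fun x => t (u x)).
  by move=> mu; exact: (measurableT_comp (continuous_measurable_fun ct) mu).
have it u : measurable_fun setT u -> P.-integrable setT (EFin \o (fun x => F x * t (u x))).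
  move=> mu; apply: (@bounded_integrable _ _ R P _ C).
    by apply: measurable_funM => //; exact: mt.
  by move=> x; rewrite normrM -[leRHS]mulr1 ler_pM.
apply/cvgrPdist_le => e e0.
pose r := e / (2 * (C + 1)).
have C1 : 0 < 2 * (C + 1) by lra.
have r0 : 0 < r by rewrite divr_gt0.
have r2 : (0%:E < (r ^+ 2)%:E)%E by rewrite lte_fin exprn_gt0.
have : \forall n \near \oo, (\int[P]_x ((f n x - g x) ^+ 2)%:E < (r ^+ 2)%:E)%E by have := h _ (open_ereal_lt' r2).
apply: filterS => n /= hn.
rewrite -RintegralB//; [|exact: it|exact: it].
have i2 : P.-integrable setT (fun x => ((f n x - g x) ^+ 2)%:E).
  apply/integrableP; split; first by apply/measurable_EFinP; apply: measurable_funX; exact: measurable_funB.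
  under eq_integral do rewrite gee0_abs ?lee_fin ?sqr_ge0//.
  exact: (lt_trans hn (ltry _)).
have iB : P.-integrable setT (EFin \o (fun x => F x * t (g x) - F x * t (f n x))).
  by apply: eq_integrable (integrableB measurableT (it _ mg) (it _ (mf n))).
apply: le_trans (le_normr_Rintegral measurableT iB) _.
have i1 : P.-integrable setT (EFin \o cst r) by exact: finite_measure_integrable_cst.
have i3 : P.-integrable setT (EFin \o (fun x => r^-1 * (f n x - g x) ^+ 2)).
  by have := integrableZl measurableT r^-1 i2; exact: eq_integrable.
have i4 : P.-integrable setT (EFin \o (fun x => r + r^-1 * (f n x - g x) ^+ 2)).
  by have := integrableD measurableT i1 i3; exact: eq_integrable.
apply: (@le_trans _ _ (\int[P]_x (C * (r + r^-1 * (f n x - g x) ^+ 2)))).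
  apply: le_Rintegral => //; first exact: integrable_norm iB.
    by have := integrableZl measurableT C i4; exact: eq_integrable.
  move=> x _; rewrite -mulrBr normrM; apply: ler_pM; [exact: normr_ge0|exact: normr_ge0|exact: FC|].
  rewrite (le_trans (tl _ _))// distrC.
  have := sqr_ge0 (r - `|f n x - g x|); rewrite -[(f n x - g x) ^+ 2]real_normK ?num_real//.
  move: `|f n x - g x| (normr_ge0 (f n x - g x)) => v v0.
  rewrite -(ler_pM2l r0 v); have -> : r * (r + r^-1 * v ^+ 2) = r ^+ 2 + v ^+ 2.
    by field; rewrite gt_eqF.
  nra.
rewrite RintegralZl// RintegralD// Rintegral_prob_cst RintegralZl//.
have hs : \int[P]_x ((f n x - g x) ^+ 2) <= r ^+ 2.
  rewrite -lee_fin /Rintegral fineK ?integrable_fin_num//; exact: ltW.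
have rr : r * (2 * (C + 1)) = e by rewrite /r divfK// gt_eqF.
have : r^-1 * \int[P]_x ((f n x - g x) ^+ 2) <= r by rewrite ler_pdivrMl// -expr2.
move: (r^-1 * _) => z; nra.
Qed.

End L2_convergence.

Section trig_lipschitz.
Context {R : realType}.

Lemma lipschitz1 (f g : R -> R) : (forall x : R, is_derive x 1 f (g x)) -> (forall x, `|g x| <= 1) ->
  forall x y, `|f x - f y| <= `|x - y|.
Proof.
move=> df g1 x y; wlog xy : x y / y <= x.
  by move=> h; have [|/ltW] := leP y x; [exact: h|rewrite distrC (distrC x); exact: h].
have := @mvt_error _ f g y x 0 1 xy df.
have xy0 : 0 <= x - y by rewrite subr_ge0.
by rewrite mul0r subr0 mul1r (ger0_norm xy0); apply=> z _; rewrite subr0.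
Qed.

Lemma cos_lipschitz (x y : R) : `|cos x - cos y| <= `|x - y|.
Proof. by apply: (lipschitz1 (g := fun x => - sin x)) => z; rewrite normrN; exact: sin_max. Qed.

Lemma sin_lipschitz (x y : R) : `|sin x - sin y| <= `|x - y|.
Proof. by apply: (lipschitz1 (g := cos)) => z; exact: cos_max. Qed.

(** Regroups a weighted sum of increments over blocks of [p] fine steps; the step [k] belongs to the
    block [k %/ p]. *)
Lemma block_sum (b c : nat -> R) (p N : nat) : (0 < p)%N ->
  \sum_(j < N) b j * (\sum_(k < j.+1 * p) c k - \sum_(k < j * p) c k) =
  \sum_(k < N * p) b (k %/ p)%N * c k.
Proof.
move=> p0; elim: N => [|N IH]; first by rewrite mul0n !big_ord0.
rewrite big_ord_recr/= IH.
have le : (N * p <= N.+1 * p)%N by rewrite leq_mul2r leqnSn orbT.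
rewrite -!(big_mkord xpredT c) -!(big_mkord xpredT (fun k => b (k %/ p)%N * c k)).
rewrite !(big_cat_nat (leq0n (N * p)) le)/= [X in b N * X]addrAC subrr add0r; congr (_ + _).
rewrite mulr_sumr; apply: eq_big_nat => k /andP[k1 k2].
congr (b _ * _); apply/eqP; rewrite eqn_leq leq_divRL// k1/= -ltnS ltn_divLR//.
Qed.

End trig_lipschitz.

(** * The law of the diffusion *)

Section sde.
Context {R : realType} {H : completeNormedModType R}.
Local Notation leb := (@lebesgue_measure R).
Variable ip : {dot H for idfun}.
Hypothesis normE : forall x : H, `|x| ^+ 2 = ip x x.
Hypothesis sepH : separable_space H.
Variable Q : {linear H -> H}.
Hypothesis hQ : covariance_operator ip Q.
Variables (I : pred nat) (zeta : nat -> H).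
Hypothesis hzeta : orthonormal_basis ip I zeta.
Variable sigma : R -> R.
Hypothesis sigma_ge0 : forall t, t \in `[0, 1] -> 0 <= sigma t.
Hypothesis sigma_continuous : {within `[0, 1], continuous sigma}.
Context (d : measure_display) (Omega : measurableType d) (P : probability Omega R).
Variables (W Y : R -> Omega -> H).
Hypothesis hW : Q_wiener ip P Q W.
Hypothesis hY : sde_solution ip P sigma W Y.

Let mip h : measurable_fun setT (ip h : borel H -> R).
Proof. exact: (measurable_continuous_borel (continuous_ip normE h)). Qed.

Let mW s : 0 <= s -> measurable_fun setT (W s : Omega -> borel H).
Proof. by case: hW => + _ _ _ _; apply. Qed.

Let mY s : 0 <= s <= 1 -> measurable_fun setT (Y s : Omega -> borel H).
Proof. by move=> s01; case: hY => + _ _ _; apply; rewrite in_itv. Qed.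

Let msub (f g : Omega -> borel H) : measurable_fun setT f -> measurable_fun setT g ->
  measurable_fun setT (fun w => f w - g w : borel H).
Proof.
move=> mf mg; apply: (measurable_coord normE sepH hzeta) => i _.
under eq_fun do rewrite ipBr.
by apply: measurable_funB; exact: (measurable_ip normE).
Qed.

Section grid.
Variables (h : H) (D : R).
Hypothesis D0 : 0 <= D.
Variable c : nat -> R.

Let dW k w := W (k.+1%:R * D) w - W (k%:R * D) w.

Let T0 k : 0 <= k%:R * D. Proof. by rewrite mulr_ge0. Qed.

Let TS k : k%:R * D <= k.+1%:R * D. Proof. by rewrite ler_wpM2r// ler_nat. Qed.

Let mdW k : measurable_fun setT (dW k : Omega -> borel H).
Proof. by apply: msub; exact: mW. Qed.

Let dW_gauss k (A : set R) : measurable A -> P [set w | A (ip h (dW k w))] = gaussian1 0 (D * ip (Q h) h) A.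
Proof.
move=> mA; have [_ _ _ _ /(_ _ _ (T0 k) (TS k))[_ /(_ h A mA)]] := hW.
have -> : k.+1%:R * D - k%:R * D = D by rewrite -mulrBl -natr1 addrAC subrr add0r mul1r.
by rewrite ip0r ipZl.
Qed.

Lemma wiener_sum_cos_sin n :
  \int[P]_w cos (\sum_(k < n) c k * ip h (dW k w)) =
    expR (- ((\sum_(k < n) c k ^+ 2 * D) * ip (Q h) h / 2)) /\
  \int[P]_w sin (\sum_(k < n) c k * ip h (dW k w)) = 0.
Proof.
pose x (k : nat) (y : borel H) := c k * ip h y.
have mx k : measurable_fun setT (x k) by apply: measurable_funM.
have v0 : 0 <= D * ip (Q h) h by rewrite mulr_ge0// (cov_ge0 hQ).
have ind m : independent_family P (fun i : 'I_m => dW i).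
  by have [_ _ _ /(_ m (fun k => k%:R * D) (T0 0%N) TS)] := hW.
have mh k : measurable_fun setT (fun w => ip h (dW k w)) by exact: (measurable_ip normE).
have hs k : \int[P]_w sin (x k (dW k w)) = 0.
  exact: (integral_gaussian1_sin (mh k) v0 (dW_gauss k)).
have [-> ->] := trig_sum_indep mdW mx ind hs n; split=> //.
rewrite (eq_bigr (fun k : 'I_n => expR (- (c k ^+ 2 * D * ip (Q h) h / 2)))); last first.
  move=> k _; rewrite (integral_gaussian1_cos (mh k) v0 (dW_gauss k)).
  by rewrite (mulrA (c k ^+ 2)).
rewrite -expR_sum; congr expR.
by rewrite sumrN !mulr_suml.
Qed.

Lemma wiener_sum_indep n (F : borel H -> R) (C : R) (t : R -> R) :
  measurable_fun setT F -> (forall x, `|F x| <= C) -> continuous t -> (forall r, `|t r| <= 1) ->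
  \int[P]_w (F (Y 0 w) * t (\sum_(k < n) c k * ip h (dW k w))) =
  (\int[P]_w F (Y 0 w)) * \int[P]_w t (\sum_(k < n) c k * ip h (dW k w)).
Proof.
move=> mF FC ct t1.
pose V (i : 'I_n.+1) := W (i%:R * D).
have mV i : measurable_fun setT (V i : Omega -> borel H) by exact: mW.
have mY0 : measurable_fun setT (Y 0 : Omega -> borel H) by apply: mY; rewrite lexx ler01.
have ind (B : 'I_n.+1 -> set (borel H)) (E : set (borel H)) : (forall i, measurable (B i)) -> measurable E ->
    P ([set w | forall i, B i (V i w)] `&` Y 0 @^-1` E) = (P [set w | forall i, B i (V i w)] * P (Y 0 @^-1` E))%E.
  move=> mB mE; have [_ _ iY _] := hY.
  by rewrite setIC muleC; apply: (iY _ (fun i : 'I_n.+1 => i%:R * D)).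
have mS : measurable_fun setT ((fun w => t (\sum_(k < n) c k * ip h (dW k w))) : g_sigma_algebraType (family_cylinders V) -> R).
  apply: (measurableT_comp (continuous_measurable_fun ct)).
  apply: measurable_sum => k; apply: measurable_funM => //.
  under eq_fun do rewrite /dW ipBr.
  apply: measurable_funB.
    by have := measurableT_comp (mip h) (@measurable_family _ _ _ _ _ V (lift ord0 k)).
  by have := measurableT_comp (mip h) (@measurable_family _ _ _ _ _ V (widen_ord (leqnSn n) k)).
under eq_Rintegral do rewrite mulrC; rewrite mulrC.
exact: (@Rintegral_indep_family _ _ _ _ P _ V mV _ (borel H) (Y 0) _ F 1 C mY0 ind mS mF (fun w => t1 _) FC).
Qed.

End grid.

Variable t : R.
Hypothesis t01 : 0 < t <= 1.
Variable h : H.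
Variable B : R -> R.
Hypothesis dB : forall x : R, is_derive x 1 B (sigma (clamp x)).
Hypothesis B0 : B 0 = 0.
Hypothesis intB : forall s t, 0 <= s -> s <= t -> t <= 1 -> \int[leb]_(u in `[s, t]) sigma u = B t - B s.

Let q := ip (Q h) h.
Let t0 : 0 < t. Proof. by case/andP: t01. Qed.
Let t1 : t <= 1. Proof. by case/andP: t01. Qed.
(** [N] indexes the coarse times [tj], at which the integrating factor [a] is frozen, and [p] the
    refinement on which the Wiener increments are taken. *)
Let dt N p : R := t / (N.+1 * p.+1)%:R.
Let dt0 N p : 0 <= dt N p. Proof. by rewrite divr_ge0// ltW. Qed.
Let tj N (j : nat) : R := j%:R * t / N.+1%:R.
Let a (x : R) : R := expR (B x / 2).

Let tj01 N j : (j <= N.+1)%N -> 0 <= tj N j <= 1.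
Proof.
move=> jN; rewrite /tj divr_ge0 ?mulr_ge0 ?(ltW t0)//= ler_pdivrMr ?ltr0n// mul1r.
by rewrite (le_trans (ler_wpM2l _ t1))// mulr1 ler_nat.
Qed.

Let incr N p k w := W (k.+1%:R * dt N p) w - W (k%:R * dt N p) w.

Let cs : continuous (sigma \o clamp). Proof. exact: continuous_comp_clamp. Qed.

(** A coarse time is a multiple of the fine step, so the Riemann sums with [j * p.+1] steps of the
    Ito integral up to [tj N j] use exactly the fine increments. For fixed [N] they run through a
    sequence with growing numbers of steps, and [is_ito_integral] applies. *)
Let ito M : (forall s, s \in `[0, 1] -> is_ito_integral P W (fun s => Num.sqrt (sigma s)) s (M s)) ->
  forall N j, (j <= N.+1)%N ->
  L2_cvg P (fun p w => \sum_(k < j * p.+1) Num.sqrt (sigma (k%:R * dt N p)) * ip h (incr N p k w))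
    (fun w => ip h (M (tj N j) w)).
Proof.
move=> hM N j jN; have tjN := tj01 jN.
have [mM lM] : is_ito_integral P W (fun s => Num.sqrt (sigma s)) (tj N j) (M (tj N j)) by apply: hM; rewrite in_itv.
have minc p k : measurable_fun setT (incr N p k : Omega -> borel H).
  by apply: msub; apply: mW; rewrite mulr_ge0.
have [nu nuoo E] : exists2 nu : nat -> nat, (fun p => nu p) @ \oo --> \oo &
    forall p w, \sum_(k < j * p.+1) Num.sqrt (sigma (k%:R * dt N p)) *: incr N p k w =
      \sum_(k < nu p) Num.sqrt (sigma (k%:R * tj N j / (nu p)%:R)) *:
         (W (k.+1%:R * tj N j / (nu p)%:R) w - W (k%:R * tj N j / (nu p)%:R) w).
  (* For [j = 0] the number of steps [j * p.+1] stays 0 and does not tend to infinity. Any other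
     sequence serves, since all increments over the trivial interval vanish. *)
  have [->|j0] := eqVneq j 0%N.
    exists id; first by [].
    move=> p w; rewrite mul0n big_ord0 big1// => k _.
    by rewrite /tj !(mul0r, mulr0) subrr scaler0.
  exists (fun p => (j * p.+1)%N).
    apply/cvgnyPge => m; near=> p; have : (m <= p)%N by near: p; exact: nbhs_infty_ge.
    by move=> mp; rewrite (leq_trans mp)// (leq_trans (leqnSn p))// leq_pmull// lt0n.
  move=> p w.
  have T k : k%:R * tj N j / (j * p.+1)%:R = k%:R * dt N p.
    have : j%:R != 0 :> R by rewrite pnatr_eq0.
    have : N.+1%:R != 0 :> R by rewrite pnatr_eq0.
    have : p.+1%:R != 0 :> R by rewrite pnatr_eq0.
    rewrite /tj /dt !natrM; move: (j%:R : R) (N.+1%:R : R) (p.+1%:R : R) => x y z z0 y0 x0.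
    by field; rewrite x0 y0 z0.
  by apply: eq_bigr => k _; rewrite !T.
split.
- move=> p; apply: measurable_sum => k; apply: measurable_funM => //; exact: (measurable_ip normE).
- exact: (measurable_ip normE).
have mS n : measurable_fun setT (fun w => \sum_(k < n) Num.sqrt (sigma (k%:R * tj N j / n%:R)) *:
         (W (k.+1%:R * tj N j / n%:R) w - W (k%:R * tj N j / n%:R) w) : borel H).
  apply: (measurable_coord normE sepH hzeta) => i _; under eq_fun do rewrite ip_sumr.
  apply: measurable_sum => k; under eq_fun do rewrite ipZr.
  apply: measurable_funM => //; apply: (measurable_ip normE); apply: msub; apply: mW;
    by rewrite divr_ge0// mulr_ge0//; case/andP: tjN.
apply: (@squeeze_cvge _ _ _ _ (cst 0%E) _ (fun p => (`|h| ^+ 2)%:E * \int[P]_w ((`|\sum_(k < nu p) Num.sqrt (sigma (k%:R * tj N j / (nu p)%:R)) *: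
         (W (k.+1%:R * tj N j / (nu p)%:R) w - W (k%:R * tj N j / (nu p)%:R) w) - M (tj N j) w| ^+ 2)%:E))%E).
- apply: nearW => p; rewrite integral_ge0/=; last by move=> x _; rewrite lee_fin sqr_ge0.
  rewrite -ge0_integralZl; last 4 first.
  + exact: measurableT.
  + by apply/measurable_EFinP; apply: measurable_funX; apply: measurable_norm; exact: (msub (mS _) mM).
  + by move=> x _; rewrite lee_fin sqr_ge0.
  + by rewrite lee_fin sqr_ge0.
  apply: ge0_le_integral => //.
  + by move=> x _; rewrite lee_fin sqr_ge0.
  + apply/measurable_EFinP; apply: measurable_funX; apply: measurable_funB; last exact: (measurable_ip normE).
    by apply: measurable_sum => k; apply: measurable_funM => //; exact: (measurable_ip normE).
  + apply: measurable_funeM; apply/measurable_EFinP; apply: measurable_funX; apply: measurable_norm; exact: (msub (mS _) mM).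
  + move=> w _; rewrite -EFinM lee_fin -exprMn -E -[leLHS]real_normK ?num_real//.
    rewrite ler_pXn2r ?nnegrE ?mulr_ge0//.
    have -> : \sum_(k < j * p.+1) Num.sqrt (sigma (k%:R * dt N p)) * ip h (incr N p k w) =
       ip h (\sum_(k < j * p.+1) Num.sqrt (sigma (k%:R * dt N p)) *: incr N p k w).
      by rewrite ip_sumr; apply: eq_bigr => k _; rewrite ipZr.
    by rewrite -ipBr; exact: (cauchy_schwarz normE).
- exact: cvg_cst.
- rewrite -[X in _ --> X](mule0 (`|h| ^+ 2)%:E); apply: cvgeZl => //.
  exact: (cvg_comp _ _ nuoo lM).
Unshelve. all: by end_near. Qed.

Let S N p w := \sum_(k < N.+1 * p.+1) a (tj N (k %/ p.+1)) * Num.sqrt (sigma (k%:R * dt N p)) * ip h (incr N p k w).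

Let SE N p w : S N p w = \sum_(j < N.+1) a (tj N j) *
  (\sum_(k < j.+1 * p.+1) Num.sqrt (sigma (k%:R * dt N p)) * ip h (incr N p k w)
  - \sum_(k < j * p.+1) Num.sqrt (sigma (k%:R * dt N p)) * ip h (incr N p k w)).
Proof.
rewrite (block_sum (fun j => a (tj N j)) (fun k => Num.sqrt (sigma (k%:R * dt N p)) * ip h (incr N p k w)))//.
by rewrite /S; apply: eq_bigr => k _; rewrite -mulrA.
Qed.

Let V N p := \sum_(k < N.+1 * p.+1) expR (B (tj N (k %/ p.+1))) * sigma (k%:R * dt N p) * dt N p.

Let kdt01 N p k : (k < N.+1 * p.+1)%N -> 0 <= k%:R * dt N p <= 1.
Proof.
move=> kN; rewrite mulr_ge0//= /dt mulrA ler_pdivrMr ?ltr0n ?muln_gt0// mul1r.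
by rewrite (le_trans (ler_wpM2l _ t1))// mulr1 ler_nat ltnW.
Qed.

Let a_sqr x : a x ^+ 2 = expR (B x).
Proof. by rewrite /a expr2 -expRD; congr expR; field. Qed.

Let S_cos_sin N p : \int[P]_w cos (S N p w) = expR (- (V N p * q / 2)) /\ \int[P]_w sin (S N p w) = 0.
Proof.
have [hc hs] := wiener_sum_cos_sin h (dt0 N p) (fun k => a (tj N (k %/ p.+1)) * Num.sqrt (sigma (k%:R * dt N p))) (N.+1 * p.+1)%N.
split; last by rewrite -[RHS]hs.
rewrite -[LHS]/(\int[P]_w cos (\sum_(k < N.+1 * p.+1) a (tj N (k %/ p.+1)) * Num.sqrt (sigma (k%:R * dt N p)) * ip h (incr N p k w))) hc.
have -> // : \sum_(k < N.+1 * p.+1) (a (tj N (k %/ p.+1)) * Num.sqrt (sigma (k%:R * dt N p))) ^+ 2 * dt N p = V N p.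
apply: eq_bigr => k _.
by rewrite exprMn a_sqr sqr_sqrtr// sigma_ge0// in_itv/= kdt01.
Qed.

Let v := expR (B t) - 1.

Let V_near e : 0 < e -> \forall N \near \oo, forall p, `|V N p - v| <= e.
Proof.
move=> e0.
have dE (x : R) : is_derive x 1 (fun x => expR (B x)) (sigma (clamp x) * expR (B x)).
  have d1 := dB x; have d2 := is_derive1_comp (is_derive_expR (B x)) d1.
  by apply: (is_derive_eq d2); rewrite mulrC.
have := variance_sum t01 cs dE e0; apply: filterS => N hN p.
have := hN p.+1 isT; rewrite B0 expR0 -/v; congr (`|_ - _| <= _).
apply: eq_bigr => k _.
have E : k%:R * t / (N.+1 * p.+1)%:R = k%:R * dt N p by rewrite /dt mulrA.
by rewrite /= E clamp_id ?kdt01.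
Qed.

(** Along almost every path the equation gives <h, M> as <h, Y> - <h, Y_0> plus a primitive of
    (sigma / 2) <h, Y>, and [discounted_sum] applies with the factor [a]. *)
Let Y_bochner M : (forall s, s \in `[0, 1] -> {ae P, forall w,
    is_bochner_integral ip (fun s => - (sigma s / 2) *: Y s w) 0 s (Y s w - Y 0 w - M s w)}) ->
  {ae P, forall w, (fun N => \sum_(j < N.+1) a (tj N j) * (ip h (M (tj N j.+1) w) - ip h (M (tj N j) w)))
    @ \oo --> a t * ip h (Y t w) - ip h (Y 0 w)}.
Proof.
move=> hM.
(* The exceptional set of the integral equation depends on the time; the grid times are countably
   many, so a single null set covers them all. *)
have A2 : {ae P, forall w, forall N j, (j <= N.+1)%N ->
    is_bochner_integral ip (fun s => - (sigma s / 2) *: Y s w) 0 (tj N j) (Y (tj N j) w - Y 0 w - M (tj N j) w)}.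
  apply: ae_foralln => N; apply: ae_foralln => j.
  have [jN|_] := leqP j N.+1; last by apply: aeW => w.
  have tjN : tj N j \in `[0, 1] by rewrite in_itv/= tj01.
  by apply: filterS (hM _ tjN) => w.
have [_ A1 _ _] := hY.
apply: (@filterS2 _ (almost_everywhere P) _ _ _ _ _ A1 A2) => w cY bY.
pose y x := ip h (Y (clamp x) w).
have cy : continuous y.
  move=> x; have := @continuous_comp_clamp R _ (fun s => Y s w) cY x => c1.
  exact: (continuous_comp c1 (@continuous_ip _ _ _ normE h _)).
have cf : continuous (fun x => sigma (clamp x) / 2 * y x).
  by move=> x; apply: cvgM; [apply: cvgMr_tmp; exact: cs|exact: cy].
have [|F dF F0] := exists_primitive cf.
  by move=> x x0; rewrite /y (clamp_le0 x0) clamp_le0.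
have nE x : 0 <= x <= 1 -> y x - y 0 + F x = y x - y 0 + F x by [].
have da (x : R) : is_derive x 1 a (sigma (clamp x) / 2 * a x).
  have d1 := dB x.
  have d0 : is_derive x 1 (fun x => B x / 2) (sigma (clamp x) / 2).
    by apply: is_derive_eq; rewrite /GRing.scale /=; ring.
  have d2 := @is_derive1_comp _ (@expR R) (fun x => B x / 2) x _ _ (is_derive_expR _) d0.
  by apply: (is_derive_eq d2); rewrite /a mulrC.
have cs2 : continuous (fun x => sigma (clamp x) / 2) by move=> x; apply: cvgMr_tmp; exact: cs.
have a0 : a 0 = 1 by rewrite /a B0 mul0r expR0.
have := discounted_sum t01 cs2 cy da dF a0 F0 nE.
have -> : y t = ip h (Y t w) by rewrite /y clamp_id// (ltW t0).
have y0E : y 0 = ip h (Y 0 w) by rewrite /y clamp_id// lexx ler01.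
rewrite y0E; apply: cvg_trans; apply: near_eq_cvg; apply: nearW => N.
have ME j : (j <= N.+1)%N -> ip h (M (tj N j) w) = y (tj N j) - y 0 + F (tj N j).
  move=> jN; have [_ _ /(_ h)] := bY N j jN; have /andP[tj0 tj1] := tj01 jN.
  have dNF (x : R) : is_derive x 1 (fun x => - F x) (- (sigma (clamp x) / 2 * y x)).
    by have d1 := dF x; exact: is_deriveN.
  rewrite (@Rintegral_primitive _ (fun x => - F x) (fun x => - (sigma (clamp x) / 2 * y x)) 0 (tj N j))//.
  - rewrite F0 oppr0 subr0 !ipBr y0E.
    have -> : y (tj N j) = ip h (Y (tj N j) w) by rewrite /y clamp_id// tj0.
    by move: (ip h _) (ip h _) (ip h _) => u1 u2 u3; lra.
  - by move=> x; apply: cvgN; exact: cf.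
  - by move=> x x01; rewrite ipZr mulNr /y clamp_id.
by apply: eq_bigr => j _; rewrite !ME ?y0E ?(ltnW (ltn_ord j))// ltnW// ltn_ord.
Qed.

Let X w := a t * ip h (Y t w) - ip h (Y 0 w).

(** Two limits in succession: at fixed [N] the sums [S N p] converge in mean square to [SN N] as [p]
    grows, then [SN N] converges almost surely to [X]. The variances [V N p] are close to [v]
    uniformly in [p], so the inner limit keeps the estimate. *)
Let trig_X (tr : R -> R) (F : borel H -> R) (C K : R) :
  measurable_fun setT F -> (forall x, `|F x| <= C) ->
  continuous tr -> (forall r, `|tr r| <= 1) -> (forall r u, `|tr r - tr u| <= `|r - u|) ->
  (forall N p, \int[P]_w (F (Y 0 w) * tr (S N p w)) = K * expR (- (V N p * q / 2))) ->
  \int[P]_w (F (Y 0 w) * tr (X w)) = K * expR (- (v * q / 2)).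
Proof.
move=> mF FC ct t1' tl hS; have [_ _ _ [M hM]] := hY.
have hM1 s : s \in `[0, 1] -> is_ito_integral P W (fun s => Num.sqrt (sigma s)) s (M s) by move=> /hM[].
have hM2 s : s \in `[0, 1] -> {ae P, forall w, is_bochner_integral ip (fun s => - (sigma s / 2) *: Y s w) 0 s (Y s w - Y 0 w - M s w)} by move=> /hM[].
have mY0 : measurable_fun setT (Y 0 : Omega -> borel H) by apply: mY; rewrite lexx ler01.
have mYt : measurable_fun setT (Y t : Omega -> borel H) by apply: mY; rewrite ltW.
have mF0 : measurable_fun setT (fun w => F (Y 0 w)) by exact: (measurableT_comp mF mY0).
have C0 : 0 <= C by apply: le_trans (FC point).
pose SN N w := \sum_(j < N.+1) a (tj N j) * (ip h (M (tj N j.+1) w) - ip h (M (tj N j) w)).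
have L2 N : L2_cvg P (S N) (SN N).
  have -> : S N = fun p w => \sum_(j < N.+1) a (tj N j) *
  (\sum_(k < j.+1 * p.+1) Num.sqrt (sigma (k%:R * dt N p)) * ip h (incr N p k w)
  + -1 * \sum_(k < j * p.+1) Num.sqrt (sigma (k%:R * dt N p)) * ip h (incr N p k w)).
    by apply/funext => p; apply/funext => w; rewrite SE; apply: eq_bigr => j _; rewrite mulN1r.
  have -> : SN N = fun w => \sum_(j < N.+1) a (tj N j) * (ip h (M (tj N j.+1) w) + -1 * ip h (M (tj N j) w)).
    by apply/funext => w; apply: eq_bigr => j _; rewrite mulN1r.
  apply: (@L2_cvg_sum _ _ _ P N.+1 (fun j p w => a (tj N j) *
  (\sum_(k < j.+1 * p.+1) Num.sqrt (sigma (k%:R * dt N p)) * ip h (incr N p k w)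
  + -1 * \sum_(k < j * p.+1) Num.sqrt (sigma (k%:R * dt N p)) * ip h (incr N p k w)))
   (fun j w => a (tj N j) * (ip h (M (tj N j.+1) w) + -1 * ip h (M (tj N j) w)))) => j jN.
  apply: L2_cvgZ; apply: L2_cvgD; first exact: (ito hM1 (N := N) jN).
  by apply: L2_cvgZ; exact: (ito hM1 (N := N) (ltnW jN)).
have mSN N : measurable_fun setT (SN N) by case: (L2 N).
set c := K * expR (- (v * q / 2)).
have lim1 N := L2_cvg_Rintegral ct t1' tl mF0 (fun w => FC _) (L2 N).
have lim2 : (fun N => \int[P]_w (F (Y 0 w) * tr (SN N w))) @ \oo --> c.
  apply/cvgrPdist_le => e e0.
  have cg : {for v, continuous (fun x : R => K * expR (- (x * q / 2)))}.
    apply: cvgMl_tmp; apply: continuous_comp; last exact: continuous_expR.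
    by apply: cvgN; apply: cvgMr_tmp; apply: cvgMr_tmp; exact: cvg_id.
  have /cvgrPdist_le/(_ _ e0)/nbhs_normP[r /= r0 hr] := cg.
  have r2 : 0 < r / 2 by rewrite divr_gt0.
  apply: filterS (V_near r2) => N hN.
  have h1 : (fun p => `|c - \int[P]_w (F (Y 0 w) * tr (S N p w))|) @ \oo --> `|c - \int[P]_w (F (Y 0 w) * tr (SN N w))|.
    by apply: cvg_norm; apply: cvgB; [exact: cvg_cst|exact: lim1].
  rewrite -(cvg_lim (@Rhausdorff R) h1); apply: limr_le; first by apply/cvg_ex; eexists; exact: h1.
  apply: nearW => p; rewrite hS; apply: hr => /=.
  by rewrite distrC (le_lt_trans (hN p))// ltr_pdivrMr// ltr_pMr// ltr1n.
apply: cvg_unique lim2 => //.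
have mtr u : measurable_fun setT u -> measurable_fun setT (fun w : Omega => tr (u w)).
  by move=> mu; exact: (measurableT_comp (continuous_measurable_fun ct) mu).
have mX : measurable_fun setT X.
  by apply: measurable_funB; [apply: measurable_funM => //|]; exact: (measurable_ip normE).
have [] := @Rdominated_convergence _ _ _ P setT measurableT (fun N w => F (Y 0 w) * tr (SN N w)) (fun w => F (Y 0 w) * tr (X w)) (cst C).
- by move=> N; apply: measurable_funM => //; exact: mtr.
- by apply: measurable_funM => //; exact: mtr.
- apply: filterS (Y_bochner hM2) => w hw _; apply: cvgM; first exact: cvg_cst.
  by apply: (continuous_cvg _ (ct _)); exact: hw.
- exact: finite_measure_integrable_cst.
- by apply: aeW => w N _; rewrite normrM -[leRHS]mulr1 ler_pM.
by move=> _; exact.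
Qed.

(** The factor [F] of the initial value is what makes this describe the joint law: it will be an
    indicator times a trigonometric function of [Y 0]. *)
Lemma sde_trig (F : borel H -> R) (C : R) : measurable_fun setT F -> (forall x, `|F x| <= C) ->
  \int[P]_w (F (Y 0 w) * cos (expR (B t / 2) * ip h (Y t w) - ip h (Y 0 w))) =
    (\int[P]_w F (Y 0 w)) * expR (- ((expR (B t) - 1) * ip (Q h) h / 2)) /\
  \int[P]_w (F (Y 0 w) * sin (expR (B t / 2) * ip h (Y t w) - ip h (Y 0 w))) = 0.
Proof.
move=> mF FC; split.
  apply: (trig_X mF FC (@continuous_cos R) (@cos_max R) cos_lipschitz) => N p.
  have [<- _] := S_cos_sin N p.
  exact: (wiener_sum_indep h (dt0 N p) (fun k => a (tj N (k %/ p.+1)) * Num.sqrt (sigma (k%:R * dt N p))) _ mF FC (@continuous_cos R) (@cos_max R)).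
transitivity (0 * expR (- (v * q / 2))); last by rewrite mul0r.
apply: (trig_X mF FC (@continuous_sin R) (@sin_max R) sin_lipschitz) => N p.
have [_ hs] := S_cos_sin N p; rewrite mul0r.
rewrite [LHS](wiener_sum_indep h (dt0 N p) (fun k => a (tj N (k %/ p.+1)) * Num.sqrt (sigma (k%:R * dt N p))) _ mF FC (@continuous_sin R) (@sin_max R)).
by rewrite -[X in _ * X]/(\int[P]_w sin (S N p w)) hs mulr0.
Qed.

End sde.

Section restricted_law.
Context d d' (T : measurableType d) (T' : measurableType d') (R : realType).
Variables (P : probability T R) (A : set T) (Y : T -> T').
Hypotheses (mA : measurable A) (mY : measurable_fun setT Y).

(** With [A] an event of the initial value, a joint law is encoded by these finite measures on a
    single space, where [char_unique] applies. *)
Definition restricted_law (B : set T') := P (A `&` Y @^-1` B).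

Let mYB B : measurable B -> measurable (Y @^-1` B).
Proof. by move=> mB; rewrite -[X in measurable X]setTI; exact: mY. Qed.

Let restricted_law0 : restricted_law set0 = 0%E.
Proof. by rewrite /restricted_law preimage_set0 setI0 measure0. Qed.

Let restricted_law_ge0 B : (0 <= restricted_law B)%E.
Proof. exact: measure_ge0. Qed.

Let restricted_law_sigma_additive : semi_sigma_additive restricted_law.
Proof.
move=> F mF tF mUF; rewrite /restricted_law preimage_bigcup setI_bigcupr.
apply: measure_semi_sigma_additive.
- by move=> n; apply: measurableI => //; exact: mYB.
- apply/trivIsetP => /= i j _ _ ij; rewrite setIACA -preimage_setI.
  by move/trivIsetP : tF => /(_ _ _ _ _ ij) ->//; rewrite preimage_set0 setI0.
- by apply: bigcupT_measurable => n; apply: measurableI => //; exact: mYB.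
Qed.

HB.instance Definition _ := isMeasure.Build _ _ _ restricted_law
  restricted_law0 restricted_law_ge0 restricted_law_sigma_additive.

Let restricted_law_fin : fin_num_fun restricted_law.
Proof. by move=> B mB; rewrite /restricted_law fin_num_measure//; apply: measurableI => //; exact: mYB. Qed.

HB.instance Definition _ := Measure_isFinite.Build _ _ _ restricted_law restricted_law_fin.

Definition restricted_law_measure : {finite_measure set T' -> \bar R} := restricted_law.

Lemma Rintegral_restricted_law (f : T' -> R) (C : R) : measurable_fun setT f ->
  (forall x, `|f x| <= C) ->
  \int[restricted_law_measure]_x f x = \int[P]_w (\1_A w * f (Y w)).
Proof.
move=> mf fC.
have PA : (P A < +oo)%E by rewrite -ge0_fin_numE// fin_num_measure.
pose n : {finite_measure set T -> \bar R} := mfrestr mA PA.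
have mfY : measurable_fun setT (f \o Y) by exact: measurableT_comp.
have ifY : n.-integrable setT (EFin \o (f \o Y)).
  by apply: (@bounded_integrable _ _ R n _ C) => // w; exact: fC.
have nE B : measurable B -> n B = (\int[P]_(w in B) (\1_A w)%:E)%E.
  by move=> mB; rewrite integral_indic//= /mfrestr /mrestr setIC.
transitivity (\int[n]_w f (Y w)).
  rewrite /Rintegral; congr fine.
  have := @integral_pushforward _ _ _ _ _ _ mY n setT (EFin \o f).
  rewrite preimage_setT => /(_ _ ifY measurableT) <-; last exact/measurable_EFinP.
  by apply: eq_measure_integral => B mB _; rewrite /pushforward /= /mfrestr /mrestr /restricted_law setIC.
rewrite /Rintegral (@integral_density _ _ _ n P _ _ _ nE _ ifY)//.
by congr fine; apply: eq_integral => w _; rewrite mulrC.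
Qed.

End restricted_law.

(** * Equality of the joint laws of the diffusion and of the interpolation *)

Section joint_law.
Context {R : realType} {H : completeNormedModType R}.
Variable ip : {dot H for idfun}.
Hypothesis normE : forall x : H, `|x| ^+ 2 = ip x x.
Hypothesis sepH : separable_space H.
Variables (I : pred nat) (zeta : nat -> H).
Hypothesis hzeta : orthonormal_basis ip I zeta.

Lemma restricted_char_unique d (T : measurableType d) (P : probability T R)
    d' (T' : measurableType d') (P' : probability T' R)
    (A : set T) (A' : set T') (Y : T -> borel H) (Y' : T' -> borel H) :
  measurable A -> measurable A' -> measurable_fun setT Y -> measurable_fun setT Y' ->
  (forall h, \int[P]_w (\1_A w * cos (ip h (Y w))) = \int[P']_w (\1_A' w * cos (ip h (Y' w)))) ->
  (forall h, \int[P]_w (\1_A w * sin (ip h (Y w))) = \int[P']_w (\1_A' w * sin (ip h (Y' w)))) ->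
  forall B, measurable B -> P (A `&` Y @^-1` B) = P' (A' `&` Y' @^-1` B).
Proof.
move=> mA mA' mY mY' hc hs B mB.
have mip h : measurable_fun setT (ip h : borel H -> R) := measurable_continuous_borel (continuous_ip normE h).
have mt (t : R -> R) h : continuous t -> measurable_fun setT (fun x : borel H => t (ip h x)).
  by move=> ct; exact: (measurableT_comp (continuous_measurable_fun ct)).
apply: (char_unique normE sepH hzeta (mu := restricted_law_measure P mA mY) (nu := restricted_law_measure P' mA' mY')) => // h.
  rewrite (Rintegral_restricted_law P mA mY (mt _ h (@continuous_cos R)) (fun x => cos_max _)).
  rewrite (Rintegral_restricted_law P' mA' mY' (mt _ h (@continuous_cos R)) (fun x => cos_max _)).
  exact: hc.
rewrite (Rintegral_restricted_law P mA mY (mt _ h (@continuous_sin R)) (fun x => sin_max _)).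
rewrite (Rintegral_restricted_law P' mA' mY' (mt _ h (@continuous_sin R)) (fun x => sin_max _)).
exact: hs.
Qed.

Variable Q : {linear H -> H}.
Hypothesis hQ : covariance_operator ip Q.
Variable sigma : R -> R.
Hypothesis sigma_ge0 : forall t, t \in `[0, 1] -> 0 <= sigma t.
Hypothesis sigma_continuous : {within `[0, 1], continuous sigma}.
Variable Pdata : probability (borel H) R.
Context (d : measure_display) (Omega : measurableType d) (P : probability Omega R).
Variables (W Y : R -> Omega -> H).
Hypothesis hW : Q_wiener ip P Q W.
Hypothesis hY0 : has_law P (Y 0) Pdata.
Hypothesis hY : sde_solution ip P sigma W Y.
Context (d' : measure_display) (Omega' : measurableType d') (P' : probability Omega' R).
Variables (Y'0 U : Omega' -> H).
Hypothesis hY'0 : has_law P' Y'0 Pdata.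
Hypothesis hU : gaussian_vector ip P' U 0 Q.
Hypothesis hindep : independent2 P' Y'0 U.

Let mY'0 : measurable_fun setT (Y'0 : Omega' -> borel H). Proof. by case: hY'0. Qed.
Let mU : measurable_fun setT (U : Omega' -> borel H). Proof. by case: hU. Qed.

Let hG : forall h (A : set R), measurable A -> law P' mU [set x | A (ip h x)] = gaussian1 0 (ip (Q h) h) A.
Proof. by move=> h A mA; rewrite lawE; have [_ /(_ h A mA)] := hU; rewrite ip0r. Qed.

Lemma measurable_interpolation t : measurable_fun setT (interpolation sigma Y'0 U t : Omega' -> borel H).
Proof.
exact: (measurable_lincomb normE sepH hzeta (@measurable_cst _ _ _ _ setT (Defs.eta sigma t)) (@measurable_cst _ _ _ _ setT (Num.sqrt (kappa sigma t))) mY'0 mU).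
Qed.

(** At the frequency [a *: h] with [a = eta t], the integrating factor [a^-1] cancels, and the noise
    variance becomes [(a ^- 2 - 1) * a ^+ 2 = kappa t] times <Q h, h>. Addition formulas split <h,
    Y_t> into its noise part and [ip (a *: h) (Y 0)], and <h, X_t> likewise; the terms containing
    the sine of the noise vanish on both sides. *)
Lemma sde_joint_law t : 0 < t <= 1 -> forall A B : set (borel H), measurable A -> measurable B ->
  P (Y 0 @^-1` A `&` Y t @^-1` B) = P' (Y'0 @^-1` A `&` interpolation sigma Y'0 U t @^-1` B).
Proof.
move=> t01 A B mA mB; have /andP[t0 t1] := t01; have t01' : 0 <= t <= 1 by rewrite ltW.
have [b [db b0 bI etaE kappaE]] := schedule_primitive sigma_continuous.
have mY s : 0 <= s <= 1 -> measurable_fun setT (Y s : Omega -> borel H).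
  by move=> s01; case: hY => + _ _ _; apply; rewrite in_itv.
have mY0 : measurable_fun setT (Y 0 : Omega -> borel H) by case: hY0.
have mpre (d1 : measure_display) (T : measurableType d1) (X : T -> borel H) C : measurable_fun setT X -> measurable C -> measurable (X @^-1` C).
  by move=> mX mC; rewrite -[X in measurable X]setTI; exact: mX.
have mip h : measurable_fun setT (ip h : borel H -> R) := measurable_continuous_borel (continuous_ip normE h).
have mt (s : R -> R) h : continuous s -> measurable_fun setT (fun x : borel H => s (ip h x)).
  by move=> ct; exact: (measurableT_comp (continuous_measurable_fun ct)).
pose F (s : R -> R) h (x : borel H) := \1_A x * s (ip h x).
have mF s h : continuous s -> measurable_fun setT (F s h).
  by move=> cs; apply: measurable_funM; [exact: measurable_indic|exact: mt].
have FC (s : R -> R) h x : (forall r, `|s r| <= 1) -> `|F s h x| <= 1.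
  by move=> s1; rewrite normrM mulr_ile1// indicE; case: (_ \in _); rewrite ?normr1 ?normr0.
pose a := expR (- (b t / 2)); have a_gt0 : 0 < a by exact: expR_gt0.
have aE : expR (b t / 2) = a^-1 by rewrite /a expRN invrK.
have kap : kappa sigma t = 1 - a ^+ 2.
  by rewrite kappaE// /a expr2 -expRD; congr (1 - expR _); field.
have kap0 : 0 <= kappa sigma t.
  have := bI 0 t (lexx _) (ltW t0) t1; rewrite b0 subr0 => bE.
  rewrite kappaE// subr_ge0 -[X in _ <= X]expR0 ler_expR oppr_le0 -bE.
  by apply: Rintegral_ge0 => // => x /=; rewrite in_itv/= => /andP[x0 xt]; rewrite sigma_ge0// in_itv/= x0 (le_trans xt).
have vE h : (expR (b t) - 1) * ip (Q (a *: h)) (a *: h) = kappa sigma t * ip (Q h) h.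
  rewrite [Q _]linearZ /= ipZl ipZr kap.
  have -> : expR (b t) = a^-1 ^+ 2 by rewrite -aE expr2 -expRD; congr expR; field.
  have vq (a0 q : R) : 0 < a0 -> (a0^-1 ^+ 2 - 1) * (a0 * (a0 * q)) = (1 - a0 ^+ 2) * q.
    by move=> a0_gt0; field; exact: lt0r_neq0.
  exact: vq.
have zE h w : expR (b t / 2) * ip (a *: h) (Y t w) - ip (a *: h) (Y 0 w) = ip h (Y t w) - ip (a *: h) (Y 0 w).
  by rewrite ipZl aE mulKf// lt0r_neq0.
have cs0 := @continuous_sin R. have cc0 := @continuous_cos R.
have iE s h : continuous s -> (forall r, `|s r| <= 1) -> \int[P]_w F s h (Y 0 w) = \int[P']_w F s h (Y'0 w).
  move=> cs s1.
  rewrite -(Rintegral_law_bounded P mY0 (mF s h cs) (fun x => FC s h x s1)).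
  rewrite -(Rintegral_law_bounded P' mY'0 (mF s h cs) (fun x => FC s h x s1)).
  rewrite /Rintegral; congr fine; apply: eq_measure_integral => C mC _.
  have [_ e1] := hY0; have [_ e2] := hY'0.
  by transitivity (Pdata C); [exact: e1|apply/esym; exact: e2].
pose K h := expR (- (kappa sigma t * ip (Q h) h / 2)).
have L s h : continuous s -> (forall r, `|s r| <= 1) ->
   \int[P]_w (F s (a *: h) (Y 0 w) * cos (ip h (Y t w) - ip (a *: h) (Y 0 w))) = \int[P']_w F s (a *: h) (Y'0 w) * K h /\
   \int[P]_w (F s (a *: h) (Y 0 w) * sin (ip h (Y t w) - ip (a *: h) (Y 0 w))) = 0.
  move=> cs s1.
  have := sde_trig normE sepH hQ hzeta sigma_ge0 sigma_continuous hW hY t01 (a *: h) db b0 (mF s (a *: h) cs) (fun x => FC s (a *: h) x s1).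
  rewrite vE -iE//.
  by under eq_Rintegral do rewrite zE; under [X in _ /\ X = _ -> _]eq_Rintegral do rewrite zE.
pose k := Num.sqrt (kappa sigma t).
have kE h : ip (Q (k *: h)) (k *: h) = kappa sigma t * ip (Q h) h.
  by rewrite [Q _]linearZ /= ipZl ipZr mulrA -expr2 sqr_sqrtr.
have L' s h : continuous s -> (forall r, `|s r| <= 1) ->
   \int[P']_w (F s (a *: h) (Y'0 w) * cos (ip (k *: h) (U w))) = \int[P']_w F s (a *: h) (Y'0 w) * K h /\
   \int[P']_w (F s (a *: h) (Y'0 w) * sin (ip (k *: h) (U w))) = 0.
  move=> cs s1; split.
    rewrite (Rintegral_indep mY'0 mU hindep (mF s (a *: h) cs) (mt _ (k *: h) cc0) (fun x => FC s (a *: h) x s1) (fun x => cos_max _)).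
    rewrite -(Rintegral_law_bounded P' mU (mt _ (k *: h) cc0) (fun x => cos_max _)).
    by rewrite (gaussian_cos normE hQ hG) kE.
  rewrite (Rintegral_indep mY'0 mU hindep (mF s (a *: h) cs) (mt _ (k *: h) cs0) (fun x => FC s (a *: h) x s1) (fun x => sin_max _)).
  rewrite -(Rintegral_law_bounded P' mU (mt _ (k *: h) cs0) (fun x => sin_max _)).
  by rewrite (gaussian_sin normE hQ hG) mulr0.
have comb d1 (T : measurableType d1) (PP : probability T R) (f g z : T -> R) :
    measurable_fun setT f -> measurable_fun setT g -> measurable_fun setT z ->
    (forall w, `|f w| <= 1) -> (forall w, `|g w| <= 1) ->
    \int[PP]_w (f w * cos (z w) - g w * sin (z w)) = \int[PP]_w (f w * cos (z w)) - \int[PP]_w (g w * sin (z w)) /\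
    \int[PP]_w (g w * cos (z w) + f w * sin (z w)) = \int[PP]_w (g w * cos (z w)) + \int[PP]_w (f w * sin (z w)).
  move=> mf mg mz f1 g1.
  have ip1 (u : T -> R) (s : R -> R) : measurable_fun setT u -> (forall w, `|u w| <= 1) -> continuous s -> (forall r, `|s r| <= 1) ->
      PP.-integrable setT (EFin \o (fun w => u w * s (z w))).
    move=> mu u1 cs s1; apply: (@bounded_integrable _ _ R PP _ 1).
      by apply: measurable_funM => //; exact: (measurableT_comp (continuous_measurable_fun cs) mz).
    by move=> w; rewrite normrM mulr_ile1.
  by split; [rewrite RintegralB|rewrite RintegralD]; rewrite ?ip1//; exact: (@cos_max R) || exact: (@sin_max R).
have mFX d1 (T : measurableType d1) (X : T -> borel H) s h : continuous s -> measurable_fun setT X -> measurable_fun setT (fun w => F s h (X w)).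
  by move=> cs mX; exact: (measurableT_comp (mF s h cs) mX).
have sm := @sin_max R. have cm := @cos_max R.
have mZ h : measurable_fun setT (fun w => ip h (Y t w) - ip (a *: h) (Y 0 w)).
  by apply: measurable_funB; apply: (measurable_ip normE) => //; exact: mY.
have mkU h : measurable_fun setT (fun w => ip (k *: h) (U w)) by exact: (measurable_ip normE).
have XE h w : ip h (interpolation sigma Y'0 U t w) = ip (a *: h) (Y'0 w) + ip (k *: h) (U w).
  by rewrite /interpolation etaE// ipDr !ipZr !ipZl.
apply: restricted_char_unique => //.
- exact: mpre.
- exact: mpre.
- exact: mY.
- exact: measurable_interpolation.
- move=> h.
  have [E1 _] := comb _ _ P (fun w => F cos (a *: h) (Y 0 w)) (fun w => F sin (a *: h) (Y 0 w)) _ (mFX _ _ _ _ (a *: h) cc0 mY0) (mFX _ _ _ _ (a *: h) cs0 mY0) (mZ h) (fun w => FC _ _ _ cm) (fun w => FC _ _ _ sm).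
  have [E2 _] := comb _ _ P' (fun w => F cos (a *: h) (Y'0 w)) (fun w => F sin (a *: h) (Y'0 w)) _ (mFX _ _ _ _ (a *: h) cc0 mY'0) (mFX _ _ _ _ (a *: h) cs0 mY'0) (mkU h) (fun w => FC _ _ _ cm) (fun w => FC _ _ _ sm).
  have [c1 _] := L cos h cc0 cm. have [_ s1] := L sin h cs0 sm.
  have [c2 _] := L' cos h cc0 cm. have [_ s2] := L' sin h cs0 sm.
  rewrite c1 s1 in E1; rewrite c2 s2 in E2; rewrite -E1 in E2.
  transitivity (\int[P]_w (F cos (a *: h) (Y 0 w) * cos (ip h (Y t w) - ip (a *: h) (Y 0 w)) - F sin (a *: h) (Y 0 w) * sin (ip h (Y t w) - ip (a *: h) (Y 0 w)))).
    apply: eq_Rintegral => w _; rewrite -{1}(subrK (ip (a *: h) (Y 0 w)) (ip h (Y t w))) cosD /F.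
    rewrite (_ : \1_(Y 0 @^-1` A) w = \1_A (Y 0 w))//.
    by move: (cos _) (sin _) (cos _) (sin _) (\1_A _) => x1 x2 x3 x4 x5; ring.
  rewrite -E2; apply: eq_Rintegral => w _; rewrite XE cosD /F.
  rewrite (_ : \1_(Y'0 @^-1` A) w = \1_A (Y'0 w))//.
  by move: (cos _) (sin _) (cos _) (sin _) (\1_A _) => x1 x2 x3 x4 x5; ring.
move=> h.
have [_ E1] := comb _ _ P (fun w => F cos (a *: h) (Y 0 w)) (fun w => F sin (a *: h) (Y 0 w)) _ (mFX _ _ _ _ (a *: h) cc0 mY0) (mFX _ _ _ _ (a *: h) cs0 mY0) (mZ h) (fun w => FC _ _ _ cm) (fun w => FC _ _ _ sm).
have [_ E2] := comb _ _ P' (fun w => F cos (a *: h) (Y'0 w)) (fun w => F sin (a *: h) (Y'0 w)) _ (mFX _ _ _ _ (a *: h) cc0 mY'0) (mFX _ _ _ _ (a *: h) cs0 mY'0) (mkU h) (fun w => FC _ _ _ cm) (fun w => FC _ _ _ sm).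
have [_ s1] := L cos h cc0 cm. have [c1 _] := L sin h cs0 sm.
have [_ s2] := L' cos h cc0 cm. have [c2 _] := L' sin h cs0 sm.
rewrite c1 s1 in E1; rewrite c2 s2 in E2; rewrite -E1 in E2.
transitivity (\int[P]_w (F sin (a *: h) (Y 0 w) * cos (ip h (Y t w) - ip (a *: h) (Y 0 w)) + F cos (a *: h) (Y 0 w) * sin (ip h (Y t w) - ip (a *: h) (Y 0 w)))).
  apply: eq_Rintegral => w _; rewrite -{1}(subrK (ip (a *: h) (Y 0 w)) (ip h (Y t w))) sinD /F.
  rewrite (_ : \1_(Y 0 @^-1` A) w = \1_A (Y 0 w))//.
  by move: (cos _) (sin _) (cos _) (sin _) (\1_A _) => x1 x2 x3 x4 x5; ring.
rewrite -E2; apply: eq_Rintegral => w _; rewrite XE sinD /F.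
rewrite (_ : \1_(Y'0 @^-1` A) w = \1_A (Y'0 w))//.
by move: (cos _) (sin _) (cos _) (sin _) (\1_A _) => x1 x2 x3 x4 x5; ring.
Qed.

End joint_law.

(** * Minimization of the score loss *)

(* The integral of a nonnegative function that is not assumed measurable is the
   supremum of the integrals of the simple functions below it. *)
Section lower_integral.
Context d (T : measurableType d) (R : realType).
Variable mu : {measure set T -> \bar R}.
Import HBNNSimple.
Local Open Scope ereal_scope.
Implicit Types f g : T -> \bar R.

Lemma lower_integral_le D f g : (forall x, D x -> 0 <= f x <= g x) ->
  \int[mu]_(x in D) f x <= \int[mu]_(x in D) g x.
Proof.
move=> fg; rewrite !ge0_integralE; last 2 first.
- by move=> x /fg /andP[f0 /(le_trans f0)].
- by move=> x /fg /andP[].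
apply: le_ereal_sup => _ [h /= hf <-]; exists h => // x; apply: (le_trans (hf x)).
rewrite !patchE; case: ifPn => //; rewrite inE => /fg /andP[_]; exact.
Qed.

(** A simple function below one integrand, set to 0 on the exceptional null set, lies below the
    other and has the same integral. *)
Lemma lower_integral_ae f g : (forall x, 0 <= f x) -> (forall x, 0 <= g x) ->
  {ae mu, forall x, f x = g x} -> \int[mu]_x f x = \int[mu]_x g x.
Proof.
have le f1 f2 : (forall x, 0 <= f1 x) -> (forall x, 0 <= f2 x) ->
    {ae mu, forall x, f1 x = f2 x} -> \int[mu]_x f1 x <= \int[mu]_x f2 x.
  move=> f10 f20 [N [mN N0 sN]]; rewrite (ge0_integralTE _ f10).
  apply: ge_ereal_sup => _ [h /= hf <-].
  have -> : sintegral mu h = \int[mu]_x ((h x * \1_(~` N) x)%:E).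
    rewrite -integralT_nnsfun; apply: ae_eq_integral => //.
    - exact/measurable_EFinP.
    - by apply/measurable_EFinP; apply: measurable_funM => //; apply: measurable_indic; exact: measurableC.
    exists N; split => // x /= /not_implyP[_]; apply: contra_notP => Nx.
    by rewrite indicE mem_set//= mulr1.
  apply: lower_integral_le => x _; rewrite lee_fin mulr_ge0//=.
  rewrite indicE; case: (boolP (x \in ~` N)) => [|_]; last by rewrite mulr0.
  rewrite inE mulr1 => /= Nx; have <- : f1 x = f2 x by apply: contra_notP Nx => /sN.
  exact: hf.
move=> f0 g0 fg; apply/eqP; rewrite eq_le !le//.
by apply: filterS fg => x.
Qed.

Lemma lower_integral_setU_le D1 D2 f : measurable D1 -> measurable D2 -> [disjoint D1 & D2] ->
  (forall x, 0 <= f x) ->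
  \int[mu]_(x in D1 `|` D2) f x <= \int[mu]_(x in D1) f x + \int[mu]_(x in D2) f x.
Proof.
move=> mD1 mD2 dD f0; rewrite ge0_integralE//; apply: ge_ereal_sup => _ [h /= hf <-].
have h0 x : ~ (D1 `|` D2) x -> h x = 0%R.
  move=> nx; apply/eqP; rewrite eq_le fun_ge0 andbT -lee_fin (le_trans (hf x))//.
  by rewrite patchE memNset.
rewrite -integralT_nnsfun.
have -> : \int[mu]_x (h x)%:E = \int[mu]_(x in D1 `|` D2) (h x)%:E.
  rewrite [RHS]integral_mkcond; apply: eq_integral => x _; rewrite patchE; case: ifPn => //.
  by rewrite notin_setE => /h0 ->.
rewrite ge0_integral_setU//; last 2 first.
- by apply/measurable_EFinP; exact: measurable_funTS.
- by move=> x _; rewrite lee_fin.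
apply: leeD; apply: lower_integral_le => x Dx; rewrite lee_fin fun_ge0/= (le_trans (hf x))//.
  by rewrite patchE mem_set//; left.
by rewrite patchE mem_set//; right.
Qed.

(** Measurability is assumed on [D2] only: a simple function below [f] on [D1], increased by [f]
    itself on [D2], stays below [f] on the union. *)
Lemma lower_integral_setU_ge D1 D2 f : measurable D1 -> measurable D2 -> [disjoint D1 & D2] ->
  (forall x, 0 <= f x) -> measurable_fun D2 f -> \int[mu]_(x in D2) f x < +oo ->
  \int[mu]_(x in D1) f x + \int[mu]_(x in D2) f x <= \int[mu]_(x in D1 `|` D2) f x.
Proof.
move=> mD1 mD2 dD f0 mf foo.
have ffin : \int[mu]_(x in D2) f x \is a fin_num by rewrite ge0_fin_numE// integral_ge0.
rewrite -leeBrDr// (ge0_integralE _ (D := D1))//; apply: ge_ereal_sup => _ [h /= hf <-].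
rewrite leeBrDr// -integralT_nnsfun [X in _ + X]integral_mkcond -ge0_integralD//; last 4 first.
- by move=> x _; rewrite lee_fin.
- exact/measurable_EFinP.
- by move=> x _; rewrite patchE; case: ifP.
- by apply/(measurable_restrictT _ mD2).
rewrite [leRHS]integral_mkcond; apply: lower_integral_le => x _.
apply/andP; split; first by rewrite adde_ge0// ?lee_fin// patchE; case: ifP.
have := hf x; rewrite !patchE in_setU.
case: (boolP (x \in D1)) => D1x /=; last first.
  move=> hx; have -> : h x = 0%R by apply/eqP; rewrite eq_le fun_ge0 andbT -lee_fin.
  by rewrite add0e.
case: (boolP (x \in D2)) => D2x; last by rewrite adde0.
by move/disj_setPS : dD => /(_ x) []; split; apply/set_mem.
Qed.

End lower_integral.

(** * First variation of a quadratic loss at a minimizer *)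

Section variation.
Context d1 d2 (T1 : measurableType d1) (T2 : measurableType d2) {R : realType}.
Variables (m : {finite_measure set T1 -> \bar R}) (P : probability T2 R).
Context {H : completeNormedModType R}.
Variable ip : {dot H for idfun}.
Hypothesis normE : forall x : H, `|x| ^+ 2 = ip x x.
Hypothesis sepH : separable_space H.
Variables (I : pred nat) (zeta : nat -> H).
Hypothesis hzeta : orthonormal_basis ip I zeta.
Variables (V X : T1 * T2 -> borel H).
Hypotheses (mV : measurable_fun setT V) (mX : measurable_fun setT X).
Hypothesis Vfin : (\int[m]_t \int[P]_w ((`|V (t, w) : H| ^+ 2)%:E) < +oo)%E.
Hypothesis Vmin : forall i l A (r : R), I i -> measurable A ->
  (\int[m]_t \int[P]_w ((`|V (t, w) : H| ^+ 2)%:E) <=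
   \int[m]_t \int[P]_w ((`|(V (t, w) : H) +
     (r * (\1_A t * \1_(cylset ip I zeta l) (X (t, w)))) *: zeta i| ^+ 2)%:E))%E.

Local Notation M := (m \x P)%E.

Let mnV : measurable_fun setT (fun z => `|V z : H|).
Proof. exact: measurable_norm. Qed.

Let mnV2 : measurable_fun setT (fun z => `|V z : H| ^+ 2).
Proof. exact: measurable_funX. Qed.

Let mip h : measurable_fun setT (fun z => ip h (V z)).
Proof. exact: (measurable_ip normE). Qed.

Let integrable_normV2 : M.-integrable setT (fun z => (`|V z : H| ^+ 2)%:E).
Proof.
apply/integrable12ltyP; first exact/measurable_EFinP.
apply: le_lt_trans Vfin; apply: lower_integral_le => t _; rewrite integral_ge0//=.
apply: lower_integral_le => w _.
by rewrite lee_fin (lee_fin (`|_|)) normr_ge0 ger0_norm ?sqr_ge0/=.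
Qed.

Let sqr_bound (x : R) : 0 <= x -> x <= 1 + x ^+ 2.
Proof. by move=> x0; have := sqr_ge0 (x - 1); nra. Qed.

Let integrable_dominated (f : T1 * T2 -> R) : measurable_fun setT f -> (forall z, `|f z| <= 1 + `|V z : H| ^+ 2) ->
  M.-integrable setT (EFin \o f).
Proof.
move=> mf fV; have i1 : M.-integrable setT (EFin \o cst 1).
  by apply: (@integrable_prod_bounded _ _ _ _ _ m P (cst 1) 1) => // z; rewrite normr1.
apply: (le_integrable measurableT _ _ (integrableD measurableT i1 integrable_normV2)).
  exact/measurable_EFinP.
move=> z _ /=; rewrite lee_fin (le_trans (fV z))// ger0_norm// addr_ge0// sqr_ge0.
Qed.

Let C l := cylset ip I zeta l.

Let mC l : measurable_fun setT (fun z => \1_(C l) (X z) : R).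
Proof. by apply: (measurableT_comp _ mX); apply: measurable_indic; exact: (measurable_cylset normE sepH hzeta). Qed.

Let indic_bound T (A : set T) x : 0 <= (\1_A x : R) <= 1.
Proof. by rewrite indicE; case: (_ \in _); rewrite ?lexx ?ler01. Qed.

Let zeta1 i : I i -> `|zeta i| = 1.
Proof.
move=> Ii; have := normE (zeta i); rewrite (orthonormal_ip hzeta)// eqxx => /eqP.
by rewrite sqrf_eq1 => /orP[/eqP //|/eqP n1]; have := normr_ge0 (zeta i); rewrite n1 lerNr oppr0 ler10.
Qed.

Let ipV_bound i z : I i -> `|ip (zeta i) (V z)| <= 1 + `|V z : H| ^+ 2.
Proof.
by move=> Ii; rewrite (le_trans (cauchy_schwarz normE _ _))// zeta1// mul1r sqr_bound.
Qed.

Let g i l z := \1_(C l) (X z) * ip (zeta i) (V z).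

Let mg i l : measurable_fun setT (g i l). Proof. exact: measurable_funM. Qed.

Let g_bound i l z : I i -> `|g i l z| <= 1 + `|V z : H| ^+ 2.
Proof.
move=> Ii; have /andP[c0 c1] := indic_bound (C l) (X z).
rewrite /g normrM ger0_norm// (le_trans _ (ipV_bound z Ii))//.
by rewrite ler_piMl.
Qed.

(** Perturbing by [r] times an indicator along [zeta i] changes the loss by
    [2 * r * G + r ^+ 2 * pp]. This is nonnegative for every real [r] only if the linear coefficient
    vanishes. *)
Let integral_variation i l A : I i -> measurable A -> \int[M]_z (\1_A z.1 * g i l z) = 0.
Proof.
move=> Ii mA; pose p z : R := \1_A z.1 * \1_(C l) (X z).
have mA1 : measurable_fun setT (fun z : T1 * T2 => \1_A z.1 : R).
  by apply: (measurableT_comp _ measurable_fst); exact: measurable_indic.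
have mp : measurable_fun setT p by exact: measurable_funM.
have p01 z : 0 <= p z <= 1.
  have /andP[c0 c1] := indic_bound (C l) (X z); have /andP[a0 a1] := indic_bound A z.1.
  by rewrite /p mulr_ge0//= mulr_ile1.
have ip_ : M.-integrable setT (EFin \o p).
  by apply: (@integrable_prod_bounded _ _ _ _ _ m P p 1) => // z; have /andP[p0 p1] := p01 z; rewrite ger0_norm.
have ig : M.-integrable setT (EFin \o (fun z => \1_A z.1 * g i l z)).
  apply: integrable_dominated; first by apply: measurable_funM.
  move=> z; rewrite normrM (le_trans _ (g_bound l z Ii))//.
  by have /andP[a0 a1] := indic_bound A z.1; rewrite (ger0_norm a0) ler_piMl.
have expand r z : `|(V z : H) + (r * p z) *: zeta i| ^+ 2 = `|V z : H| ^+ 2 + (2 * r * (\1_A z.1 * g i l z) + r ^+ 2 * p z).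
  rewrite normE ipDl !ipDr !ipZr !ipZl -normE (ipC ip (V z)) (orthonormal_ip hzeta)// eqxx.
  have pp : p z * p z = p z.
    by rewrite /p !indicE; case: (_ \in _); case: (_ \in _); rewrite ?(mulr1, mulr0).
  have -> : \1_A z.1 * g i l z = p z * ip (zeta i) (V z) by rewrite /g mulrA.
  rewrite expr2 -{6}pp (_ : true%:R = 1)//.
  by move: (ip _ _) (`|V z : H|) (p z) => x1 x2 x3; ring.
have fubE (f : T1 * T2 -> R) : measurable_fun setT f -> (forall z, 0 <= f z) -> (\int[m]_t \int[P]_w (f (t, w))%:E = \int[M]_z (f z)%:E)%E.
  by move=> mf f0; rewrite (@fubini_tonelli1 _ _ _ _ _ m P (EFin \o f))//; exact/measurable_EFinP.
set G := \int[M]_z (\1_A z.1 * g i l z); pose pp := \int[M]_z p z.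
have pp0 : 0 <= pp by apply: Rintegral_ge0 => z _; have /andP[] := p01 z.
have key r : 0 <= 2 * r * G + r ^+ 2 * pp.
  have := Vmin l r Ii mA.
  rewrite (fubE (fun z => `|V z : H| ^+ 2))//.
  rewrite (fubE (fun z => `|(V z : H) + (r * p z) *: zeta i| ^+ 2)); last 2 first.
  - under eq_fun do rewrite expand; apply: measurable_funD => //; apply: measurable_funD; apply: measurable_funM => //.
    by apply: measurable_funM.
  - by move=> z; rewrite sqr_ge0.
  have i2 : M.-integrable setT (EFin \o (fun z => 2 * r * (\1_A z.1 * g i l z))).
    by have := integrableZl measurableT (2 * r) ig; apply: eq_integrable.
  have i3 : M.-integrable setT (EFin \o (fun z => r ^+ 2 * p z)).
    by have := integrableZl measurableT (r ^+ 2) ip_; apply: eq_integrable.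
  have i4 : M.-integrable setT (EFin \o (fun z => 2 * r * (\1_A z.1 * g i l z) + r ^+ 2 * p z)).
    by have := integrableD measurableT i2 i3; apply: eq_integrable.
  have i5 : M.-integrable setT (EFin \o (fun z => `|V z : H| ^+ 2 + (2 * r * (\1_A z.1 * g i l z) + r ^+ 2 * p z))).
    by have := integrableD measurableT integrable_normV2 i4; apply: eq_integrable.
  under [X in (_ <= X)%E]eq_integral do rewrite expand.
  rewrite -(fineK (integrable_fin_num measurableT integrable_normV2)) -(fineK (integrable_fin_num measurableT i5)) lee_fin.
  rewrite -/(Rintegral _ _ _) -/(Rintegral _ _ _) RintegralD// lerDl RintegralD//.
  by rewrite RintegralZl// RintegralZl.
have p1 : 0 < pp + 1 by rewrite ltr_wpDl.
(* Nearly the minimizer [- G / pp] of the parabola; adding 1 avoids dividing by 0 when the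
   perturbation is null. *)
have := key (- G / (pp + 1)).
have -> : 2 * (- G / (pp + 1)) * G + (- G / (pp + 1)) ^+ 2 * pp = - (G ^+ 2 * (pp + 2) / (pp + 1) ^+ 2).
  by field; exact: lt0r_neq0.
rewrite oppr_ge0 => h; apply/eqP; rewrite -sqrf_eq0 eq_le sqr_ge0 andbT.
by move: h; rewrite pmulr_lle0 ?invr_gt0 ?exprn_gt0// pmulr_lle0// ltr_wpDl.
Qed.

Let ae_variation i l : I i -> {ae m, forall t, (\int[P]_w (g i l (t, w))%:E = 0)%E}.
Proof.
move=> Ii; have ig : M.-integrable setT (EFin \o g i l).
  by apply: integrable_dominated => // z; exact: g_bound.
have ic := integrable_fubini_F ig.
have : ae_eq m setT (fubini_F P (EFin \o g i l)) (cst 0%E).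
  apply: integral_ae_eq => // E _ mE; rewrite integral0.
  have igE : M.-integrable setT (EFin \o (fun z => \1_E z.1 * g i l z)).
    apply: integrable_dominated.
      by apply: measurable_funM => //; apply: (measurableT_comp _ measurable_fst); exact: measurable_indic.
    move=> z; rewrite normrM (le_trans _ (g_bound l z Ii))//.
    by have /andP[a0 a1] := indic_bound E z.1; rewrite (ger0_norm a0) ler_piMl.
  have := integral_variation l Ii mE; rewrite /Rintegral -(integral12_prod_meas1 igE) => F0.
  transitivity (\int[m]_t fubini_F P (EFin \o (fun z : T1 * T2 => (\1_E z.1 * g i l z)%R)) t)%E.
    rewrite integral_mkcond; apply: eq_integral => t _; rewrite patchE /fubini_F /=.
    case: ifPn => tE.
      by apply: eq_integral => w _ /=; rewrite indicE tE mul1r.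
    by rewrite integral0_eq// => w _; rewrite indicE (negbTE tE) mul0r.
  by rewrite -[LHS]fineK ?F0//; apply: integrable_fin_num => //; exact: integrable_fubini_F.
by apply: filterS => t /(_ Logic.I).
Qed.

(** The null set of times must not depend on the direction or the event. It is obtained from the
    countably many pairs of a basis vector and a cylinder, encoded by [pickle]; all Borel events
    then follow from the pi-system argument, and all [h] from the basis expansion by dominated
    convergence. *)
Lemma minimizer_orthogonal : {ae m, forall t,
  P.-integrable setT (fun w => (`|V (t, w) : H|)%:E) /\
  forall h B, measurable B -> \int[P]_(w in (fun w => X (t, w)) @^-1` B) ip h (V (t, w)) = 0}.
Proof.
have A1 := ae_integrable1 integrable_normV2.
have A2 : {ae m, forall t, forall k, let: il := odflt (0%N, [::]) (unpickle k) in
    I il.1 -> (\int[P]_w (g il.1 il.2 (t, w))%:E = 0)%E}.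
  apply: ae_foralln => k; case: (odflt _ _) => i l /=.
  have [Ii|nI] := boolP (I i); last by apply: aeW => t.
  by apply: filterS (ae_variation l Ii).
apply: (@filterS2 _ (almost_everywhere m) _ _ _ _ _ A1 A2) => t iV2 hg.
have mX' : measurable_fun setT (fun w => X (t, w)) by exact: measurableT_comp.
have mV' : measurable_fun setT (fun w => V (t, w)) by exact: measurableT_comp.
have mip' h : measurable_fun setT (fun w => ip h (V (t, w))) by exact: (measurable_ip normE).
have mnV' : measurable_fun setT (fun w => `|V (t, w) : H|) by exact: measurable_norm.
have iV : P.-integrable setT (fun w => (`|V (t, w) : H|)%:E).
  have i1 : P.-integrable setT (cst 1%:E) by exact: finite_measure_integrable_cst.
  apply: (le_integrable measurableT _ _ (integrableD measurableT i1 iV2)); first exact/measurable_EFinP.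
  move=> w _ /=; rewrite lee_fin normr_id ger0_norm ?addr_ge0 ?sqr_ge0//.
  exact: sqr_bound.
split=> // h B mB.
have iip h' : P.-integrable setT (EFin \o (fun w => ip h' (V (t, w)))).
  have := integrableZl measurableT `|h'| iV; apply: le_integrable => //; first exact/measurable_EFinP.
  by move=> w _ /=; rewrite lee_fin normrM !normr_id; exact: (cauchy_schwarz normE).
have mXB : measurable ((fun w => X (t, w)) @^-1` B) by rewrite -[X in measurable X]setTI; exact: mX'.
have coord i : I i -> \int[P]_(w in (fun w => X (t, w)) @^-1` B) ip (zeta i) (V (t, w)) = 0.
  move=> Ii; rewrite /Rintegral (integral0_cylset normE sepH hzeta (X := fun w => X (t, w)))// => l.
  have := hg (pickle (i, l)); rewrite pickleK /= => /(_ Ii) <-.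
  rewrite integral_mkcond; apply: eq_integral => w _; rewrite patchE /g indicE.
  rewrite (_ : (w \in (fun w => X (t, w)) @^-1` cylset ip I zeta l) = (X (t, w) \in C l))//.
  by case: (_ \in C l); rewrite ?mul1r ?mul0r.
have [] := @Rdominated_convergence _ _ _ P _ mXB
  (fun n w => \sum_(i < n | I i) ip (zeta i) h * ip (zeta i) (V (t, w))) (fun w => ip h (V (t, w))) (fun w => `|h| * `|V (t, w) : H|).
- move=> n; apply: measurable_funTS; under eq_fun do rewrite big_mkcond.
  by apply: measurable_sum => i; case: (I i) => //; exact: measurable_funM.
- exact: measurable_funTS.
- by apply: aeW => w _; exact: (ip_expand normE hzeta).
- have := integrableZl measurableT `|h| iV; apply: (integrableS measurableT) => //.
- apply: aeW => w n _.
  have -> : \sum_(i < n | I i) ip (zeta i) h * ip (zeta i) (V (t, w)) = ip (\sum_(i < n | I i) ip (zeta i) h *: zeta i) (V (t, w)).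
    by rewrite ip_suml; apply: eq_bigr => i _; rewrite ipZl.
  rewrite (le_trans (cauchy_schwarz normE _ _))// ler_wpM2r//.
  have := norm_orthonormal_sum normE hzeta 0 n (fun i => ip (zeta i) h); rewrite !big_mkord => nE.
  rewrite -(ler_pXn2r (ltn0Sn 1)) ?nnegrE// nE.
  exact: (bessel_basis normE hzeta).
move=> _ lim; apply/esym; apply: (cvg_unique _ _ lim) => //.
rewrite (_ : (fun n => _) = cst 0); first exact: cvg_cst.
apply/funext => n /=.
have kE n' w : \sum_(i < n' | I i) ip (zeta i) h * ip (zeta i) (V (t, w)) = ip (\sum_(i < n' | I i) ip (zeta i) h *: zeta i) (V (t, w)).
  by rewrite ip_suml; apply: eq_bigr => i _; rewrite ipZl.
under eq_Rintegral do rewrite kE.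
elim: n => [|n IH].
  by under eq_Rintegral do rewrite big_ord0 ip0l; rewrite Rintegral_cst// mul0r.
rewrite big_mkcond big_ord_recr -big_mkcond /=.
have [Ii|nI] := boolP (I n); last by rewrite addr0.
have iS h' : P.-integrable ((fun w => X (t, w)) @^-1` B) (EFin \o (fun w => ip h' (V (t, w)))).
  exact: (integrableS measurableT mXB _ (iip h')).
under eq_Rintegral do rewrite ipDl.
by rewrite RintegralD// IH add0r; under eq_Rintegral do rewrite ipZl; rewrite RintegralZl// coord// mulr0.
Qed.

End variation.

(** * The loss at a fixed time, given the initial value *)

Section conditional_law.
Context {R : realType} {H : completeNormedModType R}.
Variable ip : {dot H for idfun}.
Hypothesis normE : forall x : H, `|x| ^+ 2 = ip x x.
Hypothesis sepH : separable_space H.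
Variable Q : {linear H -> H}.
Hypothesis hQ : covariance_operator ip Q.
Variables (I : pred nat) (zeta : nat -> H) (lam : nat -> R).
Hypothesis hzeta : orthonormal_basis ip I zeta.
Hypothesis hlam : forall i, I i -> Q (zeta i) = lam i *: zeta i.
Variable Pdata : probability (borel H) R.
Context (d : measure_display) (Omega : measurableType d) (P : probability Omega R).
Variables (X0 U : Omega -> H).
Hypothesis hX0 : has_law P X0 Pdata.
Hypothesis hU : gaussian_vector ip P U 0 Q.
Hypothesis hindep : independent2 P X0 U.
Variables (e k : R) (K : R.-pker (borel H) ~> (borel H)).
Let X w := e *: X0 w + k *: U w.
Hypothesis hK : forall A B : set (borel H), measurable A -> measurable B ->
  P (X0 @^-1` A `&` X @^-1` B) = (\int[Pdata]_(y in A) K y B)%E.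

Let mX0 : measurable_fun setT (X0 : Omega -> borel H). Proof. by case: hX0. Qed.
Let mU : measurable_fun setT (U : Omega -> borel H). Proof. by case: hU. Qed.

Let G := law P mU.

Let hG : forall h (A : set R), measurable A -> G [set x | A (ip h x)] = gaussian1 0 (ip (Q h) h) A.
Proof. by move=> h A mA; rewrite lawE; have [_ /(_ h A mA)] := hU; rewrite ip0r. Qed.

Let lawX0 A : measurable A -> law P mX0 A = Pdata A.
Proof. by move=> mA; have [_ h] := hX0; exact: h. Qed.

Let T2 := (borel H * borel H)%type.

Let mcomb : measurable_fun setT (fun z : T2 => e *: (z.1 : H) + k *: (z.2 : H) : borel H).
Proof. exact: (measurable_lincomb normE sepH hzeta (@measurable_cst _ _ _ _ setT e) (@measurable_cst _ _ _ _ setT k) measurable_fst measurable_snd). Qed.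

Let maff y : measurable_fun setT (fun u : borel H => e *: (y : H) + k *: (u : H) : borel H).
Proof. by have := measurable_affine normE sepH hzeta (e *: y) k. Qed.

Let K1 y : K y setT = 1%E. Proof. exact: prob_kernel. Qed.

Let uniq_cylset (mu nu : {measure set (borel H) -> \bar R}) : (mu setT < +oo)%E ->
  (forall l, mu (cylset ip I zeta l) = nu (cylset ip I zeta l)) ->
  forall B, measurable B -> mu B = nu B.
Proof.
move=> muoo h; apply: (measure_unique (range (cylset ip I zeta)) (fun=> setT)) => //.
- exact: (borel_cylset normE sepH hzeta).
- exact: setI_closed_cylset.
- by move=> _; exists [::] => //; rewrite cylset_nil.
- by rewrite bigcup_const.
- by move=> _ [l _ <-]; exact: h.
Qed.

(** Uniqueness of regular conditional laws: both kernels integrate to the joint law over every event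
    [A], so on each cylinder they agree for almost every [y], and countably many cylinders determine
    a measure. *)
Lemma conditional_law_affine : {ae Pdata, forall y : borel H, forall B : set (borel H), measurable B ->
  K y B = G [set u | B (e *: (y : H) + k *: (u : H))]}.
Proof.
have key l : {ae Pdata, forall y : borel H, K y (cylset ip I zeta l) = G [set u | cylset ip I zeta l (e *: (y : H) + k *: (u : H))]}.
  have mB := measurable_cylset normE sepH hzeta l.
  set B := cylset _ _ _ _ in mB *.
  pose F (z : T2) : \bar R := (\1_B (e *: (z.1 : H) + k *: (z.2 : H)))%:E.
  have mF : measurable_fun setT F.
    by apply/measurable_EFinP; apply: (measurableT_comp _ mcomb); exact: measurable_indic.
  have F0 z : (0 <= F z)%E by rewrite lee_fin indicE.
  have FE y : (\int[G]_u F (y, u))%E = G [set u | B (e *: (y : H) + k *: (u : H))].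
    rewrite -[X in _ = G X]setIT -integral_indic//; last by have := maff y measurableT mB; rewrite setTI.
  have mG : measurable_fun setT (fun y : borel H => G [set u | B (e *: (y : H) + k *: (u : H))]).
    under eq_fun do rewrite -FE.
    have mFF := @measurable_fun_fubini_tonelli_F _ _ (borel H) (borel H) R G F mF F0.
    exact: mFF.
  have mKB : measurable_fun setT (K ^~ B) by exact: measurable_kernel.
  have : ae_eq Pdata setT (K ^~ B) (fun y : borel H => G [set u | B (e *: (y : H) + k *: (u : H))]).
    apply: integral_ae_eq => //.
      apply/integrableP; split => //.
      apply: (@le_lt_trans _ _ (\int[Pdata]_y 1)%E).
        apply: ge0_le_integral => //.
        - exact: measurableT_comp.
        - by move=> y _; rewrite gee0_abs// -(K1 y) le_measure ?inE.
      by rewrite integral_cst// mul1e (le_lt_trans (probability_le1 _ measurableT)) ?ltry.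
    move=> A _ mA; rewrite -hK//.
    rewrite [RHS]integral_mkcond.
    transitivity (\int[Pdata]_y \int[G]_u ((\1_A y)%:E * F (y, u)))%E; last first.
      apply: eq_integral => y _; rewrite patchE ge0_integralZl//; last exact: (measurableT_comp mF).
      by rewrite FE indicE; case: (_ \in A); rewrite ?mul1e ?mul0e.
    transitivity (\int[law P mX0]_y \int[G]_u ((\1_A y)%:E * F (y, u)))%E; last first.
      by apply: eq_measure_integral => C mC _; exact: lawX0.
    rewrite -(ge0_integral_indep mX0 mU hindep (F := fun z : T2 => ((\1_A z.1)%:E * F z)%E)); last 2 first.
    - apply: emeasurable_funM => //; apply/measurable_EFinP.
      by apply: (measurableT_comp _ measurable_fst); exact: measurable_indic.
    - by move=> z; rewrite mule_ge0// lee_fin indicE.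
    rewrite -[X in P X]setIT -integral_indic//; last first.
      apply: measurableI; first by rewrite -[X in measurable X]setTI; exact: mX0.
      have mX : measurable_fun setT (X : Omega -> borel H).
        exact: (measurableT_comp mcomb (measurable_fun_pair mX0 mU)).
      by rewrite -[X in measurable X]setTI; exact: mX.
    by apply: eq_integral => w _; rewrite indicI /F -EFinM.
  move=> AE; apply: (@filterS _ (almost_everywhere Pdata) _ _ _ _ AE) => y; exact.
have : {ae Pdata, forall y : borel H, forall j, let l := odflt [::] (unpickle j) : seq (nat * rat) in
    K y (cylset ip I zeta l) = G [set u | cylset ip I zeta l (e *: (y : H) + k *: (u : H))]}.
  by apply: ae_foralln => j; exact: key.
apply: filterS => y hy B mB.
have -> : G [set u | B (e *: (y : H) + k *: (u : H))] = law G (maff y) B by [].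
apply: (uniq_cylset (mu := K y) (nu := law G (maff y))) => // [|l]; first by rewrite K1 ltry.
by have := hy (pickle l); rewrite pickleK.
Qed.

(** Given [y], the substitution [x = e *: y + k *: u] turns the logarithmic gradient into
    [- k^-1 *: u]. As it is selected separately for each [K y], the inner integral has no evident
    measurability in [y]; equality for almost every [y] suffices for lower integrals. *)
Lemma score_loss_conditional (S : borel H -> borel H) : 0 < k -> measurable_fun setT S ->
  (\int[Pdata]_y \int[K y]_x
     ((`|(S x : H) - log_gradient ip Q I zeta lam (K y) x| ^+ 2)%:E) =
   \int[P]_w ((`|(S (X w) : H) + k^-1 *: U w| ^+ 2)%:E))%E.
Proof.
move=> k0 mS.
pose F (z : T2) : \bar R := (`|(S (e *: (z.1 : H) + k *: (z.2 : H)) : H) + k^-1 *: (z.2 : H)| ^+ 2)%:E.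
have madd d1 (T : measurableType d1) (f g : T -> borel H) c : measurable_fun setT f -> measurable_fun setT g ->
    measurable_fun setT (fun x => (f x : H) + c *: (g x : H) : borel H).
  move=> mf mg; apply: (measurable_coord normE sepH hzeta) => i _.
  under eq_fun do rewrite ipDr ipZr.
  by apply: measurable_funD; [|apply: measurable_funM => //]; exact: (measurable_ip normE).
have mF : measurable_fun setT F.
  apply/measurable_EFinP; apply: measurable_funX; apply: measurable_norm; apply: madd => //.
  exact: (measurableT_comp mS mcomb).
have F0 z : (0 <= F z)%E by rewrite lee_fin sqr_ge0.
transitivity (\int[P]_w F (X0 w, U w))%E; last by [].
rewrite (ge0_integral_indep mX0 mU hindep mF F0).
transitivity (\int[Pdata]_y \int[G]_u F (y, u))%E; last first.
  by apply: eq_measure_integral => C mC _; apply/esym; exact: lawX0.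
apply: lower_integral_ae.
- by move=> y; apply: integral_ge0 => x _; rewrite lee_fin sqr_ge0.
- by move=> y; exact: integral_ge0.
apply: filterS conditional_law_affine => y hy.
have [mL LE] := log_gradient_gaussian normE sepH hQ hzeta hlam hG k0 hy.
set L := log_gradient _ _ _ _ _ _ in mL LE *.
have mSL : measurable_fun setT (fun x : borel H => (`|(S x : H) - L x| ^+ 2)%:E).
  apply/measurable_EFinP; apply: measurable_funX; apply: measurable_norm.
  have := madd _ _ S L (-1) mS mL; congr (measurable_fun _ _).
  by apply/funext => x; rewrite scaleN1r.
transitivity (\int[law G (maff y)]_x (`|(S x : H) - L x| ^+ 2)%:E)%E.
  by apply: eq_measure_integral => C mC _; exact: hy.
rewrite (ge0_integral_law G (maff y) mSL); last by move=> x; rewrite lee_fin sqr_ge0.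
apply: ae_eq_integral => //.
- exact: (measurableT_comp mSL (maff y)).
- exact: measurableT_comp.
by apply: (@filterS _ (almost_everywhere G) _ _ _ _ LE) => u uE _; rewrite uE /F /= scaleNr opprK.
Qed.

End conditional_law.

(** * The velocity of the interpolation *)

Section schedule.
Context {R : realType}.
Local Notation leb := (@lebesgue_measure R).
Variable sigma : R -> R.
Hypothesis sigma_ge0 : forall t, t \in `[0, 1] -> 0 <= sigma t.
Hypothesis sigma_continuous : {within `[0, 1], continuous sigma}.

Lemma primitive_nondecreasing (B : R -> R) : (forall x : R, is_derive x 1 B (sigma (clamp x))) ->
  forall x y, x <= y -> B x <= B y.
Proof.
move=> dB x y xy.
apply: (@ger0_derive1_ndecr _ B x y) => //.
- by move=> z _; rewrite derive1E; have [_ ->] := dB z; rewrite sigma_ge0// in_itv/= clamp01.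
- by apply: continuous_subspaceT => z; exact: (is_derive_continuous dB).
Qed.

Lemma kappa_ge0 t : 0 <= t <= 1 -> 0 <= kappa sigma t.
Proof.
have [B [dB B0 _ _ kE]] := schedule_primitive sigma_continuous.
move=> t01; rewrite kE// subr_ge0 -[X in _ <= X]expR0 ler_expR oppr_le0 -B0.
by apply: (primitive_nondecreasing dB); case/andP: t01.
Qed.

Let primitive_kappa0 (B : R -> R) t : (forall t, 0 <= t <= 1 -> kappa sigma t = 1 - expR (- B t)) ->
  0 <= t <= 1 -> kappa sigma t = 0 -> B t = 0.
Proof.
move=> kE t01; rewrite kE// => /eqP; rewrite subr_eq0 eq_sym -expR0 => /eqP/expR_inj/eqP.
by rewrite oppr_eq0 => /eqP.
Qed.

(** [kappa t = 0] means [B t = 0], the minimum of the nondecreasing [B] on the positive half-line,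
    so that its derivative [sigma t] vanishes. *)
Lemma kappa_eq0_sigma t : 0 < t <= 1 -> kappa sigma t = 0 -> sigma t = 0.
Proof.
have [B [dB B0 _ _ kE]] := schedule_primitive sigma_continuous.
move=> /andP[t0 t1] k0; have t01 : 0 <= t <= 1 by rewrite ltW.
have Bt := primitive_kappa0 kE t01 k0.
have d0 : is_derive t 1 B 0.
  (* The interval ]0, 2[ has [t = 1] in its interior; [B] lives on the whole line thanks to
     [clamp]. *)
  apply: (@derive1_at_min _ B 0 2) => //.
  - by rewrite in_itv/= t0 (le_lt_trans t1)// ltr1n.
  - move=> s; rewrite in_itv/= => /andP[s0 _]; rewrite Bt -B0.
    by apply: (primitive_nondecreasing dB); exact: ltW.
have [_ e1] := dB t; have [_ e2] := d0.
by rewrite -(clamp_id t01) -e1 e2.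
Qed.

Lemma kappa_nondecreasing s t : 0 <= s -> s <= t -> t <= 1 -> kappa sigma s <= kappa sigma t.
Proof.
have [B [dB B0 _ _ kE]] := schedule_primitive sigma_continuous.
move=> s0 st t1; rewrite !kE ?s0 ?t1 ?(le_trans st) ?(le_trans s0)//.
by rewrite lerD2l lerN2 ler_expR lerN2; exact: (primitive_nondecreasing dB).
Qed.

Let near01 (t : R) : 0 < t < 1 -> \forall s \near t, 0 <= s <= 1.
Proof.
move=> /andP[t0 t1].
have : t \in `]0, 1[ by rewrite in_itv/= t0.
move=> /near_in_itvoo; apply: filterS => s; rewrite in_itv/= => /andP[s0 s1].
by rewrite !ltW.
Qed.

Lemma eta_is_derive (t : R) : 0 < t < 1 ->
  is_derive t 1 (Defs.eta sigma) (- (sigma t / 2) * Defs.eta sigma t).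
Proof.
have [B [dB B0 _ eE _]] := schedule_primitive sigma_continuous.
move=> t01; have /andP[t0 t1] := t01.
have t01' : 0 <= t <= 1 by rewrite !ltW.
apply: (@near_eq_is_derive _ _ _ (fun s => expR (- (B s / 2)))).
  by apply: filterS (near01 t01) => s s01; rewrite eE.
have d1 := dB t.
have d2 : is_derive t 1 (fun s => - (B s / 2)) (- (sigma (clamp t) / 2)).
  by apply: is_derive_eq; rewrite /GRing.scale /=; ring.
have d3 := @is_derive1_comp _ (@expR R) (fun s => - (B s / 2)) t _ _ (is_derive_expR _) d2.
by apply: (is_derive_eq d3); rewrite eE// clamp_id// mulrC.
Qed.

Lemma sqrt_kappa_is_derive t : 0 < t < 1 -> 0 < kappa sigma t ->
  is_derive t 1 (fun s => Num.sqrt (kappa sigma s)) (sigma t / 2 * (1 - kappa sigma t) / Num.sqrt (kappa sigma t)).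
Proof.
have [B [dB B0 _ _ kE]] := schedule_primitive sigma_continuous.
move=> t01 k0; have /andP[t0 t1] := t01.
have t01' : 0 <= t <= 1 by rewrite !ltW.
apply: (@near_eq_is_derive _ _ _ (fun s => Num.sqrt (1 - expR (- B s)))).
  by apply: filterS (near01 t01) => s s01; rewrite kE.
have d1 := dB t.
have d2 : is_derive t 1 (fun s => - B s) (- sigma (clamp t)) by exact: is_deriveN.
have d3 := @is_derive1_comp _ (@expR R) (fun s => - B s) t _ _ (is_derive_expR _) d2.
have d4 : is_derive t 1 (fun s => 1 - expR (- B s)) (sigma t * (1 - kappa sigma t)).
  by apply: is_derive_eq; rewrite kE// clamp_id//; ring.
have k0' : 0 < 1 - expR (- B t) by rewrite -kE.
have d5 := @is_derive1_comp _ (@Num.sqrt R) (fun s => 1 - expR (- B s)) t _ _ (is_derive1_sqrt k0') d4.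
apply: (is_derive_eq d5); rewrite -kE//.
have vq (x y z : R) : x != 0 -> (2 * x)^-1 * (y * (1 - z)) = y / 2 * (1 - z) / x.
  by move=> x0; field.
by apply: vq; rewrite lt0r_neq0// sqrtr_gt0.
Qed.

Lemma kappa_eq0_near s t : 0 < t < s -> s <= 1 -> kappa sigma s = 0 ->
  \forall u \near t, kappa sigma u = 0 /\ Defs.eta sigma u = 1.
Proof.
have [B [dB B0 _ eE kE]] := schedule_primitive sigma_continuous.
move=> /andP[t0 ts] s1 ks.
have : t \in `]0, s[ by rewrite in_itv/= t0.
move=> /near_in_itvoo; apply: filterS => u; rewrite in_itv/= => /andP[u0 us].
have u01 : 0 <= u <= 1 by rewrite (ltW u0) (le_trans (ltW us)).
have ku : kappa sigma u = 0.
  by apply/eqP; rewrite eq_le kappa_ge0// andbT -ks kappa_nondecreasing// ltW.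
by split => //; rewrite eE// (primitive_kappa0 kE u01 ku) mul0r oppr0 expR0.
Qed.

Lemma kappa_gt0_rational (t : R) : 0 < t <= 1 -> 0 < kappa sigma t ->
  exists q : rat, [/\ 0 < (ratr q : R) < 1, (ratr q : R) <= t & 0 < kappa sigma (ratr q)].
Proof.
have [B [dB B0 _ eE kE]] := schedule_primitive sigma_continuous.
move=> /andP[t0 t1] kt; have t01 : 0 <= t <= 1 by rewrite ltW.
have Bt : 0 < B t by move: kt; rewrite kE// subr_gt0 -[X in _ < X]expR0 ltr_expR oppr_lt0.
have cB : B @ t --> B t by exact: (is_derive_continuous dB).
have Bn : \forall s \near t, 0 < B s by exact: (cvgr_gt _ cB).
have /nbhs_ballP[r /= r0 hr] := Bn.
have mt : Num.max 0 (t - r) < t by rewrite gt_max t0 gtrBl.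
have [q] := rat_in_itvoo mt.
rewrite in_itv/= gt_max => /andP[/andP[q0 qr] qt].
have q01 : 0 <= (ratr q : R) <= 1 by rewrite (ltW q0) (le_trans (ltW qt)).
exists q; split; [by rewrite q0 (lt_le_trans qt t1)|exact: ltW|].
rewrite (kE _ q01) subr_gt0 -[X in _ < X]expR0 ltr_expR oppr_lt0; apply: hr.
rewrite /ball/= gtr0_norm; last by rewrite subr_gt0.
by rewrite ltrBlDr -ltrBlDl.
Qed.

End schedule.

Lemma is_derive_scalev (R : realType) (H : normedModType R) (g : R -> R) (a : H) (x l : R) :
  is_derive x 1 g l -> is_derive x 1 (fun s => g s *: a) (l *: a).
Proof.
move=> [dg <-]; have c : (fun h => h^-1 *: ((fun s => g s *: a) (h *: 1 + x) - g x *: a)) @ 0^' --> 'D_1 g x *: a.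
  rewrite (_ : (fun h => _) = fun h => (h^-1 *: (g (h *: 1 + x) - g x)) *: a); last first.
    by apply/funext => h; rewrite -scalerBl scalerA.
  by apply: cvgZr_tmp; exact: dg.
split; first by apply/cvg_ex; exists ('D_1 g x *: a).
exact: (cvg_lim (@norm_hausdorff _ _) c).
Qed.

(** * Identification of conditional expectations and of supports *)

Section velocity.
Context {R : realType} {H : completeNormedModType R}.
Variable ip : {dot H for idfun}.
Hypothesis normE : forall x : H, `|x| ^+ 2 = ip x x.
Hypothesis sepH : separable_space H.
Variables (I : pred nat) (zeta : nat -> H).
Hypothesis hzeta : orthonormal_basis ip I zeta.

(** An error [N] orthogonal to all events of [X] does not change the integrals over them. The
    preimages of balls provide the countable cover on which [V] is integrable. *)
Lemma is_conditional_expectation_orthogonal d (T : measurableType d) (P : probability T R)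
    (X V N : T -> H) (g : H -> H) :
  measurable_fun setT (X : T -> borel H) -> measurable_fun setT (V : T -> borel H) ->
  measurable_fun setT (g : borel H -> borel H) ->
  (forall n : nat, P.-integrable (X @^-1` ball (0 : H) n.+1%:R) (fun w => (`|V w|)%:E)) ->
  (forall w, g (X w) = V w + N w) ->
  P.-integrable setT (fun w => (`|N w|)%:E) ->
  (forall h (B : set (borel H)), measurable B -> \int[P]_(w in X @^-1` B) ip h (N w) = 0) ->
  is_conditional_expectation ip P V X g.
Proof.
move=> mX mV mg iV gE iN N0.
have mN : measurable_fun setT (N : T -> borel H).
  have := measurable_lincomb normE sepH hzeta (@measurable_cst _ _ _ _ setT (1 : R)) (@measurable_cst _ _ _ _ setT (-1 : R)) (measurableT_comp mg mX) mV.
  congr (measurable_fun _ _); apply/funext => w; rewrite /= gE scale1r scaleN1r.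
  by rewrite addrC addKr.
have mXB (B : set (borel H)) : measurable B -> measurable (X @^-1` B).
  by move=> mB; rewrite -[X in measurable X]setTI; exact: mX.
split => //.
  exists (fun n => ball (0 : H) n.+1%:R); split => //.
    by move=> n; exact: measurable_ball_borel.
  apply/seteqP; split => // x _; exists (Num.truncn `|x|) => //.
  have : `|0 - (x : H)| < (Num.truncn `|x|).+1%:R by rewrite sub0r normrN truncnS_gt.
  by rewrite -ball_normE.
move=> B mB iVB.
have iNB : P.-integrable (X @^-1` B) (fun w => (`|N w|)%:E).
  exact: (integrableS measurableT (mXB _ mB) _ iN).
have iip (F : T -> H) h : measurable_fun setT (F : T -> borel H) ->
    P.-integrable (X @^-1` B) (fun w => (`|F w|)%:E) -> P.-integrable (X @^-1` B) (EFin \o (fun w => ip h (F w))).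
  move=> mF iF; have := integrableZl (mXB _ mB) `|h| iF; apply: le_integrable.
  - exact: mXB.
  - by apply/measurable_EFinP; apply: measurable_funTS; exact: (measurable_ip normE).
  - by move=> w _ /=; rewrite lee_fin normrM !normr_id; exact: (cauchy_schwarz normE).
split.
  have := integrableD (mXB _ mB) iVB iNB; apply: le_integrable.
  - exact: mXB.
  - apply/measurable_EFinP; apply: measurable_funTS.
    exact: (measurable_norm (measurableT_comp mg mX)).
  - by move=> w _ /=; rewrite lee_fin normr_id [leRHS]ger0_norm ?addr_ge0// gE ler_normD.
move=> h; transitivity (\int[P]_(w in X @^-1` B) (ip h (V w) + ip h (N w))); last first.
  by apply: eq_Rintegral => w _; rewrite gE ipDr.
by rewrite RintegralD ?N0 ?addr0//; [exact: mXB|exact: iip|exact: iip].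
Qed.

(** Given [X0 = y], the event that the sum lies in a ball is that [U] lies in another ball, which
    has positive Gaussian measure. A positive function of [y] cannot integrate to 0. *)
Lemma gaussian_shift_support (Q : {linear H -> H}) (lam : nat -> R) d (T : measurableType d)
    (P : probability T R) (X0 U : T -> H) (e k : R) (x : H) :
  covariance_operator ip Q -> (forall i, I i -> Q (zeta i) = lam i *: zeta i) ->
  random_vector X0 -> gaussian_vector ip P U 0 Q -> independent2 P X0 U -> 0 < k ->
  law_support P (fun w => e *: X0 w + k *: U w) x.
Proof.
move=> hQ hlam mX0 [mU hU] hindep k0 r r0.
have hG : forall h (A : set R), measurable A -> law P mU [set x | A (ip h x)] = gaussian1 0 (ip (Q h) h) A.
  by move=> h A mA; rewrite lawE; have := hU h A mA; rewrite ip0r.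
pose X w := e *: X0 w + k *: U w.
pose T2 := (borel H * borel H)%type.
have mcomb : measurable_fun setT (fun z : T2 => e *: (z.1 : H) + k *: (z.2 : H) : borel H).
  exact: (measurable_lincomb normE sepH hzeta (@measurable_cst _ _ _ _ setT e) (@measurable_cst _ _ _ _ setT k) measurable_fst measurable_snd).
pose F (z : T2) : \bar R := (\1_(ball x r) (e *: (z.1 : H) + k *: (z.2 : H)))%:E.
have mb : measurable (ball x r : set (borel H)) := measurable_ball_borel x r.
have mF : measurable_fun setT F.
  by apply/measurable_EFinP; apply: (measurableT_comp _ mcomb); exact: measurable_indic.
have F0 z : (0 <= F z)%E by rewrite lee_fin indicE.
have mX : measurable_fun setT (X : T -> borel H) := measurableT_comp mcomb (measurable_fun_pair mX0 mU).
have -> : P (X @^-1` ball x r) = (\int[P]_w F (X0 w, U w))%E.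
  rewrite -[X in P X]setIT -integral_indic//.
  by rewrite -[X in measurable X]setTI; exact: mX.
rewrite (ge0_integral_indep mX0 mU hindep mF F0).
have pos y : (0 < \int[law P mU]_u F (y, u))%E.
  have -> : (\int[law P mU]_u F (y, u))%E = law P mU (ball (k^-1 *: (x - e *: (y : H))) (r / k)).
    rewrite -[X in _ = law P mU X](setIT) -integral_indic//; last exact: measurable_ball_borel.
    apply: eq_integral => u _; congr (_%:E); rewrite !indicE; congr (_%:R); congr nat_of_bool.
    have E : x - (e *: (y : H) + k *: (u : H)) = k *: (k^-1 *: (x - e *: (y : H)) - (u : H)).
      by rewrite scalerBr scalerA divff ?lt0r_neq0// scale1r opprD addrA.
    have B1 : ball x r (e *: (y : H) + k *: (u : H)) = (`|x - (e *: (y : H) + k *: (u : H))| < r) :> Prop by rewrite -ball_normE.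
    have B2 : ball (k^-1 *: (x - e *: (y : H))) (r / k) (u : H) = (`|k^-1 *: (x - e *: (y : H)) - (u : H)| < r / k) :> Prop by rewrite -ball_normE.
    by apply/idP/idP; rewrite !inE /= B1 B2 E normrZ (gtr0_norm k0) ltr_pdivlMr// mulrC.
  by apply: (gaussian_ball_gt0 normE sepH hQ hzeta hlam hG); rewrite divr_gt0.
pose f y := (\int[law P mU]_u F (y, u))%E.
have mf : measurable_fun setT f.
  exact: (@measurable_fun_fubini_tonelli_F _ _ (borel H) (borel H) R (law P mU) F mF F0).
rewrite lt0e integral_ge0 ?andbT; last by move=> y _; exact: ltW.
apply/eqP => i0.
have : (\int[law P mX0]_y `|f y| = 0)%E.
  rewrite -[RHS]i0; apply: eq_integral => y _; rewrite gee0_abs//.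
  by rewrite /f; apply/ltW/pos.
move=> /(ae_eq_integral_abs (law P mX0) measurableT mf)[N [mN N0 sN]].
have : law P mX0 N = 1%E.
  rewrite (_ : N = setT) ?probability_setT//; apply/seteqP; split => // y _; apply: sN => /= /(_ Logic.I) fy.
  by have := pos y; rewrite -/(f y) fy ltxx.
by rewrite N0 => /esym/eqP; rewrite eqe oner_eq0.
Qed.

End velocity.

Section bochner_modification.
Context {R : realType} {H : completeNormedModType R}.
Variable ip : {dot H for idfun}.
Hypothesis normE : forall x : H, `|x| ^+ 2 = ip x x.

(** Makes a change of the velocity field at the single time [c] invisible to the flow. *)
Lemma is_bochner_integral_eq (f g : R -> H) (c a b : R) (v : H) :
  (forall s, s != c -> f s = g s) -> is_bochner_integral ip f a b v ->
  is_bochner_integral ip g a b v.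
Proof.
move=> fg [mf If vE].
have gE : g = fun s => if s == c then g c else f s.
  by apply/funext => s; have [->//|sc] := eqVneq s c; rewrite fg.
have mD : measurable (`[a, b]%classic : set (measurableTypeR R)) by exact: measurable_itv.
have mc : measurable_fun `[a, b] (fun s : measurableTypeR R => s == c).
  by apply: measurable_fun_eqr => //; exact: measurable_id.
have mg : measurable_fun `[a, b] (g : R -> borel H).
  rewrite gE; apply: (measurable_fun_if mD mc); first exact: measurable_cst.
  by apply: measurable_funS mf => //; exact: subIsetl.
have ae (F G : measurableTypeR R -> R) : (forall s, s != c -> F s = G s) -> ae_eq (@lebesgue_measure R) `[a, b]%classic (EFin \o F) (EFin \o G).
  move=> FG; exists [set c]; split => //; first exact: lebesgue_measure_set1.
  move=> s /= /not_implyP[_ h]; apply: contra_notP h => /eqP sc.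
  by rewrite FG.
have mip (F : R -> H) h : measurable_fun `[a, b] (F : R -> borel H) -> measurable_fun `[a, b] (fun s => ip h (F s)).
  by move=> mF; exact: (measurableT_comp (measurable_continuous_borel (continuous_ip normE h)) mF).
have mnorm (F : R -> H) : measurable_fun `[a, b] (F : R -> borel H) -> measurable_fun `[a, b] (fun s => `|F s|).
  by move=> mF; exact: (measurableT_comp (measurable_norm (@measurable_id _ (borel H) setT)) mF).
have mEnorm (F : R -> H) : measurable_fun `[a, b] (F : R -> borel H) -> measurable_fun `[a, b] (fun s => (`|F s|)%:E).
  by move=> mF; apply/measurable_EFinP; exact: mnorm.
split => //.
  apply/integrableP; split; first exact: mEnorm.
  have /integrableP[_] := If; have -> // : (\int[@lebesgue_measure R]_(x in `[a, b]) `|(`|f x|)%:E| =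
     \int[@lebesgue_measure R]_(x in `[a, b]) `|(`|g x|)%:E|)%E.
  apply: ae_eq_integral => //.
  - by apply: measurableT_comp => //; exact: mEnorm.
  - by apply: measurableT_comp => //; exact: mEnorm.
  - by apply: (ae (fun s => `| `|f s| |) (fun s => `| `|g s| |)) => s sc; rewrite fg.
move=> h; rewrite vE /Rintegral; congr fine; apply: ae_eq_integral => //.
- by apply/measurable_EFinP; exact: mip.
- by apply/measurable_EFinP; exact: mip.
- by apply: (ae (fun s => ip h (f s)) (fun s => ip h (g s))) => s sc; rewrite fg.
Qed.

End bochner_modification.

(** * The probability flow *)

Lemma continuous_inv_max (R : realType) (c : R) : 0 < c -> continuous (fun x : R => (Num.max c x)^-1).
Proof.
move=> c0 x; apply: cvgV; first by apply: lt0r_neq0; rewrite lt_max c0.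
by apply: continuous_max; [exact: cvg_cst|exact: cvg_id].
Qed.

Section score.
Context {R : realType} {H : completeNormedModType R}.
Local Notation leb := (@lebesgue_measure R).
Variable ip : {dot H for idfun}.
Hypothesis normE : forall x : H, `|x| ^+ 2 = ip x x.
Hypothesis sepH : separable_space H.
Variable Q : {linear H -> H}.
Hypothesis hQ : covariance_operator ip Q.
Variables (I : pred nat) (zeta : nat -> H) (lam : nat -> R).
Hypothesis hzeta : orthonormal_basis ip I zeta.
Hypothesis hlam : forall i, I i -> Q (zeta i) = lam i *: zeta i.
Variable sigma : R -> R.
Hypothesis sigma_ge0 : forall t, t \in `[0, 1] -> 0 <= sigma t.
Hypothesis sigma_continuous : {within `[0, 1], continuous sigma}.
Variable Pdata : probability (borel H) R.
Context (d : measure_display) (Omega : measurableType d) (P : probability Omega R).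
Variables (W Y : R -> Omega -> H).
Hypothesis hW : Q_wiener ip P Q W.
Hypothesis hY0 : has_law P (Y 0) Pdata.
Hypothesis hY : sde_solution ip P sigma W Y.
Variable mu : R -> R.-pker (borel H) ~> (borel H).
Hypothesis hmu : forall t, t \in `[0, 1] -> is_conditional_law P Pdata (Y 0) (Y t) (mu t).
Variable S : R -> H -> H.
Hypothesis hS : score_minimizer ip Q I zeta lam Pdata mu S.
Context (d' : measure_display) (Omega' : measurableType d') (P' : probability Omega' R).
Variables (Y'0 U : Omega' -> H).
Hypothesis hY'0 : has_law P' Y'0 Pdata.
Hypothesis hU : gaussian_vector ip P' U 0 Q.
Hypothesis hindep : independent2 P' Y'0 U.

(** Fields are measurable over the times in [0, 1] only; clamping the time gives a globally
    measurable function to compose with. *)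
Lemma measurable_field_clamp (v : R -> H -> H) : measurable_field v ->
  measurable_fun setT ((fun p => v (clamp p.1) p.2) : measurableTypeR R * borel H -> borel H).
Proof.
move=> mv; pose f (p : measurableTypeR R * borel H) := (clamp p.1 : measurableTypeR R, p.2).
have mcl : measurable_fun setT (clamp : measurableTypeR R -> measurableTypeR R).
  by have := continuous_measurable_fun (@continuous_clamp R).
have mf : measurable_fun setT f.
  apply: measurable_fun_pair; last exact: measurable_snd.
  exact: (measurableT_comp mcl measurable_fst).
have mF : measurable ([set p | 0 <= p.1 <= 1] : set (measurableTypeR R * borel H)).
  have := @measurable_fst _ _ (measurableTypeR R) (borel H) measurableT _ (measurable_itv (`[0, 1] : interval R)).
  by rewrite setTI; congr measurable; apply/seteqP; split=> p /=; rewrite in_itv.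
have sF : f @` setT `<=` [set p | 0 <= p.1 <= 1] by move=> _ [p _ <-] /=; exact: clamp01.
exact: (measurable_comp mF sF mv mf).
Qed.

Lemma measurable_field_eq (v : R -> H -> H) (g : measurableTypeR R * borel H -> borel H) :
  measurable_fun setT g -> (forall t x, 0 <= t <= 1 -> v t x = g (t, x)) -> measurable_field v.
Proof.
move=> mg vg; have mgD : measurable_fun ([set p | 0 <= p.1 <= 1] : set (measurableTypeR R * borel H)) g by exact: measurable_funTS.
by apply: eq_measurable_fun mgD => -[t x]; rewrite inE /= => t01; rewrite vg.
Qed.

Let X := interpolation sigma Y'0 U.
Let kk t := Num.sqrt (kappa sigma t).
(** The residual of the score [T]: given [Y'0], the logarithmic gradient at [X t w] is
    [- (kk t)^-1 *: U w]. *)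
Let VV (T : R -> H -> H) t w := T t (X t w) + (kk t)^-1 *: U w.

Let mY'0 : measurable_fun setT (Y'0 : Omega' -> borel H). Proof. by case: hY'0. Qed.
Let mU : measurable_fun setT (U : Omega' -> borel H). Proof. by case: hU. Qed.

Let mslice T t : measurable_field T -> 0 <= t <= 1 -> measurable_fun setT (T t : borel H -> borel H).
Proof.
move=> mT t01; have := measurable_field_clamp mT => mTc.
have m1 : measurable_fun setT (fun x : borel H => ((t : measurableTypeR R), x)) by exact: measurable_fun_pair.
by have := measurableT_comp mTc m1; congr (measurable_fun _ _); apply/funext => x /=; rewrite clamp_id.
Qed.

Let mS : measurable_field S. Proof. by case: hS. Qed.

(** * Minimality over the times from [eps] on *)

Section from_eps.
Variable eps : R.
Hypothesis eps01 : 0 < eps < 1.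
Hypothesis kappa_eps : 0 < kappa sigma eps.

Let D : set (measurableTypeR R) := `[eps, 1]%classic.
Let loss := score_loss ip Q I zeta lam Pdata mu.

Let D01 t : D t -> 0 < t <= 1.
Proof.
rewrite /D /= in_itv/= => /andP[et ->]; have /andP[e0 _] := eps01.
by rewrite (lt_le_trans e0).
Qed.

Let D01w t : D t -> 0 <= t <= 1. Proof. by move=> /D01/andP[/ltW -> ->]. Qed.

Let mD : measurable D. Proof. exact: measurable_itv. Qed.

Let kappaD t : D t -> kappa sigma eps <= kappa sigma t.
Proof.
rewrite /D /= in_itv/= => /andP[et t1]; have /andP[e0 _] := eps01.
exact: (kappa_nondecreasing sigma_ge0 sigma_continuous (ltW e0) et t1).
Qed.

Let kD t : D t -> 0 < kk t.
Proof. by move=> Dt; rewrite sqrtr_gt0; exact: (lt_le_trans kappa_eps (kappaD Dt)). Qed.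

Let slice_loss T t : measurable_field T -> D t ->
  (\int[Pdata]_y \int[mu t y]_x ((`|T t x - log_gradient ip Q I zeta lam (mu t y) x| ^+ 2)%:E) =
   \int[P']_w ((`|VV T t w| ^+ 2)%:E))%E.
Proof.
move=> mT Dt; have t01 := D01 Dt; have t01w := D01w Dt.
apply: (score_loss_conditional normE sepH hQ hzeta hlam hY'0 hU hindep _ (kD Dt) (mslice mT t01w)).
move=> A B mA mB.
have h := sde_joint_law normE sepH hzeta hQ sigma_ge0 sigma_continuous hW hY0 hY hY'0 hU hindep t01 mA mB.
rewrite -[LHS]h; apply: hmu => //; rewrite in_itv/=; exact: t01w.
Qed.

Let e1 (t : R) := Defs.eta sigma (clamp t).
Let k1 (t : R) := kk (clamp t).

Let me1 : measurable_fun setT (e1 : measurableTypeR R -> R).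
Proof.
have [b [db b0 bI etaE kappaE]] := schedule_primitive sigma_continuous.
have -> : e1 = fun t => expR (- (b (clamp t) / 2)) by apply/funext => t; rewrite /e1 etaE// clamp01.
apply: continuous_measurable_fun => t; apply: continuous_comp; last exact: continuous_expR.
apply: cvgN; apply: cvgMr_tmp; apply: continuous_comp; first exact: continuous_clamp.
exact: (is_derive_continuous db).
Qed.

Let mk1 : measurable_fun setT (k1 : measurableTypeR R -> R).
Proof.
have [b [db b0 bI etaE kappaE]] := schedule_primitive sigma_continuous.
have -> : k1 = fun t => Num.sqrt (1 - expR (- b (clamp t))) by apply/funext => t; rewrite /k1 /kk kappaE// clamp01.
apply: continuous_measurable_fun => t; apply: continuous_comp; last exact: sqrt_continuous.
apply: cvgB; first exact: cvg_cst.
apply: continuous_comp; last exact: continuous_expR.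
apply: cvgN; apply: continuous_comp; first exact: continuous_clamp.
exact: (is_derive_continuous db).
Qed.

Let X1 (z : measurableTypeR R * Omega') : borel H := e1 z.1 *: Y'0 z.2 + k1 z.1 *: U z.2.

(* On D the maximum is kk t; it makes the inverse a continuous function. *)
Let V1 (T : R -> H -> H) (z : measurableTypeR R * Omega') : borel H :=
  T (clamp z.1) (X1 z) + (Num.max (kk eps) (k1 z.1))^-1 *: U z.2.

Let mX1 : measurable_fun setT X1.
Proof.
by apply: (measurable_lincomb normE sepH hzeta); [exact: (measurableT_comp me1 measurable_fst)|exact: (measurableT_comp mk1 measurable_fst)
  |exact: (measurableT_comp mY'0 measurable_snd)|exact: (measurableT_comp mU measurable_snd)].
Qed.

Let mV1 T : measurable_field T -> measurable_fun setT (V1 T).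
Proof.
move=> mT; have mT1 : measurable_fun setT (fun z => T (clamp z.1) (X1 z) : borel H).
  exact: (measurableT_comp (measurable_field_clamp mT) (measurable_fun_pair measurable_fst mX1)).
have mk1V : measurable_fun setT (fun z : measurableTypeR R * Omega' => (Num.max (kk eps) (k1 z.1))^-1).
  apply: (@measurableT_comp _ _ _ _ _ _ (fun x : R => (Num.max (kk eps) x)^-1)); last exact: (measurableT_comp mk1 measurable_fst).
  have ke : 0 < kk eps by rewrite sqrtr_gt0.
  exact: (continuous_measurable_fun (continuous_inv_max ke)).
have := measurable_lincomb normE sepH hzeta (@measurable_cst _ _ _ _ setT (1 : R)) mk1V mT1 (measurableT_comp mU measurable_snd).
by congr (measurable_fun _ _); apply/funext => z; rewrite scale1r.
Qed.

Let X1E t w : D t -> X1 (t, w) = X t w.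
Proof. by move=> Dt; rewrite /X1 /e1 /k1 /= (clamp_id (D01w Dt)). Qed.

Let V1E T t w : D t -> V1 T (t, w) = VV T t w.
Proof.
move=> Dt; have le : kk eps <= kk t := ler_wsqrtr (kappaD Dt).
by rewrite /V1 (X1E w Dt) /k1 /= (clamp_id (D01w Dt)) (max_r le).
Qed.

Let Doo : (leb D < +oo)%E.
Proof. by rewrite /D lebesgue_measure_itv/=; case: ifP => _; rewrite ?EFinN -?EFinD ltry. Qed.

Let m : {finite_measure set (measurableTypeR R) -> \bar R} := mfrestr mD Doo.

Let integral_m (f : measurableTypeR R -> \bar R) : measurable_fun setT f -> (forall t, 0 <= f t)%E ->
  (\int[m]_t f t = \int[leb]_(t in D) f t)%E.
Proof.
move=> mf f0; have mE A : measurable A -> m A = (\int[leb]_(t in A) (\1_D t)%:E)%E.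
  by move=> mA; rewrite integral_indic//= /mfrestr /mrestr setIC.
rewrite (@ge0_integral_density _ _ _ m leb _ _ mE)//.
rewrite [RHS]integral_mkcond; apply: eq_integral => t _.
by rewrite patchE indicE; case: (_ \in D); rewrite ?mule1 ?mule0.
Qed.

Let mV2 T : measurable_field T -> measurable_fun setT (fun t : measurableTypeR R => \int[P']_w (`|V1 T (t, w) : H| ^+ 2)%:E)%E.
Proof.
move=> mT; have mVT : measurable_fun setT (fun z => (`|V1 T z : H| ^+ 2)%:E).
  by apply/measurable_EFinP; apply: measurable_funX; apply: measurable_norm; exact: mV1.
have := @measurable_fun_fubini_tonelli_F _ _ (measurableTypeR R) Omega' R P' _ mVT; apply.
by move=> z; rewrite lee_fin sqr_ge0.
Qed.

Let L T t := (\int[Pdata]_y \int[mu t y]_x ((`|T t x - log_gradient ip Q I zeta lam (mu t y) x| ^+ 2)%:E))%E.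

Let L0 T t : (0 <= L T t)%E.
Proof. by apply: integral_ge0 => y _; apply: integral_ge0 => x _; rewrite lee_fin sqr_ge0. Qed.

Let LE T t : measurable_field T -> D t -> L T t = (\int[P']_w (`|V1 T (t, w) : H| ^+ 2)%:E)%E.
Proof.
move=> mT Dt; rewrite /L (slice_loss mT Dt); apply: eq_integral => w _.
by rewrite (V1E T w Dt).
Qed.

Let mL T : measurable_field T -> measurable_fun D (L T).
Proof.
move=> mT; have := measurable_funTS (D := D) (mV2 mT); apply: eq_measurable_fun => t.
by rewrite inE => Dt; rewrite (LE mT Dt).
Qed.

Let loss_epsE T : measurable_field T ->
  loss eps T = (\int[m]_t \int[P']_w (`|V1 T (t, w) : H| ^+ 2)%:E)%E.
Proof.
move=> mT; rewrite (integral_m (mV2 mT)); last first.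
  by move=> t; apply: integral_ge0 => w _; rewrite lee_fin sqr_ge0.
by apply: eq_integral => t; rewrite inE => Dt; exact: (LE mT Dt).
Qed.

(** The zero score has loss E|U|^2 / kappa at each time, bounded on [[eps], 1] because [kappa] is
    nondecreasing. Hence the minimal loss from [eps] on is finite. *)
Let loss_eps0 : (loss eps (fun _ _ => 0%R) < +oo)%E.
Proof.
have m0 : measurable_field (fun _ _ => 0 : H).
  by apply: (measurable_field_eq (g := cst 0)) => //; exact: measurable_cst.
have hG : forall h (A : set R), measurable A -> law P' mU [set x | A (ip h x)] = gaussian1 0 (ip (Q h) h) A.
  by move=> h A mA; rewrite lawE; have [_ /(_ h A mA)] := hU; rewrite ip0r.
have mU2 : measurable_fun setT (fun u : borel H => (`|u : H| ^+ 2)%:E).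
  by apply/measurable_EFinP; apply: measurable_funX; apply: measurable_norm; exact: measurable_id.
have U2 : (\int[P']_w (`|U w| ^+ 2)%:E < +oo)%E.
  have := gaussian_norm_second_moment normE hQ hG.
  by rewrite (ge0_integral_law P' mU mU2)// => u; rewrite lee_fin sqr_ge0.
have mUw : measurable_fun setT (fun w => (`|U w| ^+ 2)%:E) by exact: (measurableT_comp mU2 mU).
set c := (\int[P']_w (`|U w| ^+ 2)%:E)%E in U2.
have c0 : (0 <= c)%E by apply: integral_ge0 => w _; rewrite lee_fin sqr_ge0.
have -> : loss eps (fun _ _ => 0) = (\int[leb]_(t in D) L (fun _ _ => 0%R) t)%E by [].
apply: (@le_lt_trans _ _ (\int[leb]_(t in D) (((kappa sigma eps)^-1)%:E * c))%E).
  apply: lower_integral_le => t Dt; rewrite L0 (LE m0 Dt) andTb (eq_integral (fun w => ((kk t) ^- 2)%:E * (`|U w| ^+ 2)%:E)%E); last first.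
    move=> w _; rewrite (V1E _ w Dt) /VV add0r normrZ exprMn real_normK; last exact: num_real.
    by rewrite EFinM exprVn.
  rewrite (ge0_integralZl P' measurableT mUw); last 2 first.
  - by move=> w _; rewrite lee_fin sqr_ge0.
  - by rewrite lee_fin invr_ge0 sqr_ge0.
  apply: (lee_wpmul2r c0); have kt := lt_le_trans kappa_eps (kappaD Dt).
  by rewrite lee_fin /kk (sqr_sqrtr (ltW kt)) (lef_pV2 kt kappa_eps); exact: kappaD.
have ki0 : 0 <= (kappa sigma eps)^-1 by rewrite invr_ge0; exact: ltW.
have kc0 : (0 <= ((kappa sigma eps)^-1)%:E * c)%E by exact: mule_ge0.
rewrite (integral_cst leb mD) (lte_mul_pinfty kc0 _ Doo)//.
by rewrite fin_numM// (ge0_fin_numE c0).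
Qed.

Let split01 : `[0, 1]%classic = `[0, eps[%classic `|` D.
Proof.
have /andP[e0 e1'] := eps01; rewrite /D; apply/seteqP; split=> t /=; rewrite !in_itv/=.
  by move=> /andP[-> ->]; case: (ltP t eps); [left|right].
by case=> /andP[a1 a2]; rewrite ?a1 ?a2 ?(ltW (lt_trans a2 e1')) ?(le_trans (ltW e0) a1).
Qed.

Let disj : [disjoint `[0, eps[%classic & D].
Proof.
apply/disj_setPS => t [] /=; rewrite /D /= !in_itv/= => /andP[_ te] /andP[et _].
by rewrite ltNge et in te.
Qed.

(* When the loss over [0, 1] is finite, the contribution of [0, eps) is common to
   S and T and cancels; its integrand is not known to be measurable. *)
Let loss_minimal T : measurable_field T -> (forall t, t < eps -> T t = S t) ->
  (loss eps S < +oo /\ loss eps S <= loss eps T)%E.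
Proof.
move=> mT TS; have [_ min0 minoo] := hS.
have [loo|lfin] := eqVneq (loss 0 S) +oo%E.
  have h := minoo loo eps eps01; split; last exact: h.
  apply: le_lt_trans loss_eps0; apply: h.
  by apply: (measurable_field_eq (g := cst 0)) => //; exact: measurable_cst.
have mI : measurable (`[0, eps[%classic : set (measurableTypeR R)) by exact: measurable_itv.
have lS : (loss 0 S < +oo)%E by rewrite ltey.
have le01 (A B : set (measurableTypeR R)) : A `<=` B -> (\int[leb]_(t in A) L S t <= \int[leb]_(t in B) L S t)%E.
  move=> AB; rewrite integral_mkcond [leRHS]integral_mkcond; apply: lower_integral_le => t _.
  rewrite !patchE; case: ifPn => tA; last by rewrite lexx/=; case: ifPn.
  by rewrite ifT ?L0 ?lexx//; apply/mem_set/AB/set_mem.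
have lepsS : (loss eps S < +oo)%E.
  by apply: le_lt_trans lS; apply: le01; rewrite split01; right.
split; first exact: lepsS.
have lA : (\int[leb]_(t in `[0%R, eps[%classic) L S t < +oo)%E.
  by apply: le_lt_trans lS; apply: le01; rewrite split01; left.
(* Superadditivity is applied to [S], with measurability of its integrand on [D]; subadditivity is
   applied to the competitor [T]. *)
have h1 : (\int[leb]_(t in `[0%R, eps[%classic) L S t + loss eps S <= loss 0 S)%E.
  rewrite /loss /score_loss split01; exact: (lower_integral_setU_ge mI mD disj (L0 S) (mL mS) lepsS).
have h2 : (loss 0 T <= \int[leb]_(t in `[0%R, eps[%classic) L T t + loss eps T)%E.
  by rewrite /loss /score_loss split01; exact: (lower_integral_setU_le leb mI mD disj (L0 T)).
have h3 : (\int[leb]_(t in `[0%R, eps[%classic) L T t = \int[leb]_(t in `[0%R, eps[%classic) L S t)%E.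
  by apply: eq_integral => t; rewrite inE /= in_itv/= => /andP[_ te]; rewrite /L TS.
have Afin : (\int[leb]_(t in `[0%R, eps[%classic) L S t)%E \is a fin_num.
  by rewrite ge0_fin_numE; [exact: lA|apply: integral_ge0 => t _; exact: L0].
have h4 : (loss 0 S <= loss 0 T)%E := min0 _ mT.
rewrite h3 in h2; rewrite -(leeD2lE _ _ Afin).
exact: (le_trans (le_trans h1 h4) h2).
Qed.

Let min_V1 i l A (r : R) : I i -> measurable A ->
  (\int[m]_t \int[P']_w ((`|V1 S (t, w) : H| ^+ 2)%:E) <=
   \int[m]_t \int[P']_w ((`|(V1 S (t, w) : H) +
     (r * (\1_A t * \1_(cylset ip I zeta l) (X1 (t, w)))) *: zeta i| ^+ 2)%:E))%E.
Proof.
(* Cutting [A] down to [D] makes the competitor coincide with [S] before [eps], as [loss_minimal]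
   demands. *)
move=> Ii mA; pose T t x := S t x + (r * (\1_(A `&` D) t * \1_(cylset ip I zeta l) x)) *: zeta i.
have mi1 : measurable_fun setT (fun p : measurableTypeR R * borel H => r * (\1_(A `&` D) p.1 * \1_(cylset ip I zeta l) p.2)).
  apply: measurable_funM => //; apply: measurable_funM.
    by apply: (measurableT_comp _ measurable_fst); apply: measurable_indic; exact: measurableI.
  by apply: (measurableT_comp _ measurable_snd); apply: measurable_indic; exact: (measurable_cylset normE sepH hzeta).
have mT : measurable_field T.
  apply: (measurable_field_eq (g := fun p => 1 *: (S (clamp p.1) p.2 : H) + (r * (\1_(A `&` D) p.1 * \1_(cylset ip I zeta l) p.2)) *: zeta i)).
    by apply: (measurable_lincomb normE sepH hzeta) => //; exact: measurable_field_clamp.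
  by move=> t x t01; rewrite /= clamp_id// scale1r.
have TS t : t < eps -> T t = S t.
  move=> te; apply/funext => x; rewrite /T indicE memNset ?mul0r ?mulr0 ?scale0r ?addr0//.
  by move=> [_]; rewrite /D /= in_itv/= leNgt te.
have [_] := loss_minimal mT TS.
rewrite (loss_epsE mS) (loss_epsE mT) => h; apply: (le_trans h).
rewrite le_eqVlt; apply/orP; left; apply/eqP; apply: lower_integral_ae.
- by move=> t; apply: integral_ge0 => w _; rewrite lee_fin sqr_ge0.
- by move=> t; apply: integral_ge0 => w _; rewrite lee_fin sqr_ge0.
exists (~` D); split.
- exact: measurableC.
- by rewrite /m /= /mfrestr /mrestr setICl measure0.
move=> t /= nt Dt; apply: nt; apply: eq_integral => w _.
have DE : \1_D t = 1 :> R by rewrite indicE (mem_set Dt).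
rewrite !(V1E _ w Dt) /VV (X1E w Dt) /T indicI /= DE mulr1.
rewrite -!addrA; congr (`|_ + _| ^+ _)%:E; exact: addrC.
Qed.

Lemma score_orthogonal_from : {ae leb, forall t, eps <= t <= 1 ->
  P'.-integrable setT (fun w => (`|VV S t w|)%:E) /\
  forall h (B : set (borel H)), measurable B -> \int[P']_(w in X t @^-1` B) ip h (VV S t w) = 0}.
Proof.
have DE t : (eps <= t <= 1) = (t \in `[eps, 1]) by rewrite in_itv.
have fin : (\int[m]_t \int[P']_w ((`|V1 S (t, w) : H| ^+ 2)%:E) < +oo)%E.
  by have [] := loss_minimal mS (fun _ _ => erefl); rewrite (loss_epsE mS).
have [N [mN N0 sN]] := minimizer_orthogonal normE sepH hzeta (mV1 mS) mX1 fin min_V1.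
exists (N `&` D); split.
- exact: measurableI.
- by rewrite -N0.
move=> t /= /not_implyP[]; rewrite DE => Dt nt; split => //; apply: sN => /= -[h1 h2]; apply: nt.
have V1w w : V1 S (t, w) = VV S t w by exact: V1E.
split.
  by move: h1; apply: eq_integrable; [exact: measurableT|move=> w _; rewrite V1w].
move=> h B mB; rewrite -(h2 h B mB).
have -> : (fun w => X1 (t, w)) = X t by apply/funext => w; exact: X1E.
by apply: eq_Rintegral => w _; rewrite V1w.
Qed.

End from_eps.

(** Each time with [kappa] positive is preceded by a rational time at which [kappa] is already
    positive, so countably many choices of [eps], and a single null set, suffice. *)
Lemma score_orthogonal : {ae leb, forall t : R, 0 < t <= 1 -> 0 < kappa sigma t ->
  P'.-integrable setT (fun w => (`|VV S t w|)%:E) /\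
  forall h (B : set (borel H)), measurable B -> \int[P']_(w in X t @^-1` B) ip h (VV S t w) = 0}.
Proof.
have : {ae leb, forall t : R, forall n : nat, let q := ratr (odflt 0 (unpickle n) : rat) : R in
  0 < q < 1 -> 0 < kappa sigma q -> q <= t <= 1 ->
  P'.-integrable setT (fun w => (`|VV S t w|)%:E) /\
  forall h (B : set (borel H)), measurable B -> \int[P']_(w in X t @^-1` B) ip h (VV S t w) = 0}.
  apply: ae_foralln => n /=; move: (ratr _ : R) => q.
  have [q01|nq] := pselect (0 < q < 1); last by apply: aeW => t.
  have [kq|nk] := pselect (0 < kappa sigma q); last by apply: aeW => t _.
  by apply: (@filterS _ (almost_everywhere leb) _ _ _ _ (score_orthogonal_from q01 kq)) => t ht _ _.
move=> AE; apply: (@filterS _ (almost_everywhere leb) _ _ _ _ AE) => t ht t01 kt.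
have [q [q01 qt kq]] := kappa_gt0_rational sigma_continuous t01 kt.
have := ht (pickle q); rewrite pickleK /= => /(_ q01 kq); apply.
by rewrite qt; case/andP: t01.
Qed.

Let f := prob_flow_field sigma S.

Lemma measurable_prob_flow_field : measurable_field f.
Proof.
have mc : measurable_fun setT (fun p : measurableTypeR R * borel H => - (sigma (clamp p.1) / 2)).
  apply: (@measurableT_comp _ _ _ _ _ _ (fun x : R => - (sigma (clamp x) / 2)) _ (@fst (measurableTypeR R) (borel H))); last exact: measurable_fst.
  apply: continuous_measurable_fun => x; apply: cvgN; apply: cvgMr_tmp.
  exact: (continuous_comp_clamp sigma_continuous).
apply: (measurable_field_eq (g := fun p => - (sigma (clamp p.1) / 2) *: (p.2 : H) + - (sigma (clamp p.1) / 2) *: S (clamp p.1) p.2)).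
  apply: (measurable_lincomb normE sepH hzeta) => //; last exact: measurable_field_clamp.
by move=> t x t01; rewrite /= (clamp_id t01) -scalerDr.
Qed.

(** With k = sqrt kappa, the derivatives are eta' = -(sigma / 2) eta and k' = -(sigma / 2)(k - 1 /
    k); the term in k completes eta Y'0 to [X]. *)
Lemma interpolation_is_derive (t : R) w : 0 < t < 1 -> 0 < kappa sigma t ->
  is_derive t 1 (X^~ w) (- (sigma t / 2) *: (X t w - (kk t)^-1 *: U w)).
Proof.
move=> t01 kt; have d1 := is_derive_scalev (Y'0 w) (eta_is_derive sigma_continuous t01).
have d2 := is_derive_scalev (U w) (sqrt_kappa_is_derive sigma_continuous t01 kt).
have d3 := is_deriveD d1 d2.
apply: (is_derive_eq d3); rewrite /X /interpolation -/(kk t).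
have k2 : kappa sigma t = kk t ^+ 2 by rewrite /kk sqr_sqrtr// ltW.
have k0 : kk t != 0 by rewrite lt0r_neq0// sqrtr_gt0.
rewrite k2 -addrA -scalerBl scalerDr !scalerA; congr (_ + _ *: _).
have vq (x y : R) : x != 0 -> y / 2 * (1 - x ^+ 2) / x = - (y / 2) * (x - x^-1) by move=> x0; field.
exact: vq.
Qed.

Lemma interpolation_is_derive0 (s t : R) w : 0 < t < s -> s <= 1 -> kappa sigma s = 0 ->
  is_derive t 1 (X^~ w) 0.
Proof.
move=> ts s1 ks; have dc : is_derive t 1 (cst (Y'0 w)) 0 by exact: is_derive_cst.
apply: (near_eq_is_derive _ dc).
apply: filterS (kappa_eq0_near sigma_ge0 sigma_continuous ts s1 ks) => u [ku eu].
by rewrite /X /interpolation ku eu sqrtr0 scale0r addr0 scale1r.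
Qed.

(* The exceptional time is the one at which kappa leaves 0, where its square
   root may fail to be differentiable. *)
Lemma ae_kappa_eq0 : {ae leb, forall t : R, 0 < t < 1 -> kappa sigma t = 0 ->
  exists s, [/\ t < s, s <= 1 & kappa sigma s = 0]}.
Proof.
pose E := [set t : R | [/\ 0 < t < 1, kappa sigma t = 0 & forall s, t < s -> s <= 1 -> kappa sigma s <> 0]].
have EE t : ~ (0 < t < 1 -> kappa sigma t = 0 -> exists s, [/\ t < s, s <= 1 & kappa sigma s = 0]) -> E t.
  move=> /not_implyP[t01 /not_implyP[kt ns]]; split => // s ts s1 ks; apply: ns.
  by exists s.
have [[t0 Et0]|nE] := pselect (exists t, E t); last first.
  by apply: aeW => t; apply: contrapT => /EE Et; apply: nE; exists t.
exists [set t0]; split => //; first exact: lebesgue_measure_set1.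
move=> t /EE Et; have [tt0|t0t|//] := ltgtP t t0.
  have [/andP[_ t01] k0 _] := Et0; have [_ _ h] := Et.
  by case: (h _ tt0 (ltW t01)).
have [/andP[_ t01] k0 _] := Et; have [_ _ h] := Et0.
by case: (h _ t0t (ltW t01)).
Qed.

Let mX t : measurable_fun setT (X t : Omega' -> borel H).
Proof. exact: (measurable_interpolation normE sepH hzeta sigma hY'0 hU). Qed.

Let conditional_expectation_gt0 t : 0 < t < 1 -> 0 < kappa sigma t ->
  P'.-integrable setT (fun w => (`|VV S t w|)%:E) ->
  (forall h (B : set (borel H)), measurable B -> \int[P']_(w in X t @^-1` B) ip h (VV S t w) = 0) ->
  is_conditional_expectation ip P' (velocity X t) (X t) (f t).
Proof.
move=> t01 kt iVV V0.
have t01' : 0 <= t <= 1 by case/andP: t01 => /ltW -> /ltW ->.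
pose c := - (sigma t / 2).
have -> : velocity X t = fun w => c *: (X t w - (kk t)^-1 *: U w).
  apply/funext => w; rewrite /velocity derive1E.
  by have [_ ->] := interpolation_is_derive w t01 kt.
have mV0 : measurable_fun setT (fun w => X t w - (kk t)^-1 *: U w : borel H).
  have := measurable_lincomb normE sepH hzeta (@measurable_cst _ _ _ _ setT (1 : R)) (@measurable_cst _ _ _ _ setT (- (kk t)^-1 : R)) (mX t) mU.
  by congr (measurable_fun _ _); apply/funext => w; rewrite scale1r scaleNr.
have mV : measurable_fun setT (fun w => c *: (X t w - (kk t)^-1 *: U w) : borel H).
  have := measurable_lincomb normE sepH hzeta (@measurable_cst _ _ _ _ setT c) (@measurable_cst _ _ _ _ setT (0 : R)) mV0 mU.
  by congr (measurable_fun _ _); apply/funext => w; rewrite scale0r addr0.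
have hG : forall h (A : set R), measurable A -> law P' mU [set x | A (ip h x)] = gaussian1 0 (ip (Q h) h) A.
  by move=> h A mA; rewrite lawE; have [_ /(_ h A mA)] := hU; rewrite ip0r.
have iU : P'.-integrable setT (fun w => (`|U w|)%:E).
  have := integrable_gaussian_norm normE hQ hG.
  move=> /(integrable_law P' mU); apply.
  by apply/measurable_EFinP; apply: measurable_norm; exact: measurable_id.
apply: (is_conditional_expectation_orthogonal normE sepH hzeta (N := fun w => c *: VV S t w)) => //.
- exact: (mslice measurable_prob_flow_field t01').
(* On the event that [X t] lies in the ball of radius [n.+1], the velocity is dominated by a
   constant plus a multiple of |U|, even when [X t] has no first moment. *)
- move=> n; have mXB : measurable (X t @^-1` ball (0 : H) n.+1%:R).
    by rewrite -[X in measurable X]setTI; apply: mX => //; exact: measurable_ball_borel.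
  have i1 : P'.-integrable setT (cst (n.+1%:R)%:E) by exact: finite_measure_integrable_cst.
  have i2 := integrableZl measurableT `|(kk t)^-1| iU.
  have i3 := integrableZl measurableT `|c| (integrableD measurableT i1 i2).
  have := integrableS measurableT mXB (@subsetT _ _) i3; apply: le_integrable => //.
    by apply/measurable_EFinP; apply: measurable_funTS; exact: measurable_norm.
  move=> w Xw; rewrite /= lee_fin normr_id normrZ [leRHS]ger0_norm; last first.
    by rewrite mulr_ge0// addr_ge0// mulr_ge0.
  rewrite ler_wpM2l// (le_trans (ler_normB _ _))// normrZ lerD2r.
  by move: Xw; rewrite /= -ball_normE /= sub0r normrN => /ltW.
- by move=> w; rewrite /f /prob_flow_field -/c -scalerDr /VV addrACA addNr addr0.
- have := integrableZl measurableT `|c| iVV; apply: eq_integrable => // w _.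
  by rewrite normrZ EFinM.
- move=> h B mB.
  have mXB : measurable (X t @^-1` B) by rewrite -[X in measurable X]setTI; apply: mX.
  under eq_Rintegral do rewrite ipZr.
  rewrite RintegralZl ?V0 ?mulr0//.
  have mVV : measurable_fun setT (VV S t : Omega' -> borel H).
    have := measurable_lincomb normE sepH hzeta (@measurable_cst _ _ _ _ setT (1 : R)) (@measurable_cst _ _ _ _ setT ((kk t)^-1 : R)) (measurableT_comp (mslice mS t01') (mX t)) mU.
    by congr (measurable_fun _ _); apply/funext => w; rewrite scale1r.
  have := integrableZl measurableT `|h| iVV => /(integrableS measurableT mXB (@subsetT _ _)); apply: le_integrable => //.
    by apply/measurable_EFinP; apply: measurable_funTS; exact: (measurable_ip normE).
  by move=> w _ /=; rewrite lee_fin normrM !normr_id; exact: (cauchy_schwarz normE).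
Qed.

Let prob_flow_eq0 t x : 0 < t <= 1 -> kappa sigma t = 0 -> f t x = 0.
Proof.
move=> t01 kt; rewrite /f /prob_flow_field (kappa_eq0_sigma sigma_ge0 sigma_continuous t01 kt).
by rewrite mul0r oppr0 scale0r.
Qed.

Lemma conditional_velocity_prob_flow : conditional_velocity ip P' X f.
Proof.
have ne (c : R) : {ae leb, forall t : R, t <> c}.
  by exists [set c]; split => //; [exact: lebesgue_measure_set1|move=> t /= /contrapT].
(* The derivative formulas hold at interior times, since [eta] and [kappa] are known through [B]
   only on [0, 1]. *)
have A1 : {ae leb, forall t : R, t <> 0 /\ t <> 1}.
  by apply: (@filterS2 _ (almost_everywhere leb) _ _ _ _ _ (ne 0) (ne 1)) => t.
rewrite /conditional_velocity.
apply: (@filterS3 _ (almost_everywhere leb) _ _ _ _ _ _ A1 score_orthogonal ae_kappa_eq0) => t [t0 t1] hV hk.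
rewrite in_itv/= => /andP[t0' t1'].
have t01 : 0 < t < 1 by rewrite !lt_neqAle t0' t1' !andbT; apply/andP; split; apply/eqP => // e; apply: t0.
have t01' : 0 < t <= 1 by case/andP: t01 => -> _.
have [kt|kt0] := ltP 0 (kappa sigma t).
  split; first by move=> w; have [] := interpolation_is_derive w t01 kt.
  by have [iV V0] := hV t01' kt; exact: conditional_expectation_gt0.
have kt : kappa sigma t = 0.
  by apply/eqP; rewrite eq_le kt0 (kappa_ge0 sigma_ge0 sigma_continuous)// t0'.
have [s [ts s1 ks]] := hk t01 kt.
have ts' : 0 < t < s by rewrite ts; case/andP: t01 => ->.
have dX w := interpolation_is_derive0 w ts' s1 ks.
split; first by move=> w; have [] := dX w.
have -> : velocity X t = fun _ => 0.
  by apply/funext => w; rewrite /velocity derive1E; have [_ ->] := dX w.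
apply: (is_conditional_expectation_orthogonal normE sepH hzeta (N := fun=> 0)) => //.
- by apply: (mslice measurable_prob_flow_field); rewrite t0'.
- move=> n; under eq_fun do rewrite normr0.
  by apply: integrable0.
- by move=> w; rewrite prob_flow_eq0// addr0.
- by under eq_fun do rewrite normr0; exact: integrable0.
- move=> h B mB; under eq_Rintegral do rewrite ip0r.
  by rewrite Rintegral_cst ?mul0r// -[X in measurable X]setTI; apply: mX.
Qed.

(* The law of X 0 need not have full support, hence the value at the time 0. *)
Let v (t : R) (x : H) : H := if t == 0 then 0 else f t x.

Lemma expected_velocity_prob_flow : expected_velocity ip P' X v.
Proof.
split.
- have mD : measurable ([set p | 0 <= p.1 <= 1] : set (measurableTypeR R * borel H)).
    have := @measurable_fst _ _ (measurableTypeR R) (borel H) measurableT _ (measurable_itv (`[0, 1] : interval R)).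
    by rewrite setTI; congr measurable; apply/seteqP; split=> p /=; rewrite in_itv.
  apply: (measurable_fun_if mD).
  + by apply: measurable_funTS; apply: measurable_fun_eqr => //; exact: measurable_fst.
  + exact: measurable_cst.
  + by apply: measurable_funS (measurable_prob_flow_field) => //; exact: subIsetl.
- have ne : {ae leb, forall t : R, t <> 0}.
    by exists [set 0]; split => //; [exact: lebesgue_measure_set1|move=> t /= /contrapT].
  apply: (@filterS2 _ (almost_everywhere leb) _ _ _ _ _ ne conditional_velocity_prob_flow) => t /eqP t0 ht /ht.
  by rewrite /v (negbTE t0).
- move=> t x; rewrite in_itv/= => /andP[t0 t1] nx; rewrite /v; case: eqVneq => // t_neq0.
  have t01 : 0 < t <= 1 by rewrite lt_neqAle eq_sym t_neq0 t0.
  apply: prob_flow_eq0 => //; apply/eqP; rewrite eq_le (kappa_ge0 sigma_ge0 sigma_continuous) ?t0// andbT.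
  rewrite leNgt; apply/negP => kt; apply: nx.
  have kkt : 0 < kk t by rewrite sqrtr_gt0.
  exact: (gaussian_shift_support normE sepH hzeta (Defs.eta sigma t) x hQ hlam mY'0 hU hindep kkt).
Qed.

Lemma reverse_flow_prob_flow (d2 : measure_display) (Omega2 : measurableType d2)
    (P2 : probability Omega2 R) (Z : R -> Omega2 -> H) :
  reverse_flow ip P2 Q f Z <-> reverse_flow ip P2 Q v Z.
Proof.
have E s x : s != 0 -> f s x = v s x by rewrite /v => /negbTE ->.
split=> -[hZ Z1 hI]; split => //; apply: filterS hI => w hw t t01.
  by apply: (@is_bochner_integral_eq _ _ _ normE (fun s => f s (Z s w)) _ 0); [move=> s s0; exact: E|exact: hw].
by apply: (@is_bochner_integral_eq _ _ _ normE (fun s => v s (Z s w)) _ 0); [move=> s s0; rewrite E|exact: hw].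
Qed.

End score.

Theorem proposition7
  (R : realType) (H : completeNormedModType R) (ip : {dot H for idfun})
  (normE : forall x : H, `|x| ^+ 2 = ip x x) (sepH : separable_space H)
  (Q : {linear H -> H}) (hQ : covariance_operator ip Q)
  (I : pred nat) (zeta : nat -> H) (lam : nat -> R)
  (hzeta : orthonormal_basis ip I zeta)
  (hlam : forall i, I i -> Q (zeta i) = lam i *: zeta i)
  (sigma : R -> R)
  (sigma_ge0 : forall t, t \in `[0, 1] -> 0 <= sigma t)
  (sigma_bounded : [bounded sigma t | t in `[0, 1]])
  (sigma_continuous : {within `[0, 1], continuous sigma})
  (Pdata : probability (borel H) R)
  (d : measure_display) (Omega : measurableType d) (P : probability Omega R)
  (W Y : R -> Omega -> H)
  (hW : Q_wiener ip P Q W)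
  (hY0 : has_law P (Y 0) Pdata)
  (hY : sde_solution ip P sigma W Y)
  (mu : R -> R.-pker (borel H) ~> (borel H))
  (hmu : forall t, t \in `[0, 1] ->
     is_conditional_law P Pdata (Y 0) (Y t) (mu t))
  (S : R -> H -> H)
  (hS : score_minimizer ip Q I zeta lam Pdata mu S)
  (d' : measure_display) (Omega' : measurableType d') (P' : probability Omega' R)
  (Y'0 U : Omega' -> H)
  (hY'0 : has_law P' Y'0 Pdata)
  (hU : gaussian_vector ip P' U 0 Q)
  (hindep : independent2 P' Y'0 U) :
  (exists v : R -> H -> H,
     expected_velocity ip P' (interpolation sigma Y'0 U) v /\
     forall (d2 : measure_display) (Omega2 : measurableType d2)
       (P2 : probability Omega2 R) (Z : R -> Omega2 -> H),
       reverse_flow ip P2 Q (prob_flow_field sigma S) Z <->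
       reverse_flow ip P2 Q v Z) /\
  conditional_velocity ip P' (interpolation sigma Y'0 U)
    (prob_flow_field sigma S).
Proof.
split.
  exists (fun t x => if t == 0 then 0 else prob_flow_field sigma S t x); split.
    exact: (expected_velocity_prob_flow normE sepH hQ hzeta hlam sigma_ge0
      sigma_continuous hW hY0 hY hmu hS hY'0 hU hindep).
  by move=> d2 Omega2 P2 Z; exact: (reverse_flow_prob_flow normE).
exact: (conditional_velocity_prob_flow normE sepH hQ hzeta hlam sigma_ge0
  sigma_continuous hW hY0 hY hmu hS hY'0 hU hindep).
Qed.
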